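(* Let $0<\alpha\le 1$, let $p,q,r>0$ be real constants with $q>p$, and consider the fractional order Mackey-Glass equation $$D^\alpha x(t)=-p\,x(t)+q\,\frac{x(t-\tau)}{1+x(t-\tau)^r},\qquad t>0.$$ Let $x_2^*=\left(\frac{q-p}{p}\right)^{1/r}$ be its nonzero equilibrium point. Suppose $\frac{p}{q}<1-\frac{2}{r}$, put $\beta=p+(p-q)\frac{rp}{q}$, and define $$\tau_*=\frac{\arccos\left(\dfrac{\left(-p\cos\left(\frac{\alpha\pi}{2}\right)+\sqrt{\beta^2-p^2\sin^2\left(\frac{\alpha\pi}{2}\right)}\right)\cos\left(\frac{\alpha\pi}{2}\right)+p}{\beta}\right)}{\left(-p\cos\left(\frac{\alpha\pi}{2}\right)+\sqrt{\beta^2-p^2\sin^2\left(\frac{\alpha\pi}{2}\right)}\right)^{1/\alpha}}.$$ Then $x_2^*$ is asymptotically stable for $0<\tau<\tau_*$ and unstable for $\tau>\tau_*$.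
   Context: For $0<\alpha<1$, $D^\alpha$ is the Caputo derivative $D^\alpha f(t)=\frac{1}{\Gamma(1-\alpha)}\int_0^t (t-s)^{-\alpha}f'(s)\,ds$, and $D^1f=f'$. The equation is posed with initial data $x(t)=\phi(t)$ for $-\tau\le t\le 0$, where $\phi:[-\tau,0]\to\mathbb{R}$; the solution is denoted $x(t,\phi)$ and $\|\phi\|=\sup_{-\tau\le t\le 0}|\phi(t)|$. When $r$ is not an integer, $x^r$ is the usual real power and the equation is considered where it is defined. The notation $x_2^*=\left(\frac{q-p}{p}\right)^{1/r}$ stands for any real equilibrium with $(x_2^* )^r=\frac{q-p}{p}$ (the positive root, and for even integer $r$ also its negative). An equilibrium point $x_*$ (a constant solution) is stable if for every $\epsilon>0$ there is $\delta>0$ such that $\|\phi-x_*\|<\delta$ implies $|x(t,\phi)-x_*|<\epsilon$ for all $t\ge 0$; it is unstable if it is not stable. It is asymptotically stable if it is stable and there is $b_0>0$ such that $\|\phi-x_*\|<b_0$ implies $\lim_{t\to\infty}x(t,\phi)=x_*$. *)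

(* Defs.v *)
From HB Require Import structures.
From mathcomp Require Import all_boot all_order all_algebra.
From mathcomp Require Import all_classical all_reals all_analysis.

Set Implicit Arguments.
Unset Strict Implicit.
Unset Printing Implicit Defensive.

Import Order.TTheory GRing.Theory Num.Theory.
Import numFieldNormedType.Exports.

Local Open Scope classical_set_scope.
Local Open Scope ring_scope.

Definition Gamma {R : realType} (z : R) : R :=
  \int[lebesgue_measure]_(s in `]0, +oo[) (s `^ (z - 1) * expR (- s)).

(* Absolute continuity on [a, b], in the form used by the Caputo derivative:
   f has an integrable derivative almost everywhere, of which it is a
   primitive.  Where f is not derivable, derive1 f takes an arbitrary value. *)
Definition abs_continuous {R : realType} (a b : R) (f : R -> R) : Prop :=
  [/\ {ae lebesgue_measure, forall s : R, `[a, b]%classic s -> derivable f s 1},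
      lebesgue_measure.-integrable `[a, b] (fun s => (derive1 f s)%:E) &
      forall s, a <= s <= b ->
        f s = f a + \int[lebesgue_measure]_(u in `[a, s]) derive1 f u].

Definition caputo_kernel {R : realType} (alpha : R) (f : R -> R) (t s : R) : R :=
  (t - s) `^ (- alpha) * derive1 f s.

(* caputo alpha f t is meaningful only when caputo_defined alpha f t holds. *)
Definition caputo_defined {R : realType} (alpha : R) (f : R -> R) (t : R) : Prop :=
  if alpha == 1 then derivable f t 1
  else abs_continuous 0 t f /\
       lebesgue_measure.-integrable `[0, t]
         (fun s => (caputo_kernel alpha f t s)%:E).

Definition caputo {R : realType} (alpha : R) (f : R -> R) (t : R) : R :=
  if alpha == 1 then derive1 f t
  else (Gamma (1 - alpha))^-1 *
       \int[lebesgue_measure]_(s in `[0, t]) caputo_kernel alpha f t s.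

(* x^r for r > 0: an integer power of any real x when r is an integer, and the
   real power otherwise.  The latter is defined only for 0 <= x: powR is total,
   with a junk value on negative numbers, hence rpow_defined. *)
Definition rpow_defined {R : realType} (r x : R) : bool :=
  (r \is a Num.nat) || (0 <= x).

Definition rpow {R : realType} (r x : R) : R :=
  if r \is a Num.nat then x ^+ Num.truncn r else x `^ r.

(* x solves the equation on [-tau, +oo[ with history phi.  Only the values of
   phi on [-tau, 0] and of x on [-tau, +oo[ matter.  Continuity on [0, +oo[ ties
   the solution to its initial value when alpha = 1, since the equation is only
   imposed for t > 0. *)
Definition mg_solution {R : realType} (alpha p q r tau : R)
    (phi x : R -> R) : Prop :=
  [/\ forall t, - tau <= t <= 0 -> x t = phi t,
      {within `[0, +oo[, continuous x} &
      forall t, 0 < t ->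
        [/\ caputo_defined alpha x t,
            rpow_defined r (x (t - tau)),
            1 + rpow r (x (t - tau)) != 0 &
            caputo alpha x t =
              - p * x t + q * (x (t - tau) / (1 + rpow r (x (t - tau))))]].

Definition hist_norm {R : realType} (tau : R) (phi : R -> R) : \bar R :=
  ereal_sup [set (`|phi t|)%:E | t in `[- tau, 0]].

Definition mg_stable {R : realType} (alpha p q r tau xs : R) : Prop :=
  forall eps : R, 0 < eps -> exists2 delta : R, 0 < delta &
    forall phi x : R -> R, mg_solution alpha p q r tau phi x ->
      (hist_norm tau (fun t => (phi t - xs)%R) < delta%:E)%E ->
      forall t, 0 <= t -> `|x t - xs| < eps.

Definition mg_attractive {R : realType} (alpha p q r tau xs : R) : Prop :=
  exists2 b0 : R, 0 < b0 &
    forall phi x : R -> R, mg_solution alpha p q r tau phi x ->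
      (hist_norm tau (fun t => (phi t - xs)%R) < b0%:E)%E ->
      x t @[t --> +oo] --> xs.

Definition mg_asymptotically_stable {R : realType}
    (alpha p q r tau xs : R) : Prop :=
  mg_stable alpha p q r tau xs /\ mg_attractive alpha p q r tau xs.

Definition mg_unstable {R : realType} (alpha p q r tau xs : R) : Prop :=
  ~ mg_stable alpha p q r tau xs.

Definition mg_beta {R : realType} (p q r : R) : R :=
  p + (p - q) * (r * p / q).

Definition tau_star {R : realType} (alpha p q r : R) : R :=
  let beta := mg_beta p q r in
  let c := cos (alpha * pi / 2) in
  let w := - p * c + Num.sqrt (beta ^+ 2 - p ^+ 2 * sin (alpha * pi / 2) ^+ 2) in
  acos ((w * c + p) / beta) / w `^ alpha^-1.

(* Main.v *)
(* With B = - mg_beta p q r > p, the deviation Y = x - xs satisfies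
     Y + B (k * Y(. - tau)) = Y(0) E + k * (Lipschitz remainder),
   where k is the nonnegative kernel whose Laplace transform is
   1 / (z^alpha + p) and E = 1 - p (1 * k); this representation replaces
   fractional calculus by convolutions.
   For tau < tau_star no root of z^alpha + p + s B exp(- z tau), 0 <= s <= 1, lies
   in Re z >= 0.  Plancherel's inequality on lines Re z = e > 0, continued in s
   from 0 to 1, bounds the energy of Y - Y(. - tau) by that of the forcing, and
   rewriting the equation with p + B in place of p turns this into a uniform
   bound and convergence to 0.
   For tau > tau_star, following the curve |z^alpha + p| = B |exp(- z tau)| from
   the real axis to the imaginary axis, the phase passes pi, which gives a root
   a0 + i b0 and a root-free line Re z = e with 0 < e < a0.  If xs were stable,
   a solution starting from a bump of height eta would remain bounded; Plancherel
   on the root-free line bounds its deviation by O(eta) in the weighted norm, while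
   testing the equation at the root shows that the transform of the bump, which
   has nonzero imaginary part, is o(eta). *)

Require Import Defs.
From mathcomp Require Import all_boot all_order all_algebra.
From mathcomp Require Import all_classical all_reals all_analysis.
From mathcomp Require Import measurable_realfun ring lra.
Set Implicit Arguments.
Unset Strict Implicit.
Unset Printing Implicit Defensive.
Import Order.TTheory GRing.Theory Num.Theory.
Import numFieldNormedType.Exports.
Local Open Scope classical_set_scope.
Local Open Scope ring_scope.

(** * Integration and convolution on the real line *)

(** The energy concerns [Y - delay tau Y] because [E] decays only like [t^(-alpha)] when
    [alpha < 1]: for [alpha <= 1/2] it is not square integrable, while [E - delay tau E] is a pulse
    minus a smoothed pulse. Writing [delay tau Y = Y - z] in the linear feedback gives the rate
    [p + B] and the extra forcing [B z]: hence the second kernel. Plancherel's inequality on a line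
    presupposes that the damped signal is integrable, and growth is exactly what has to be excluded.
    Continuation in [s] breaks this circle: the bound at [s] makes solutions at [s + ds] bounded,
    and Plancherel's inequality then applies to them with an undiminished constant. Positivity of
    [k] makes its [L1] norm exactly [1 / p], so constants in time match those in frequency.
    Instability requires an actual solution, with nonnegative values and a Caputo derivative; hence
    a [C^1] bump as history. The root-free line lies to the left of the root so that a weighted
    square bound on it controls integrals weighted at the root. The Lipschitz constant of the
    remainder is fixed before [eta], so both sides of the final comparison are linear in [eta]. A
    negative equilibrium, which forces [r] to be an even integer, reduces to the positive one by
    oddness. *)

Definition L1 {R : realType} (f : R -> R) : Prop :=
  (@lebesgue_measure R).-integrable [set: R] (EFin \o f).

Section L1_calculus.
Context {R : realType}.
Local Notation mu := (@lebesgue_measure R).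
Implicit Types f g h : R -> R.

Lemma L1_measurable f : L1 f -> measurable_fun [set: R] f.
Proof. by move=> /integrableP[/measurable_EFinP]. Qed.

Lemma L1_le f g : measurable_fun [set: R] f -> (forall x, `|f x| <= g x) ->
  L1 g -> L1 f.
Proof.
move=> mf fg; apply: le_integrable => //; first exact/measurable_EFinP.
by move=> x _ /=; rewrite lee_fin (le_trans (fg x))// ler_norm.
Qed.

Lemma L1D f g : L1 f -> L1 g -> L1 (fun x => f x + g x).
Proof.
move=> f1 g1; rewrite /L1 /comp; under eq_fun do rewrite EFinD.
exact: integrableD.
Qed.

Lemma L1B f g : L1 f -> L1 g -> L1 (fun x => f x - g x).
Proof.
move=> f1 g1; rewrite /L1 /comp; under eq_fun do rewrite EFinB.
exact: integrableB.
Qed.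

Lemma L1Z c f : L1 f -> L1 (fun x => c * f x).
Proof.
move=> f1; rewrite /L1 /comp; under eq_fun do rewrite EFinM.
exact: integrableZl.
Qed.

Lemma L1N f : L1 f -> L1 (fun x => - f x).
Proof.
move=> /(L1Z (-1)); congr L1; apply/funext => x; exact: mulN1r.
Qed.

Lemma L1_norm f : L1 f -> L1 (fun x => `|f x|).
Proof. by move=> f1; exact: (integrable_norm f1). Qed.

Lemma L1_0 : L1 (fun=> 0 : R).
Proof. exact: integrable0. Qed.

Lemma L1_bounded_mul M f g : measurable_fun [set: R] g ->
  (forall x, `|g x| <= M) -> L1 f -> L1 (fun x => f x * g x).
Proof.
move=> mg gM f1; apply: (@L1_le _ (fun x => M * `|f x|)).
- by apply: measurable_funM => //; exact: L1_measurable.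
- by move=> x; rewrite normrM mulrC ler_wpM2r.
- exact/L1Z/L1_norm.
Qed.

Lemma L1_indic (A : set R) f : measurable A -> L1 f ->
  L1 (fun x => f x * \1_A x).
Proof.
move=> mA; apply: (@L1_bounded_mul 1) => [|x]; first exact: measurable_indic.
by rewrite indicE; case: (_ \in _); rewrite ?normr1 ?normr0.
Qed.

Lemma L1_indic_itv (a b : R) : L1 \1_`[a, b].
Proof.
apply/integrableP; split; first exact/measurable_EFinP.
under eq_integral do rewrite /= ger0_norm//.
rewrite integral_indic// setIT/= lebesgue_measure_itv/=.
by case: ifP => // _; rewrite -EFinB ltry.
Qed.

Lemma L1_bounded_support f a b M : measurable_fun [set: R] f ->
  (forall x, `|f x| <= M * \1_`[a, b] x) -> L1 f.
Proof. by move=> mf fM; apply: (L1_le mf fM); exact/L1Z/L1_indic_itv. Qed.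

Lemma intD f g : L1 f -> L1 g ->
  \int[mu]_x (f x + g x) = \int[mu]_x f x + \int[mu]_x g x.
Proof. by move=> f1 g1; rewrite RintegralD. Qed.

Lemma intB f g : L1 f -> L1 g ->
  \int[mu]_x (f x - g x) = \int[mu]_x f x - \int[mu]_x g x.
Proof. by move=> f1 g1; rewrite RintegralB. Qed.

Lemma intZ c f : L1 f -> \int[mu]_x (c * f x) = c * \int[mu]_x f x.
Proof. by move=> f1; rewrite RintegralZl. Qed.

Lemma int_not_L1 f : measurable_fun [set: R] f -> ~ L1 f -> \int[mu]_x f x = 0.
Proof.
move=> mf nf1; rewrite /Rintegral.
have : ~~ ((\int[mu]_x (f x)%:E)%E \is a fin_num).
  apply/negP; rewrite -integral_fin_num_abs// => foo; apply: nf1.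
  by apply/integrableP; split=> //; exact/measurable_EFinP.
by case: (\int[mu]_x _)%E.
Qed.

(** A non-integrable function has integral 0, the value of [fine] at infinity, so homogeneity
    survives without integrability. Scalings and dampings of convolutions thereby carry no side
    condition. *)
Lemma int_mulrl c f : measurable_fun [set: R] f ->
  \int[mu]_x (c * f x) = c * \int[mu]_x f x.
Proof.
move=> mf; have [f1|nf1] := pselect (L1 f); first exact: intZ.
have [->|c0] := eqVneq c 0.
  by under eq_Rintegral do rewrite mul0r; rewrite mul0r /Rintegral integral0.
rewrite (int_not_L1 mf nf1) mulr0 int_not_L1//; first exact: measurable_funM.
move=> /(L1Z c^-1); under eq_fun do rewrite mulrA mulVf// mul1r.
exact: nf1.
Qed.

Lemma L1_in (D : set R) f : measurable D ->
  mu.-integrable D (EFin \o f) <-> L1 (fun x => f x * \1_D x).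
Proof.
move=> mD; rewrite /L1.
have <- : (EFin \o f) \_ D = EFin \o (fun x => f x * \1_D x).
  apply/funext => x; rewrite /patch /= indicE.
  by case: ifP => _; rewrite ?mulr1 ?mulr0.
exact: (@integrable_mkcond _ _ R mu D (EFin \o f) mD).
Qed.

Lemma int_in (D : set R) f :
  \int[mu]_(x in D) f x = \int[mu]_x (f x * \1_D x).
Proof.
rewrite Rintegral_mkcond; apply: eq_Rintegral => x _.
by rewrite /patch indicE; case: ifP => _; rewrite ?mulr1 ?mulr0.
Qed.

Lemma int_le f g : L1 f -> L1 g -> (forall x, f x <= g x) ->
  \int[mu]_x f x <= \int[mu]_x g x.
Proof. by move=> f1 g1 fg; apply: le_Rintegral. Qed.

Lemma int_norm_le f g : measurable_fun [set: R] f -> L1 g ->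
  (forall x, `|f x| <= g x) -> `|\int[mu]_x f x| <= \int[mu]_x g x.
Proof.
move=> mf g1 fg; have f1 := L1_le mf fg g1.
rewrite (le_trans (le_normr_Rintegral _ f1))//.
by apply: int_le => //; exact: L1_norm.
Qed.

Lemma int_indic_itv (a b : R) : a <= b -> \int[mu]_x (\1_`[a, b] x) = b - a.
Proof.
move=> ab; rewrite /Rintegral integral_indic// setIT/= lebesgue_measure_itv/=.
by case: ifPn => // ; rewrite lte_fin -leNgt => ba; apply/eqP; rewrite eq_sym subr_eq0 eq_le ab ba.
Qed.

Lemma int_dominated_cvg (f_ : nat -> R -> R) f g :
  (forall n, measurable_fun [set: R] (f_ n)) ->
  (forall x, f_ n x @[n --> \oo] --> f x) -> L1 g ->
  (forall n x, `|f_ n x| <= g x) ->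
  L1 f /\ \int[mu]_x f_ n x @[n --> \oo] --> \int[mu]_x f x.
Proof.
move=> mf_ ff g1 fg.
have mf : measurable_fun [set: R] f by apply: measurable_fun_cvg => // x _.
have f_1 n : L1 (f_ n) by exact: L1_le (mf_ n) (fg n) g1.
have ffE : {ae mu, forall x, setT x -> (EFin \o f_ n) x @[n --> \oo] --> (EFin \o f) x}.
  by apply: aeW => x _; apply: cvg_EFin (ff x); exact: nearW.
have fgE : {ae mu, forall x n, setT x -> (`|(EFin \o f_ n) x| <= (EFin \o g) x)%E}.
  by apply: aeW => x n _; rewrite /= lee_fin.
have [f1 _ If] := @dominated_convergence _ _ R mu setT measurableT
  (fun n => EFin \o f_ n) (EFin \o f) (EFin \o g)
  (fun n => (measurable_EFinP _ _).2 (mf_ n)) ((measurable_EFinP _ _).2 mf)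
  ffE g1 fgE.
split=> //; apply: fine_cvg; rewrite fineK//; exact: integrable_fin_num.
Qed.

Lemma dominated_cvg_pinfty (f_ : R -> R -> R) f g :
  (forall t, measurable_fun [set: R] (f_ t)) ->
  (forall x, f_ t x @[t --> +oo] --> f x) -> L1 g ->
  (forall t x, `|f_ t x| <= g x) ->
  \int[mu]_x f_ t x @[t --> +oo] --> \int[mu]_x f x.
Proof.
move=> mf ff g1 fg; apply/cvg_pinftyP => u uoo.
have fu x : f_ (u n) x @[n --> \oo] --> f x by move/cvg_pinftyP : (ff x); exact.
by have [] := int_dominated_cvg (fun n => mf (u n)) fu g1 (fun n => fg (u n)).
Qed.

Lemma dominated_cvg_pt (f_ : R -> R -> R) (t0 : R) g :
  (forall t, measurable_fun [set: R] (f_ t)) ->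
  (forall x, f_ t x @[t --> t0] --> f_ t0 x) -> L1 g ->
  (forall t x, `|f_ t x| <= g x) ->
  {for t0, continuous (fun t => \int[mu]_x f_ t x)}.
Proof.
move=> mf ff g1 fg; apply/(@cvg_nbhsP _ R^o) => u uoo.
have fu x : f_ (u n) x @[n --> \oo] --> f_ t0 x.
  by have /(@cvg_nbhsP _ R^o) := ff x; apply.
by have [] := int_dominated_cvg (fun n => mf (u n)) fu g1 (fun n => fg (u n)).
Qed.

Let affine (c d x : R) : measurableTypeR R := c * x + d.

Let measurable_affine c d : measurable_fun [set: R] (affine c d).
Proof. by apply: measurable_funD => //; exact: measurable_funM. Qed.

(** The scaled image measure agrees with Lebesgue measure on half-open intervals, hence everywhere.
    A negative [c] moves the open end to the other side, which preserves the length. *)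
Let lebesgue_measure_affine c d (A : set R) : c != 0 -> measurable A ->
  mu A = (`|c|%:E * mu (affine c d @^-1` A))%E.
Proof.
move=> c0 mA.
pose pf := measure_function_pushforward__canonical__measure_function_Measure mu
    (measurable_affine c d).
pose ms := measure_function_mscale__canonical__measure_function_Measure
  (NngNum (normr_ge0 c)) pf.
apply: (@lebesgue_measure_unique R ms) => // _ [[a b]] _ <-.
rewrite /= /mscale/= /pushforward/=.
have [c_gt0|c_lt0|ce0] := ltgtP 0 c; last by rewrite ce0 eqxx in c0.
- rewrite (_ : _ @^-1` _ = `](a - d) / c, (b - d) / c]%classic); last first.
    apply/seteqP; split => x /=;
      by rewrite /affine !in_itv/= ltr_pdivrMr// ler_pdivlMr// (mulrC x) ltrBlDr lerBrDr.
  rewrite !lebesgue_measure_itv/= !lte_fin ltr_pM2r ?invr_gt0// ltrD2r.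
  case: ifP => _; last by rewrite mule0.
  by rewrite -!EFinB -EFinM gtr0_norm//; congr EFin; field.
- rewrite (_ : _ @^-1` _ = `[(b - d) / c, (a - d) / c[%classic); last first.
    apply/seteqP; split => x /=;
      by rewrite /affine !in_itv/= ltr_ndivlMr// ler_ndivrMr// (mulrC x) andbC
        ltrBlDr lerBrDr.
  rewrite !lebesgue_measure_itv/= !lte_fin ltr_nM2r ?invr_lt0// ltrD2r.
  case: ifP => _; last by rewrite mule0.
  rewrite -!EFinB -EFinM ltr0_norm//; congr EFin; field.
  by rewrite c0.
Qed.

Lemma ge0_integral_affine (c d : R) (f : R -> \bar R) : c != 0 ->
  measurable_fun [set: R] f -> (forall x, (0 <= f x)%E) ->
  (\int[mu]_x f (c * x + d)%R = `|c|^-1%:E * \int[mu]_x f x)%E.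
Proof.
move=> c0 mf f0.
pose pf := measure_function_pushforward__canonical__measure_function_Measure mu
    (measurable_affine c d).
pose ms := measure_function_mscale__canonical__measure_function_Measure
  (NngNum (normr_ge0 c)) pf.
rewrite [X in _ = (_ * X)%E](@eq_measure_integral _ _ _ _ ms); last first.
  by move=> A mA _; exact: lebesgue_measure_affine.
rewrite ge0_integral_mscale// muleA -EFinM mulVf ?normr_eq0// mul1e.
have := @ge0_integral_pushforward _ _ (measurableTypeR R) (measurableTypeR R) R _
  (measurable_affine c d) (@lebesgue_measure R) setT f measurableT mf
  (fun x _ => f0 x).
by rewrite preimage_setT.
Qed.

Lemma L1_affine c d f : c != 0 -> L1 f -> L1 (fun x => f (c * x + d)).
Proof.
move=> c0 f1; have mf := L1_measurable f1.
apply/integrableP; split.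
  by apply/measurable_EFinP; apply: (measurableT_comp mf); exact: measurable_affine.
rewrite (ge0_integral_affine d (f := fun x => `|(f x)%:E|%E))//.
  move: f1 => /integrableP[_ f1].
  by apply: lte_mul_pinfty => //; rewrite lee_fin invr_ge0.
by apply: measurableT_comp => //; exact/measurable_EFinP.
Qed.

Lemma int_affine c d f : c != 0 -> L1 f ->
  \int[mu]_x f (c * x + d) = `|c|^-1 * \int[mu]_x f x.
Proof.
move=> c0 f1; have mf := L1_measurable f1.
have mp : measurable_fun [set: R] (fun x => Num.max (f x) 0).
  exact: measurable_maxr.
have mn : measurable_fun [set: R] (fun x => Num.max (- f x) 0).
  by apply: measurable_maxr => //; exact: measurableT_comp.
have fE x : f x = Num.max (f x) 0 - Num.max (- f x) 0 by 
  by rewrite /Num.max; case: ltP => ?; case: ltP => ?; lra.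
have p1 : L1 (fun x => Num.max (f x) 0).
  by apply: (L1_le mp _ (L1_norm f1)) => x; rewrite /Num.max; case: ltP; rewrite ?normr0.
have n1 : L1 (fun x => Num.max (- f x) 0).
  by apply: (L1_le mn _ (L1_norm f1)) => x; rewrite /Num.max; case: ltP; rewrite ?normr0 ?normrN.
have ge0 g : L1 g -> (forall x, 0 <= g x) ->
    \int[mu]_x g (c * x + d) = `|c|^-1 * \int[mu]_x g x.
  move=> g1 g0; rewrite /Rintegral (ge0_integral_affine d (f := EFin \o g))//.
    by rewrite fineM//; exact: integrable_fin_num.
  by apply/measurable_EFinP; exact: L1_measurable.
have max0 (x : R) : 0 <= Num.max x 0 by rewrite le_max lexx orbT.
under eq_Rintegral do rewrite fE.
under [in RHS]eq_Rintegral do rewrite fE.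
rewrite !intB//; last 2 first.
- exact: (L1_affine d c0 p1).
- exact: (L1_affine d c0 n1).
by rewrite (ge0 (fun x => Num.max (f x) 0))// (ge0 (fun x => Num.max (- f x) 0))// mulrBr.
Qed.

Lemma L1_shift a f : L1 f -> L1 (fun x => f (x - a)).
Proof.
move=> /(L1_affine (- a) (oner_neq0 R)); congr L1; apply/funext => x.
by rewrite mul1r.
Qed.

Lemma int_shift a f : L1 f -> \int[mu]_x f (x - a) = \int[mu]_x f x.
Proof.
move=> /(int_affine (- a) (oner_neq0 R)); rewrite normr1 invr1 mul1r => <-.
by apply: eq_Rintegral => x _; rewrite mul1r.
Qed.

Lemma L1_reflect a f : L1 f -> L1 (fun x => f (a - x)).
Proof.
have N1 : - 1 != 0 :> R by rewrite oppr_eq0 oner_neq0.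
move=> /(L1_affine a N1); congr L1; apply/funext => x.
by rewrite mulN1r addrC.
Qed.

Lemma int_reflect a f : L1 f -> \int[mu]_x f (a - x) = \int[mu]_x f x.
Proof.
have N1 : - 1 != 0 :> R by rewrite oppr_eq0 oner_neq0.
move=> /(int_affine a N1); rewrite normrN normr1 invr1 mul1r => <-.
by apply: eq_Rintegral => x _; rewrite mulN1r addrC.
Qed.

(** Inner integrals in Fubini's theorem may be infinite on a null set, where [fine] makes them 0;
    this changes neither integrability nor the integral. *)
Let integrable_fine (G : R -> \bar R) : mu.-integrable setT G ->
  L1 (fine \o G) /\ \int[mu]_x (fine (G x)) = fine (\int[mu]_x G x).
Proof.
move=> iG; have mG := measurable_int _ iG.
have mfG : measurable_fun [set: R] (fine \o G) by exact: measurableT_comp.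
split.
  apply: le_integrable iG => //; first exact/measurable_EFinP.
  by move=> x _ /=; case: (G x) => //= ; rewrite normr0 leey.
rewrite /Rintegral; congr fine; apply: ae_eq_integral => //.
  exact/measurable_EFinP.
have := integrable_ae measurableT iG.
by apply: filterS => x /= /(_ Logic.I) Gx _; rewrite fineK.
Qed.

Lemma fubiniR (F : R * R -> R) :
  (mu \x mu)%E.-integrable setT (EFin \o F) ->
  [/\ L1 (fun x => \int[mu]_y F (x, y)), L1 (fun y => \int[mu]_x F (x, y)) &
      \int[mu]_x \int[mu]_y F (x, y) = \int[mu]_y \int[mu]_x F (x, y)].
Proof.
move=> iF.
have [FL FE] := integrable_fine (integrable_fubini_F iF).
have iG : mu.-integrable setT (fubini_G mu (EFin \o F)).
  apply/integrableP; split; first exact: measurable_fubini_G iF.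
  apply: le_lt_trans ((integrable21ltyP mu mu (measurable_int _ iF)).1 iF).
  apply: ge0_le_integral => //.
  - by apply: measurableT_comp => //; exact: measurable_fubini_G iF.
  - apply: (@measurable_fun_fubini_tonelli_G _ _ _ _ _ mu (abse \o (EFin \o F))) => //.
    + by apply: measurableT_comp => //; exact: measurable_int iF.
    + by move=> z; exact: abse_ge0.
  - move=> y _; apply: le_abse_integral => //.
    by apply: measurableT_comp (measurable_int _ iF) _; exact: measurable_pair2.
have [GL GE] := integrable_fine iG.
split; [exact: FL | exact: GL |].
have FG := Fubini iF.
exact: (etrans FE (etrans (congr1 fine FG) (esym GE))).
Qed.

Lemma product_integrable (F : R * R -> R) : measurable_fun setT F ->
  (forall y, L1 (fun x => F (x, y))) ->
  L1 (fun y => \int[mu]_x `|F (x, y)|) ->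
  (mu \x mu)%E.-integrable setT (EFin \o F).
Proof.
move=> mF F1 FF; apply/integrable21ltyP; first exact/measurable_EFinP.
under eq_integral => y _.
  rewrite (_ : (\int[mu]_x _)%E = (\int[mu]_x `|F (x, y)|)%:E); last first.
    rewrite /Rintegral fineK//; apply: integrable_fin_num => //.
    exact: (L1_norm (F1 y)).
  over.
rewrite -[ltLHS]fineK ?ltry//; exact: integrable_fin_num.
Qed.

End L1_calculus.

Definition convol {R : realType} (f g : R -> R) (t : R) : R :=
  \int[lebesgue_measure]_s (f (t - s) * g s).

Section convolution.
Context {R : realType}.
Local Notation mu := (@lebesgue_measure R).
Implicit Types f g h : R -> R.

Lemma measurable_sub2 f : measurable_fun [set: R] f ->
  measurable_fun [set: R * R] (fun z => f (z.1 - z.2)).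
Proof.
move=> mf; apply: (measurableT_comp mf) => //.
by apply: measurable_funB => //; exact: measurable_fst || exact: measurable_snd.
Qed.

Lemma conv_prod_integrable f g : L1 f -> L1 g ->
  (mu \x mu)%E.-integrable setT (EFin \o (fun z => f (z.1 - z.2) * g z.2)).
Proof.
move=> f1 g1; apply: product_integrable.
- apply: measurable_funM; first exact: measurable_sub2 (L1_measurable f1).
  by apply: (measurableT_comp (L1_measurable g1)); exact: measurable_snd.
- move=> y /=; have := L1Z (g y) (L1_shift y f1).
  by congr L1; apply/funext => x; rewrite mulrC.
- have := L1Z (\int[mu]_x `|f x|) (L1_norm g1).
  congr L1; apply/funext => y /=.
  rewrite -(int_shift y (L1_norm f1)) mulrC -intZ; last exact: L1_shift (L1_norm f1).
  by apply: eq_Rintegral => x _; rewrite normrM mulrC.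
Qed.

Lemma L1_conv f g : L1 f -> L1 g -> L1 (convol f g).
Proof. by move=> f1 g1; have [] := fubiniR (conv_prod_integrable f1 g1). Qed.

Lemma int_conv f g : L1 f -> L1 g ->
  \int[mu]_x convol f g x = (\int[mu]_x f x) * \int[mu]_x g x.
Proof.
move=> f1 g1; have [_ _] := fubiniR (conv_prod_integrable f1 g1).
rewrite /convol => -> /=; rewrite -intZ//; apply: eq_Rintegral => y _.
rewrite -(int_shift y f1) mulrC -intZ; last exact: L1_shift.
by apply: eq_Rintegral => x _; rewrite mulrC.
Qed.

Lemma convolC f g t : L1 (fun s => f (t - s) * g s) -> convol f g t = convol g f t.
Proof.
move=> fg1; rewrite /convol -(int_reflect t fg1); apply: eq_Rintegral => x _.
by rewrite subKr mulrC.
Qed.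

(** Fubini for [f (t - s) * g (s - u) * h u]. The absolute triple convolution is controlled at the
    one point [t] only, because Caputo weights and the Heaviside function are not integrable on the
    whole line. *)
Lemma conv_assoc f g h t :
  measurable_fun [set: R] f -> measurable_fun [set: R] g ->
  measurable_fun [set: R] h ->
  (forall x, L1 (fun s => f (x - s) * g s)) ->
  L1 (fun u => convol (fun x => `|f x|) (fun x => `|g x|) (t - u) * `|h u|) ->
  L1 (fun s => f (t - s) * convol g h s) /\
  convol f (convol g h) t = convol (convol f g) h t.
Proof.
move=> mf mg mh fg1 fgh1.
pose F (z : R * R) := f (t - z.1) * g (z.1 - z.2) * h z.2.
have shE u : (fun s => f (t - s) * g (s - u)) =
    (fun s => (fun v => f (t - u - v) * g v) (s - u)).
  by apply/funext => s /=; congr (f _ * _); ring.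
have sh1 u : L1 (fun s => f (t - s) * g (s - u)).
  by rewrite shE; exact: (L1_shift u (fg1 (t - u))).
have iF : (mu \x mu)%E.-integrable setT (EFin \o F).
  apply: product_integrable.
  - apply: measurable_funM.
      apply: measurable_funM; last exact: measurable_sub2.
      by apply: (measurableT_comp mf); exact: measurable_funB.
    by apply: (measurableT_comp mh); exact: measurable_snd.
  - move=> u; have := L1Z (h u) (sh1 u).
    by congr L1; apply/funext => s; rewrite /F/= mulrC.
  - move: fgh1; congr L1; apply/funext => u; rewrite /F/= mulrC /convol.
    rewrite -(@int_shift _ u); last first.
      have := L1_norm (fg1 (t - u)).
      by congr L1; apply/funext => s /=; rewrite normrM.
    rewrite -intZ.
      apply: eq_Rintegral => s _ /=; rewrite !normrM mulrC.
      by congr (`|f _| * _ * _); ring.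
    have := L1_norm (sh1 u).
    by congr L1; apply/funext => s; rewrite normrM; congr (`|f _| * _); ring.
have [F1 F2 F12] := fubiniR iF.
have FE s : \int[mu]_u F (s, u) = f (t - s) * convol g h s.
  rewrite /convol -int_mulrl; first by apply: eq_Rintegral => u _; rewrite /F/= mulrA.
  apply: measurable_funM => //; apply: (measurableT_comp mg).
  exact: measurable_funB.
split; first by move: F1; congr L1; apply/funext.
rewrite /convol -/(convol _ _).
transitivity (\int[mu]_s \int[mu]_u F (s, u)).
  by apply: eq_Rintegral => s _; rewrite FE.
rewrite F12; apply: eq_Rintegral => u _.
rewrite mulrC /convol -(int_shift u (fg1 (t - u))) -intZ.
  by apply: eq_Rintegral => s _; rewrite /F/= [RHS]mulrC; congr (f _ * _ * _); ring.
by move: (sh1 u); rewrite shE.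
Qed.

End convolution.

(** * Cosine and sine transforms *)

(** The value at 0 is 0, so that every kernel carrying this factor vanishes on the closed half line
    [t <= 0]. *)
Definition heaviside {R : realType} (x : R) : R := (0 < x)%R%:R.

Definition cosT {R : realType} (f : R -> R) (w : R) : R :=
  \int[lebesgue_measure]_t (f t * cos (w * t)).

Definition sinT {R : realType} (f : R -> R) (w : R) : R :=
  \int[lebesgue_measure]_t (f t * sin (w * t)).

Section pointwise_derivatives.
Context {R : realType}.
Implicit Types (f g : R -> R) (x a b c : R).

Lemma dCst c x : is_derive x 1 (fun _ : R => c) 0.
Proof. exact: is_derive_cst. Qed.

Lemma dId x : is_derive x 1 (fun t : R => t) 1.
Proof. exact: is_derive_id. Qed.

Lemma dD f g x a b : is_derive x 1 f a -> is_derive x 1 g b ->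
  is_derive x 1 (fun t => f t + g t) (a + b).
Proof. by move=> fa gb; exact: is_deriveD. Qed.

Lemma dN f x a : is_derive x 1 f a -> is_derive x 1 (fun t => - f t) (- a).
Proof. by move=> fa; exact: is_deriveN. Qed.

Lemma dB f g x a b : is_derive x 1 f a -> is_derive x 1 g b ->
  is_derive x 1 (fun t => f t - g t) (a - b).
Proof. by move=> fa gb; exact: is_deriveB. Qed.

Lemma dM f g x a b : is_derive x 1 f a -> is_derive x 1 g b ->
  is_derive x 1 (fun t => f t * g t) (a * g x + f x * b).
Proof.
move=> fa gb; have -> : a * g x + f x * b = f x *: b + g x *: a.
  by rewrite /GRing.scale/= addrC [a * _]mulrC.
exact: is_deriveM.
Qed.

Lemma dZ f c x a : is_derive x 1 f a -> is_derive x 1 (fun t => c * f t) (c * a).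
Proof.
move=> fa; apply: is_derive_eq (dM (dCst c x) fa) _.
by rewrite mul0r add0r.
Qed.

Lemma dComp f g x a b : is_derive (g x) 1 f a -> is_derive x 1 g b ->
  is_derive x 1 (fun t => f (g t)) (a * b).
Proof. by move=> fa gb; exact: is_derive1_comp. Qed.

End pointwise_derivatives.

Section half_line.
Context {R : realType}.
Local Notation mu := (@lebesgue_measure R).
Local Notation H := (@heaviside R).
Implicit Types f g F : R -> R.

Lemma heavisideE (x : R) : 0 < x -> H x = 1.
Proof. by rewrite /heaviside => ->. Qed.

Lemma heaviside_le0 (x : R) : x <= 0 -> H x = 0.
Proof. by rewrite /heaviside leNgt => /negbTE ->. Qed.

Lemma heaviside_ge0 (x : R) : 0 <= H x.
Proof. by rewrite /heaviside; case: ltP. Qed.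

Lemma heaviside_le1 (x : R) : H x <= 1.
Proof. by rewrite /heaviside; case: ltP. Qed.

Lemma heaviside_indic : H = \1_`]0, +oo[.
Proof. by apply/funext => x; rewrite /heaviside indicE mem_setE in_itv/= andbT. Qed.

Lemma measurable_heaviside : measurable_fun [set: R] H.
Proof. by rewrite heaviside_indic; exact: measurable_indic. Qed.

Lemma continuous_measurableT f : continuous f -> measurable_fun [set: R] f.
Proof. exact: continuous_measurable_fun. Qed.

Lemma is_derive_continuous F f : (forall x : R, is_derive x 1 F (f x)) -> continuous F.
Proof.
move=> dF x; apply/differentiable_continuous/derivable1_diffP.
by have [] := dF x.
Qed.

Lemma FTC_itv f F (a b : R) : a <= b -> {within `[a, b], continuous f} ->
  {within `[a, b], continuous F} ->
  (forall x : R, x \in `]a, b[ -> is_derive x 1 F (f x)) ->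
  \int[mu]_(x in `[a, b]) f x = F b - F a.
Proof.
rewrite le_eqVlt => /predU1P[<- _ _ _|ab cf cF dF].
  by rewrite set_itv1 Rintegral_set1 subrr.
rewrite /Rintegral (@continuous_FTC2 _ f F a b ab cf)//.
- have [_ Fa Fb] := (continuous_within_itvP _ ab).1 cF.
  by split=> // x xab; have [] := dF x xab.
- by move=> x xab; rewrite derive1E; have /@derive_val := dF x xab.
Qed.

Lemma L1_continuous_itv f (a b : R) : {within `[a, b], continuous f} ->
  L1 (fun x => f x * \1_`[a, b] x).
Proof.
move=> cf; apply: (L1_in _ _).1 => //.
by apply: continuous_compact_integrable => //; exact: segment_compact.
Qed.

Lemma int_ocitv f (a b : R) : {within `[a, b], continuous f} ->
  \int[mu]_x (f x * \1_`]a, b] x) = \int[mu]_(x in `[a, b]) f x.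
Proof.
move=> cf; rewrite -int_in; apply: (@Rintegral_itv_obnd_cbnd R a (BRight b) f).
have : mu.-integrable `[a, b] (EFin \o f).
  by apply: continuous_compact_integrable => //; exact: segment_compact.
by apply: integrableS => //; exact: subset_itv_oc_cc.
Qed.

Lemma FTC_half_line f F (l : R) : continuous f ->
  (forall x : R, is_derive x 1 F (f x)) -> F x @[x --> +oo] --> l ->
  L1 (fun x => f x * H x) -> \int[mu]_x (f x * H x) = l - F 0.
Proof.
move=> cf dF Fl f1; have cF := is_derive_continuous dF.
pose f_ (t x : R) := f x * \1_`]0, t] x.
have f_H t x : `|f_ t x| <= `|f x * H x|.
  rewrite /f_ heaviside_indic !normrM ler_wpM2l// !indicE !mem_setE !in_itv/= andbT.
  by case: (0 < x); rewrite /= ?normr0//; case: (x <= t); rewrite ?normr0 ?normr1.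
have f_cvg : \int[mu]_x f_ t x @[t --> +oo] --> \int[mu]_x (f x * H x).
  apply: (dominated_cvg_pinfty _ _ (L1_norm f1) f_H).
    move=> t; apply: measurable_funM; first exact: continuous_measurableT.
    exact: measurable_indic.
  move=> x; apply: cvg_near_cst; near=> t.
  rewrite /f_ heaviside_indic !indicE !mem_setE !in_itv/= andbT.
  have -> : x <= t by near: t; apply: nbhs_pinfty_ge; exact: num_real.
  by rewrite andbT.
have FE : {near +oo, (fun t => F t - F 0) =1 (fun t => \int[mu]_x f_ t x)}.
  near=> t; have t0 : 0 < t by near: t; apply: nbhs_pinfty_gt; exact: num_real.
  rewrite -(@FTC_itv f F 0 t) ?ltW//; last 2 first.
  - exact: continuous_subspaceT.
  - exact: continuous_subspaceT.
  by rewrite -int_ocitv//; exact: continuous_subspaceT.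
apply: (cvg_unique _ f_cvg) => //.
apply: cvg_trans (near_eq_cvg FE) _; apply: cvgB => //; exact: cvg_cst.
Unshelve. all: by end_near. Qed.

Lemma ge0_FTC_half_line f F (l : R) : (forall x, 0 <= x -> 0 <= f x) ->
  continuous f -> (forall x : R, is_derive x 1 F (f x)) ->
  F x @[x --> +oo] --> l -> L1 (fun x => f x * H x).
Proof.
move=> f0 cf dF Fl; have cF := is_derive_continuous dF.
have : mu.-integrable `[0, +oo[ (EFin \o f).
  apply/integrableP; split.
    by apply/measurable_EFinP/measurable_funTS; exact: continuous_measurableT.
  rewrite (_ : (\int[mu]_(x in _) _ = \int[mu]_(x in `[0%R, +oo[) (f x)%:E)%E); last first.
    apply: eq_integral; move=> x /[!inE]/=; rewrite in_itv/= andbT => x0.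
    by rewrite ger0_norm// f0.
  rewrite (@ge0_continuous_FTC2y _ f F 0 l)//.
  - by rewrite -EFinB ltry.
  - exact: continuous_subspaceT.
  - exact: cvg_at_right_filter (cF 0).
  - by move=> x _; rewrite derive1E; have /@derive_val := dF x.
move=> f1; rewrite heaviside_indic; apply: (L1_in f (measurable_itv _)).1.
apply: (integrableS _ _ _ f1) => //; apply: subset_itvr.
by rewrite bnd_simp.
Qed.

End half_line.

Section fourier.
Context {R : realType}.
Local Notation mu := (@lebesgue_measure R).
Local Notation H := (@heaviside R).
Implicit Types f g u v : R -> R.

Lemma measurable_cosM (w : R) : measurable_fun [set: R] (fun t => cos (w * t)).
Proof.
apply: continuous_measurable_fun => x; apply: continuous_comp.
  exact: mulrl_continuous.
exact: continuous_cos.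
Qed.

Lemma measurable_sinM (w : R) : measurable_fun [set: R] (fun t => sin (w * t)).
Proof.
apply: continuous_measurable_fun => x; apply: continuous_comp.
  exact: mulrl_continuous.
exact: continuous_sin.
Qed.

Lemma cos_norm_le1 (x : R) : `|cos x| <= 1.
Proof. by rewrite ler_norml cos_geN1 cos_le1. Qed.

Lemma sin_norm_le1 (x : R) : `|sin x| <= 1.
Proof. by rewrite ler_norml sin_geN1 sin_le1. Qed.

Lemma L1_cos f w : L1 f -> L1 (fun t => f t * cos (w * t)).
Proof.
apply: L1_bounded_mul (measurable_cosM w) _ => t; exact: cos_norm_le1.
Qed.

Lemma L1_sin f w : L1 f -> L1 (fun t => f t * sin (w * t)).
Proof.
apply: L1_bounded_mul (measurable_sinM w) _ => t; exact: sin_norm_le1.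
Qed.

Lemma cosTD f g w : L1 f -> L1 g ->
  cosT (fun t => f t + g t) w = cosT f w + cosT g w.
Proof.
move=> f1 g1; rewrite /cosT -intD; [|exact: L1_cos..].
by apply: eq_Rintegral => t _; rewrite mulrDl.
Qed.

Lemma sinTD f g w : L1 f -> L1 g ->
  sinT (fun t => f t + g t) w = sinT f w + sinT g w.
Proof.
move=> f1 g1; rewrite /sinT -intD; [|exact: L1_sin..].
by apply: eq_Rintegral => t _; rewrite mulrDl.
Qed.

Lemma cosTZ c f w : L1 f -> cosT (fun t => c * f t) w = c * cosT f w.
Proof.
move=> f1; rewrite /cosT -intZ; last exact: L1_cos.
by apply: eq_Rintegral => t _; rewrite mulrA.
Qed.

Lemma sinTZ c f w : L1 f -> sinT (fun t => c * f t) w = c * sinT f w.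
Proof.
move=> f1; rewrite /sinT -intZ; last exact: L1_sin.
by apply: eq_Rintegral => t _; rewrite mulrA.
Qed.

Lemma cosT_norm_le f w : L1 f -> `|cosT f w| <= \int[mu]_t `|f t|.
Proof.
move=> f1; apply: int_norm_le; last 2 first.
- exact: L1_norm.
- by move=> t; rewrite normrM ler_piMr// cos_norm_le1.
- exact: L1_measurable (L1_cos w f1).
Qed.

Lemma sinT_norm_le f w : L1 f -> `|sinT f w| <= \int[mu]_t `|f t|.
Proof.
move=> f1; apply: int_norm_le; last 2 first.
- exact: L1_norm.
- by move=> t; rewrite normrM ler_piMr// sin_norm_le1.
- exact: L1_measurable (L1_sin w f1).
Qed.

Lemma conv_transform f g (e : R -> R) : L1 f -> L1 g ->
  measurable_fun [set: R] e -> (forall t, `|e t| <= 1) ->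
  \int[mu]_t (convol f g t * e t) =
  \int[mu]_s (g s * \int[mu]_t (f t * e (t + s))).
Proof.
move=> f1 g1 me e1.
pose F (z : R * R) := f (z.1 - z.2) * g z.2 * e z.1.
have iF : (mu \x mu)%E.-integrable setT (EFin \o F).
  have mF : measurable_fun setT F.
    apply: measurable_funM; last exact: measurableT_comp me measurable_fst.
    apply: measurable_funM; first exact: measurable_sub2 (L1_measurable f1).
    exact: measurableT_comp (L1_measurable g1) measurable_snd.
  apply: le_integrable (conv_prod_integrable f1 g1) => //.
    exact/measurable_EFinP.
  by move=> z _ /=; rewrite lee_fin /F normrM ler_piMr.
have [_ _ F12] := fubiniR iF.
transitivity (\int[mu]_t \int[mu]_s F (t, s)).
  apply: eq_Rintegral => t _; rewrite mulrC /conv -int_mulrl.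
    by apply: eq_Rintegral => s _; rewrite /F/= mulrC.
  apply: measurable_funM; last exact: L1_measurable.
  apply: (measurableT_comp (L1_measurable f1)); exact: measurable_funB.
rewrite F12; apply: eq_Rintegral => s _.
have fe : L1 (fun t => f t * e (t + s)).
  apply: (@L1_bounded_mul _ 1) => //.
  by apply: (measurableT_comp me); exact: measurable_funD.
rewrite -(int_shift s fe) -intZ; last exact: (L1_shift s fe).
by apply: eq_Rintegral => t _; rewrite /F/= subrK; ring.
Qed.

Lemma cosT_conv f g w : L1 f -> L1 g ->
  cosT (convol f g) w = cosT f w * cosT g w - sinT f w * sinT g w.
Proof.
move=> f1 g1; rewrite /cosT conv_transform//; last 2 first.
- exact: measurable_cosM.
- by move=> t; exact: cos_norm_le1.
rewrite -!/(cosT _ _) -intZ; last exact: L1_cos.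
rewrite -[X in _ = _ - X]intZ; last exact: L1_sin.
rewrite -intB; [|exact/L1Z/L1_cos|exact/L1Z/L1_sin].
apply: eq_Rintegral => s _.
transitivity (g s * (cosT f w * cos (w * s) - sinT f w * sin (w * s))); last by ring.
congr (_ * _); rewrite ![_ * cos (w * s)]mulrC ![_ * sin (w * s)]mulrC.
rewrite /cosT /sinT -!intZ; [|exact: L1_sin|exact: L1_cos].
rewrite -intB; [|exact/L1Z/L1_cos|exact/L1Z/L1_sin].
by apply: eq_Rintegral => t _; rewrite mulrDr cosD; ring.
Qed.

Lemma sinT_conv f g w : L1 f -> L1 g ->
  sinT (convol f g) w = sinT f w * cosT g w + cosT f w * sinT g w.
Proof.
move=> f1 g1; rewrite /sinT conv_transform//; last 2 first.
- exact: measurable_sinM.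
- by move=> t; exact: sin_norm_le1.
rewrite -!/(sinT _ _) -intZ; last exact: L1_cos.
rewrite -[X in _ = _ + X]intZ; last exact: L1_sin.
rewrite -intD; [|exact/L1Z/L1_cos|exact/L1Z/L1_sin].
apply: eq_Rintegral => s _.
transitivity (g s * (sinT f w * cos (w * s) + cosT f w * sin (w * s))); last by ring.
congr (_ * _); rewrite ![_ * cos (w * s)]mulrC ![_ * sin (w * s)]mulrC.
rewrite /cosT /sinT -!intZ; [|exact: L1_cos|exact: L1_sin].
rewrite -intD; [|exact/L1Z/L1_sin|exact/L1Z/L1_cos].
by apply: eq_Rintegral => t _; rewrite mulrDr sinD; ring.
Qed.

End fourier.

(** * An inequality form of Plancherel's theorem *)

Section plancherel.
Context {R : realType}.
Local Notation mu := (@lebesgue_measure R).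
Local Notation H := (@heaviside R).
Implicit Types f g u v : R -> R.

(** Its cosine transform is the squared modulus of the Fourier transform of [u], and its value at 0
    is the square norm of [u]: Plancherel's inequality becomes a comparison of two autocorrelations
    at 0. *)
Definition autocorrelation u := convol u (fun x => u (- x)).

Lemma L1_opp u : L1 u -> L1 (fun x => u (- x)).
Proof. by move=> /(L1_reflect 0); under eq_fun do rewrite sub0r. Qed.

Lemma L1_autocorrelation u : L1 u -> L1 (autocorrelation u).
Proof. by move=> u1; apply: L1_conv => //; exact: L1_opp. Qed.

Lemma cosT_autocorrelation u w : L1 u ->
  cosT (autocorrelation u) w = cosT u w ^+ 2 + sinT u w ^+ 2.
Proof.
move=> u1; rewrite cosT_conv//; last exact: L1_opp.
have -> : cosT (fun x => u (- x)) w = cosT u w.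
  rewrite /cosT -(int_reflect 0 (L1_cos w u1)); apply: eq_Rintegral => x _.
  by rewrite sub0r mulrN cosN.
have -> : sinT (fun x => u (- x)) w = - sinT u w.
  transitivity (-1 * sinT u w); last by rewrite mulN1r.
  rewrite /sinT -intZ; last exact: L1_sin.
  rewrite -(int_reflect 0 (L1Z (-1) (L1_sin w u1))); apply: eq_Rintegral => x _.
  by rewrite sub0r mulrN sinN; ring.
by rewrite !expr2; ring.
Qed.

Lemma autocorrelationE u r :
  L1 (fun s => u (s + r) * u s) ->
  autocorrelation u r = \int[mu]_s (u (s + r) * u s).
Proof.
move=> u1; rewrite -(int_reflect 0 u1) /autocorrelation /convol.
by apply: eq_Rintegral => s _; rewrite sub0r addrC.
Qed.

Lemma L1_bounded_shift_mul u M r : L1 u -> (forall x, `|u x| <= M) ->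
  L1 (fun s => u (s + r) * u s).
Proof.
move=> u1 uM; under eq_fun do rewrite mulrC.
apply: (@L1_bounded_mul _ M) => //.
by apply: (measurableT_comp (L1_measurable u1)); exact: measurable_funD.
Qed.

Lemma autocorrelation_le u M r : L1 u -> (forall x, `|u x| <= M) ->
  `|autocorrelation u r| <= \int[mu]_x u x ^+ 2.
Proof.
move=> u1 uM; have ur1 r' := L1_bounded_shift_mul r' u1 uM.
rewrite autocorrelationE//.
have u2 : L1 (fun x => u x ^+ 2).
  by move: (ur1 0); under eq_fun do rewrite addr0 -expr2.
have u2r : L1 (fun x => u (x + r) ^+ 2).
  by move: (L1_shift (- r) u2); under eq_fun do rewrite opprK.
have -> : \int[mu]_x u x ^+ 2 = \int[mu]_x (2^-1 * (u (x + r) ^+ 2 + u x ^+ 2)).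
  rewrite intZ; last exact: L1D.
  rewrite intD// (_ : \int[mu]_x u (x + r) ^+ 2 = \int[mu]_x u x ^+ 2); first by field.
  by rewrite -[RHS](int_shift (- r) u2); apply: eq_Rintegral => x _; rewrite opprK.
apply: int_norm_le.
- exact: L1_measurable.
- exact/L1Z/L1D.
- move=> x; rewrite normrM -(real_normK (num_real (u (x + r)))) -(real_normK (num_real (u x))).
  have := sqr_ge0 (`|u (x + r)| - `|u x|); nra.
Qed.

Lemma autocorrelation0 u M : L1 u -> (forall x, `|u x| <= M) ->
  autocorrelation u 0 = \int[mu]_x u x ^+ 2.
Proof.
move=> u1 uM; rewrite autocorrelationE; last exact: L1_bounded_shift_mul u1 uM.
by apply: eq_Rintegral => x _; rewrite addr0 expr2.
Qed.

Lemma L1_tail u (e : R) : L1 u -> 0 < e -> exists2 N : R, 0 < N &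
  \int[mu]_x (`|u x| * (1 - \1_`[- N, N] x)) <= e.
Proof.
move=> u1 e0.
pose f_ (t x : R) := `|u x| * (1 - \1_`[- t, t] x).
have mf t : measurable_fun [set: R] (f_ t).
  apply: measurable_funM; first exact: L1_measurable (L1_norm u1).
  by apply: measurable_funB => //; exact: measurable_indic.
have f_le t x : `|f_ t x| <= `|u x|.
  rewrite normrM normr_id ler_piMr// indicE.
  by case: (_ \in _); rewrite ?subrr ?subr0 ?normr0 ?normr1.
have f_cvg x : f_ t x @[t --> +oo] --> 0.
  apply: cvg_near_cst; near=> t.
  rewrite /f_ indicE mem_setE in_itv/= -ler_norml.
  have -> : `|x| <= t by near: t; apply: nbhs_pinfty_ge; exact: num_real.
  by rewrite subrr mulr0.
have /cvgrPdist_le/(_ _ e0) := dominated_cvg_pinfty mf f_cvg (L1_norm u1) f_le.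
move=> [N [Nr NP]].
exists (Num.max N 0 + 1); first by rewrite ltr_wpDl ?le_max ?lexx ?orbT.
have := NP (Num.max N 0 + 1); rewrite /Rintegral integral0/= sub0r normrN.
move=> /(_ _)/(le_trans (ler_norm _)); apply.
by rewrite ltr_pwDr// le_max lexx.
Unshelve. all: by end_near. Qed.

Lemma dist_clamp_le (M x y : R) : `|x| <= M ->
  `|x - Num.max (- M) (Num.min M y)| <= `|x - y|.
Proof.
move=> xM; have := xM; rewrite ler_norml => /andP[x1 x2].
have M0 : 0 <= M by exact: le_trans xM.
have [h1|h1] := leP M y; first by rewrite max_r ?ler0_norm; lra.
by have [h2|h2] := leP (- M) y => //; rewrite ?ger0_norm; lra.
Qed.

Lemma clamp_norm_le (M y : R) : 0 <= M -> `|Num.max (- M) (Num.min M y)| <= M.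
Proof.
move=> M0; rewrite ler_norml le_max lexx/= ge_max ge_min lexx/= andbT.
by rewrite (le_trans _ M0)// oppr_le0.
Qed.

(** Continuity of translations in [L1]: on a bounded interval [u] is replaced by a continuous [g],
    and the tail is small. The bound [M] reduces the quadratic expression to an [L1] distance. *)
Lemma autocorrelation_cvg0 u (M : R) : L1 u -> (forall x, `|u x| <= M) ->
  {for 0, continuous (autocorrelation u)}.
Proof.
move=> u1 uM.
wlog M0 : M uM / 0 < M.
  move=> /(_ (`|M| + 1)); apply; last by rewrite ltr_wpDl.
  by move=> x; rewrite (le_trans (uM x))// (le_trans (ler_norm _))// lerDl.
apply/cvgrPdist_le => e e0.
(* The final budget is [2 M] times the tail plus [M] times two approximation errors and one
   translation error: [e/4 + e/8 + e/8 + e/4]. *)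
have e8 : 0 < e / (8 * M) by rewrite divr_gt0// mulr_gt0.
have e4 : 0 < e / (4 * M) by rewrite divr_gt0// mulr_gt0.
have [N N0 uN] := L1_tail u1 e8.
pose E : set R := `[- N - 1, N + 1]%classic.
have mE : measurable E by exact: measurable_itv.
have Efin : (mu E < +oo)%E.
  by rewrite lebesgue_measure_itv/=; case: ifP => _; rewrite ?ltry// -EFinB ltry.
have uE : mu.-integrable E (EFin \o u) by exact: integrableS u1.
have [g_ [cg_ ig_ ug_]] := approximation_continuous_integrable mE Efin uE.
have [n un] : exists n, \int[mu]_x (`|u x - g_ n x| * \1_E x) <= e / (8 * M).
  have /fine_cvgP[_ /cvgrPdist_le/(_ _ e8)[n _ /(_ n (leqnn _))]] := ug_.
  rewrite /= sub0r normrN => un; exists n; rewrite -int_in.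
  exact: le_trans (ler_norm _) un.
(* Clamping does not increase the distance to [u], whose values lie in [[-M, M]], and it supplies a
   dominating function for the translates of [g]. *)
pose g x : R := Num.max (- M) (Num.min M (g_ n x)).
have cg : continuous g.
  have cmin : continuous (fun x => Num.min M (g_ n x)).
    by move=> x; apply: (@continuous_min _ _ (cst M) (g_ n) x); [exact: cvg_cst|exact: cg_].
  move=> x; apply: (@continuous_max _ _ (cst (- M)) _ x); [exact: cvg_cst|exact: cmin].
have gM x : `|g x| <= M by exact/clamp_norm_le/ltW.
have ug x : `|u x - g x| <= `|u x - g_ n x| by exact: dist_clamp_le.
have mg := continuous_measurableT cg.
pose D x := `|u x - g x| * \1_E x.
have D1 : L1 D.
  apply: (@L1_le _ _ (fun x => `|u x * \1_E x| + M * \1_E x)).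
  - apply: measurable_funM; last exact: measurable_indic.
    apply: measurableT_comp => //; apply: measurable_funB => //.
    exact: L1_measurable.
  - move=> x; rewrite /D indicE; case: (_ \in _); rewrite ?mulr1 ?mulr0 ?normr0 ?addr0//.
    by rewrite normr_id (le_trans (ler_normB _ _))// lerD2l.
  - by apply: L1D; [exact/L1_norm/L1_indic | exact/L1Z/L1_indic_itv].
have intD8 : \int[mu]_x D x <= e / (8 * M).
  apply: le_trans un; apply: int_le => //.
    have := L1_norm (L1B ((L1_in u mE).1 uE) ((L1_in (g_ n) mE).1 (ig_ n))).
    congr L1; apply/funext => x; rewrite -mulrBl normrM; congr (_ * _).
    by rewrite indicE; case: (_ \in _); rewrite ?normr0 ?normr1.
  by move=> x; rewrite /D ler_wpM2r// indicE; case: (_ \in _).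
pose G (r s : R) := `|g s - g (s + r)| * \1_`[- N, N] s.
have mG r : measurable_fun [set: R] (G r).
  apply: measurable_funM; last exact: measurable_indic.
  apply: measurableT_comp => //; apply: measurable_funB => //.
  by apply: (measurableT_comp mg); exact: measurable_funD.
have G_le r s : `|G r s| <= 2 * M * \1_`[- N, N] s.
  rewrite normrM normr_id (ger0_norm (x := \1_`[- N, N] s)); last first.
    by rewrite indicE; case: (_ \in _).
  rewrite ler_wpM2r//.
  by rewrite (le_trans (ler_normB _ _))// mulr2n mulrDl mul1r lerD.
have G1 r : L1 (G r) by exact: L1_le (mG r) (G_le r) (L1Z _ (L1_indic_itv _ _)).
have G0 : \int[mu]_x G 0 x = 0.
  rewrite /Rintegral integral0_eq// => x _.
  by rewrite /G addr0 subrr normr0 mul0r.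
have Gcvg : {for 0, continuous (fun r => \int[mu]_x G r x)}.
  apply: (@dominated_cvg_pt _ _ _ _ mG _ (L1Z _ (L1_indic_itv _ _)) G_le) => x.
  apply: cvgM; last exact: cvg_cst.
  apply: cvg_norm; apply: cvgB; first exact: cvg_cst.
  apply: continuous_comp; last exact: cg.
  by apply: cvgD; [exact: cvg_cst|exact: cvg_id].
have /cvgrPdist_le/(_ _ e4) := Gcvg.
rewrite G0 => Gnear.
near=> r.
have r1 : `|r| <= 1.
  near: r; have /cvgrPdist_le/(_ _ ltr01) := @cvg_id R (nbhs 0).
  by apply: filterS => r; rewrite sub0r normrN.
have Gr : \int[mu]_x G r x <= e / (4 * M).
  rewrite (le_trans (ler_norm _))// -normrN -sub0r.
  by near: r; exact: Gnear.
have ur1 r' := L1_bounded_shift_mul r' u1 uM.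
rewrite !autocorrelationE// -intB//.
pose B s := 2 * M * (`|u s| * (1 - \1_`[- N, N] s)) + M * (D s + G r s + D (s + r)).
have D1r : L1 (fun s => D (s + r)).
  by move: (L1_shift (- r) D1); under eq_fun do rewrite opprK.
have t1 : L1 (fun s => `|u s| * (1 - \1_`[- N, N] s)).
  under eq_fun do rewrite mulrBr mulr1.
  by apply: L1B; [exact: L1_norm|apply: L1_indic => //; exact: L1_norm].
apply: (@le_trans _ _ (\int[mu]_s B s)).
  apply: int_norm_le.
  - by apply: L1_measurable; exact: L1B.
  - by apply: L1D; apply: L1Z => //; apply: L1D => //; exact: L1D.
  - move=> s; rewrite addr0 -mulrBl normrM mulrC /B indicE mem_setE in_itv/= -ler_norml.
    have [sN|sN] := leP `|s| N.
      rewrite subrr !mulr0 add0r; apply: ler_pM => //.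
      have sE x : `|x| <= N + 1 -> x \in E.
        by rewrite /E mem_setE in_itv/= -opprD -ler_norml.
      have -> : D s = `|u s - g s|.
        by rewrite /D indicE sE ?mulr1// (le_trans sN)// lerDl.
      have -> : D (s + r) = `|u (s + r) - g (s + r)|.
        rewrite /D indicE sE ?mulr1// (le_trans (ler_normD _ _))// lerD//.
      have -> : G r s = `|g s - g (s + r)|.
        by rewrite /G indicE mem_setE in_itv/= -ler_norml sN mulr1.
      rewrite [`|u (s + r) - _|]distrC.
      have -> : u s - u (s + r) = u s - g s + (g s - g (s + r)) + (g (s + r) - u (s + r)).
        by ring.
      by apply: le_trans (ler_normD _ _) _; rewrite lerD2r; exact: ler_normD.
    rewrite subr0 mulr1 -[leLHS]addr0 lerD//.
      rewrite mulrC ler_wpM2r// (le_trans (ler_normB _ _))// mulr2n mulrDl mul1r lerD//.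
    rewrite mulr_ge0 ?(ltW M0)// !addr_ge0// ?/D ?/G mulr_ge0// indicE; by case: (_ \in _).
rewrite intD//; last 2 first.
- exact: L1Z.
- by apply: L1Z; apply: L1D => //; exact: L1D.
rewrite !intZ//; last by apply: L1D => //; exact: L1D.
rewrite !intD//; last exact: L1D.
have -> : \int[mu]_x D (x + r) = \int[mu]_x D x.
  by rewrite -[RHS](int_shift (- r) D1); apply: eq_Rintegral => x _; rewrite opprK.
have := mulr_gt0 M0 M0.
have := ler_wpM2l (ltW M0) uN; have := ler_wpM2l (ltW M0) intD8.
have := ler_wpM2l (ltW M0) Gr.
have -> : M * (e / (4 * M)) = e / 4 by field; rewrite gt_eqF.
have -> : M * (e / (8 * M)) = e / 8 by field; rewrite gt_eqF.
rewrite !mulrDr; lra.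
Unshelve. all: by end_near. Qed.

Lemma expR_cvg0 (d : R) : 0 < d -> expR (- (d * x)) @[x --> +oo] --> 0.
Proof.
move=> d0; have := @cvgr_expR R.
apply: (cvg_comp (fun x => d * x) (fun x => expR (- x))).
by apply: gt0_cvgMry => //; exact: cvg_id.
Qed.

Definition exp_step (d x : R) : R := expR (- (d * x)) * H x.

Let dlin (w x : R) : is_derive x 1 (fun x => w * x) w.
Proof. by apply: is_derive_eq (dZ w (dId x)) _; rewrite mulr1. Qed.

Let dexp (d x : R) : is_derive x 1 (fun x => expR (- (d * x))) (expR (- (d * x)) * - d).
Proof. exact: (dComp (is_derive_expR _) (dN (dlin d x))). Qed.

Let dcos (w x : R) : is_derive x 1 (fun x => cos (w * x)) (- sin (w * x) * w).
Proof. exact: (dComp (is_derive_cos _) (dlin w x)). Qed.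

Let dsin (w x : R) : is_derive x 1 (fun x => sin (w * x)) (cos (w * x) * w).
Proof. exact: (dComp (is_derive_sin _) (dlin w x)). Qed.

Lemma L1_exp_step (d : R) : 0 < d -> L1 (exp_step d).
Proof.
move=> d0; apply: (@ge0_FTC_half_line _ _ (fun x => (- d)^-1 * expR (- (d * x))) 0).
- by move=> x _; exact: expR_ge0.
- by move=> x; exact: (is_derive_continuous (dexp d)).
- move=> x; apply: is_derive_eq (dZ _ (dexp d x)) _.
  by rewrite mulrC -mulrA mulfV ?mulr1// oppr_eq0 gt_eqF.
- by rewrite -(mulr0 (- d)^-1); apply: cvgM (expR_cvg0 d0); exact: cvg_cst.
Qed.

Lemma transform_exp_step (d w : R) : 0 < d ->
  cosT (exp_step d) w = d / (d ^+ 2 + w ^+ 2) /\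
  sinT (exp_step d) w = w / (d ^+ 2 + w ^+ 2).
Proof.
move=> d0; have D0 : d ^+ 2 + w ^+ 2 != 0.
  by rewrite gt_eqF// ltr_wpDr ?sqr_ge0// exprn_gt0.
have bnd0 (e : R -> R) (C : R) : (forall x, `|e x| <= C) ->
    expR (- (d * x)) * e x / (d ^+ 2 + w ^+ 2) @[x --> +oo] --> 0.
  move=> eC; rewrite -(mul0r (d ^+ 2 + w ^+ 2)^-1); apply: cvgM; last exact: cvg_cst.
  apply/norm_cvg0P; apply: (@squeeze_cvgr _ _ _ _ (cst 0) (fun x => expR (- (d * x)) * C)).
  - near=> x; rewrite normr_ge0/= normrM ger0_norm ?expR_ge0//.
    by rewrite ler_wpM2l// expR_ge0.
  - exact: cvg_cst.
  - by rewrite -(mul0r C); apply: cvgM (cvg_cst _); exact: expR_cvg0.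
have sc (a b x : R) : `|a * sin (w * x) + b * cos (w * x)| <= `|a| + `|b|.
  rewrite (le_trans (ler_normD _ _))// !normrM lerD// ler_piMr//;
    [exact: sin_norm_le1 | exact: cos_norm_le1].
split.
- rewrite (_ : cosT _ _ = \int[mu]_x (expR (- (d * x)) * cos (w * x) * H x)); last first.
    by apply: eq_Rintegral => x _; rewrite /exp_step mulrAC.
  have cont : continuous (fun x : R => expR (- (d * x)) * cos (w * x)).
    move=> x; apply: cvgM; [exact: (is_derive_continuous (dexp d))|
      exact: (is_derive_continuous (dcos w))].
  have der (x : R) : is_derive x 1 (fun x => expR (- (d * x)) *
      (w * sin (w * x) + (- d) * cos (w * x)) / (d ^+ 2 + w ^+ 2)) (expR (- (d * x)) * cos (w * x)).
    apply: is_derive_eq (dM (dM (dexp d x) (dD (dZ _ (dsin w x))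
      (dZ _ (dcos w x)))) (dCst _ x)) _.
    by field.
  have fL1 : L1 (fun x => expR (- (d * x)) * cos (w * x) * H x).
    move: (L1_cos w (L1_exp_step d0)).
    by congr L1; apply/funext => x; rewrite /exp_step mulrAC.
  have -> := FTC_half_line cont der (bnd0 _ _ (sc _ _)) fL1.
  by rewrite !mulr0 oppr0 expR0 sin0 cos0; field.
- rewrite (_ : sinT _ _ = \int[mu]_x (expR (- (d * x)) * sin (w * x) * H x)); last first.
    by apply: eq_Rintegral => x _; rewrite /exp_step mulrAC.
  have cont : continuous (fun x : R => expR (- (d * x)) * sin (w * x)).
    move=> x; apply: cvgM; [exact: (is_derive_continuous (dexp d))|
      exact: (is_derive_continuous (dsin w))].
  have der (x : R) : is_derive x 1 (fun x => expR (- (d * x)) *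
      (- d * sin (w * x) + (- w) * cos (w * x)) / (d ^+ 2 + w ^+ 2)) (expR (- (d * x)) * sin (w * x)).
    apply: is_derive_eq (dM (dM (dexp d x) (dD (dZ _ (dsin w x))
      (dZ _ (dcos w x)))) (dCst _ x)) _.
    by field.
  have fL1 : L1 (fun x => expR (- (d * x)) * sin (w * x) * H x).
    move: (L1_sin w (L1_exp_step d0)).
    by congr L1; apply/funext => x; rewrite /exp_step mulrAC.
  have -> := FTC_half_line cont der (bnd0 _ _ (sc _ _)) fL1.
  by rewrite !mulr0 oppr0 expR0 sin0 cos0; field.
Unshelve. all: by end_near. Qed.

(** The multiplication formula, by Fubini on [f x * g y * cos (x y)]. It moves the transform from
    the autocorrelation to an explicit weight. *)
Lemma cosT_duality f g : L1 f -> L1 g ->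
  L1 (fun x => f x * cosT g x) /\
  \int[mu]_x (f x * cosT g x) = \int[mu]_x (g x * cosT f x).
Proof.
move=> f1 g1.
pose F (z : R * R) := f z.1 * g z.2 * cos (z.1 * z.2).
have mfg : measurable_fun setT (fun z : R * R => f z.1 * g z.2).
  apply: measurable_funM.
    exact: measurableT_comp (L1_measurable f1) measurable_fst.
  exact: measurableT_comp (L1_measurable g1) measurable_snd.
have ifg : (mu \x mu)%E.-integrable setT (EFin \o (fun z => f z.1 * g z.2)).
  apply: product_integrable => //= [y|].
    by move: (L1Z (g y) f1); under eq_fun do rewrite mulrC.
  move: (L1Z (\int[mu]_x `|f x|) (L1_norm g1)); congr L1; apply/funext => y.
  rewrite mulrC -intZ; last exact: L1_norm.
  by apply: eq_Rintegral => x _; rewrite normrM mulrC.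
have iF : (mu \x mu)%E.-integrable setT (EFin \o F).
  apply: le_integrable ifg => //.
    apply/measurable_EFinP/measurable_funM => //.
    apply: (measurableT_comp (continuous_measurableT (@continuous_cos R))).
    exact: measurable_funM.
  by move=> z _ /=; rewrite lee_fin /F normrM ler_piMr// cos_norm_le1.
have [F1 _ F12] := fubiniR iF.
have FE x : \int[mu]_y F (x, y) = f x * cosT g x.
  rewrite /cosT -intZ; last exact: L1_cos.
  by apply: eq_Rintegral => y _; rewrite /F/= mulrA.
split; first by move: F1; under eq_fun do rewrite FE.
transitivity (\int[mu]_x \int[mu]_y F (x, y)).
  by apply: eq_Rintegral => x _; rewrite FE.
rewrite F12; apply: eq_Rintegral => y _; rewrite /cosT -intZ; last exact: L1_cos.
by apply: eq_Rintegral => x _; rewrite /F/= [y * x]mulrC; ring.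
Qed.

Lemma L1_even f : measurable_fun [set: R] f -> (forall x, f (- x) = f x) ->
  L1 (fun x => f x * H x) -> L1 f.
Proof.
move=> mf fN f1.
apply: (@L1_le _ _ (fun x => `|f x * H x| + `|f (- x) * H (- x)| + `|f 0| * \1_`[0, 0] x)) => //.
  move=> x; rewrite indicE mem_setE in_itv/= fN.
  have [x0|x0|->] := ltgtP x 0.
  - by rewrite (heavisideE (x := - x)) ?oppr_gt0// mulr1 /= mulr0 addr0 lerDr.
  - by rewrite (heavisideE x0) mulr1 /= mulr0 addr0 lerDl.
  - by rewrite oppr0 /= mulr1 lerDr addr_ge0.
apply: L1D; last exact/L1Z/L1_indic_itv.
by apply: L1D; [exact: L1_norm|exact: (L1_norm (L1_opp f1))].
Qed.

(** Cosine transform of [exp(- |w|)]. Its mass occurs on both sides of Plancherel's inequality and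
    cancels, being positive. *)
Definition cauchy_density (x : R) : R := 2 / (1 + x ^+ 2).

Lemma L1_cauchy_density : L1 cauchy_density.
Proof.
have c0 (x : R) : 1 + x ^+ 2 != 0 by rewrite gt_eqF// ltr_pwDl// sqr_ge0.
have cc : continuous cauchy_density.
  move=> x; apply: cvgM; first exact: cvg_cst.
  apply: cvgV => //; apply: cvgD; first exact: cvg_cst.
  exact: exprn_continuous.
apply: L1_even; first exact: continuous_measurableT.
  by move=> x; rewrite /cauchy_density sqrrN.
apply: (@ge0_FTC_half_line _ _ (fun x => 2 * atan x) (2 * (pi / 2))) => //.
- by move=> x _; rewrite divr_ge0// addr_ge0// sqr_ge0.
- by apply: cvgM; [exact: cvg_cst|exact: cvgy_atan].
Qed.

Lemma int_cauchy_density_gt0 : 0 < \int[mu]_x cauchy_density x.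
Proof.
apply: (@lt_le_trans _ _ (\int[mu]_x \1_`[0, 1] x)).
  by rewrite int_indic_itv// subr0.
apply: int_le; [exact: L1_indic_itv|exact: L1_cauchy_density|] => x.
rewrite indicE mem_setE in_itv/= /cauchy_density.
have x2 := sqr_ge0 x.
have [/andP[x0 x1]|_] := boolP (0 <= x <= 1); last by rewrite divr_ge0// addr_ge0.
by rewrite ler_pdivlMr ?mul1r; nra.
Qed.

(** Away from 0 the weight on the left is [exp(- d |w|)], whose cosine transform is
    [2 d / (d^2 + r^2)]; the multiplication formula and the substitution [r = d x] give the
    right-hand side. *)
Lemma poisson_autocorrelation u (M d : R) : L1 u -> (forall x, `|u x| <= M) -> 0 < d ->
  \int[mu]_w ((exp_step d w + exp_step d (- w)) * (cosT u w ^+ 2 + sinT u w ^+ 2)) =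
  \int[mu]_x (autocorrelation u (d * x) * cauchy_density x).
Proof.
move=> u1 uM d0; have E1 := L1_exp_step d0; have E1N := L1_opp E1.
have A1 := L1_autocorrelation u1.
under eq_Rintegral do rewrite -cosT_autocorrelation//.
rewrite (cosT_duality (L1D E1 E1N) A1).2.
have cE r : cosT (fun w => exp_step d w + exp_step d (- w)) r = 2 * d / (d ^+ 2 + r ^+ 2).
  rewrite cosTD//; have -> : cosT (fun x => exp_step d (- x)) r = cosT (exp_step d) r.
    rewrite /cosT -(int_reflect 0 (L1_cos r E1)); apply: eq_Rintegral => x _.
    by rewrite sub0r mulrN cosN.
  by rewrite (transform_exp_step r d0).1; ring.
under eq_Rintegral do rewrite cE.
have AP : L1 (fun x => autocorrelation u x * (2 * d / (d ^+ 2 + x ^+ 2))).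
  apply: (@L1_bounded_mul _ (2 / d)) => //.
    apply: continuous_measurableT => x; apply: cvgM; first exact: cvg_cst.
    apply: cvgV; first by rewrite gt_eqF// ltr_pwDl ?sqr_ge0// exprn_gt0.
    by apply: cvgD; [exact: cvg_cst|exact: exprn_continuous].
  move=> x; rewrite ger0_norm.
    rewrite ler_pdivlMr// mulrAC ler_pdivrMr ?ltr_pwDl ?sqr_ge0 ?exprn_gt0//.
    by have := sqr_ge0 x; nra.
  by rewrite divr_ge0 ?mulr_ge0 ?addr_ge0 ?sqr_ge0// ltW.
have := int_affine 0 (negbT (gt_eqF d0)) AP.
under eq_Rintegral do rewrite addr0.
rewrite gtr0_norm// => /(congr1 (fun x => d * x)).
rewrite mulrA mulfV ?gt_eqF// mul1r => <-; rewrite -intZ; last first.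
  by move: (L1_affine 0 (negbT (gt_eqF d0)) AP); under eq_fun do rewrite addr0.
apply: eq_Rintegral => x _; rewrite /cauchy_density mulrCA; congr (_ * _).
have h1 : d ^+ 2 + (d * x) ^+ 2 != 0.
  by rewrite gt_eqF// ltr_pwDl ?sqr_ge0// exprn_gt0.
have h2 : 1 + x ^+ 2 != 0 by rewrite gt_eqF// ltr_pwDl// sqr_ge0.
have h3 : d != 0 by rewrite gt_eqF.
by field; do ?(apply/andP; split).
Qed.

(** Abel summation: the hypothesis is integrated against [exp(- d |w|)] with [d = 1 / (n + 1)],
    which makes the squared transforms integrable. On the side of [u] the limit [d -> 0] is taken;
    on the side of [v] the autocorrelation is bounded by the square norm already for fixed [d]. *)
Lemma plancherel_le u v (m Mu Mv : R) : L1 u -> L1 v ->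
  (forall x, `|u x| <= Mu) -> (forall x, `|v x| <= Mv) ->
  (forall w, m * (cosT u w ^+ 2 + sinT u w ^+ 2) <= cosT v w ^+ 2 + sinT v w ^+ 2) ->
  m * \int[mu]_x u x ^+ 2 <= \int[mu]_x v x ^+ 2.
Proof.
move=> u1 v1 uM vM mle.
set C := \int[mu]_x cauchy_density x; have C0 : 0 < C := int_cauchy_density_gt0.
have c1 := L1_cauchy_density.
have cge0 x : 0 <= cauchy_density x by rewrite divr_ge0// addr_ge0// sqr_ge0.
have ma w : L1 w -> measurable_fun [set: R] (autocorrelation w).
  by move=> w1; exact: L1_measurable (L1_autocorrelation w1).
have f_le (n : nat) x : `|autocorrelation u (n.+1%:R^-1 * x) * cauchy_density x| <=
    (\int[mu]_x u x ^+ 2) * cauchy_density x.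
  by rewrite normrM (ger0_norm (cge0 x)) ler_wpM2r//; exact: autocorrelation_le u1 uM.
have mf n : measurable_fun [set: R]
    (fun x => autocorrelation u (n.+1%:R^-1 * x) * cauchy_density x).
  apply: measurable_funM; last exact: L1_measurable.
  by apply: (measurableT_comp (ma _ u1)); exact: measurable_funM.
have f_cvg x : autocorrelation u (n.+1%:R^-1 * x) * cauchy_density x @[n --> \oo]
    --> autocorrelation u 0 * cauchy_density x.
  apply: cvgM; last exact: cvg_cst.
  apply: (cvg_comp (fun n => n.+1%:R^-1 * x) (autocorrelation u)); last first.
    exact: autocorrelation_cvg0 u1 uM.
  have : n.+1%:R^-1 * x @[n --> \oo] --> 0 * x.
    by apply: cvgM; [exact: cvg_harmonic|exact: cvg_cst].
  by rewrite mul0r.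
have [_] := int_dominated_cvg mf f_cvg (L1Z (\int[mu]_x u x ^+ 2) c1) f_le.
rewrite (autocorrelation0 u1 uM) intZ// -/C => lim_u.
rewrite -(ler_pM2r C0) -mulrA.
have -> : m * ((\int[mu]_x u x ^+ 2) * C) =
    lim ((m * \int[mu]_x (autocorrelation u (n.+1%:R^-1 * x) * cauchy_density x)) @[n --> \oo]).
  apply/esym/cvg_lim => //; apply: cvgM => //; exact: cvg_cst.
apply: limr_le.
  apply/cvg_ex; exists (m * ((\int[mu]_x u x ^+ 2) * C)).
  by apply: cvgM => //; exact: cvg_cst.
near=> n.
have d0 : (0 : R) < n.+1%:R^-1 by rewrite invr_gt0.
rewrite -(poisson_autocorrelation u1 uM d0).
have W1 : L1 (fun w => exp_step n.+1%:R^-1 w + exp_step n.+1%:R^-1 (- w)).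
  by apply: L1D; [exact: L1_exp_step|exact/L1_opp/L1_exp_step].
have L1W z : L1 z -> L1 (fun w => (exp_step n.+1%:R^-1 w + exp_step n.+1%:R^-1 (- w)) *
    (cosT z w ^+ 2 + sinT z w ^+ 2)).
  move=> z1; under eq_fun do rewrite -cosT_autocorrelation//.
  exact: (cosT_duality W1 (L1_autocorrelation z1)).1.
rewrite -intZ; last exact: L1W.
apply: (@le_trans _ _ (\int[mu]_w ((exp_step n.+1%:R^-1 w + exp_step n.+1%:R^-1 (- w)) *
    (cosT v w ^+ 2 + sinT v w ^+ 2)))).
  apply: int_le; [exact/L1Z/L1W|exact: L1W|] => w.
  rewrite mulrCA ler_wpM2l//.
  by rewrite addr_ge0// mulr_ge0 ?expR_ge0 ?heaviside_ge0.
rewrite (poisson_autocorrelation v1 vM d0).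
apply: (@le_trans _ _ (\int[mu]_x ((\int[mu]_y v y ^+ 2) * cauchy_density x))); last by rewrite intZ.
apply: int_le; last 1 first.
- move=> x; rewrite ler_wpM2r//.
  exact: le_trans (ler_norm _) (autocorrelation_le _ v1 vM).
- under eq_fun do rewrite mulrC.
  apply: (@L1_bounded_mul _ (\int[mu]_x v x ^+ 2)) => //.
    by apply: (measurableT_comp (ma _ v1)); exact: measurable_funM.
  by move=> x; exact: autocorrelation_le v1 vM.
- exact: L1Z.
Unshelve. all: by end_near. Qed.

End plancherel.

(** * Riesz kernels and the fractional resolvent *)

Definition entire {R : realType} (f : nat -> R) : Prop :=
  forall K : R, 0 < K -> exists C : R, forall n, `|f n| * K ^+ n <= C.

Section entire_series.
Context {R : realType}.
Implicit Types f : nat -> R.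

Lemma entire_diffs f : entire f -> entire (pseries_diffs f).
Proof.
move=> fe K K0; have K2 : 0 < 2 * K by rewrite mulr_gt0.
have [C fC] := fe (2 * K) K2; exists (C / K) => n.
rewrite ler_pdivlMr//; apply: le_trans (fC n.+1).
rewrite /pseries_diffs normrM ger0_norm//.
have -> : n.+1%:R * `|f n.+1| * K ^+ n * K = `|f n.+1| * (n.+1%:R * K ^+ n.+1).
  by rewrite exprSr; ring.
rewrite ler_wpM2l// exprMn ler_wpM2r ?exprn_ge0//; first exact: ltW.
by rewrite -natrX ler_nat ltnW// ltn_expl.
Qed.

Lemma entire_ratio f (r : nat -> R) : r n @[n --> \oo] --> 0 ->
  (forall n, `|f n.+1| <= r n * `|f n|) -> entire f.
Proof.
move=> r0 fr K K0.
have Ki : 0 < K^-1 by rewrite invr_gt0.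
have [N _ rN] : \forall n \near \oo, r n <= K^-1.
  have /cvgrPdist_le/(_ _ Ki) := r0; apply: filterS => n.
  by rewrite sub0r normrN; apply: le_trans; exact: ler_norm.
have dec n : `|f (N + n)%N| * K ^+ (N + n) <= `|f N| * K ^+ N.
  elim: n => [|n]; first by rewrite addn0.
  apply: le_trans; rewrite addnS exprS mulrA ler_wpM2r//.
    by rewrite exprn_ge0// ltW.
  have := fr (N + n)%N; have := rN (N + n)%N (leq_addr _ _).
  move=> rK /le_trans fn; rewrite -ler_pdivlMr//; apply: fn.
  by rewrite mulrC ler_wpM2l.
exists (\sum_(i < N.+1) `|f i| * K ^+ i) => n.
have pos i : 0 <= `|f i| * K ^+ i by rewrite mulr_ge0// exprn_ge0// ltW.
have [nN|Nn] := leqP n N.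
  by rewrite (bigD1 (Ordinal (nN : (n < N.+1)%N)))//= lerDl; apply: sumr_ge0 => i _; exact: pos.
have := dec (n - N)%N; rewrite (subnKC (ltnW Nn)) => /le_trans; apply.
by rewrite (bigD1 ord_max)//= lerDl; apply: sumr_ge0 => i _; exact: pos.
Qed.

Lemma entire_bounded f (K : R) : entire f -> 0 < K -> exists M : R,
  forall x N, `|x| <= K -> `|pseries f x N| <= M.
Proof.
move=> fe K0; have K2 : 0 < 2 * K by rewrite mulr_gt0.
have [C fC] := fe (2 * K) K2; exists (2 * C) => x N xK.
have C0 : 0 <= C by apply: le_trans (fC 0%N); rewrite mulr_ge0.
rewrite /pseries /series/=; apply: le_trans (ler_norm_sum _ _ _) _.
apply: (@le_trans _ _ (\sum_(0 <= i < N) C * 2^-1 ^+ i)).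
  apply: ler_sum => i _; rewrite normrM normrX exprVn ler_pdivlMr ?exprn_gt0//.
  rewrite -mulrA -exprMn; apply: le_trans (fC i); rewrite ler_wpM2l//.
  by rewrite lerXn2r// ?nnegrE ?mulr_ge0// ?(ltW K0)// mulrC ler_wpM2l.
rewrite -mulr_sumr mulrC ler_wpM2r//.
suff -> : \sum_(0 <= i < N) 2^-1 ^+ i = 2 - 2 * 2^-1 ^+ N :> R.
  by rewrite lerBlDr lerDl mulr_ge0// exprn_ge0.
elim: N => [|N IH]; first by rewrite big_nil expr0; ring.
by rewrite big_nat_recr//= IH exprS; field.
Qed.

Lemma entire_cvg f x : entire f -> cvgn (pseries f x).
Proof.
move=> fe; have K0 : 0 < 2 * (`|x| + 1) by rewrite mulr_gt0// ltr_wpDl.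
have [C fC] := fe _ K0.
have C0 : 0 <= C by apply: le_trans (fC 0%N); rewrite mulr_ge0.
apply: normed_cvg; apply: (@series_le_cvg _ _ (geometric C 2^-1)) => [n|n|n|].
- exact: normr_ge0.
- by rewrite geometric_ge0.
- rewrite /geometric/= exprVn ler_pdivlMr ?exprn_gt0// normrM normrX -mulrA -exprMn.
  apply: le_trans (fC n); rewrite ler_wpM2l// lerXn2r ?nnegrE ?mulr_ge0 ?addr_ge0//.
  by rewrite mulrC ler_wpM2l// lerDl.
- by apply: is_cvg_geometric_series; rewrite ger0_norm// invf_lt1// ltr1n.
Qed.

Lemma entire_continuous f : entire f -> continuous (fun x => limn (pseries f x)).
Proof.
move=> fe x.
have fe1 := entire_diffs fe; have fe2 := entire_diffs fe1.
apply/differentiable_continuous/derivable1_diffP.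
have xK : `|x| < `| `|x| + 1| by rewrite [ltRHS]ger0_norm ?addr_ge0// ltrDl.
by have [] := pseries_snd_diffs (@entire_cvg _ _ fe) (@entire_cvg _ _ fe1) (@entire_cvg _ _ fe2) xK.
Qed.

End entire_series.

(** The Riesz kernel without its factor [1 / Gamma s]. The Beta constants of convolutions are
    carried as the values [convol (riesz s1) (riesz s2) 1] and normalized once, in the construction
    of the resolvent. *)
Definition riesz {R : realType} (s t : R) : R := t `^ (s - 1) * heaviside t.

Section riesz_kernels.
Context {R : realType}.
Local Notation mu := (@lebesgue_measure R).
Local Notation H := (@heaviside R).
Implicit Types s t x : R.

Lemma riesz_ge0 s t : 0 <= riesz s t.
Proof. by rewrite mulr_ge0 ?powR_ge0 ?heaviside_ge0. Qed.

Lemma riesz_le0 s t : t <= 0 -> riesz s t = 0.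
Proof. by move=> t0; rewrite /riesz heaviside_le0// mulr0. Qed.

Lemma riesz_gt0 s t : 0 < t -> 0 < riesz s t.
Proof. by move=> t0; rewrite /riesz heavisideE// mulr1 powR_gt0. Qed.

Lemma rieszE s t : 0 < t -> riesz s t = t `^ (s - 1).
Proof. by move=> t0; rewrite /riesz heavisideE// mulr1. Qed.

Lemma measurable_riesz s : measurable_fun [set: R] (riesz s).
Proof.
apply: measurable_funM; last exact: measurable_heaviside.
exact: measurable_powR.
Qed.

Lemma powRD_gt0 x r s : 0 < x -> x `^ (r + s) = x `^ r * x `^ s.
Proof. by move=> x0; rewrite powRD// (gt_eqF x0) implybT. Qed.

Lemma riesz_scale s t x : 0 < t -> riesz s (t * x) = t `^ (s - 1) * riesz s x.
Proof.
move=> t0; have [x0|x0] := ltP 0 x.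
  by rewrite !rieszE ?mulr_gt0// powRM ?ltW.
by rewrite !riesz_le0 ?mulr0// pmulr_rle0.
Qed.

Lemma riesz_dec s t x : s <= 1 -> 0 < t -> t <= x -> riesz s x <= riesz s t.
Proof.
move=> s1 t0 tx; have x0 := lt_le_trans t0 tx.
rewrite !rieszE// -(opprB 1) 2!powRN lef_pV2 ?posrE ?powR_gt0//.
by apply: ge0_ler_powR => //; rewrite ?nnegrE ?subr_ge0// ltW.
Qed.

Lemma continuous_powR s t : 0 < t -> {for t, continuous (fun u => u `^ s)}.
Proof.
move=> t0; apply/differentiable_continuous/derivable1_diffP/derivable_powR.
by rewrite in_itv/= andbT.
Qed.

Lemma int_riesz s x : 0 < s -> 0 < x ->
  L1 (fun u => riesz s u * H (x - u)) /\
  \int[mu]_u (riesz s u * H (x - u)) = x `^ s / s.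
Proof.
move=> s0 x0.
(* The power is singular at 0 when [s < 1]: the fundamental theorem is applied on these compact
   intervals, and monotone convergence exhausts []0, x]]. *)
pose F (n : nat) : set (measurableTypeR R) := `[x / n.+2%:R, x]%classic.
have xn n : 0 < x / n.+2%:R :> R by rewrite divr_gt0.
have xnx n : x / n.+2%:R <= x by rewrite ler_pdivrMr// ler_peMr ?ler1n//; exact: ltW.
have Fcont n : {within F n, continuous (fun u => u `^ (s - 1))}.
  apply: continuous_in_subspaceT => u /[!inE]; rewrite /F/= in_itv/= => /andP[xu _].
  exact: continuous_powR (lt_le_trans (xn n) xu).
have FE n : (\int[mu]_(u in F n) (u `^ (s - 1))%:E = ((x `^ s - (x / n.+2%:R) `^ s) / s)%:E)%E.
  have -> : (x `^ s - (x / n.+2%:R) `^ s) / s = x `^ s / s - (x / n.+2%:R) `^ s / s.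
    by rewrite mulrBl.
  have <- : \int[mu]_(u in F n) (u `^ (s - 1)) = x `^ s / s - (x / n.+2%:R) `^ s / s.
    apply: (@FTC_itv _ _ (fun u => u `^ s / s)) => //; last first.
    - move=> u; rewrite in_itv/= => /andP[xu _].
      apply: is_derive_eq (dM (is_derive1_powR s (lt_trans (xn n) xu)) (dCst _ u)) _.
      by field; rewrite gt_eqF.
    - apply: continuous_in_subspaceT => u /[!inE]/=; rewrite in_itv/= => /andP[xu _].
      apply: cvgM; last exact: cvg_cst.
      exact: continuous_powR (lt_le_trans (xn n) xu).
    - exact: Fcont.
  have iF : mu.-integrable (F n) (EFin \o (fun u => u `^ (s - 1))).
    by apply: continuous_compact_integrable => //; exact: segment_compact.
  rewrite /Rintegral fineK//; apply: integrable_fin_num iF.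
  exact: measurable_itv.
have Fcup : \bigcup_n F n = `]0, x]%classic.
  apply/seteqP; split=> [u [n _]|u] /=.
    rewrite /F/= !in_itv/= => /andP[nu ->]; rewrite andbT.
    exact: lt_le_trans nu.
  rewrite in_itv/= => /andP[u0 ux].
  exists (Num.truncn (x / u)) => //; rewrite /F/= in_itv/= ux andbT.
  rewrite ler_pdivrMr// mulrC -ler_pdivrMr//.
  by rewrite (le_trans (ltW (truncnS_gt _)))// ler_nat.
have Fmono : {homo F : n m / (n <= m)%N >-> (n <= m)%O}.
  move=> n m nm; rewrite subsetEset => u /=; rewrite /F/= !in_itv/= => /andP[nu ->].
  rewrite andbT (le_trans _ nu)// ler_pM2l// lef_pV2 ?posrE// ler_nat.
  by rewrite !ltnS.
have mp : measurable_fun [set: R] (fun u => u `^ (s - 1)) by exact: measurable_powR.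
have := @ge0_nondecreasing_set_cvg_integral _ _ R F (fun u => (u `^ (s - 1))%:E) mu Fmono.
rewrite Fcup => /(_ _ _ _) cvgF.
have {}cvgF : (\int[mu]_(u in F n) (u `^ (s - 1))%:E)%E @[n --> \oo] -->
    (\int[mu]_(u in `]0%R, x]) (u `^ (s - 1))%:E)%E.
  apply: cvgF.
  - by move=> n; exact: measurable_itv.
  - by move=> n; apply/measurable_EFinP; exact: measurable_funTS.
  - by move=> n u _; rewrite lee_fin powR_ge0.
have intE : (\int[mu]_(u in `]0%R, x]) (u `^ (s - 1))%:E = (x `^ s / s)%:E)%E.
  apply: cvg_unique cvgF _ => //.
  rewrite (funext FE : (fun n => \int[mu]_(u in F n) (u `^ (s - 1))%:E)%E = _).
  apply: cvg_EFin; first exact: nearW.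
  rewrite /comp/=; apply: cvgM; last exact: cvg_cst.
  rewrite -[X in _ --> X]subr0; apply: cvgB; first exact: cvg_cst.
  apply: (cvg_at_rightP _ _ _).1 (powR_cvg0 s0) _ _; split=> //.
  rewrite -[X in _ --> X](mulr0 x); apply: cvgM; first exact: cvg_cst.
  have := @cvg_harmonic R; rewrite -cvg_shiftS; exact.
have i1 : mu.-integrable `]0, x] (EFin \o (fun u => u `^ (s - 1))).
  apply/integrableP; split.
    by apply/measurable_EFinP; exact: measurable_funTS.
  rewrite (_ : (\int[mu]_(u in _) _)%E = (x `^ s / s)%:E) ?ltry// -intE.
  by apply: eq_integral => u _ /=; rewrite ger0_norm ?powR_ge0.
have rE : (fun u => riesz s u * H (x - u)) = (fun u => u `^ (s - 1) * \1_`]0, x[ u).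
  apply/funext => u; rewrite /riesz /heaviside indicE mem_setE in_itv/= subr_gt0.
  by case: (0 < u); case: (u < x); rewrite /= ?mulr0 ?mulr1.
have i2 : mu.-integrable `]0, x[ (EFin \o (fun u => u `^ (s - 1))).
  by apply: integrableS i1 => //; exact: subset_itv_oo_oc.
rewrite rE; split; first exact: (L1_in _ _).1.
rewrite -int_in (Rintegral_itv_bndo_bndc (a := BRight 0) i2).
by rewrite /Rintegral intE.
Qed.

(** Each factor can be singular at one end of []0, t[] only, so cutting at [t / 2] leaves on each
    half a bounded factor and an integrable one. *)
Lemma L1_riesz_pair s1 s2 t : 0 < s1 -> 0 < s2 ->
  L1 (fun u => riesz s1 (t - u) * riesz s2 u).
Proof.
move=> s10 s20.
have mr : measurable_fun [set: R] (fun u => riesz s1 (t - u) * riesz s2 u).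
  apply: measurable_funM; last exact: measurable_riesz.
  by apply: (measurableT_comp (measurable_riesz s1)); exact: measurable_funB.
have [t0|t0] := ltP 0 t; last first.
  apply: (L1_le mr _ L1_0) => u.
  have [u0|u0] := ltP 0 u; last by rewrite (riesz_le0 s2 u0) mulr0 normr0.
  by rewrite (@riesz_le0 s1) ?mul0r ?normr0// subr_le0 (le_trans t0)// ltW.
have t20 : 0 < t / 2 by rewrite divr_gt0.
pose C1 := (t / 2) `^ (s1 - 1) + t `^ (s1 - 1).
pose C2 := (t / 2) `^ (s2 - 1) + t `^ (s2 - 1).
have pow_le s v : t / 2 <= v -> v <= t -> v `^ (s - 1) <= (t / 2) `^ (s - 1) + t `^ (s - 1).
  move=> v1 v2; have v0 := lt_le_trans t20 v1.
  have [s1'|s1'] := leP 0 (s - 1).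
    apply: (@le_trans _ _ (t `^ (s - 1))); last by rewrite lerDr powR_ge0.
    by apply: ge0_ler_powR => //; rewrite ?nnegrE ltW.
  apply: (@le_trans _ _ ((t / 2) `^ (s - 1))); last by rewrite lerDl powR_ge0.
  rewrite -(opprK (s - 1)) 2!(powRN _ (- _)) lef_pV2 ?posrE ?powR_gt0//.
  by apply: ge0_ler_powR => //; rewrite ?nnegrE ?oppr_ge0 ltW.
apply: (@L1_le _ _ (fun u => C1 * (riesz s2 u * H (t - u)) +
                            C2 * (riesz s1 (t - u) * H (t - (t - u))))) => //.
  move=> u; rewrite normrM !ger0_norm ?riesz_ge0//.
  have [u0|u0] := ltP 0 u; last first.
    by rewrite (riesz_le0 s2 u0) !(mulr0, mul0r) add0r subKr heaviside_le0// !mulr0.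
  have [ut|ut] := ltP u t; last first.
    by rewrite (@riesz_le0 s1 (t - u)) ?subr_le0// !(mul0r, mulr0) addr0
      heaviside_le0 ?subr_le0// !mulr0.
  rewrite subKr !heavisideE ?subr_gt0// !mulr1 !rieszE ?subr_gt0//.
  have [u2|u2] := leP u (t / 2).
    rewrite -[leLHS]addr0 lerD ?mulr_ge0 ?addr_ge0 ?powR_ge0//.
    by rewrite ler_wpM2r ?powR_ge0// pow_le//; lra.
  rewrite -[leLHS]add0r lerD ?mulr_ge0 ?addr_ge0 ?powR_ge0//.
  by rewrite mulrC ler_wpM2r ?powR_ge0// pow_le//; lra.
apply: L1D; apply: L1Z; first exact: (int_riesz s20 t0).1.
exact: (L1_reflect t (int_riesz s10 t0).1).
Qed.

Lemma convol_riesz s1 s2 t : 0 < s1 -> 0 < s2 -> 0 < t ->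
  convol (riesz s1) (riesz s2) t =
  t `^ (s1 + s2 - 1) * convol (riesz s1) (riesz s2) 1.
Proof.
move=> s10 s20 t0; rewrite /convol.
have := int_affine 0 (negbT (gt_eqF t0)) (L1_riesz_pair t s10 s20).
rewrite gtr0_norm// => /(congr1 (fun x => t * x)).
rewrite mulrA mulfV ?gt_eqF// mul1r => <-.
rewrite -!intZ; last 2 first.
- exact: L1_riesz_pair.
- exact: (L1_affine 0 (negbT (gt_eqF t0)) (L1_riesz_pair t s10 s20)).
apply: eq_Rintegral => u _; rewrite addr0.
rewrite (_ : t - t * u = t * (1 - u)); last by ring.
rewrite !riesz_scale// (_ : s1 + s2 - 1 = 1 + ((s1 - 1) + (s2 - 1))); last by ring.
rewrite (powRD_gt0 1)// (powRD_gt0 (s1 - 1))// powRr1 ?ltW//; ring.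
Qed.

Lemma convol_riesz_gt0 s1 s2 : 0 < s1 -> 0 < s2 -> s1 <= 1 -> s2 <= 1 ->
  0 < convol (riesz s1) (riesz s2) 1.
Proof.
move=> s10 s20 s11 s21; apply: (@lt_le_trans _ _ (\int[mu]_u \1_`[4^-1, 2^-1] u)).
  by rewrite int_indic_itv; lra.
apply: int_le; [exact: L1_indic_itv|exact: L1_riesz_pair|] => u.
rewrite indicE mem_setE in_itv/=; case: (boolP (4^-1 <= u <= 2^-1)) => [/andP[u1 u2]|_]; last first.
  by rewrite mulr_ge0 ?riesz_ge0.
rewrite -[leLHS]mulr1.
have ge1 s v : s <= 1 -> 0 < v -> v <= 1 -> 1 <= riesz s v.
  move=> sle1 v0 v1; apply: le_trans (riesz_dec sle1 v0 v1).
  by rewrite rieszE// powR1.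
by apply: ler_pM => //; apply: ge1 => //; lra.
Qed.

End riesz_kernels.

(** * The Mittag-Leffler kernel and its positivity *)

Section resolvent_kernel.
Context {R : realType}.
Variables (alpha nu c : R).
Hypotheses (alpha_gt0 : 0 < alpha) (alpha_lt1 : alpha < 1) (nu_gt0 : 0 < nu)
  (c_gt0 : 0 < c).
Local Notation mu := (@lebesgue_measure R).
Local Notation H := (@heaviside R).
Implicit Types s t x : R.

Let a t : R := nu * riesz alpha t.
(** The power [t^(alpha (n + 1) - 1)] on [t > 0]. By homogeneity, convolution with [a] sends it to a
    multiple of the next one, and [ratio n] is that multiple. *)
Let mono n t : R := (t `^ alpha) ^+ n * riesz alpha t.
Let ratio n : R := convol a (mono n) 1.

Let measurable_a : measurable_fun [set: R] a.
Proof. by apply: measurable_funM => //; exact: measurable_riesz. Qed.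

Let measurable_mono n : measurable_fun [set: R] (mono n).
Proof.
apply: measurable_funM; last exact: measurable_riesz.
by apply: measurable_funX; exact: measurable_powR.
Qed.

Let mono_ge0 n t : 0 <= mono n t.
Proof. by rewrite mulr_ge0 ?riesz_ge0// exprn_ge0// powR_ge0. Qed.

Let a_ge0 t : 0 <= a t.
Proof. by rewrite mulr_ge0 ?riesz_ge0// ltW. Qed.

Let a_le0 t : t <= 0 -> a t = 0.
Proof. by move=> t0; rewrite /a riesz_le0// mulr0. Qed.

Let mono_le n s t : s <= t -> mono n s <= (t `^ alpha) ^+ n * riesz alpha s.
Proof.
have [s0|s0] := ltP 0 s => st; last by rewrite /mono riesz_le0// !mulr0.
rewrite ler_wpM2r ?riesz_ge0// lerXn2r ?nnegrE ?powR_ge0//.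
by apply: ge0_ler_powR => //; rewrite ?nnegrE ltW// (lt_le_trans s0).
Qed.

Let L1_a_riesz t : L1 (fun s => a (t - s) * riesz alpha s).
Proof.
move: (L1Z nu (L1_riesz_pair t alpha_gt0 alpha_gt0)).
by congr L1; apply/funext => s; rewrite mulrA.
Qed.

Let L1_a_dom (f : R -> R) (M t : R) : measurable_fun [set: R] f ->
  (forall s, s <= t -> `|f s| <= M * riesz alpha s) ->
  (forall s, `|a (t - s) * f s| <= M * (a (t - s) * riesz alpha s)) /\
  L1 (fun s => a (t - s) * f s).
Proof.
move=> mf fM.
have le s : `|a (t - s) * f s| <= M * (a (t - s) * riesz alpha s).
  have [st|ts] := leP s t; last first.
    by rewrite a_le0; [rewrite !mul0r mulr0 normr0|rewrite subr_le0 ltW].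
  by rewrite normrM (ger0_norm (a_ge0 _)) mulrCA ler_wpM2l// fM.
split=> //; apply: L1_le (L1Z M (L1_a_riesz t)) => //.
apply: measurable_funM => //; apply: (measurableT_comp measurable_a).
exact: measurable_funB.
Qed.

Let L1_a_mono n t : L1 (fun s => a (t - s) * mono n s).
Proof.
apply: (@L1_a_dom (mono n) ((t `^ alpha) ^+ n) t (measurable_mono n) _).2 => s st.
by rewrite ger0_norm; [exact: mono_le|exact: mono_ge0].
Qed.

Let convol_a_mono n t : convol a (mono n) t = ratio n * mono n.+1 t.
Proof.
have [t0|t0] := ltP 0 t; last first.
  rewrite /mono riesz_le0// !mulr0 /convol.
  transitivity (\int[mu]_s (0 * (a (t - s) * mono n s))); last first.
    by rewrite intZ; [rewrite mul0r|exact: L1_a_mono].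
  apply: eq_Rintegral => s _; rewrite mul0r.
  have [s0|s0] := ltP 0 s; last by rewrite /mono riesz_le0// !mulr0.
  by rewrite a_le0 ?mul0r// subr_le0 (le_trans t0)// ltW.
rewrite /ratio /convol.
have := int_affine 0 (negbT (gt_eqF t0)) (L1_a_mono n t).
rewrite gtr0_norm// => /(congr1 (fun x => t * x)).
rewrite mulrA mulfV ?gt_eqF// mul1r => <-.
rewrite -[LHS]intZ; last exact: (L1_affine 0 (negbT (gt_eqF t0)) (L1_a_mono n t)).
rewrite [RHS]mulrC -[RHS]intZ; last exact: L1_a_mono.
apply: eq_Rintegral => u _; rewrite addr0 /a /mono.
rewrite (_ : t - t * u = t * (1 - u)); last by ring.
rewrite !riesz_scale// (rieszE _ t0) exprS.
have [u0|u0] := ltP 0 u; last by rewrite (riesz_le0 _ u0) !mulr0.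
rewrite powRM ?ltW// exprMn.
have tE : t `^ alpha = t * t `^ (alpha - 1).
  by rewrite -[X in X * _]powRr1 ?ltW// -powRD_gt0//; congr (_ `^ _); ring.
transitivity ((t * t `^ (alpha - 1)) * (t `^ alpha) ^+ n * t `^ (alpha - 1) *
  (nu * riesz alpha (1 - u) * ((u `^ alpha) ^+ n * riesz alpha u))); first by ring.
by rewrite -tE.
Qed.

Let ratio_ge0 n : 0 <= ratio n.
Proof. by apply: Rintegral_ge0 => s _; rewrite mulr_ge0. Qed.

(** Dominated convergence, as [s^(alpha n)] tends to 0 on []0, 1[]. Vanishing ratios make the
    coefficient sequence entire. *)
Let ratio_cvg0 : ratio n @[n --> \oo] --> 0.
Proof.
have mf n : measurable_fun [set: R] (fun s => a (1 - s) * mono n s).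
  exact: L1_measurable (L1_a_mono n 1).
have f_le n s : `|a (1 - s) * mono n s| <= a (1 - s) * riesz alpha s.
  rewrite ger0_norm; last exact: mulr_ge0 (a_ge0 _) (mono_ge0 _ _).
  have [s1|s1] := leP s 1; last by rewrite a_le0; [rewrite !mul0r|rewrite subr_le0 ltW].
  by rewrite ler_wpM2l//; apply: le_trans (mono_le n s1) _; rewrite powR1 expr1n mul1r.
have f_cvg s : a (1 - s) * mono n s @[n --> \oo] --> (fun=> 0 : R) s.
  have [s0|s0] := ltP 0 s; last first.
    by under eq_cvg do rewrite /mono riesz_le0// !mulr0; exact: cvg_cst.
  have [s1|s1] := ltP s 1; last first.
    by under eq_cvg do rewrite a_le0 ?subr_le0// mul0r; exact: cvg_cst.
  rewrite -(mulr0 (a (1 - s))); apply: cvgM; first exact: cvg_cst.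
  rewrite -(mul0r (riesz alpha s)); apply: cvgM; last exact: cvg_cst.
  apply: cvg_expr; rewrite ger0_norm ?powR_ge0//.
  by rewrite -[ltRHS](f_equal (fun h => h alpha) (powR1 R)); apply: gt0_ltr_powR => //; rewrite nnegrE ltW.
have [_] := int_dominated_cvg mf f_cvg (L1_a_riesz 1) f_le.
by rewrite /Rintegral integral0.
Qed.

(** Obtained by inserting a series in the [mono n] into the Volterra equation
    [k = a - c (a * k)]. *)
Let coef : nat -> R := fix coef n := if n is m.+1 then - c * ratio m * coef m else nu.

Let coef_entire : entire coef.
Proof.
apply: (@entire_ratio _ _ (fun n => c * ratio n)).
  by rewrite -(mulr0 c); apply: cvgM; [exact: cvg_cst|exact: ratio_cvg0].
by move=> n /=; rewrite !normrM normrN (gtr0_norm c_gt0) (ger0_norm (ratio_ge0 n)).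
Qed.

Let kpart N t : R := pseries coef (t `^ alpha) N * riesz alpha t.

(** For [nu = 1 / Gamma alpha] this is [t^(alpha - 1) E_{alpha, alpha}(- c t^alpha)] on [t > 0]. The
    singular power stays outside the series, whose sum is a continuous function of [t^alpha]. *)
Definition fkernel t : R := limn (pseries coef (t `^ alpha)) * riesz alpha t.
Local Notation k := fkernel.

Let kpartE N t : kpart N t = \sum_(0 <= i < N) coef i * mono i t.
Proof.
rewrite /kpart /pseries /series/= mulr_suml; apply: eq_bigr => i _.
by rewrite /mono mulrA.
Qed.

Let measurable_kpart N : measurable_fun [set: R] (kpart N).
Proof.
have -> : kpart N = (fun t => \sum_(0 <= i < N) coef i * mono i t).
  by apply/funext => t; rewrite kpartE.
apply: measurable_sum => i.
by apply: measurable_funM.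
Qed.

Let kpart_cvg t : kpart N t @[N --> \oo] --> k t.
Proof. by apply: cvgM; [exact: (@entire_cvg _ _ _ coef_entire)|exact: cvg_cst]. Qed.

Lemma measurable_fkernel : measurable_fun [set: R] k.
Proof. by apply: (measurable_fun_cvg measurable_kpart) => t _; exact: kpart_cvg. Qed.

Let kpart_bound (T : R) : exists M : R, forall N s, s <= T ->
  `|kpart N s| <= M * riesz alpha s.
Proof.
have T0 : 0 < `|T| `^ alpha + 1 by rewrite ltr_wpDl// powR_ge0.
have [M KM] := entire_bounded coef_entire T0; exists M => N s sT.
have [s0|s0] := ltP 0 s; last by rewrite /kpart riesz_le0// !mulr0 normr0.
rewrite /kpart normrM (ger0_norm (riesz_ge0 _ _)) ler_wpM2r ?riesz_ge0//.
apply: KM; rewrite ger0_norm ?powR_ge0//.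
apply: (@le_trans _ _ (`|T| `^ alpha)); last by rewrite lerDl.
apply: ge0_ler_powR; rewrite ?nnegrE//; first exact: ltW.
  exact: ltW.
exact: le_trans sT (ler_norm T).
Qed.

Lemma fkernel_bound (T : R) : exists M : R, forall s, s <= T -> `|k s| <= M * riesz alpha s.
Proof.
have [M KM] := kpart_bound T; exists M => s sT.
have cn : `|kpart N s| @[N --> \oo] --> `|k s| by apply: cvg_norm; exact: kpart_cvg.
rewrite -(cvg_lim _ cn)//; apply: limr_le; first by apply/cvg_ex; eexists; exact: cn.
by apply: nearW => N; exact: KM.
Qed.

Let L1_a_k t : L1 (fun s => a (t - s) * k s).
Proof.
have [M kM] := fkernel_bound t.
exact: (L1_a_dom measurable_fkernel kM).2.
Qed.

Let L1_a_kpart N t : L1 (fun s => a (t - s) * kpart N s).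
Proof.
have [M kM] := kpart_bound t.
exact: (L1_a_dom (measurable_kpart N) (kM N)).2.
Qed.

Let kpart_rec N t : kpart N.+1 t = a t - c * convol a (kpart N) t.
Proof.
have -> : convol a (kpart N) t = \sum_(0 <= i < N) coef i * convol a (mono i) t.
  elim: N => [|N IH].
    rewrite big_nil /convol; under eq_Rintegral do rewrite kpartE big_nil mulr0.
    by rewrite /Rintegral integral0.
  rewrite big_nat_recr//= -IH -intZ// -intD//; last exact: L1Z.
  by apply: eq_Rintegral => s _; rewrite !kpartE big_nat_recr//=; ring.
rewrite kpartE big_nat_recl// /mono expr0 mul1r; congr (_ + _).
rewrite mulr_sumr -sumrN; apply: eq_bigr => i _.
by rewrite -/(mono _ _) convol_a_mono /=; ring.
Qed.

Lemma fkernelE t : k t = a t - c * convol a k t.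
Proof.
have [M kM] := kpart_bound t.
have dom N s : `|a (t - s) * kpart N s| <= M * (a (t - s) * riesz alpha s).
  exact: (L1_a_dom (measurable_kpart N) (kM N)).1.
have cv s : a (t - s) * kpart N s @[N --> \oo] --> a (t - s) * k s.
  by apply: cvgM; [exact: cvg_cst|exact: kpart_cvg].
have [_ icv] := int_dominated_cvg (fun N => L1_measurable (L1_a_kpart N t)) cv
  (L1Z M (L1_a_riesz t)) dom.
have := kpart_cvg (t := t); rewrite -(cvg_shiftS (fun N => kpart N t)) => kcv.
apply: (cvg_unique _ kcv) => //.
rewrite (_ : [sequence _]_n = fun N => a t - c * convol a (kpart N) t); last first.
  by apply/funext => N; exact: kpart_rec.
apply: cvgB; first exact: cvg_cst.
by apply: cvgM; [exact: cvg_cst|exact: icv].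
Qed.

Lemma fkernel_le0 t : t <= 0 -> k t = 0.
Proof. by move=> t0; rewrite /fkernel riesz_le0// mulr0. Qed.

Lemma fkernel_continuous t : 0 < t -> {for t, continuous k}.
Proof.
move=> t0.
pose g u := limn (pseries coef (u `^ alpha)) * u `^ (alpha - 1).
have kg u : 0 < u -> k u = g u by move=> u0; rewrite /fkernel rieszE.
change (k u @[u --> t] --> k t); rewrite (kg _ t0).
have gc : g u @[u --> t] --> g t.
  apply: cvgM; last exact: continuous_powR.
  apply: (@cvg_comp _ _ _ (fun u => u `^ alpha) (fun x => limn (pseries coef x))).
    exact: continuous_powR.
  exact: entire_continuous.
apply: cvg_trans gc; apply: near_eq_cvg; near=> u; rewrite kg//; near: u.
exact: lt_nbhsr.
Unshelve. all: end_near. Qed.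

Let pseries_coef0 : limn (pseries coef 0) = nu.
Proof.
apply: cvg_lim => //; rewrite -(cvg_shiftS (pseries coef 0)).
rewrite (_ : [sequence _]_n = fun=> nu); first exact: cvg_cst.
apply/funext => n /=; rewrite /pseries /series/= big_nat_recl//= expr0 mulr1.
by rewrite big1 ?addr0// => i _; rewrite expr0n mulr0.
Qed.

Let fkernel_gt0_near0 : exists2 d, 0 < d & forall t, 0 < t -> t < d -> 0 < k t.
Proof.
have /cvgrPdist_lt/(_ _ nu_gt0) := @entire_continuous _ _ coef_entire 0.
rewrite pseries_coef0 => /nbhs_ballP[e /= e0 ed].
exists (e `^ alpha^-1); first exact: powR_gt0.
move=> t t0 td; rewrite /fkernel mulr_gt0 ?riesz_gt0//.
have : ball (0 : R) e (t `^ alpha).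
  rewrite /ball/= sub0r normrN ger0_norm ?powR_ge0//.
  have -> : e = (e `^ alpha^-1) `^ alpha.
    by rewrite -powRrM mulVf ?gt_eqF// powRr1// ltW.
  by apply: gt0_ltr_powR => //; rewrite nnegrE ?powR_ge0// ltW.
by move=> /ed /=; rewrite ltr_distlC => /andP[+ _]; rewrite subrr.
Qed.

(* At the first zero [t0] of [k], log-convexity of [a] gives
   [k t <= a t / a t0 * (c * \int_t^t0 a (t0 - s) * k s)], so [k] is at most half of
   its own maximum just before [t0]. *)
Lemma fkernel_gt0 t : 0 < t -> 0 < k t.
Proof.
move=> t_gt0; rewrite ltNge; apply/negP => kt0.
have [d d0 kd] := fkernel_gt0_near0.
pose Z := [set u : R | 0 < u /\ k u <= 0].
have Zt : Z t by [].
have Zlb : lbound Z d.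
  by move=> u [u0 ku]; rewrite leNgt; apply/negP => /(kd _ u0); rewrite ltNge ku.
have Zinf u : Z u -> inf Z <= u by move=> Zu; apply: ge_inf Zu; exists d.
set t0 := inf Z in Zinf.
have t00 : 0 < t0 by apply: lt_le_trans d0 _; apply: lb_le_inf; [exists t|].
have kpos u : 0 < u -> u < t0 -> 0 < k u.
  by move=> u0 ut; rewrite ltNge; apply/negP => ku; move: ut; rewrite ltNge Zinf.
have kt00 : k t0 <= 0.
  rewrite leNgt; apply/negP => kt0_gt0.
  have /cvgrPdist_lt/(_ _ kt0_gt0)/nbhs_ballP[e /= e0 ed] := fkernel_continuous t00.
  suff : t0 + e <= t0 by lra.
  apply: lb_le_inf; first by exists t.
  move=> u [u0 ku]; have t0u : t0 <= u by exact: Zinf.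
  rewrite leNgt; apply/negP => ue.
  have /ed /= : ball t0 e u by rewrite /ball/= distrC ger0_norm; lra.
  by rewrite ltr_distlC => /andP[]; lra.
(* The factor 2 anticipates [rho <= 2], itself due to [t1 >= t0 / 2]: altogether [rho * c] times the
   mass of [a (t0 - .)] on [[t1, t0]] will be at most [1/2]. *)
have [t1 [t1_gt0 t1t t1a]] : exists t1, [/\ 0 < t1, t0 / 2 <= t1 < t0 &
    2 * c * (nu * ((t0 - t1) `^ alpha / alpha)) <= 2^-1].
  pose e := alpha / (4 * c * nu).
  have e0 : 0 < e by rewrite divr_gt0// !mulr_gt0.
  pose h := Num.min (t0 / 2) (e `^ alpha^-1).
  have h0 : 0 < h by rewrite lt_min divr_gt0// powR_gt0.
  have ht : h <= t0 / 2 by rewrite ge_min lexx.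
  have he : h `^ alpha <= e.
    have -> : e = (e `^ alpha^-1) `^ alpha.
      by rewrite -powRrM mulVf ?gt_eqF// powRr1// ltW.
    apply: ge0_ler_powR; rewrite ?nnegrE ?powR_ge0//; [exact: ltW|exact: ltW|].
    by rewrite ge_min lexx orbT.
  exists (t0 - h); split; [lra|lra|]; rewrite subKr.
  have -> : 2^-1 = 2 * c * (nu * (e / alpha)).
    by rewrite /e; field; rewrite ?gt_eqF.
  by rewrite ler_pM2l ?mulr_gt0// ler_pM2l// ler_pM2r ?invr_gt0.
have [t1_le t1_lt] := andP t1t.
pose t2 := (t1 + t0) / 2.
have t12 : t1 < t2 by rewrite /t2; lra.
have t20 : t2 < t0 by rewrite /t2; lra.
have t2_gt0 : 0 < t2 by exact: lt_trans t12.
have kcont : {within `[t2, t0], continuous k}.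
  apply: continuous_in_subspaceT => u /[!inE]/=; rewrite in_itv/= => /andP[tu _].
  exact: fkernel_continuous (lt_le_trans t2_gt0 tu).
have [m /[!in_itv]/= /andP[t2m mt0] kmax] := EVT_max (ltW t20) kcont.
have km0 : 0 < k m.
  apply: lt_le_trans (kpos _ t2_gt0 t20) _; apply: kmax.
  by rewrite in_itv/= lexx ltW.
have m0 : 0 < m by exact: lt_le_trans t2m.
have {}mt0 : m < t0.
  by rewrite lt_neqAle mt0 andbT; apply: contraTneq km0 => ->; rewrite -leNgt.
pose rho := (m / t0) `^ (alpha - 1).
have rho0 : 0 <= rho by exact: powR_ge0.
have rho2 : rho <= 2.
  have m2 : 2^-1 <= m / t0 by rewrite ler_pdivlMr// mulrC; lra.
  have m2_gt0 : 0 < m / t0 by rewrite divr_gt0.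
  apply: (@le_trans _ _ (2^-1 `^ (alpha - 1))).
    by rewrite /rho -!rieszE ?invr_gt0//; apply: riesz_dec => //; exact: ltW.
  rewrite -powR_inv1// -powRrM -[leRHS]powRr1//.
  by apply: ler_powR; rewrite ?ler1n// mulN1r opprB lerBlDr lerDl ltW.
have arho : a m = rho * a t0.
  rewrite /a !rieszE// /rho mulrCA -powRM ?divr_ge0 ?ltW//.
  by rewrite divfK// gt_eqF.
(* Below [m] this is monotonicity of the power [alpha - 1], since [(m / t0) (t0 - s) >= m - s].
   Above [m] the right-hand side vanishes, and the term in [k m] compensates because [k s <= k m] on
   [[t2, t0]]. *)
have pw s : rho * (a (t0 - s) * k s - k m * (a (t0 - s) * H (s - t1))) <= a (m - s) * k s.
  have [s0|s0] := ltP 0 s; last first.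
    by rewrite (fkernel_le0 s0) heaviside_le0 ?mulr0 ?subrr ?mulr0//; lra.
  have [sm|ms] := ltP s m; last first.
    rewrite (@a_le0 (m - s)) ?subr_le0// mul0r mulr_ge0_le0//.
    have [st0|t0s] := ltP s t0; last by rewrite a_le0 ?subr_le0// !mul0r mulr0.
    rewrite (mulrCA (k m)) -mulrBr; apply: mulr_ge0_le0 => //.
    have t2s : t2 <= s by exact: le_trans ms.
    rewrite heavisideE ?subr_gt0 ?(lt_le_trans t12)// mulr1 subr_le0 kmax//.
    by rewrite in_itv/= t2s ltW.
  apply: (@le_trans _ _ (rho * (a (t0 - s) * k s))).
    rewrite ler_wpM2l// lerBlDr lerDl; apply: mulr_ge0; first exact: ltW.
    by apply: mulr_ge0; [exact: a_ge0|exact: heaviside_ge0].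
  have st0 : s < t0 by exact: lt_trans sm mt0.
  rewrite mulrA ler_wpM2r//; first by apply: ltW; exact: kpos.
  rewrite /a !rieszE ?subr_gt0// mulrCA ler_wpM2l//; first exact: ltW.
  have st0' : 0 < t0 - s by rewrite subr_gt0.
  have mt0' : 0 < m / t0 by rewrite divr_gt0.
  rewrite /rho -(powRM _ (ltW mt0') (ltW st0')).
  have ms0 : 0 < m - s by rewrite subr_gt0.
  rewrite -!rieszE//; last exact: mulr_gt0.
  apply: riesz_dec => //; first exact: ltW.
  rewrite mulrAC ler_pdivlMr//; nra.
have L1_ah : L1 (fun s => a (t0 - s) * H (s - t1)) /\
    \int[mu]_s (a (t0 - s) * H (s - t1)) = nu * ((t0 - t1) `^ alpha / alpha).
  have t10 : 0 < t0 - t1 by rewrite subr_gt0.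
  have [i1 <-] := int_riesz alpha_gt0 t10.
  have ff : (fun s => a (t0 - s) * H (s - t1)) =
      (fun s => nu * (riesz alpha (t0 - s) * H (t0 - t1 - (t0 - s)))).
    by apply/funext => s; rewrite /a -mulrA; congr (_ * (_ * H _)); ring.
  rewrite ff; split; first exact/L1Z/(L1_reflect t0 i1).
  rewrite intZ; last exact: (L1_reflect t0 i1).
  by rewrite (int_reflect t0 i1).
have [i1 i1E] := L1_ah.
have := int_le _ (L1_a_k m) pw; rewrite intZ; last by apply: L1B => //; exact: L1Z.
rewrite intB//; last exact: L1Z.
rewrite intZ// i1E => /(_ _); rewrite -[X in _ -> _ <= X]/(convol a k m).
move=> /(_ (L1Z _ (L1B (L1_a_k t0) (L1Z _ i1)))).
rewrite -[X in _ * (X - _)]/(convol a k t0) => ineq.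
have := fkernelE m; have := fkernelE t0; rewrite arho.
set X := convol a k t0 in ineq *; set Y := convol a k m in ineq *.
set J := nu * _ in ineq t1a *; move=> e0 em.
have J0 : 0 <= J by rewrite !mulr_ge0 ?invr_ge0 ?powR_ge0// ltW.
have cJ : rho * (c * J) <= 2^-1.
  by apply: le_trans t1a; rewrite -mulrA ler_wpM2r// mulr_ge0// ltW.
have : k m <= 2^-1 * k m.
  apply: (@le_trans _ _ (rho * (c * J) * k m)); last by rewrite ler_wpM2r// ltW.
  have h1 : c * (rho * (X - k m * J)) <= c * Y by rewrite ler_pM2l.
  have h2 : rho * a t0 <= rho * (c * X) by rewrite ler_wpM2l//; lra.
  by rewrite [leLHS]em; lra.
lra.
Qed.

Lemma fkernel_ge0 t : 0 <= k t.
Proof.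
have [t0|t0] := ltP 0 t; first exact/ltW/fkernel_gt0.
by rewrite fkernel_le0.
Qed.

Lemma fkernel_le t : k t <= nu * riesz alpha t.
Proof.
rewrite fkernelE lerBlDr lerDl mulr_ge0//; first exact: ltW.
by apply: Rintegral_ge0 => s _; rewrite mulr_ge0// fkernel_ge0.
Qed.

End resolvent_kernel.

Definition causal {R : realType} (f : R -> R) : Prop := forall t, t <= 0 -> f t = 0.

Definition loc_L1 {R : realType} (f : R -> R) : Prop :=
  [/\ measurable_fun [set: R] f, causal f &
      forall T, L1 (fun t => f t * heaviside (T - t))].

Definition loc_bounded {R : realType} (f : R -> R) : Prop :=
  [/\ measurable_fun [set: R] f, (forall t, t < 0 -> f t = 0) &
      forall T, exists M, forall t, t <= T -> `|f t| <= M].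

Section causal_convolution.
Context {R : realType}.
Local Notation mu := (@lebesgue_measure R).
Local Notation H := (@heaviside R).
Implicit Types (f g h j : R -> R) (s t T M : R).

Lemma loc_L1_intro f : L1 f -> causal f -> loc_L1 f.
Proof.
move=> f1 f0; split=> //; first exact: L1_measurable f1.
move=> T; apply: (@L1_bounded_mul _ 1) => // [|t].
  by apply: (measurableT_comp measurable_heaviside); exact: measurable_funB.
by rewrite ger0_norm ?heaviside_ge0 ?heaviside_le1.
Qed.

Lemma convol_causal f g : causal f -> causal g -> causal (convol f g).
Proof.
move=> f0 g0 t t0; rewrite /convol (_ : (fun s => _) = cst 0).
  by rewrite /Rintegral integral0.
apply/funext => s /=; have [s0|s0] := ltP 0 s; last by rewrite g0// mulr0.
by rewrite f0 ?mul0r// subr_le0 (le_trans t0)// ltW.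
Qed.

Lemma convol_left0 f g t : causal f -> (forall s, s < 0 -> g s = 0) -> t <= 0 ->
  convol f g t = 0.
Proof.
move=> f0 g0 t0; rewrite /convol (_ : (fun s => _) = cst 0).
  by rewrite /Rintegral integral0.
apply/funext => s /=; have [s0|s0] := leP 0 s; last by rewrite g0// mulr0.
by rewrite f0 ?mul0r// subr_le0 (le_trans t0).
Qed.

Lemma measurable_reflect f t : measurable_fun [set: R] f ->
  measurable_fun [set: R] (fun s => f (t - s)).
Proof. by move=> mf; apply: (measurableT_comp mf); exact: measurable_funB. Qed.

Lemma measurable_shift f t : measurable_fun [set: R] f ->
  measurable_fun [set: R] (fun s => f (s - t)).
Proof. by move=> mf; apply: (measurableT_comp mf); exact: measurable_funB. Qed.

Lemma loc_L1_trunc j t : loc_L1 j -> L1 (fun s => j s * \1_`[0, t] s).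
Proof.
move=> [mj j0 j1]; apply: L1_le (L1_norm (j1 (t + 1))).
  by apply: measurable_funM => //; exact: measurable_indic.
move=> s; rewrite !normrM ler_wpM2l// indicE mem_setE in_itv/=.
case: (boolP (0 <= s <= t)) => [/andP[_ st]|_]; last by rewrite normr0.
by rewrite heavisideE// subr_gt0; lra.
Qed.

Lemma L1_convol j g t M : loc_L1 j -> measurable_fun [set: R] g ->
  (forall s, s < 0 -> g s = 0) -> (forall s, s < t -> `|g s| <= M) ->
  L1 (fun s => j (t - s) * g s) /\
  `|convol j g t| <= M * \int[mu]_s (`|j s| * \1_`[0, t] s).
Proof.
move=> jl mg g0 gM; have j1 := L1_norm (loc_L1_trunc t jl); have [mj j0 _] := jl.
have jE : (fun s => `|j s * \1_`[0, t] s|) = (fun s => `|j s| * \1_`[0, t] s).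
  by apply/funext => s; rewrite normrM (@ger0_norm _ (\1_ _ _)).
rewrite jE in j1.
have le s : `|j (t - s) * g s| <= M * (`|j (t - s)| * \1_`[0, t] (t - s)).
  rewrite normrM indicE mem_setE in_itv/=.
  have [st|ts] := ltP s t; last by rewrite (j0 (t - s)) ?normr0 ?mul0r ?mulr0// subr_le0.
  have [s0|s0] := ltP s 0.
    rewrite g0// normr0 mulr0; apply: mulr_ge0; last exact: mulr_ge0.
    exact: le_trans (gM _ st).
  have -> : (0 <= t - s <= t) by apply/andP; split; lra.
  by rewrite mulr1 mulrC ler_wpM2r// gM.
have mjg : measurable_fun [set: R] (fun s => j (t - s) * g s).
  by apply: measurable_funM => //; exact: measurable_reflect.
have l1 := L1_reflect t j1.
split; first exact: L1_le mjg le (L1Z M l1).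
apply: le_trans (int_norm_le mjg (L1Z M l1) le) _.
by rewrite intZ// (int_reflect t j1).
Qed.

Lemma loc_bounded_L1 g T : loc_bounded g -> L1 (fun t => g t * \1_`[0, T] t).
Proof.
move=> [mg g0 gM]; have [M gMT] := gM T.
apply: (@L1_bounded_support _ _ 0 T M) => [|t].
  by apply: measurable_funM => //; exact: measurable_indic.
rewrite normrM indicE mem_setE in_itv/=.
case: (boolP (0 <= t <= T)) => [/andP[_ tT]|_]; rewrite ?normr1 ?mulr1 ?normr0 ?mulr0//.
exact: gMT.
Qed.

Lemma loc_bounded_loc_L1 g : loc_bounded g -> loc_L1 (fun t => g t * H t).
Proof.
move=> gb; have [mg g0 gM] := gb; split.
- by apply: measurable_funM => //; exact: measurable_heaviside.
- by move=> t t0; rewrite heaviside_le0// mulr0.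
move=> T; apply: L1_le (L1_norm (loc_bounded_L1 T gb)).
  apply: measurable_funM; last exact: measurable_reflect measurable_heaviside.
  by apply: measurable_funM => //; exact: measurable_heaviside.
move=> t; rewrite !normrM -mulrA ler_wpM2l// indicE mem_setE in_itv/=.
rewrite -normrM /heaviside subr_gt0.
case: (ltP 0 t) => t0; last by rewrite mul0r normr0.
case: (ltP t T) => tT; last by rewrite mulr0 normr0.
by rewrite (ltW t0) (ltW tT) mulr1.
Qed.

(** Up to time [T] a causal convolution sees its factors on [[0, T]] only; measurability is thereby
    inherited from convolutions of integrable functions. *)
Lemma convol_trunc j g t T : causal j -> (forall s, s < 0 -> g s = 0) -> t <= T ->
  convol j g t = convol (fun s => j s * \1_`[0, T] s) (fun s => g s * \1_`[0, T] s) t.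
Proof.
move=> j0 g0 tT; apply: eq_Rintegral => s _; rewrite !indicE !mem_setE !in_itv/=.
have [s0|s0] := ltP s 0; first by rewrite g0// !(mulr0, mul0r).
have [st|ts] := ltP s t; last by rewrite j0 ?subr_le0// !mul0r.
have -> : 0 <= t - s <= T by apply/andP; split; lra.
have sT : s <= T by lra.
by rewrite sT !mulr1.
Qed.

Lemma measurable_convol j g : loc_L1 j -> loc_bounded g ->
  measurable_fun [set: R] (convol j g).
Proof.
move=> jl gb; have [mj j0 j1] := jl; have [mg g0 gM] := gb.
pose c n := convol (fun s => j s * \1_`[0, n%:R] s) (fun s => g s * \1_`[0, n%:R] s).
apply: (@measurable_fun_cvg _ _ _ _ c) => [n|t _].
  exact: L1_measurable (L1_conv (loc_L1_trunc n%:R jl) (loc_bounded_L1 n%:R gb)).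
apply: cvg_near_cst; near=> n; apply/esym/convol_trunc => //.
near: n; exact: nbhs_infty_ger.
Unshelve. all: end_near. Qed.

Lemma loc_bounded_convol j g : loc_L1 j -> loc_bounded g -> loc_bounded (convol j g).
Proof.
move=> jl gb; have [mj j0 j1] := jl; have [mg g0 gM] := gb; split.
- exact: measurable_convol.
- by move=> t t0; apply: convol_left0 => //; exact: ltW.
move=> T; have [M gMT] := gM T.
exists (M * \int[mu]_s (`|j s| * \1_`[0, T] s)) => t tT.
have [_ le] := @L1_convol j g t M jl mg g0 (fun s st => gMT s (ltW (lt_le_trans st tT))).
apply: le_trans le _.
have M0 : 0 <= M by exact: le_trans (gMT T (lexx T)).
rewrite ler_wpM2l//.
have jn u : L1 (fun s => `|j s| * \1_`[0, u] s).
  have := L1_norm (loc_L1_trunc u jl); congr L1; apply/funext => s.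
  by rewrite normrM (@ger0_norm _ (\1_ _ _)).
apply: int_le => // s; rewrite ler_wpM2l// !indicE !mem_setE !in_itv/= ler_nat.
by case: (boolP (0 <= s <= t)) => // /andP[-> st]; rewrite (le_trans st tT).
Qed.

Lemma convolDr j f g t : loc_L1 j -> loc_bounded f -> loc_bounded g ->
  convol j (fun s => f s + g s) t = convol j f t + convol j g t.
Proof.
move=> jl [mf f0 fM] [mg g0 gM]; have [M1 fM1] := fM t; have [M2 gM2] := gM t.
rewrite /convol -intD; first by apply: eq_Rintegral => s _; rewrite mulrDr.
- by apply: (@L1_convol _ _ _ M1 jl mf f0 _).1 => s /ltW; exact: fM1.
- by apply: (@L1_convol _ _ _ M2 jl mg g0 _).1 => s /ltW; exact: gM2.
Qed.

Lemma convolZr j f c t : measurable_fun [set: R] j -> measurable_fun [set: R] f ->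
  convol j (fun s => c * f s) t = c * convol j f t.
Proof.
move=> mj mf; rewrite /convol -int_mulrl.
  by apply: eq_Rintegral => s _; rewrite mulrCA.
by apply: measurable_funM => //; exact: measurable_reflect.
Qed.

Lemma loc_boundedD f g : loc_bounded f -> loc_bounded g ->
  loc_bounded (fun t => f t + g t).
Proof.
move=> [mf f0 fM] [mg g0 gM]; split; first exact: measurable_funD.
  by move=> t t0; rewrite f0// g0// addr0.
move=> T; have [M1 fM1] := fM T; have [M2 gM2] := gM T; exists (M1 + M2) => t tT.
by apply: le_trans (ler_normD _ _) _; rewrite lerD ?fM1 ?gM2.
Qed.

Lemma loc_boundedZ c f : loc_bounded f -> loc_bounded (fun t => c * f t).
Proof.
move=> [mf f0 fM]; split; first by apply: measurable_funM.
  by move=> t t0; rewrite f0// mulr0.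
move=> T; have [M fMT] := fM T; exists (`|c| * M) => t tT.
by rewrite normrM ler_wpM2l// fMT.
Qed.

Lemma loc_boundedB f g : loc_bounded f -> loc_bounded g ->
  loc_bounded (fun t => f t - g t).
Proof.
move=> fb /(loc_boundedZ (-1)) /(loc_boundedD fb).
by congr loc_bounded; apply/funext => t; rewrite mulN1r.
Qed.

Lemma convolBr j f g t : loc_L1 j -> loc_bounded f -> loc_bounded g ->
  convol j (fun s => f s - g s) t = convol j f t - convol j g t.
Proof.
move=> jl fb gb; have [mj _ _] := jl; have [mg _ _] := gb.
rewrite -mulN1r -convolZr// -convolDr//; last exact: loc_boundedZ.
by congr (convol _ _ t); apply/funext => s; rewrite mulN1r.
Qed.

Definition delay (tau : R) f t := f (t - tau).

Lemma loc_bounded_delay tau f : 0 <= tau -> loc_bounded f -> loc_bounded (delay tau f).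
Proof.
move=> tau0 [mf f0 fM]; split; first exact: measurable_shift.
  by move=> t t0; rewrite /delay f0// subr_lt0; lra.
move=> T; have [M fMT] := fM T; exists M => t tT; apply: fMT; lra.
Qed.

Lemma convol_delay tau j f t : L1 (fun s => j (t - tau - s) * f s) ->
  convol j (delay tau f) t = delay tau (convol j f) t.
Proof.
move=> l1; rewrite /delay /convol -(int_shift tau l1).
by apply: eq_Rintegral => s _; congr (j _ * _); ring.
Qed.

End causal_convolution.

(** For [alpha < 1] the Caputo derivative is the convolution of this kernel with the ordinary
    derivative; the Laplace transform of the kernel is [z^(alpha - 1)]. *)
Definition caputo_weight {R : realType} (alpha t : R) : R :=
  (Gamma (1 - alpha))^-1 * riesz (1 - alpha) t.

(* [k] is the kernel with Laplace transform [1 / (z^alpha + c)]. *)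
Record resolvent {R : realType} (alpha c : R) (k : R -> R) : Prop := Resolvent {
  resolvent_causal : causal k;
  resolvent_ge0 : forall t, 0 <= k t;
  resolvent_L1 : L1 k;
  resolvent_int : \int[lebesgue_measure]_t k t = c^-1;
  resolvent_bound : forall d, 0 < d -> exists M, forall t, d <= t -> k t <= M;
  resolvent_caputo : alpha < 1 -> forall t,
    L1 (fun s => caputo_weight alpha (t - s) * k s) /\
    convol (caputo_weight alpha) k t = heaviside t - c * convol heaviside k t;
  resolvent_exp : alpha = 1 -> k = exp_step c }.

Section gamma_integral.
Context {R : realType}.
Local Notation mu := (@lebesgue_measure R).
Local Notation H := (@heaviside R).

Lemma L1_riesz_exp (z e : R) : 0 < z -> z <= 1 -> 0 < e ->
  L1 (fun s => riesz z s * expR (- (e * s))).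
Proof.
move=> z0 z1 e0.
apply: (@L1_le _ _ (fun s => riesz z s * H (1 - s) + (exp_step e s + \1_`[1, 1] s))).
- apply: measurable_funM; first exact: measurable_riesz.
  apply: continuous_measurableT; exact: is_derive_continuous.
- move=> s; rewrite ger0_norm; last by rewrite mulr_ge0 ?riesz_ge0// expR_ge0.
  have [s0|s0] := ltP 0 s; last first.
    by rewrite riesz_le0// !mul0r add0r addr_ge0// mulr_ge0 ?expR_ge0 ?heaviside_ge0.
  have [s1|s1] := ltP s 1.
    rewrite heavisideE ?subr_gt0// mulr1 -[leLHS]addr0 lerD//; last first.
      by rewrite addr_ge0// mulr_ge0 ?expR_ge0 ?heaviside_ge0.
    by rewrite ler_piMr ?riesz_ge0// -expR0 ler_expR oppr_le0 mulr_ge0// ltW.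
  rewrite [H (1 - s)]heaviside_le0 ?subr_le0// mulr0 add0r /exp_step heavisideE// mulr1.
  apply: (@le_trans _ _ (expR (- (e * s)))); last by rewrite lerDl.
  rewrite ler_piMl ?expR_ge0//; apply: le_trans (riesz_dec z1 ltr01 s1) _.
  by rewrite rieszE// powR1.
apply: L1D; first exact: (int_riesz z0 ltr01).1.
by apply: L1D; [exact: L1_exp_step|exact: L1_indic_itv].
Qed.

Lemma GammaE (z : R) : Gamma z = \int[mu]_s (riesz z s * expR (- s)).
Proof.
rewrite /Gamma int_in; apply: eq_Rintegral => s _.
by rewrite /riesz heaviside_indic mulrAC.
Qed.

Lemma Gamma_gt0 (z : R) : 0 < z -> z <= 1 -> 0 < Gamma z.
Proof.
move=> z0 z1; rewrite GammaE.
apply: (@lt_le_trans _ _ (\int[mu]_s (expR (- 1) * \1_`[2^-1, 1] s))).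
  rewrite intZ; last exact: L1_indic_itv.
  rewrite int_indic_itv; last lra.
  by rewrite mulr_gt0 ?expR_gt0//; lra.
have l1 : L1 (fun s => riesz z s * expR (- s)).
  by have := L1_riesz_exp z0 z1 ltr01; congr L1; apply/funext => s; rewrite mul1r.
apply: int_le => //; first exact/L1Z/L1_indic_itv.
move=> s; rewrite indicE mem_setE in_itv/=.
case: (boolP (2^-1 <= s <= 1)) => [/andP[s2 s1]|_]; last first.
  by rewrite mulr0 mulr_ge0 ?riesz_ge0 ?expR_ge0.
have s0 : 0 < s by lra.
rewrite mulr1 -[leLHS]mul1r ler_pM ?expR_ge0 ?ler_expR ?lerN2//.
apply: le_trans (riesz_dec z1 s0 s1).
by rewrite rieszE// powR1.
Qed.

End gamma_integral.

(** * Existence of resolvent kernels *)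

Section existence.
Context {R : realType}.
Local Notation mu := (@lebesgue_measure R).
Local Notation H := (@heaviside R).
Variables (alpha c : R).
Hypotheses (alpha_gt0 : 0 < alpha) (c_gt0 : 0 < c).

Lemma resolvent_1 : resolvent 1 c (exp_step c).
Proof.
split.
- by move=> t t0; rewrite /exp_step heaviside_le0// mulr0.
- by move=> t; rewrite mulr_ge0 ?expR_ge0 ?heaviside_ge0.
- exact: L1_exp_step.
- have [+ _] := transform_exp_step 0 c_gt0; rewrite expr0n addr0 /cosT.
  under eq_Rintegral do rewrite mul0r cos0 mulr1.
  by move=> ->; field; rewrite gt_eqF.
- move=> d d0; exists 1 => t dt; rewrite /exp_step -[leRHS]mulr1 ler_pM ?expR_ge0 ?heaviside_ge0 ?heaviside_le1//.
  by rewrite -[leRHS]expR0 ler_expR oppr_le0 mulr_ge0 ?ltW// (lt_le_trans d0).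
- by rewrite ltxx.
- by [].
Qed.

Hypothesis alpha_lt1 : alpha < 1.

Let al1 : 0 < 1 - alpha. Proof. by rewrite subr_gt0. Qed.
Let al1' : 1 - alpha <= 1. Proof. by rewrite lerBlDr lerDl ltW. Qed.

Let g : R := (Gamma (1 - alpha))^-1.
Let B0 : R := convol (riesz (1 - alpha)) (riesz alpha) 1.
(** Chosen so that [b * a] is the Heaviside function; its value is [1 / Gamma alpha]. *)
Let nu : R := (g * B0)^-1.
Let b := @caputo_weight R alpha.
Let a (t : R) : R := nu * riesz alpha t.
Let k := fkernel alpha nu c.

Let g_gt0 : 0 < g. Proof. by rewrite invr_gt0 Gamma_gt0. Qed.
Let B0_gt0 : 0 < B0. Proof. by apply: convol_riesz_gt0 => //; exact: ltW. Qed.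
Let nu_gt0 : 0 < nu. Proof. by rewrite invr_gt0 mulr_gt0. Qed.

Let L1_ba t : L1 (fun s => b (t - s) * a s).
Proof.
have := L1Z (g * nu) (L1_riesz_pair t al1 alpha_gt0).
by congr L1; apply/funext => s; rewrite /b /a /caputo_weight -/g; ring.
Qed.

Let b_ge0 t : 0 <= b t.
Proof. by rewrite mulr_ge0 ?riesz_ge0// ltW. Qed.

Let a_ge0 t : 0 <= a t.
Proof. by rewrite mulr_ge0 ?riesz_ge0// ltW. Qed.

Let b_causal : causal b.
Proof. by move=> t t0; rewrite /b /caputo_weight riesz_le0// mulr0. Qed.

Let a_causal : causal a.
Proof. by move=> t t0; rewrite /a riesz_le0// mulr0. Qed.

Let mb : measurable_fun [set: R] b.
Proof. by apply: measurable_funM => //; exact: measurable_riesz. Qed.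

Let ma : measurable_fun [set: R] a.
Proof. by apply: measurable_funM => //; exact: measurable_riesz. Qed.

Let mk : measurable_fun [set: R] k. Proof. exact: measurable_fkernel. Qed.

Let conv_ba t : convol b a t = H t.
Proof.
have [t0|t0] := ltP 0 t; last by rewrite convol_causal// heaviside_le0.
rewrite heavisideE//.
have -> : convol b a t = g * nu * convol (riesz (1 - alpha)) (riesz alpha) t.
  rewrite /convol -intZ; last exact: L1_riesz_pair.
  by apply: eq_Rintegral => s _; rewrite /b /a /caputo_weight -/g; ring.
rewrite convol_riesz// subrK subrr powRr0 mul1r -/B0 /nu.
by field; rewrite ?mulf_neq0 ?gt_eqF.
Qed.

Let k_ge0 t : 0 <= k t. Proof. exact: fkernel_ge0. Qed.
Let k_causal : causal k. Proof. by move=> t; exact: fkernel_le0. Qed.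

Let k_loc T : L1 (fun u => H (T - u) * k u).
Proof.
have [T0|T0] := ltP 0 T; last first.
  apply: (@L1_le _ _ (fun=> 0)); last exact: L1_0.
    by apply: measurable_funM => //; exact: measurable_reflect measurable_heaviside.
  move=> u; have [u0|u0] := ltP 0 u; last by rewrite k_causal// mulr0 normr0.
  by rewrite heaviside_le0 ?mul0r ?normr0// subr_le0 (le_trans T0)// ltW.
apply: L1_le (L1Z nu (int_riesz alpha_gt0 T0).1).
  by apply: measurable_funM => //; exact: measurable_reflect measurable_heaviside.
move=> u; rewrite ger0_norm; last exact: mulr_ge0 (heaviside_ge0 _) (k_ge0 _).
rewrite mulrC mulrA; apply: ler_wpM2r; first exact: heaviside_ge0.
exact: fkernel_le.
Qed.

(** Convolve [k = a - c (a * k)] with [b] and use [b * a = H]. *)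
Let caputo_k t : L1 (fun s => b (t - s) * k s) /\
  convol b k t = H t - c * convol H k t.
Proof.
have [|i1 cE] := @conv_assoc _ b a k t mb ma mk L1_ba.
  have := k_loc t; congr L1; apply/funext => u; congr (_ * _); last by rewrite ger0_norm.
  by rewrite -conv_ba; apply: eq_Rintegral => s _; rewrite !ger0_norm.
have kE s : b (t - s) * k s = b (t - s) * a s - c * (b (t - s) * convol a k s).
  by rewrite /k fkernelE// -/k -/(a s); ring.
rewrite /convol (funext kE); split; first by apply: L1B => //; exact: L1Z.
rewrite intB//; last exact: L1Z.
rewrite intZ// -/(convol b a t) conv_ba -/(convol b _ t) cE.
by congr (_ - c * _); congr convol; apply/funext => s; exact: conv_ba.
Qed.

Let E t := convol b k t.

Let E_ge0 t : 0 <= E t.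
Proof. by apply: Rintegral_ge0 => s _; rewrite mulr_ge0. Qed.

(** Since [b * k >= 0], the identity of [caputo_k] bounds [c] times every partial integral of [k] by
    1; monotone convergence does the rest. *)
Let L1_k : L1 k.
Proof.
have ck T : c * \int[mu]_u (H (T - u) * k u) <= 1.
  rewrite -/(convol H k T); have [_ e] := caputo_k T; have := E_ge0 T.
  by rewrite /E e; have := heaviside_le1 T; lra.
apply/integrableP; split; first exact/measurable_EFinP.
pose f_ (n : nat) (u : R) := (H (n%:R - u) * k u)%:E.
have f_ge0 n u : setT u -> (0 <= f_ n u)%E.
  by move=> _; rewrite lee_fin mulr_ge0 ?heaviside_ge0.
have mf n : measurable_fun [set: R] (f_ n).
  apply/measurable_EFinP; exact: L1_measurable (k_loc n%:R).
have f_mono u : setT u -> {homo f_ ^~ u : n m / (n <= m)%N >-> (n <= m)%E}.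
  move=> _ n m nm; rewrite lee_fin ler_wpM2r// /heaviside ler_nat.
  case: (ltP 0 (n%:R - u)) => // nu0.
  have : n%:R <= m%:R :> R by rewrite ler_nat.
  by move=> nm'; have -> : (0 < m%:R - u)%R by lra.
have := @cvg_monotone_convergence _ _ _ mu _ measurableT f_ mf f_ge0 f_mono.
have -> : (fun u => limn (f_ ^~ u)) = (fun u => (`|k u|)%:E).
  apply/funext => u; apply: cvg_lim => //; apply: cvg_near_cst.
  near=> n; rewrite /f_ heavisideE ?mul1r ?ger0_norm// subr_gt0.
  by near: n; exact: nbhs_infty_gtr.
move=> cv; apply: (@le_lt_trans _ _ (c^-1)%:E); last exact: ltry.
rewrite -(cvg_lim _ cv)//; apply: lime_le; first by apply/cvg_ex; eexists; exact: cv.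
apply: nearW => n.
have := ck n%:R; rewrite mulrC -ler_pdivlMr// div1r => {}ck.
have ifin : (\int[mu]_u f_ n u)%E \is a fin_num.
  exact: integrable_fin_num (k_loc n%:R).
by rewrite -(fineK ifin) lee_fin.
Unshelve. all: end_near. Qed.

(** If the integral were smaller, [b * k] would stay above some [e > 0], and its integral over
    [[0, T]] would grow linearly in [T]. But that integral is at most the mass of [b] on [[0, T]]
    times the mass of [k], which is of order [T^(1 - alpha)]. *)
Let int_k : \int[mu]_t k t = c^-1.
Proof.
have HkT T : \int[mu]_u (H (T - u) * k u) <= \int[mu]_t k t.
  apply: int_le; [exact: k_loc|exact: L1_k|] => u.
  by apply: ler_piMl; [exact: k_ge0|exact: heaviside_le1].
apply/eqP; rewrite eq_le; apply/andP; split.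
  have cv : \int[mu]_u (H (T - u) * k u) @[T --> +oo] --> \int[mu]_t k t.
    apply: (@dominated_cvg_pinfty _ (fun T u => H (T - u) * k u) k k) => //.
    - by move=> T; exact: L1_measurable (k_loc T).
    - move=> u; apply: cvg_near_cst; near=> T; rewrite heavisideE ?mul1r// subr_gt0.
      by near: T; apply: nbhs_pinfty_gt; exact: num_real.
    - move=> T u; rewrite ger0_norm; last exact: mulr_ge0 (heaviside_ge0 _) (k_ge0 _).
      by apply: ler_piMl; [exact: k_ge0|exact: heaviside_le1].
  rewrite -(cvg_lim _ cv)//; apply: limr_le; first by apply/cvg_ex; eexists; exact: cv.
  near=> T; rewrite -[c^-1]div1r ler_pdivlMr// mulrC -/(convol H k T).
  have [_ eT] := caputo_k T; have := E_ge0 T.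
  by rewrite /E eT; have := heaviside_le1 T; lra.
rewrite leNgt; apply/negP => kc.
pose e := 1 - c * \int[mu]_t k t.
have e0 : 0 < e by rewrite subr_gt0 mulrC -ltr_pdivlMr// div1r.
have Ee t : 0 < t -> e <= E t.
  move=> t0; rewrite /E (caputo_k t).2 heavisideE// lerD2l lerN2 ler_pM2l//.
  exact: HkT.
clear HkT; pose K := g / (1 - alpha) * \int[mu]_t k t.
have key T : 0 < T -> e * (T / 2) <= K * T `^ (1 - alpha).
  move=> T0; pose bT u := b u * H (T - u).
  have [r1 r1E] := int_riesz al1 T0.
  have bTE : bT = fun u => g * (riesz (1 - alpha) u * H (T - u)).
    by apply/funext => u; rewrite /bT /b /caputo_weight -/g mulrA.
  have bT1 : L1 bT by rewrite bTE; exact: L1Z.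
  have bT_ge0 u : 0 <= bT u by rewrite mulr_ge0 ?heaviside_ge0.
  have := int_conv bT1 L1_k; rewrite [in X in _ = X]bTE intZ// r1E => kT.
  apply: (@le_trans _ _ (\int[mu]_t convol bT k t)); last first.
    by rewrite kT /K le_eqVlt; apply/orP; left; apply/eqP; ring.
  have -> : e * (T / 2) = \int[mu]_t (e * \1_`[T / 2, T] t).
    rewrite intZ; last exact: L1_indic_itv.
    by rewrite int_indic_itv; [congr (_ * _)|]; lra.
  apply: int_le; [exact/L1Z/L1_indic_itv|exact: L1_conv|] => t.
  rewrite indicE mem_setE in_itv/=; case: (boolP (T / 2 <= t <= T)) => [/andP[t0' tT]|_]; last first.
    by rewrite mulr0; apply: Rintegral_ge0 => s _; rewrite mulr_ge0.
  have t0 : 0 < t by lra.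
  rewrite mulr1; apply: le_trans (Ee t t0) _.
  rewrite le_eqVlt; apply/orP; left; apply/eqP; apply: eq_Rintegral => s _.
  have [s0|s0] := ltP 0 s; last by rewrite (k_causal s0) !mulr0.
  by rewrite /bT heavisideE ?mulr1//; lra.
(* Makes [e T^alpha / 2 = K + e / 2], which contradicts [key] after division by [T^(1 - alpha)]. *)
pose T := (2 * K / e + 1) `^ alpha^-1.
have K0 : 0 <= K.
  apply: mulr_ge0; first by apply: divr_ge0; exact: ltW.
  by apply: Rintegral_ge0 => s _; exact: k_ge0.
have Ke : 0 < 2 * K / e + 1.
  by apply: ltr_wpDl => //; apply: divr_ge0; [exact: mulr_ge0|exact: ltW].
have T0 : 0 < T by exact: powR_gt0.
have := key T T0.
have {1}-> : T = T `^ alpha * T `^ (1 - alpha).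
  by rewrite -powRD_gt0// addrC subrK powRr1// ltW.
rewrite mulrAC mulrA ler_pM2r ?powR_gt0// /T -powRrM mulVf ?gt_eqF// powRr1; last exact: ltW.
have -> : e * ((2 * K / e + 1) / 2) = K + e / 2 by field; rewrite gt_eqF.
by rewrite gerDl leNgt divr_gt0.
Unshelve. all: end_near. Qed.

Lemma resolvent_lt1 : resolvent alpha c k.
Proof.
split=> //.
- move=> d d0; exists (nu * riesz alpha d) => t dt.
  apply: le_trans (fkernel_le _ _ _ _ _) _ => //; rewrite ler_wpM2l//; first exact: ltW.
  by apply: riesz_dec => //; exact: ltW.
- by move=> a1; move: alpha_lt1; rewrite a1 ltxx.
Qed.

End existence.

Theorem resolvent_exists {R : realType} (alpha c : R) : 0 < alpha -> alpha <= 1 ->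
  0 < c -> exists k, resolvent alpha c k.
Proof.
move=> a0; rewrite le_eqVlt => /predU1P[->|a1] c0; first by eexists; exact: resolvent_1.
by eexists; exact: resolvent_lt1.
Qed.

(** * Laplace transform of the resolvent *)

Definition damp {R : realType} (e : R) (f : R -> R) (t : R) : R :=
  expR (- (e * t)) * f t.

(* Real and imaginary parts of [z^alpha] for [z = e + i w], [0 < e]. *)
Definition zpow_re {R : realType} (alpha e w : R) : R :=
  expR (alpha * (ln (e ^+ 2 + w ^+ 2) / 2)) * cos (alpha * atan (w / e)).
Definition zpow_im {R : realType} (alpha e w : R) : R :=
  expR (alpha * (ln (e ^+ 2 + w ^+ 2) / 2)) * sin (alpha * atan (w / e)).

Section transform_derivative.
Context {R : realType}.
Local Notation mu := (@lebesgue_measure R).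
Implicit Types f : R -> R.

Let dlin (t w : R) : is_derive w 1 (fun x : R => x * t) t.
Proof. by apply: is_derive_eq (dM (dId w) (dCst t w)) _; rewrite mul1r mulr0 addr0. Qed.

Let dcos f (t w : R) : is_derive w 1 (fun x : R => f t * cos (x * t)) (- (t * f t * sin (w * t))).
Proof.
have -> : - (t * f t * sin (w * t)) = f t * (- sin (w * t) * t) by ring.
exact: (dZ (f t) (@dComp _ cos (fun x => x * t) w _ _ (is_derive_cos (w * t)) (dlin t w))).
Qed.

Let dsin f (t w : R) : is_derive w 1 (fun x : R => f t * sin (x * t)) (t * f t * cos (w * t)).
Proof.
have -> : t * f t * cos (w * t) = f t * (cos (w * t) * t) by ring.
exact: (dZ (f t) (@dComp _ sin (fun x => x * t) w _ _ (is_derive_sin (w * t)) (dlin t w))).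
Qed.

Lemma cosT_derive f (w : R) : L1 f -> L1 (fun t => t * f t) ->
  is_derive w 1 (cosT f) (- sinT (fun t => t * f t) w).
Proof.
move=> f1 tf1.
have w1 : `]w - 1, w + 1[%classic w by rewrite /= in_itv/=; apply/andP; split; lra.
have i1 (x : R) : `]w - 1, w + 1[%classic x -> mu.-integrable setT (EFin \o (fun t => f t * cos (x * t))).
  by move=> _; exact: L1_cos.
have dd (x t : R) : `]w - 1, w + 1[%classic x -> setT t -> derivable (fun x : R => f t * cos (x * t)) x 1.
  by move=> _ _; have [] := dcos f t x.
have DE (x t : R) : partial1of2 (fun x t : R => f t * cos (x * t)) x t = - (t * f t * sin (x * t)).
  by rewrite partial1of2E; exact: (@derive_val _ _ _ _ _ _ _ (dcos f t x)).
have G (x t : R) : `]w - 1, w + 1[%classic x -> setT t ->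
    `|partial1of2 (fun x t : R => f t * cos (x * t)) x t| <= `|t * f t|.
  by move=> _ _; rewrite DE normrN normrM ler_piMr// sin_norm_le1.
apply: DeriveDef.
  exact: (derivable_under_integral measurableT w1 i1 dd (fun=> normr_ge0 _) (L1_norm tf1) G).
rewrite -derive1E (differentiation_under_integral measurableT w1 i1 dd (fun=> normr_ge0 _) (L1_norm tf1) G).
rewrite /sinT -mulN1r -intZ; last exact: L1_sin.
by apply: eq_Rintegral => t _; rewrite DE mulN1r.
Qed.

Lemma sinT_derive f (w : R) : L1 f -> L1 (fun t => t * f t) ->
  is_derive w 1 (sinT f) (cosT (fun t => t * f t) w).
Proof.
move=> f1 tf1.
have w1 : `]w - 1, w + 1[%classic w by rewrite /= in_itv/=; apply/andP; split; lra.
have i1 (x : R) : `]w - 1, w + 1[%classic x -> mu.-integrable setT (EFin \o (fun t => f t * sin (x * t))).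
  by move=> _; exact: L1_sin.
have dd (x t : R) : `]w - 1, w + 1[%classic x -> setT t -> derivable (fun x : R => f t * sin (x * t)) x 1.
  by move=> _ _; have [] := dsin f t x.
have DE (x t : R) : partial1of2 (fun x t : R => f t * sin (x * t)) x t = t * f t * cos (x * t).
  by rewrite partial1of2E; exact: (@derive_val _ _ _ _ _ _ _ (dsin f t x)).
have G (x t : R) : `]w - 1, w + 1[%classic x -> setT t ->
    `|partial1of2 (fun x t : R => f t * sin (x * t)) x t| <= `|t * f t|.
  by move=> _ _; rewrite DE normrM ler_piMr// cos_norm_le1.
apply: DeriveDef.
  exact: (derivable_under_integral measurableT w1 i1 dd (fun=> normr_ge0 _) (L1_norm tf1) G).
rewrite -derive1E (differentiation_under_integral measurableT w1 i1 dd (fun=> normr_ge0 _) (L1_norm tf1) G).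
by apply: eq_Rintegral => t _; rewrite DE.
Qed.

End transform_derivative.

Section laplace.
Context {R : realType}.
Local Notation mu := (@lebesgue_measure R).
Local Notation H := (@heaviside R).
Implicit Types (f g k : R -> R) (e w c alpha t : R).

Lemma measurable_exp e : measurable_fun [set: R] (fun t => expR (- (e * t))).
Proof. by apply: continuous_measurableT; exact: is_derive_continuous. Qed.

Lemma measurable_damp e f : measurable_fun [set: R] f -> measurable_fun [set: R] (damp e f).
Proof. by move=> mf; apply: measurable_funM => //; exact: measurable_exp. Qed.

Lemma L1_damp e f : 0 <= e -> causal f -> L1 f -> L1 (damp e f).
Proof.
move=> e0 f0 f1; apply: L1_le (L1_norm f1).
  by apply: measurable_damp; exact: L1_measurable f1.
move=> t; rewrite /damp normrM (ger0_norm (expR_ge0 _)).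
have [t0|t0] := ltP 0 t; last by rewrite f0// normr0 mulr0.
by rewrite ler_piMl// -expR0 ler_expR oppr_le0 mulr_ge0// ltW.
Qed.

Lemma convol_damp e f g t : measurable_fun [set: R] f -> measurable_fun [set: R] g ->
  convol (damp e f) (damp e g) t = damp e (convol f g) t.
Proof.
move=> mf mg; rewrite /damp /convol -int_mulrl; last first.
  by apply: measurable_funM => //; exact: measurable_reflect.
apply: eq_Rintegral => s _.
rewrite (_ : - (e * t) = - (e * (t - s)) + - (e * s)); last by ring.
by rewrite expRD; ring.
Qed.

Lemma damp_heaviside e : damp e H = exp_step e. Proof. by []. Qed.

Lemma zpow_polar e w : 0 < e -> expR (ln (e ^+ 2 + w ^+ 2) / 2) * cos (atan (w / e)) = e /\
  expR (ln (e ^+ 2 + w ^+ 2) / 2) * sin (atan (w / e)) = w.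
Proof.
move=> e0; have D0 : 0 < e ^+ 2 + w ^+ 2 by rewrite ltr_wpDr ?sqr_ge0// exprn_gt0.
have sqE : expR (ln (e ^+ 2 + w ^+ 2) / 2) = Num.sqrt (e ^+ 2 + w ^+ 2).
  by rewrite -powR12_sqrt ?ltW// /powR gt_eqF// mulrC.
have cE : expR (ln (e ^+ 2 + w ^+ 2) / 2) * cos (atan (w / e)) = e.
  rewrite sqE cos_atan.
  have -> : e ^+ 2 + w ^+ 2 = e ^+ 2 * (1 + (w / e) ^+ 2) by field; rewrite gt_eqF.
  rewrite sqrtrM ?sqr_ge0// sqrtr_sqr gtr0_norm// -mulrA mulfV ?mulr1//.
  by rewrite gt_eqF// sqrtr_gt0 ltr_wpDr ?sqr_ge0.
split=> //.
have /andP[a1 a2] : - (pi / 2) < atan (w / e) < pi / 2 by rewrite atan_gtNpi2 atan_ltpi2.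
have c0 : 0 < cos (atan (w / e)) by apply: cos_gt0_pihalf; rewrite a1.
have : tan (atan (w / e)) = w / e by exact: atanK.
rewrite /tan => /(congr1 (fun x => x * cos (atan (w / e)) )).
rewrite divfK ?gt_eqF// => ->.
by rewrite mulrCA cE divfK// gt_eqF.
Qed.

Lemma zpow_re1 e w : 0 < e -> zpow_re 1 e w = e.
Proof. by move=> e0; rewrite /zpow_re !mul1r; have [] := zpow_polar w e0. Qed.

Lemma zpow_im1 e w : 0 < e -> zpow_im 1 e w = w.
Proof. by move=> e0; rewrite /zpow_im !mul1r; have [] := zpow_polar w e0. Qed.

(* With [z = e + i w], the transform [F] of the damped kernel satisfies
   [dF/dw = - i (1 - alpha) F / z], so [z^(1 - alpha) F] is constant. *)
Lemma transform_caputo_weight alpha e w : 0 < alpha -> alpha < 1 -> 0 < e ->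
  [/\ L1 (damp e (caputo_weight alpha)),
      e * cosT (damp e (caputo_weight alpha)) w + w * sinT (damp e (caputo_weight alpha)) w
        = zpow_re alpha e w &
      w * cosT (damp e (caputo_weight alpha)) w - e * sinT (damp e (caputo_weight alpha)) w
        = zpow_im alpha e w].
Proof.
move=> a0 a1 e0; set b := caputo_weight alpha; pose s := 1 - alpha.
have s0 : 0 < s by rewrite subr_gt0.
have s1 : s <= 1 by rewrite lerBlDr lerDl ltW.
have G0 : 0 < Gamma s by exact: Gamma_gt0.
have mb : measurable_fun [set: R] b by apply: measurable_funM => //; exact: measurable_riesz.
have b1 : L1 (damp e b).
  have := L1Z (Gamma s)^-1 (L1_riesz_exp s0 s1 e0).
  by congr L1; apply/funext => t; rewrite /damp /b /caputo_weight -/s; ring.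
(* For this power, [t b(t) = (1 - alpha) (H * b)(t)]. On the transform side the left is a derivative
   in [w] and the right a division by [z], which gives the differential equation. *)
have tbE t : t * damp e b t = s * convol (exp_step e) (damp e b) t.
  rewrite -damp_heaviside convol_damp//; last exact: measurable_heaviside.
  rewrite /damp mulrCA [RHS]mulrCA; congr (_ * _).
  have [t0|t0] := ltP 0 t; last first.
    rewrite convol_causal ?mulr0; first by rewrite /b /caputo_weight riesz_le0 ?mulr0.
    - by move=> u; exact: heaviside_le0.
    - by move=> u u0; rewrite /b /caputo_weight riesz_le0 ?mulr0.
    - by [].
  have [i1 i1E] := int_riesz s0 t0.
  have -> : convol H b t = (Gamma s)^-1 * (t `^ s / s).
    rewrite -i1E -intZ//; apply: eq_Rintegral => u _.
    by rewrite /b /caputo_weight -/s; ring.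
  rewrite /b /caputo_weight -/s rieszE//.
  have -> : t `^ s = t * t `^ (s - 1).
    by rewrite -[X in X * _]powRr1 ?ltW// -powRD_gt0//; congr (_ `^ _); ring.
  by field; rewrite !gt_eqF.
have e1 := L1_exp_step e0.
have tb1 : L1 (fun t => t * damp e b t).
  by rewrite (funext tbE); apply/L1Z/L1_conv.
pose P := cosT (damp e b); pose Q := sinT (damp e b).
have D0 (x : R) : 0 < e ^+ 2 + x ^+ 2 by rewrite ltr_wpDr ?sqr_ge0// exprn_gt0.
have dP (x : R) : is_derive x 1 P (- (s * ((x * P x + e * Q x) / (e ^+ 2 + x ^+ 2)))).
  have [cE sE] := transform_exp_step x e0.
  apply: is_derive_eq (cosT_derive x b1 tb1) _.
  rewrite (funext tbE) sinTZ; last exact: L1_conv.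
  by rewrite sinT_conv// cE sE -/(P x) -/(Q x); congr (- (s * _)); field; rewrite gt_eqF.
have dQ (x : R) : is_derive x 1 Q (s * ((e * P x - x * Q x) / (e ^+ 2 + x ^+ 2))).
  have [cE sE] := transform_exp_step x e0.
  apply: is_derive_eq (sinT_derive x b1 tb1) _.
  rewrite (funext tbE) cosTZ; last exact: L1_conv.
  by rewrite cosT_conv// cE sE -/(P x) -/(Q x); congr (s * _); field; rewrite gt_eqF.
pose L x : R := ln (e ^+ 2 + x ^+ 2) / 2; pose th x : R := atan (x / e).
have dL (x : R) : is_derive x 1 L (x / (e ^+ 2 + x ^+ 2)).
  have dD0 : is_derive x 1 (fun y : R => e ^+ 2 + y ^+ 2) (2 * x).
    apply: is_derive_eq (dD (dCst (e ^+ 2) x) (dM (dId x) (dId x))) _.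
    by ring.
  have dl : is_derive x 1 (fun y : R => ln (e ^+ 2 + y ^+ 2)) ((e ^+ 2 + x ^+ 2)^-1 * (2 * x)).
    exact: (@dComp R (@ln R) (fun y => e ^+ 2 + y ^+ 2) x _ _ (is_derive1_ln (D0 x)) dD0).
  have d2 := dM dl (dCst 2^-1 x).
  apply: is_derive_eq d2 _.
  by field; rewrite gt_eqF.
have dth (x : R) : is_derive x 1 th (e / (e ^+ 2 + x ^+ 2)).
  have dl : is_derive x 1 (fun y : R => y / e) e^-1.
    by apply: is_derive_eq (dM (dId x) (dCst e^-1 x)) _; ring.
  apply: is_derive_eq (@dComp R (@atan R) (fun y => y / e) x _ _ (is_derive1_atan (x / e)) dl) _.
  have D0' : e ^+ 2 + x ^+ 2 != 0 by rewrite gt_eqF.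
  have -> : 1 + (x / e) ^+ 2 = (e ^+ 2 + x ^+ 2) / e ^+ 2 by field; rewrite gt_eqF.
  by field; rewrite D0' gt_eqF.
pose M x := expR (s * L x); pose C x := cos (s * th x); pose S x := sin (s * th x).
have dMx (x : R) : is_derive x 1 M (M x * (s * (x / (e ^+ 2 + x ^+ 2)))).
  exact: (@dComp R (@expR R) (fun y => s * L y) x _ _ (is_derive_expR _) (dZ s (dL x))).
have dC (x : R) : is_derive x 1 C (- S x * (s * (e / (e ^+ 2 + x ^+ 2)))).
  exact: (@dComp R (@cos R) (fun y => s * th y) x _ _ (is_derive_cos _) (dZ s (dth x))).
have dS (x : R) : is_derive x 1 S (C x * (s * (e / (e ^+ 2 + x ^+ 2)))).
  exact: (@dComp R (@sin R) (fun y => s * th y) x _ _ (is_derive_sin _) (dZ s (dth x))).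
(* Real and imaginary parts of [z^(1 - alpha) F], where [F = P - i Q] and [z = e + i x]. *)
pose U x := M x * (P x * C x + Q x * S x); pose V x := M x * (P x * S x - Q x * C x).
have dU (x : R) : is_derive x 1 U 0.
  apply: is_derive_eq (dM (dMx x) (dD (dM (dP x) (dC x)) (dM (dQ x) (dS x)))) _.
  by field; rewrite gt_eqF.
have dV (x : R) : is_derive x 1 V 0.
  apply: is_derive_eq (dM (dMx x) (dB (dM (dP x) (dS x)) (dM (dQ x) (dC x)))) _.
  by field; rewrite gt_eqF.
(* The constant is read off at [w = 0], where scaling by [e] turns the transform into a Gamma
   integral. *)
have P0 : P 0 * e `^ s = 1.
  have f1 : L1 (fun t => riesz s t * expR (- t)).
    by have := L1_riesz_exp s0 s1 ltr01; congr L1; apply/funext => t; rewrite mul1r.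
  have := int_affine 0 (negbT (gt_eqF e0)) f1; rewrite -GammaE gtr0_norm//.
  have -> : \int[mu]_x (riesz s (e * x + 0) * expR (- (e * x + 0))) =
      e `^ (s - 1) * Gamma s * P 0.
    rewrite /P /cosT -intZ; last exact: L1_cos.
    apply: eq_Rintegral => t _; rewrite addr0 riesz_scale// mul0r cos0 mulr1.
    by rewrite /damp /b /caputo_weight -/s; field; rewrite gt_eqF.
  have -> : e `^ s = e * e `^ (s - 1).
    by rewrite -[X in X * _]powRr1 ?ltW// -powRD_gt0//; congr (_ `^ _); ring.
  move=> h; apply: (@mulfI _ (Gamma s)); first by rewrite gt_eqF.
  transitivity (e * (e `^ (s - 1) * Gamma s * P 0)); first by ring.
  by rewrite h mulrA mulfV ?mul1r ?mulr1// gt_eqF.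
have Q0 : Q 0 = 0.
  rewrite /Q /sinT (_ : (fun t => _) = cst 0) ?/Rintegral ?integral0//.
  by apply/funext => t /=; rewrite mul0r sin0 mulr0.
have th0 : th 0 = 0 by rewrite /th mul0r atan0.
have M0 : M 0 = e `^ s.
  rewrite /M /L expr0n addr0 lnXn// /powR gt_eqF//; congr (expR (_ * _)).
  by rewrite mulr2n; field.
have UE : U w = 1.
  rewrite (@is_derive_0_is_cst _ U w 0 dU) /U /C /S th0 mulr0 cos0 sin0 M0.
  by rewrite mulr0 addr0 mulr1 mulrC.
have VE : V w = 0.
  rewrite (@is_derive_0_is_cst _ V w 0 dV) /V /C /S th0 mulr0 cos0 sin0 Q0.
  by rewrite mulr0 mul0r subrr mulr0.
have CS : C w ^+ 2 + S w ^+ 2 = 1 by exact: cos2Dsin2.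
have M_neq0 : M w != 0 by rewrite gt_eqF// expR_gt0.
have PE : P w = C w / M w.
  apply: (@mulfI _ (M w)) => //; rewrite mulrCA divff// mulr1.
  by rewrite -[LHS]mulr1 -CS -[RHS]mulr1 -UE /U -[RHS]addr0 -(mulr0 (S w)) -VE /V; ring.
have QE : Q w = S w / M w.
  apply: (@mulfI _ (M w)) => //; rewrite mulrCA divff// mulr1.
  by rewrite -[LHS]mulr1 -CS -[RHS]mulr1 -UE /U -[RHS]subr0 -(mulr0 (C w)) -VE /V; ring.
have [eE wE] := zpow_polar w e0.
have ME : expR (L w) / M w = expR (alpha * L w).
  by rewrite /M -expRB; congr expR; rewrite /s; ring.
have thE : alpha * th w = th w - s * th w by rewrite /s; ring.
split=> //; rewrite -/(P w) -/(Q w) PE QE.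
  rewrite /zpow_re -/(L w) -/(th w) -ME thE cosB -/(C w) -/(S w).
  by rewrite -[X in X * _ + _]eE -[X in _ + X * _]wE -/(L w) -/(th w); ring.
rewrite /zpow_im -/(L w) -/(th w) -ME thE sinB -/(C w) -/(S w).
by rewrite -[X in _ - X * _]eE -[X in X * _ - _]wE -/(L w) -/(th w); ring.
Qed.

(** Real and imaginary parts of [(z^alpha + c) K = 1] with [K = cosT - i sinT]. For [alpha < 1] it
    is the transform of [resolvent_caputo] multiplied by [z]; for [alpha = 1] the kernel is an
    explicit exponential. *)
Lemma transform_resolvent alpha c k e w : 0 < alpha -> alpha <= 1 -> 0 < c ->
  resolvent alpha c k -> 0 < e ->
  (zpow_re alpha e w + c) * cosT (damp e k) w + zpow_im alpha e w * sinT (damp e k) w = 1 /\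
  zpow_im alpha e w * cosT (damp e k) w = (zpow_re alpha e w + c) * sinT (damp e k) w.
Proof.
move=> a0 + c0 rk e0; have [k0 k_ge0 k1 _ _ rcap rexp] := rk.
have D0 : 0 < e ^+ 2 + w ^+ 2 by rewrite ltr_wpDr ?sqr_ge0// exprn_gt0.
rewrite le_eqVlt => /predU1P[a1|a1].
  have ce0 : 0 < c + e by rewrite addr_gt0.
  have D1 : 0 < (c + e) ^+ 2 + w ^+ 2 by rewrite ltr_wpDr ?sqr_ge0// exprn_gt0.
  have -> : damp e k = exp_step (c + e).
    apply/funext => t; rewrite (rexp a1) /damp /exp_step mulrA -expRD.
    by congr (expR _ * _); ring.
  have [-> ->] := transform_exp_step w ce0.
  rewrite a1 zpow_re1// zpow_im1//.
  by split; field; rewrite gt_eqF.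
have [b1 <- <-] := transform_caputo_weight w a0 a1 e0.
have {rcap} rcap := rcap a1.
set b := caputo_weight alpha in b1 rcap *.
have mb : measurable_fun [set: R] b by apply: measurable_funM => //; exact: measurable_riesz.
have mk := L1_measurable k1.
have dk1 := L1_damp (ltW e0) k0 k1.
have e1 := L1_exp_step e0.
have E : convol (damp e b) (damp e k) =
    fun t => exp_step e t - c * convol (exp_step e) (damp e k) t.
  apply/funext => t; rewrite convol_damp// -damp_heaviside.
  rewrite convol_damp//; last exact: measurable_heaviside.
  by rewrite /damp (rcap t).2; ring.
have ek1 := L1_conv e1 dk1.
have := cosT_conv w b1 dk1; have := sinT_conv w b1 dk1; rewrite E.
have NE : (fun t => exp_step e t - c * convol (exp_step e) (damp e k) t) =
    fun t => exp_step e t + - c * convol (exp_step e) (damp e k) t.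
  by apply/funext => t; rewrite mulNr.
rewrite NE sinTD//; last exact: L1Z.
rewrite cosTD//; last exact: L1Z.
rewrite sinTZ// cosTZ// sinT_conv// cosT_conv//.
have [-> ->] := transform_exp_step w e0.
set P := cosT (damp e b) w; set Q := sinT (damp e b) w.
set X := cosT _ w; set Y := sinT _ w => h1 h2.
have {}h1 : w - c * (w * X + e * Y) = (Q * X + P * Y) * (e ^+ 2 + w ^+ 2).
  by rewrite -h1; field; rewrite gt_eqF.
have {}h2 : e - c * (e * X - w * Y) = (P * X - Q * Y) * (e ^+ 2 + w ^+ 2).
  by rewrite -h2; field; rewrite gt_eqF.
split; apply: (@mulfI _ (e ^+ 2 + w ^+ 2)); rewrite ?gt_eqF//.
  have := congr1 (fun z => e * z) h2; have := congr1 (fun z => w * z) h1.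
  by move=> {h1 h2}; lra.
have := congr1 (fun z => w * z) h2; have := congr1 (fun z => e * z) h1.
by move=> {h1 h2}; lra.
Qed.

End laplace.

(** * Representation of the solutions of Caputo equations *)

Section bounded_derivative.
Context {R : realType}.
Local Notation mu := (@lebesgue_measure R).
Local Notation H := (@heaviside R).
Implicit Types (y z : R -> R).

(** The argument [(t + |t|) / 2] is the retraction of the line onto [[0, +oo[], so [y] is extended
    to the left by the constant [y 0]. *)
Lemma continuous_half_line y : {within `[0, +oo[, continuous y} ->
  continuous (fun t : R => y ((t + `|t|) / 2)).
Proof.
move=> yc.
move=> t; have pos u : 0 <= (u + `|u|) / 2 :> R.
  by rewrite divr_ge0//; have := ler_norm (- u); rewrite normrN; lra.
have /subspace_continuousP/(_ ((t + `|t|) / 2)) := yc.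
rewrite /= in_itv/= andbT => /(_ (pos t)); apply: cvg_comp => P /= wP.
have mc : (u + `|u|) / 2 @[u --> t] --> (t + `|t|) / 2.
  apply: cvgM; last exact: cvg_cst.
  by apply: cvgD; [exact: cvg_id|exact: norm_continuous].
have mc' : nbhs t ((fun u => (u + `|u|) / 2) @^-1` [set x | `[0, +oo[%classic x -> P x]).
  exact: (mc _ wP).
by apply: filterS mc' => u /= h; apply: h; rewrite /= in_itv/= andbT; exact: pos.
Qed.

Lemma difference_quotient_cvg y (t : R) : derivable y t 1 ->
  n.+1%:R * (y (t + n.+1%:R^-1) - y t) @[n --> \oo] --> derive1 y t.
Proof.
move=> dy.
have c : h^-1 *: (y (h%:A + t) - y t) @[h --> 0^'] --> derive1 y t.
  by rewrite derive1E; exact: dy.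
have /cvgr_dnbhsP/(_ (fun n => n.+1%:R^-1)) := c.
have h2 : (forall n, n.+1%:R^-1 != 0 :> R) /\ (n.+1%:R^-1 @[n --> \oo] --> (0 : R)).
  by split=> [n|]; [rewrite invr_eq0|exact: (@cvg_harmonic R)].
move=> /(_ h2); apply: cvg_trans; apply: near_eq_cvg; apply: nearW => n.
transitivity (n.+1%:R * (y (n.+1%:R^-1 * 1 + t) - y t)); last by rewrite mulr1 (addrC t).
by rewrite invrK.
Qed.

Let chi (s : R) : R := ((0 <= s) && (s < 1))%R%:R.

Let chiE : chi = \1_`[0, 1[.
Proof. by apply/funext => s; rewrite indicE mem_setE in_itv. Qed.

Let mchi : measurable_fun [set: R] chi.
Proof. by rewrite chiE; exact: measurable_indic. Qed.

Let int_chi : L1 chi /\ \int[mu]_s chi s = 1.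
Proof.
split.
  apply: L1_le (L1_indic_itv 0 1) => // s; rewrite /chi indicE mem_setE in_itv/=.
  by rewrite ger0_norm// ler_nat; case: (0 <= s) => //=; case: ltgtP.
rewrite chiE /Rintegral integral_indic// setIT/= lebesgue_measure_itv/= lte_fin ltr01.
by rewrite -EFinB subr0.
Qed.

Lemma average_cvg z (a : R) : continuous z ->
  n.+1%:R * \int[mu]_t (z t * chi (n.+1%:R * (t - a))) @[n --> \oo] --> z a.
Proof.
move=> zc; have mz := continuous_measurableT zc; have [c1 cE] := int_chi.
have [M zM] : exists M, forall s, a <= s <= a + 1 -> `|z s| <= M.
  have nc : {within `[a, a + 1], continuous (fun s => `|z s|)}.
    by apply: continuous_subspaceT => s; apply: cvg_norm; exact: zc.
  have [|m _ zm] := EVT_max _ nc; first by rewrite lerDl.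
  by exists `|z m| => s sa; apply: zm; rewrite in_itv.
pose f n u := z (n.+1%:R^-1 * u + a) * chi u.
have f_dom n u : `|f n u| <= M * chi u.
  rewrite /f normrM /chi; case: (boolP ((0 <= u) && (u < 1))) => [/andP[u0 u1]|_]; last first.
    by rewrite normr0 !mulr0.
  rewrite normr1 !mulr1; apply: zM; rewrite lerDr mulr_ge0//= addrC lerD2l.
  by rewrite mulr_ile1// ?invf_le1 ?ler1n// ltW.
have mf n : measurable_fun [set: R] (f n).
  apply: measurable_funM => //; apply: (measurableT_comp mz).
  by apply: measurable_funD => //; exact: measurable_funM.
have f_cvg u : f n u @[n --> \oo] --> z a * chi u.
  apply: cvgM; last exact: cvg_cst.
  apply: (@cvg_comp _ _ _ (fun n : nat => n.+1%:R^-1 * u + a) z); last exact: zc.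
  suff : n.+1%:R^-1 * u + a @[n --> \oo] --> 0 * u + a by rewrite mul0r add0r.
  apply: cvgD; last exact: cvg_cst.
  by apply: cvgM; [exact: (@cvg_harmonic R)|exact: cvg_cst].
have [_] := int_dominated_cvg mf f_cvg (L1Z M c1) f_dom.
rewrite intZ// cE mulr1; apply: cvg_trans; apply: near_eq_cvg; apply: nearW => n.
have fn1 : L1 (f n) by exact: L1_le (mf n) (f_dom n) (L1Z M c1).
have n0 : n.+1%:R != 0 :> R by [].
have := int_affine (- (n.+1%:R * a)) n0 fn1; rewrite gtr0_norm// => /(congr1 (fun v => n.+1%:R * v)).
rewrite mulrA mulfV// mul1r => <-; congr (_ * _); apply: eq_Rintegral => t _.
rewrite /f; congr (z _ * chi _); last by ring.
by field.
Qed.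

(* Integrate the difference quotients, which the mean value theorem bounds. *)
Lemma FTC_bounded_derivative y (T M : R) : 0 < T ->
  {within `[0, +oo[, continuous y} -> (forall t, 0 < t -> derivable y t 1) ->
  (forall t, 0 < t -> t <= T + 1 -> `|derive1 y t| <= M) ->
  L1 (fun t => derive1 y t * \1_`]0, T[ t) /\
  \int[mu]_t (derive1 y t * \1_`]0, T[ t) = y T - y 0.
Proof.
move=> T0 yc dy yM.
pose z t := y ((t + `|t|) / 2).
have zc : continuous z by exact: continuous_half_line.
have zy t : 0 <= t -> z t = y t.
  by move=> t0; rewrite /z ger0_norm//; congr y; field.
pose q n t := n.+1%:R * (z (t + n.+1%:R^-1) - z t).
have mz := continuous_measurableT zc.
have mq n : measurable_fun [set: R] (q n).
  apply: measurable_funM => //; apply: measurable_funB => //.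
  by apply: (measurableT_comp mz); exact: measurable_funD.
have i_gt0 n : 0 < n.+1%:R^-1 :> R by rewrite invr_gt0.
have q_dom n t : `|q n t * \1_`]0, T[ t| <= M * \1_`[0, T] t.
  rewrite !indicE !mem_setE !in_itv/=.
  case: (boolP (0 < t < T)) => [/andP[t0 tT]|_]; last first.
    rewrite mulr0 normr0 mulr_ge0//; apply: le_trans (yM T T0 _) => //.
    by rewrite lerDl.
  rewrite (ltW t0) (ltW tT) !mulr1.
  have tlt : t < t + n.+1%:R^-1 by rewrite ltrDl.
  have yc' : {within `[t, t + n.+1%:R^-1], continuous y}.
    apply: derivable_within_continuous => u; rewrite in_itv/= => /andP[tu _].
    exact: dy (lt_le_trans t0 tu).
  have dy' u : u \in `]t, t + n.+1%:R^-1[ -> is_derive u 1 y (derive1 y u).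
    rewrite in_itv/= => /andP[tu _]; rewrite derive1E; apply: DeriveDef => //.
    exact: dy (lt_trans t0 tu).
  have [u] := MVT tlt dy' yc'; rewrite in_itv/= => /andP[tu ut] yE.
  rewrite /q !zy ?addr_ge0 ?(ltW t0)// yE addrAC subrr add0r mulrCA mulfV// mulr1.
  apply: yM; first exact: lt_trans tu.
  apply: le_trans (ltW ut) _; rewrite lerD ?(ltW tT)//.
  by rewrite invf_le1// ler1n.
have q_cvg t : q n t * \1_`]0, T[ t @[n --> \oo] --> derive1 y t * \1_`]0, T[ t.
  rewrite indicE mem_setE in_itv/=; case: (boolP (0 < t < T)) => [/andP[t0 tT]|_]; last first.
    by under eq_fun do rewrite mulr0; rewrite mulr0; exact: cvg_cst.
  apply: cvgM; last exact: cvg_cst.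
  apply: cvg_trans (difference_quotient_cvg (dy t t0)).
  apply: near_eq_cvg; apply: nearW => n.
  by rewrite /q !zy ?addr_ge0// ltW.
have mq' n : measurable_fun [set: R] (fun t => q n t * \1_`]0, T[ t).
  by apply: measurable_funM => //; exact: measurable_indic.
have [d1 cv1] := int_dominated_cvg mq' q_cvg (L1Z M (L1_indic_itv 0 T)) q_dom.
split=> //; apply: (cvg_unique _ cv1) => //.
(* The integral of a difference quotient of step [h] telescopes to the difference of the averages
   over [[T, T + h]] and [[0, h]], which converge to the two endpoint values. *)
rewrite -(zy T (ltW T0)) -(zy 0 (lexx 0)).
apply: cvg_trans (cvgB (average_cvg (a := T) zc) (average_cvg (a := 0) zc)).
pose I (a b t : R) : R := ((a <= t) && (t < b))%R%:R.
have IE a b : I a b = \1_`[a, b[.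
  by apply/funext => t; rewrite indicE mem_setE in_itv.
have zI a b : L1 (fun t => z t * I a b t).
  apply: L1_le (L1_norm (@L1_continuous_itv _ z a b _)).
  - by apply: measurable_funM => //; rewrite IE; exact: measurable_indic.
  - move=> t; rewrite !normrM ler_wpM2l// /I indicE mem_setE in_itv/=.
    by case: (a <= t) => //=; case: ltgtP; rewrite ?normr0.
  - exact: continuous_subspaceT.
apply: near_eq_cvg; near=> n; set h := n.+1%:R^-1 : R.
have hT : h <= T.
  rewrite /h -[T]invrK lef_pV2 ?posrE ?invr_gt0// -natr1.
  rewrite (@le_trans _ _ n%:R)// ?lerDl//; near: n; exact: nbhs_infty_ger.
have n0 : n.+1%:R != 0 :> R by [].
have h0 : 0 < h by rewrite invr_gt0.
have chi_scale a t : chi (n.+1%:R * (t - a)) = I a (a + h) t.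
  rewrite /chi /I pmulr_rge0// subr_ge0; congr ((_ && _)%:R).
  by rewrite mulrC -ltr_pdivlMr// div1r ltrBlDr addrC.
transitivity (n.+1%:R * \int[mu]_t (z t * I T (T + h) t) -
    n.+1%:R * \int[mu]_t (z t * I 0 h t)).
  transitivity (n.+1%:R * \int[mu]_t (z t * chi (n.+1%:R * (t - T))) -
    n.+1%:R * \int[mu]_t (z t * chi (n.+1%:R * (t - 0)))); first by [].
  by congr (_ * _ - _ * _); apply: eq_Rintegral => t _; rewrite chi_scale ?add0r.
symmetry.
have qi : mu.-integrable `]0, T[ (EFin \o q n).
  apply: (L1_in _ _).2 => //.
  exact: L1_le (mq' n) (q_dom n) (L1Z M (L1_indic_itv 0 T)).
rewrite -int_in (Rintegral_itv_obnd_cbnd qi) int_in -IE.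
have zhI : L1 (fun t => z (t + h) * I 0 T t).
  have := L1_shift (- h) (zI h (T + h)); congr L1; apply/funext => t.
  by rewrite opprK /I lerDr ltrD2r.
have -> : \int[mu]_x (q n x * I 0 T x) =
    n.+1%:R * (\int[mu]_x (z x * I h (T + h) x) - \int[mu]_x (z x * I 0 T x)).
  have -> : \int[mu]_x (z x * I h (T + h) x) = \int[mu]_x (z (x + h) * I 0 T x).
    rewrite -(int_shift (- h) (zI h (T + h))); apply: eq_Rintegral => t _.
    by rewrite opprK /I lerDr ltrD2r.
  rewrite -intB// -intZ; last exact: L1B.
  by apply: eq_Rintegral => t _; rewrite /q -/h; ring.
rewrite -mulrBr; congr (_ * _); rewrite -!intB//.
apply: eq_Rintegral => t _; rewrite -!mulrBr; congr (_ * _).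
rewrite /I !ltNge; case: (leP h t) => a1; case: (leP 0 t) => a2;
  case: (leP T t) => a3; case: (leP (T + h) t) => a4 //=; lra.
Unshelve. all: end_near. Qed.

End bounded_derivative.

(** When [k] is the resolvent of order [alpha], this is [E_alpha(- c t^alpha)] on [t > 0], the
    solution of [D^alpha E = - c E] with initial value 1. *)
Definition step_response {R : realType} (c : R) (k : R -> R) (t : R) : R :=
  heaviside t - c * convol k heaviside t.

Section step_responses.
Context {R : realType}.
Local Notation mu := (@lebesgue_measure R).
Local Notation H := (@heaviside R).
Variables (alpha c : R) (k : R -> R).
Hypotheses (c_gt0 : 0 < c) (rk : resolvent alpha c k).
Local Notation E := (step_response c k).

Lemma loc_bounded_heaviside : loc_bounded H.
Proof.
split; first exact: measurable_heaviside.
  by move=> t t0; rewrite heaviside_le0// ltW.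
by move=> T; exists 1 => t _; rewrite ger0_norm ?heaviside_ge0 ?heaviside_le1.
Qed.

Lemma resolvent_loc_L1 : loc_L1 k.
Proof. by apply: loc_L1_intro; [exact: resolvent_L1 rk|exact: resolvent_causal rk]. Qed.

Lemma L1_resolvent_heaviside t : L1 (fun s => k (t - s) * H s).
Proof.
have [mH H0 HM] := loc_bounded_heaviside; have [M HMt] := HM t.
by apply: (@L1_convol _ k H t M resolvent_loc_L1 mH H0 _).1 => s /ltW; exact: HMt.
Qed.

Lemma measurable_step_response : measurable_fun [set: R] E.
Proof.
apply: measurable_funB; first exact: measurable_heaviside.
by apply: measurable_funM => //; apply: measurable_convol; [exact: resolvent_loc_L1|exact: loc_bounded_heaviside].
Qed.

Lemma step_response_causal : causal E.
Proof.
move=> t t0; rewrite /step_response heaviside_le0// convol_left0 ?mulr0 ?subr0//.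
- exact: resolvent_causal rk.
- by move=> s s0; rewrite heaviside_le0// ltW.
Qed.

Lemma step_response_ge0 t : 0 <= E t.
Proof.
have [t0|t0] := ltP 0 t; last by rewrite step_response_causal.
have k1 := L1_reflect t (resolvent_L1 rk).
rewrite /step_response heavisideE// subr_ge0 mulrC -ler_pdivlMr// div1r -(resolvent_int rk).
rewrite -(int_reflect t (resolvent_L1 rk)); apply: int_le => //.
  exact: L1_resolvent_heaviside.
by move=> s; rewrite ler_piMr ?heaviside_le1// (resolvent_ge0 rk).
Qed.

Lemma step_response_le1 t : E t <= 1.
Proof.
apply: (@le_trans _ _ (H t)); last exact: heaviside_le1.
rewrite lerBlDr lerDl mulr_ge0//; first exact: ltW.
by apply: Rintegral_ge0 => s _; rewrite mulr_ge0 ?heaviside_ge0 ?(resolvent_ge0 rk).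
Qed.

Lemma step_response_cvg0 : E t @[t --> +oo] --> 0.
Proof.
have -> : (0 : R) = 1 - c * c^-1 by rewrite mulfV ?subrr// gt_eqF.
apply: cvgB; first by apply: cvg_near_cst; near=> t; rewrite heavisideE.
apply: cvgM; first exact: cvg_cst.
have -> : convol k H = fun t => \int[mu]_s (H (t - s) * k s).
  by apply/funext => t; rewrite convolC//; exact: L1_resolvent_heaviside.
rewrite -(resolvent_int rk); apply: (@dominated_cvg_pinfty _ (fun t s => H (t - s) * k s) k k).
- move=> t; apply: measurable_funM; last exact: L1_measurable (resolvent_L1 rk).
  exact: measurable_reflect measurable_heaviside.
- move=> s; apply: cvg_near_cst; near=> t; rewrite heavisideE ?mul1r// subr_gt0.
  by near: t; apply: nbhs_pinfty_gt; exact: num_real.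
- exact: resolvent_L1 rk.
- move=> t s; rewrite ger0_norm; last by rewrite mulr_ge0 ?heaviside_ge0 ?(resolvent_ge0 rk).
  by rewrite ler_piMl ?heaviside_le1 ?(resolvent_ge0 rk).
Unshelve. all: end_near. Qed.

End step_responses.

(** For [alpha = 1] the role of the Caputo weight is played by a Dirac mass, so [k = E] takes the
    place of [resolvent_caputo]. *)
Lemma exp_step_response {R : realType} (c : R) : 0 < c ->
  step_response c (exp_step c) = exp_step c.
Proof.
move=> c0; apply/funext => t; have rk := resolvent_1 c0.
have [t0|t0] := ltP 0 t; last first.
  by rewrite (step_response_causal rk)// (resolvent_causal rk).
have dy (s : R) : is_derive s 1 (fun u => expR (- (c * u))) (expR (- (c * s)) * - c).
  have dl : is_derive s 1 (fun u => - (c * u)) (- c).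
    by apply: is_derive_eq (dN (dZ c (dId s))) _; rewrite mulr1.
  exact: (@dComp R (@expR R) (fun u => - (c * u)) s _ _ (is_derive_expR _) dl).
have y' (s : R) : derive1 (fun u => expR (- (c * u))) s = expR (- (c * s)) * - c.
  by rewrite derive1E; exact: (@derive_val _ _ _ _ _ _ _ (dy s)).
have yc : {within `[0, +oo[, continuous (fun u => expR (- (c * u)))}.
  by apply: continuous_subspaceT; exact: (is_derive_continuous dy).
have yd (s : R) : 0 < s -> derivable (fun u => expR (- (c * u))) s 1.
  by move=> _; have [] := dy s.
have yb (s : R) : 0 < s -> s <= t + 1 -> `|derive1 (fun u => expR (- (c * u))) s| <= c.
  move=> s0 _; rewrite y' normrM normrN (gtr0_norm c0) ger0_norm ?expR_ge0//.
  by rewrite ler_piMl ?ltW// -expR0 ltr_expR oppr_lt0 mulr_gt0.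
have [] := FTC_bounded_derivative t0 yc yd yb.
move=> l1; rewrite mulr0 oppr0 expR0 => lE.
rewrite /step_response convolC; last exact: (L1_resolvent_heaviside rk).
have -> : convol (@heaviside R) (exp_step c) t = (- c^-1) * (expR (- (c * t)) - 1).
  rewrite -lE -intZ//; apply: eq_Rintegral => s _.
  rewrite y' /exp_step /heaviside subr_gt0 indicE mem_setE in_itv/=.
  by case: (0 < s); case: (s < t); rewrite /= ?(mulr0, mul0r)//; field; rewrite gt_eqF.
by rewrite /exp_step heavisideE//; field; rewrite gt_eqF.
Qed.

Lemma loc_bounded_half_line {R : realType} (y : R -> R) : {within `[0, +oo[, continuous y} ->
  loc_bounded (fun t => y t * heaviside t).
Proof.
move=> yc; pose yH s := y s * heaviside s.
have zc := continuous_half_line yc.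
have yHE s : yH s = y ((s + `|s|) / 2) * heaviside s.
  rewrite /yH; have [s0|s0] := ltP 0 s; last by rewrite heaviside_le0// !mulr0.
  by rewrite ger0_norm ?ltW//; congr (y _ * _); field.
split.
- rewrite (funext yHE : (fun t => y t * heaviside t) = _); apply: measurable_funM; last exact: measurable_heaviside.
  exact: continuous_measurableT.
- by move=> s s0; rewrite /yH heaviside_le0 ?mulr0// ltW.
move=> T; have [T0|T0] := ltP 0 T; last first.
  by exists 0 => s sT; rewrite /yH heaviside_le0 ?mulr0 ?normr0// (le_trans sT).
have nc : {within `[0, T], continuous (fun s => `|y ((s + `|s|) / 2)|)}.
  by apply: continuous_subspaceT => s; apply: cvg_norm; exact: zc.
have [m _ ym] := EVT_max (ltW T0) nc.
exists `|y ((m + `|m|) / 2)| => s sT; rewrite -/(yH s) yHE.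
have [s0|s0] := ltP 0 s; last by rewrite heaviside_le0// mulr0 normr0.
by rewrite heavisideE// mulr1; apply: ym; rewrite in_itv/= sT ltW.
Qed.

Section representation.
Context {R : realType}.
Local Notation mu := (@lebesgue_measure R).
Local Notation H := (@heaviside R).
Variables (alpha c : R) (k y : R -> R).
Hypotheses (alpha_gt0 : 0 < alpha) (alpha_le1 : alpha <= 1) (c_gt0 : 0 < c).
Hypothesis rk : resolvent alpha c k.
Hypothesis yc : {within `[0, +oo[, continuous y}.
Hypothesis ydef : forall t, 0 < t -> caputo_defined alpha y t.
Hypothesis ybound : alpha = 1 -> forall T, exists M, forall t, 0 < t -> t <= T ->
  `|derive1 y t| <= M.
Local Notation E := (step_response c k).

Let dy t := derive1 y t * H t.
Let D t := caputo alpha y t * H t.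

Let loc_L1_intro' (f : R -> R) : causal f ->
  (forall T, 0 < T -> L1 (fun t => f t * \1_`]0, T[ t)) -> loc_L1 f.
Proof.
move=> f0 f1.
have fE T : (fun t => f t * H (T - t)) = (fun t => f t * \1_`]0, T[ t).
  apply/funext => t; rewrite indicE mem_setE in_itv/= /heaviside subr_gt0.
  by have [t0|t0] := ltP 0 t; [|rewrite f0// !mul0r].
have fL T : L1 (fun t => f t * H (T - t)).
  have [T0|T0] := ltP 0 T; first by rewrite fE; exact: f1.
  rewrite fE (_ : (fun t => _) = cst 0); first exact: L1_0.
  apply/funext => t; rewrite indicE mem_setE in_itv/=; case: (boolP (0 < t < T)) => [/andP[t0 tT]|_].
    lra.
  by rewrite mulr0.
split=> //; apply: (@measurable_fun_cvg _ _ _ _ (fun n : nat => fun t => f t * H (n%:R - t))).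
  by move=> n; exact: L1_measurable (fL n%:R).
move=> t _; apply: cvg_near_cst; near=> n; rewrite heavisideE ?mulr1// subr_gt0.
by near: n; exact: nbhs_infty_gtr.
Unshelve. all: end_near. Qed.

Let dy_causal : causal dy.
Proof. by move=> t t0; rewrite /dy heaviside_le0// mulr0. Qed.

(* Both sides differ at the endpoints only. *)
Let int_closed (f : R -> R) T : mu.-integrable `[0, T] (EFin \o f) -> 0 < T ->
  L1 (fun t => f t * \1_`]0, T[ t) /\
  \int[mu]_(t in `[0, T]) f t = \int[mu]_t (f t * \1_`]0, T[ t).
Proof.
move=> fi T0.
have i1 : mu.-integrable `]0, T[ (EFin \o f) by apply: integrableS fi => //; exact: subset_itv_oo_cc.
have i2 : mu.-integrable `]0, T] (EFin \o f) by apply: integrableS fi => //; exact: subset_itv_oc_cc.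
split; first exact: (L1_in _ _).1.
by rewrite -int_in (Rintegral_itv_bndo_bndc i1) (Rintegral_itv_obnd_cbnd i2).
Qed.

Let dy_primitive : loc_L1 dy /\ forall t, 0 < t -> y t - y 0 = convol H dy t.
Proof.
have key T : 0 < T -> L1 (fun t => derive1 y t * \1_`]0, T[ t) /\
    \int[mu]_t (derive1 y t * \1_`]0, T[ t) = y T - y 0.
  move=> T0; have := ydef T0; rewrite /caputo_defined; case: eqP => [a1 _|_ [[_ yi yE] _]].
    have [M yM] := ybound a1 (T + 1); apply: (FTC_bounded_derivative T0 yc _ yM).
    by move=> t t0; have := ydef t0; rewrite /caputo_defined a1 eqxx.
  have [l1 lE] := int_closed yi T0; split=> //.
  by rewrite -lE (yE T); [rewrite addrAC subrr add0r|rewrite lexx ltW].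
have dE T : (fun t => dy t * \1_`]0, T[ t) = (fun t => derive1 y t * \1_`]0, T[ t).
  apply/funext => t; rewrite /dy indicE mem_setE in_itv/= -mulrA /heaviside.
  by case: (0 < t); rewrite /= ?mul1r// !mulr0.
split; first by apply: loc_L1_intro' => // T T0; rewrite dE; exact: (key T T0).1.
move=> t t0; rewrite -(key t t0).2 -dE; apply: eq_Rintegral => s _.
rewrite indicE mem_setE in_itv/= /heaviside subr_gt0 mulrC.
by have [s0|s0] := ltP 0 s; [|rewrite dy_causal// !mulr0].
Qed.

Let caputoE t : alpha < 1 -> D t = convol (caputo_weight alpha) dy t.
Proof.
move=> a1; have [t0|t0] := ltP 0 t; last first.
  rewrite /D heaviside_le0// mulr0 convol_causal// => u u0.
  by rewrite /caputo_weight riesz_le0// mulr0.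
have := ydef t0; rewrite /D /caputo_defined /caputo heavisideE// mulr1 lt_eqF// => -[_ ki].
have [l1 ->] := int_closed ki t0; rewrite -intZ//; apply: eq_Rintegral => s _.
rewrite indicE mem_setE in_itv/= /caputo_kernel /caputo_weight /dy.
have [s0|s0] := ltP 0 s; last by rewrite (heaviside_le0 s0) /= !mulr0.
have [st|st] := ltP s t; last by rewrite riesz_le0 ?subr_le0// !mulr0 mul0r.
rewrite heavisideE// rieszE ?subr_gt0//= !mulr1 mulrA; congr (_ * _ `^ _ * _).
by ring.
Qed.

Let mD : measurable_fun [set: R] D.
Proof.
have [[mdy _ dyL] _] := dy_primitive.
have [a1|a1] := eqVneq alpha 1.
  have -> : D = dy by apply/funext => t; rewrite /D /caputo a1 eqxx.
  exact: mdy.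
have {}a1 : alpha < 1 by rewrite lt_neqAle a1.
have -> : D = convol (caputo_weight alpha) dy by apply/funext => t; exact: caputoE.
pose c_ n := convol (fun s => caputo_weight alpha s * \1_`[0, n%:R] s) (fun s => dy s * \1_`[0, n%:R] s).
apply: (@measurable_fun_cvg _ _ _ _ c_) => [n|t _].
  have w1 : loc_L1 (caputo_weight alpha).
    apply: loc_L1_intro'.
      by move=> u u0; rewrite /caputo_weight riesz_le0// mulr0.
    move=> T T0; have a0 : 0 < 1 - alpha by rewrite subr_gt0.
    have := L1Z (Gamma (1 - alpha))^-1 (int_riesz a0 T0).1.
    congr L1; apply/funext => t; rewrite indicE mem_setE in_itv/= mulrA.
    have -> : H (T - t) = (t < T)%R%:R by rewrite /heaviside subr_gt0.
    have [t0|t0] := ltP 0 t => //=.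
    by rewrite /caputo_weight riesz_le0// !(mulr0, mul0r).
  exact: L1_measurable (L1_conv (loc_L1_trunc n%:R w1) (loc_L1_trunc n%:R dy_primitive.1)).
apply: cvg_near_cst; near=> n; apply/esym/convol_trunc.
- by move=> u u0; rewrite /caputo_weight riesz_le0// mulr0.
- by move=> s s0; rewrite dy_causal// ltW.
- near: n; exact: nbhs_infty_ger.
Unshelve. all: end_near. Qed.

Let mE := measurable_step_response rk.
Let E_ge0 := step_response_ge0 c_gt0 rk.
Let E_le1 := step_response_le1 c_gt0 rk.

Let L1_E_loc (f : R -> R) t : loc_L1 f -> L1 (fun s => E (t - s) * f s).
Proof.
move=> [mf f0 fL]; have mEt : measurable_fun [set: R] (fun s => E (t - s)) by exact: measurable_reflect.
have h s : `|E (t - s)| <= 1 by rewrite ger0_norm; [exact: E_le1|exact: E_ge0].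
have := @L1_bounded_mul _ 1 _ _ mEt h (fL t).
congr L1; apply/funext => s; rewrite /heaviside subr_gt0.
have [st|ts] := ltP s t; first by rewrite mulr1 mulrC.
by rewrite mulr0 mul0r (step_response_causal rk) ?mul0r// subr_le0.
Qed.

Let mk := L1_measurable (resolvent_L1 rk).

Let conv_k_caputo t : L1 (fun s => k (t - s) * D s) /\ convol k D t = convol E dy t.
Proof.
have [dyl _] := dy_primitive; have [mdy _ dyL] := dyl.
have [a1|a1] := eqVneq alpha 1.
  have DE : D = dy by apply/funext => s; rewrite /D /caputo a1 eqxx.
  have kE s : k s = E s by rewrite (resolvent_exp rk a1) exp_step_response.
  rewrite DE; split.
    have := L1_E_loc t dyl; congr L1; apply/funext => s.
    by rewrite -kE.
  by apply: eq_Rintegral => s _; rewrite -kE.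
have {}a1 : alpha < 1 by rewrite lt_neqAle a1.
have DE : D = convol (caputo_weight alpha) dy by apply/funext => s; exact: caputoE.
set b := caputo_weight alpha in DE *.
have mb : measurable_fun [set: R] b by apply: measurable_funM => //; exact: measurable_riesz.
have kb1 x : L1 (fun s => k (x - s) * b s).
  have [l1 _] := resolvent_caputo rk a1 x.
  have := L1_reflect x l1; congr L1; apply/funext => s.
  by rewrite subKr mulrC.
have kbE : convol k b = E.
  apply/funext => x; have [_ e] := resolvent_caputo rk a1 x.
  rewrite convolC// -/b e /step_response; congr (_ - _ * _).
  by symmetry; apply: convolC; exact: (L1_resolvent_heaviside rk).
have [|l1 lE] := @conv_assoc _ k b dy t mk mb mdy kb1.
  have := L1_E_loc t (_ : loc_L1 (fun s => `|dy s|)).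
  have -> : convol (fun x => `|k x|) (fun x => `|b x|) = E.
    rewrite -kbE; apply/funext => x; apply: eq_Rintegral => s _.
    rewrite !ger0_norm ?(resolvent_ge0 rk)// mulr_ge0 ?riesz_ge0// invr_ge0 ltW//.
    by apply: Gamma_gt0; rewrite ?subr_gt0// lerBlDr lerDl ltW.
  apply; split; first exact: measurableT_comp.
    by move=> s s0; rewrite dy_causal// normr0.
  move=> T; have := L1_norm (dyL T); congr L1; apply/funext => s.
  by rewrite normrM (ger0_norm (heaviside_ge0 _)).
by rewrite DE; split=> //; rewrite lE kbE.
Qed.

(** With [b] the Caputo weight, [D^alpha y = b * y'] and [k * b = E] give [k * D^alpha y = E * y'];
    then [E = H - c (k * H)] and [H * y' = y - y 0] return [y]. For [alpha = 1], where the
    derivative is only known to exist pointwise, [ybound] yields the fundamental theorem that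
    absolute continuity yields otherwise. *)
Lemma caputo_representation :
  measurable_fun [set: R] (fun t => caputo alpha y t * H t) /\
  forall t, 0 < t ->
    y t = y 0 * E t + convol k (fun s => (caputo alpha y s + c * y s) * H s) t.
Proof.
split=> [//|t t0].
have [dyl dyE] := dy_primitive; have [mdy _ dyL] := dyl.
have [mH H0 HM] := @loc_bounded_heaviside R.
have kl := resolvent_loc_L1 rk.
pose yH s := y s * H s.
have yHb : loc_bounded yH by exact: loc_bounded_half_line.
pose w s := yH s - y 0 * H s.
have Hb : loc_bounded H by exact: loc_bounded_heaviside.
have wb : loc_bounded w by apply: loc_boundedB => //; exact: loc_boundedZ.
have wE : convol H dy = w.
  apply/funext => s; have [s0|s0] := ltP 0 s; last first.
    rewrite convol_causal//; last by move=> u; exact: heaviside_le0.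
    by rewrite /w /yH heaviside_le0// !mulr0 subrr.
  by rewrite -dyE// /w /yH heavisideE// !mulr1.
have kHE u : convol k H u = c^-1 * (H u - E u).
  by rewrite /step_response; field; rewrite gt_eqF.
have kH1 x := @L1_resolvent_heaviside _ _ _ _ rk x.
have [|_ kHdy] := @conv_assoc _ k H dy t mk mH mdy kH1.
  have ndy : loc_L1 (fun s => `|dy s|).
    split; first exact: measurableT_comp.
      by move=> s s0; rewrite dy_causal// normr0.
    move=> T; have := L1_norm (dyL T); congr L1; apply/funext => s.
    by rewrite normrM (ger0_norm (heaviside_ge0 _)).
  have [_ _ ndyL] := ndy.
  have := L1Z c^-1 (L1B (ndyL t) (L1_E_loc t ndy)); congr L1; apply/funext => u.
  have -> : convol (fun x => `|k x|) (fun x => `|H x|) = convol k H.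
    apply/funext => x; apply: eq_Rintegral => s _.
    by rewrite !ger0_norm ?(resolvent_ge0 rk) ?heaviside_ge0.
  by rewrite kHE; ring.
have [kD1 kDE] := conv_k_caputo t.
have Hdy1 : L1 (fun s => H (t - s) * dy s).
  by have := dyL t; congr L1; apply/funext => s; rewrite mulrC.
have EdyE : convol E dy t = w t - c * convol k w t.
  rewrite -wE kHdy /convol -intZ; last first.
    have := L1Z c^-1 (L1B Hdy1 (L1_E_loc t dyl)); congr L1; apply/funext => u.
    by rewrite -/(convol k H _) kHE; ring.
  rewrite -intB//; last first.
    have := L1B Hdy1 (L1_E_loc t dyl); congr L1; apply/funext => u.
    by rewrite -/(convol k H _) kHE; field; rewrite gt_eqF.
  by apply: eq_Rintegral => s _; rewrite /step_response -/(convol k H _); ring.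
have kyH : convol k yH t = convol k w t + y 0 * convol k H t.
  rewrite -convolZr// -convolDr//; last exact: loc_boundedZ.
  by congr (convol k _ t); apply/funext => s; rewrite /w subrK.
have [myH yH0 yHM] := yHb; have [M yHMt] := yHM t.
have kyH1 : L1 (fun s => k (t - s) * yH s).
  by apply: (@L1_convol _ k yH t M kl myH yH0 _).1 => s /ltW; exact: yHMt.
have -> : convol k (fun s => (caputo alpha y s + c * y s) * H s) t =
    convol k D t + c * convol k yH t.
  rewrite /convol -intZ// -intD//; last exact: L1Z.
  by apply: eq_Rintegral => s _; rewrite /D /yH; ring.
rewrite kDE EdyE kyH kHE /w /yH heavisideE//.
by field; rewrite gt_eqF.
Qed.

End representation.

(** * Energy estimates and delay equations *)

Definition energy {R : realType} (T : R) (z : R -> R) : R :=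
  \int[lebesgue_measure]_t (z t ^+ 2 * heaviside (T - t)).

Section energies.
Context {R : realType}.
Local Notation mu := (@lebesgue_measure R).
Local Notation H := (@heaviside R).
Implicit Types (k z w g : R -> R) (s t T : R).

Lemma loc_bounded_L1_heaviside z T : loc_bounded z -> L1 (fun t => z t * H (T - t)).
Proof.
move=> zb; have [mz z0 _] := zb; apply: L1_le (L1_norm (loc_bounded_L1 T zb)).
  by apply: measurable_funM => //; exact: measurable_reflect measurable_heaviside.
move=> t; rewrite !normrM indicE mem_setE in_itv/= /heaviside subr_gt0.
have [t0|t0] := ltP t 0; first by rewrite z0// normr0 !mul0r.
by rewrite ler_wpM2l//=; case: ltgtP => //; rewrite ?normr0 ?normr1.
Qed.

Lemma loc_bounded_sqr z : loc_bounded z -> loc_bounded (fun t => z t ^+ 2).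
Proof.
move=> [mz z0 zM]; split; first exact: measurable_funX.
  by move=> t t0; rewrite z0// expr0n.
move=> T; have [M zMT] := zM T; exists (M ^+ 2) => t tT.
by rewrite normrX lerXn2r ?nnegrE ?zMT// (le_trans _ (zMT t tT)).
Qed.

Lemma L1_energy z T : loc_bounded z -> L1 (fun t => z t ^+ 2 * H (T - t)).
Proof. by move=> zb; exact: loc_bounded_L1_heaviside (loc_bounded_sqr zb). Qed.

Lemma energy_ge0 z T : 0 <= energy T z.
Proof. by apply: Rintegral_ge0 => t _; rewrite mulr_ge0 ?sqr_ge0 ?heaviside_ge0. Qed.

Lemma eq_energy z w T : (forall t, t < T -> z t = w t) -> energy T z = energy T w.
Proof.
move=> zw; apply: eq_Rintegral => t _; have [tT|tT] := ltP t T; first by rewrite zw.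
by rewrite heaviside_le0 ?subr_le0// !mulr0.
Qed.

Lemma energyB_le z w T : loc_bounded z -> loc_bounded w ->
  energy T (fun t => z t - w t) <= 2 * energy T z + 2 * energy T w.
Proof.
move=> zb wb; have z1 := L1_energy T zb; have w1 := L1_energy T wb.
rewrite /energy -!intZ// -intD; [|exact: L1Z|exact: L1Z].
apply: int_le; [exact: L1_energy (loc_boundedB zb wb)|by apply: L1D; exact: L1Z|].
move=> t; rewrite !mulrA -mulrDl ler_wpM2r ?heaviside_ge0//.
by rewrite -subr_ge0 (_ : _ - _ = (z t + w t) ^+ 2) ?sqr_ge0//; ring.
Qed.

Lemma energyZ c z T : loc_bounded z -> energy T (fun t => c * z t) = c ^+ 2 * energy T z.
Proof.
move=> zb; rewrite /energy -intZ; last exact: L1_energy.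
by apply: eq_Rintegral => t _; rewrite exprMn mulrA.
Qed.

Lemma energy_delay tau z T : 0 <= tau -> loc_bounded z ->
  energy T (delay tau z) <= energy T z.
Proof.
move=> tau0 zb; rewrite /energy -(int_shift tau (L1_energy T zb)).
apply: int_le.
- exact: L1_energy (loc_bounded_delay tau0 zb).
- exact: (L1_shift tau (L1_energy T zb)).
move=> t; rewrite /delay ler_wpM2l ?sqr_ge0// /heaviside ler_nat !subr_gt0.
by case: (ltP t T) => // tT; have -> : (t - tau < T)%R by lra.
Qed.

Section positive_kernel.
Variable k : R -> R.
Hypotheses (k0 : causal k) (k_ge0 : forall t, 0 <= k t) (k1 : L1 k).

Let kl : loc_L1 k. Proof. exact: loc_L1_intro. Qed.

(* Young's inequality, from [(k * z)^2 <= |k|_1 (k * z^2)]. *)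
Lemma energy_convol z T : loc_bounded z ->
  energy T (convol k z) <= (\int[mu]_t k t) ^+ 2 * energy T z.
Proof.
move=> zb; have [mz z0 zM] := zb; set K := \int[mu]_t k t.
have K0 : 0 <= K by apply: Rintegral_ge0.
have zb2 := loc_bounded_sqr zb; have [mz2 z20 z2M] := zb2.
have kz t : L1 (fun s => k (t - s) * z s).
  by have [M zMt] := zM t; apply: (@L1_convol _ k z t M kl mz z0 _).1 => s /ltW; exact: zMt.
have kz2 t : L1 (fun s => k (t - s) * z s ^+ 2).
  have [M zMt] := z2M t.
  by apply: (@L1_convol _ k (fun s => z s ^+ 2) t M kl mz2 z20 _).1 => s /ltW; exact: zMt.
have kr t := L1_reflect t k1.
have jensen t : convol k z t ^+ 2 <= K * convol k (fun s => z s ^+ 2) t.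
  have [K0'|K0'] := eqVneq K 0; last first.
    have Kp : 0 < K by rewrite lt_neqAle eq_sym K0' K0.
    pose c := convol k z t / K.
    have : 0 <= \int[mu]_s (k (t - s) * z s ^+ 2 + (- (2 * c) * (k (t - s) * z s) + c ^+ 2 * k (t - s))).
      apply: Rintegral_ge0 => s _.
      rewrite (_ : _ + _ = k (t - s) * (z s - c) ^+ 2); last by ring.
      by rewrite mulr_ge0 ?sqr_ge0.
    rewrite intD//; last by apply: L1D; exact: L1Z.
    rewrite intD//; [|exact: L1Z|exact: L1Z].
    rewrite !intZ// (int_reflect t k1) -/(convol k z t) -/(convol k _ t) -/K => h.
    have {}h : 0 <= K * convol k (fun s => z s ^+ 2) t - convol k z t ^+ 2.
      have := mulr_ge0 K0 h; congr (0 <= _); rewrite /c; field.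
      by rewrite gt_eqF.
    by rewrite -subr_ge0.
  have [M zMt] := zM t.
  have : `|convol k z t| <= M * K.
    rewrite /K -(int_reflect t k1) -intZ//.
    apply: int_norm_le; [exact: L1_measurable (kz t)|exact: L1Z|].
    move=> s; rewrite normrM ger0_norm// mulrC.
    have [st|ts] := leP s t; first by rewrite ler_wpM2r// zMt.
    by rewrite k0 ?mulr0// subr_le0 ltW.
  by rewrite K0' mulr0 normr_le0 => /eqP ->; rewrite expr0n mul0r.
pose zT t := z t ^+ 2 * H (T - t).
have zT1 : L1 zT by exact: L1_energy.
have kzb := loc_bounded_convol kl zb.
rewrite /energy expr2 -mulrA -(int_conv k1 zT1) -intZ; last exact: L1_conv.
apply: int_le; [exact: L1_energy|by apply: L1Z; exact: L1_conv|] => t.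
have conv_ge0 : 0 <= convol k zT t.
  by apply: Rintegral_ge0 => s _; rewrite mulr_ge0// /zT mulr_ge0 ?sqr_ge0 ?heaviside_ge0.
have [tT|tT] := ltP t T; last first.
  by rewrite heaviside_le0 ?subr_le0// mulr0 mulr_ge0.
rewrite heavisideE ?subr_gt0// mulr1; apply: le_trans (jensen t) _.
rewrite ler_wpM2l// le_eqVlt; apply/orP; left; apply/eqP.
apply: eq_Rintegral => s _; rewrite /zT.
have [st|ts] := ltP s t; last by rewrite k0 ?mul0r// subr_le0.
by rewrite heavisideE ?mulr1// subr_gt0; exact: lt_trans tT.
Qed.

Hypothesis k_bound : forall d, 0 < d -> exists M, forall t, d <= t -> k t <= M.

(** Near 0 the kernel may be unbounded but has mass at most [eta], to be paired with the supremum of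
    [z]. Beyond [d] it is bounded by [M], hence [k^2 <= M k], and [k |z|] is at most
    [lam k^2 + z^2 / lam]. The constant [C] depends on neither [z] nor [t]. *)
Lemma convol_split eta : 0 < eta -> exists2 C, 0 <= C & forall z t Z lam,
  loc_bounded z -> (forall s, s < t -> `|z s| <= Z) -> 0 < lam ->
  `|convol k z t| <= eta * Z + (lam * C + lam^-1 * energy t z).
Proof.
move=> eta0.
have [d d0 kd] : exists2 d, 0 < d & \int[mu]_u (k u * H (d - u)) <= eta.
  have mf n : measurable_fun [set: R] (fun u => k u * H (n.+1%:R^-1 - u)).
    apply: measurable_funM; first exact: L1_measurable k1.
    exact: measurable_reflect measurable_heaviside.
  have f_cvg u : k u * H (n.+1%:R^-1 - u) @[n --> \oo] --> (fun=> 0 : R) u.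
    have [u0|u0] := ltP 0 u; last by rewrite k0//; under eq_fun do rewrite mul0r; exact: cvg_cst.
    apply: cvg_near_cst; near=> n; rewrite heaviside_le0 ?mulr0// subr_le0.
    rewrite -[u]invrK lef_pV2 ?posrE ?invr_gt0// -natr1.
    rewrite (@le_trans _ _ n%:R)// ?lerDl//; near: n; exact: nbhs_infty_ger.
  have f_dom n u : `|k u * H (n.+1%:R^-1 - u)| <= k u.
    by rewrite ger0_norm ?mulr_ge0 ?heaviside_ge0// ler_piMr// heaviside_le1.
  have [_] := int_dominated_cvg mf f_cvg k1 f_dom.
  rewrite /Rintegral integral0/= -/(Rintegral _ _ _) => /cvgrPdist_le/(_ _ eta0)[n _ /(_ n (leqnn n))].
  rewrite sub0r normrN => h; exists n.+1%:R^-1; first by rewrite invr_gt0.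
  exact: le_trans (ler_norm _) h.
have [M kM] := k_bound d0.
have M0 : 0 <= M by apply: le_trans (kM d (lexx d)).
exists (M * \int[mu]_u k u); first by rewrite mulr_ge0//; exact: Rintegral_ge0.
move=> z t Z lam zb zZ lam0; have [mz z0 _] := zb.
have kH1 : L1 (fun u => k u * H (d - u)).
  apply: L1_le k1; last first.
    by move=> u; rewrite ger0_norm ?mulr_ge0 ?heaviside_ge0// ler_piMr// heaviside_le1.
  by apply: measurable_funM; [exact: L1_measurable k1|exact: measurable_reflect measurable_heaviside].
have Z0 : 0 <= Z by apply: le_trans (zZ (t - 1) _) => //; lra.
have r1 := L1_reflect t kH1; have r2 := L1_reflect t k1; have e1 := L1_energy t zb.
have mkz : measurable_fun [set: R] (fun s => k (t - s) * z s).
  by apply: measurable_funM => //; exact: measurable_reflect (L1_measurable k1).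
apply: (@le_trans _ _ (\int[mu]_s (Z * (k (t - s) * H (d - (t - s))) +
    (lam * M * k (t - s) + lam^-1 * (z s ^+ 2 * H (t - s)))))).
  apply: int_norm_le => //; first by apply: L1D; [|apply: L1D]; exact: L1Z.
  move=> s; have [ts|st] := leP t s.
    rewrite k0 ?subr_le0// !mul0r mulr0 normr0 add0r mulr0 add0r.
    by rewrite mulr_ge0 ?invr_ge0 ?(ltW lam0)// mulr_ge0 ?sqr_ge0 ?heaviside_ge0.
  rewrite (heavisideE (x := t - s)) ?subr_gt0// mulr1 normrM (ger0_norm (k_ge0 _)).
  have kz0 := mulr_ge0 (k_ge0 (t - s)) (normr_ge0 (z s)).
  have ez0 : 0 <= lam^-1 * z s ^+ 2 by rewrite mulr_ge0 ?sqr_ge0 ?invr_ge0 ?ltW.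
  have mk0 : 0 <= lam * M * k (t - s) by apply: mulr_ge0 => //; apply: mulr_ge0 => //; exact: ltW.
  have [tsd|dts] := ltP (t - s) d.
    rewrite heavisideE ?subr_gt0// mulr1 -[leLHS]addr0 lerD ?addr_ge0//.
    by rewrite mulrC ler_wpM2r// zZ.
  rewrite heaviside_le0 ?subr_le0// !mulr0 add0r.
  have k2 : k (t - s) ^+ 2 <= M * k (t - s) by rewrite expr2 ler_wpM2r// kM.
  apply: (@le_trans _ _ (lam * k (t - s) ^+ 2 + lam^-1 * z s ^+ 2)); last first.
    by rewrite lerD2r -mulrA ler_wpM2l// ltW.
  rewrite -(real_normK (num_real (z s))) -subr_ge0.
  rewrite (_ : _ - _ = lam^-1 * ((lam * k (t - s) - `|z s| / 2) ^+ 2 + 3 / 4 * `|z s| ^+ 2)).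
    by rewrite mulr_ge0 ?invr_ge0 ?(ltW lam0)// addr_ge0 ?sqr_ge0// mulr_ge0 ?sqr_ge0//; lra.
  by field; rewrite gt_eqF.
rewrite intD; [|exact: L1Z|by apply: L1D; exact: L1Z].
rewrite intD; [|exact: L1Z|exact: L1Z].
rewrite !intZ// (int_reflect t kH1) (int_reflect t k1) -/(energy t z).
by rewrite mulrC -mulrA lerD2r ler_wpM2r.
Unshelve. all: end_near. Qed.

End positive_kernel.

End energies.

(** * The method of steps *)

Section delay_equations.
Context {R : realType}.
Variables (tau : R) (F : (R -> R) -> R -> R).
Hypothesis tau_gt0 : 0 < tau.
Implicit Types z w : R -> R.
Hypothesis F_bounded : forall z, loc_bounded z -> loc_bounded (F z).
Hypothesis F_causal : forall z w T, loc_bounded z -> loc_bounded w ->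
  (forall t, t < T -> z t = w t) -> forall t, t < T + tau -> F z t = F w t.

Lemma delay_unique z w T : loc_bounded z -> loc_bounded w ->
  (forall t, t < T -> z t = F z t) -> (forall t, t < T -> w t = F w t) ->
  forall t, t < T -> z t = w t.
Proof.
move=> zb wb zF wF t tT.
have key n : forall t, t < Num.min T (n%:R * tau) -> z t = w t.
  elim: n => [|n IH] u; rewrite lt_min => /andP[uT].
    by rewrite mul0r => u0; have [_ -> //] := zb; have [_ -> //] := wb.
  rewrite -natr1 mulrDl mul1r => un; rewrite zF// wF//.
  by apply: (F_causal zb wb IH); rewrite addr_minl lt_min un (lt_trans uT)// ltrDl.
apply: (key (Num.truncn (t / tau)).+1); rewrite lt_min tT/= -ltr_pdivrMr//.
exact: truncnS_gt.
Qed.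

Let it n := iter n F (fun=> 0).

Let it_bounded n : loc_bounded (it n).
Proof.
elim: n => [|n IH]; last exact: F_bounded.
split; [exact: measurable_cst|by []|].
by move=> T; exists 0 => t _; rewrite /it/= normr0.
Qed.

Let it_agree n m t : (n <= m)%N -> t < n%:R * tau -> it n t = it m t.
Proof.
elim: n m t => [|n IH] m t.
  move=> _; rewrite mul0r => t0.
  by have [_ -> //] := it_bounded 0; have [_ -> //] := it_bounded m.
case: m => // m nm; rewrite -natr1 mulrDl mul1r => tn /=.
by apply: (F_causal (it_bounded n) (it_bounded m)) tn => u; exact: IH.
Qed.

(** Each application of [F] extends agreement by one delay, so the iterates from 0 are stationary on
    [t < n tau] from the [n]-th on. *)
Lemma delay_fixpoint : exists2 z, loc_bounded z & forall t, z t = F z t.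
Proof.
pose N t := (Num.truncn (t / tau)).+1.
have tN t : t < (N t)%:R * tau by rewrite -ltr_pdivrMr//; exact: truncnS_gt.
pose z t := it (N t) t.
have zit n t : t < n%:R * tau -> z t = it n t.
  move=> tn; have [nN|Nn] := leqP n (N t); first by rewrite /z (it_agree nN).
  by rewrite /z (it_agree (ltnW Nn)).
have zb : loc_bounded z.
  split.
  - apply: (@measurable_fun_cvg _ _ _ _ it) => [n|t _]; first by have [] := it_bounded n.
    apply: cvg_near_cst; exists (N t) => // n /= Nn.
    by rewrite /z (it_agree Nn).
  - by move=> t t0; have [_ + _] := it_bounded (N t); exact.
  move=> T; have [_ _ /(_ T)[M itM]] := it_bounded (N T); exists M => t tT.
  by rewrite (zit (N T)) ?itM// (le_lt_trans tT).
exists z => // t; rewrite (zit (N t).+1); last first.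
  by apply: lt_trans (tN t) _; rewrite ltr_pM2r// ltr_nat.
symmetry; apply: (@F_causal z (it (N t)) ((N t)%:R * tau) zb (it_bounded _)) => [u|].
  exact: zit.
by apply: lt_trans (tN t) _; rewrite ltrDl.
Qed.

End delay_equations.

(* With [z = e + i w], lower bound of [|z^alpha + p + s B e^(-z tau)|^2]
   relatively to [|z^alpha + p|^2]. *)
Definition char_bound {R : realType} (alpha p B tau m s e : R) : Prop :=
  forall w,
  m * ((zpow_re alpha e w + p) ^+ 2 + zpow_im alpha e w ^+ 2) <=
  (zpow_re alpha e w + p + s * B * expR (- (e * tau)) * cos (w * tau)) ^+ 2 +
  (zpow_im alpha e w - s * B * expR (- (e * tau)) * sin (w * tau)) ^+ 2.

(** * The energy estimate for the linear delay equation *)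

Section characteristic.
Context {R : realType}.
Local Notation mu := (@lebesgue_measure R).
Local Notation H := (@heaviside R).
Variables (alpha p B tau : R) (k : R -> R).
Hypotheses (alpha_gt0 : 0 < alpha) (alpha_le1 : alpha <= 1) (p_gt0 : 0 < p)
  (B_ge0 : 0 <= B) (tau_gt0 : 0 < tau).
Hypothesis rk : resolvent alpha p k.
Implicit Types (s e w t T m : R) (u z g y : R -> R).

(** Its symbol at the complex frequency [zeta] is [1 + s B exp(- zeta tau) / (zeta^alpha + p)]. The
    value [s = 1] is the linearized equation and [s = 0] the identity. *)
Definition char_op s z t : R := z t + s * B * convol k (delay tau z) t.

Let kl := resolvent_loc_L1 rk.
Let k1 := resolvent_L1 rk.
Let k_ge0 := resolvent_ge0 rk.

Let kd_bounded z : loc_bounded z -> loc_bounded (convol k (delay tau z)).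
Proof. by move=> zb; apply: loc_bounded_convol => //; apply: loc_bounded_delay => //; exact: ltW. Qed.

Lemma char_op_bounded s z : loc_bounded z -> loc_bounded (char_op s z).
Proof.
by move=> zb; apply: loc_boundedD => //; apply: loc_boundedZ; exact: kd_bounded.
Qed.

Lemma cosT_shift u w : L1 u -> cosT (fun t => u (t - tau)) w =
  cos (w * tau) * cosT u w - sin (w * tau) * sinT u w.
Proof.
move=> u1; rewrite /cosT /sinT -!intZ; [|exact: L1_sin|exact: L1_cos].
rewrite -intB; [|by apply: L1Z; exact: L1_cos|by apply: L1Z; exact: L1_sin].
have l1 : L1 (fun t => cos (w * tau) * (u t * cos (w * t)) - sin (w * tau) * (u t * sin (w * t))).
  by apply: L1B; apply: L1Z; [exact: L1_cos|exact: L1_sin].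
rewrite -(int_shift tau l1); apply: eq_Rintegral => t _.
by rewrite [in LHS](_ : w * t = w * tau + w * (t - tau)) ?cosD; ring.
Qed.

Lemma sinT_shift u w : L1 u -> sinT (fun t => u (t - tau)) w =
  sin (w * tau) * cosT u w + cos (w * tau) * sinT u w.
Proof.
move=> u1; rewrite /cosT /sinT -!intZ; [|exact: L1_sin|exact: L1_cos].
rewrite -intD; [|by apply: L1Z; exact: L1_cos|by apply: L1Z; exact: L1_sin].
have l1 : L1 (fun t => sin (w * tau) * (u t * cos (w * t)) + cos (w * tau) * (u t * sin (w * t))).
  by apply: L1D; apply: L1Z; [exact: L1_cos|exact: L1_sin].
rewrite -(int_shift tau l1); apply: eq_Rintegral => t _.
by rewrite [in LHS](_ : w * t = w * tau + w * (t - tau)) ?sinD; ring.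
Qed.

Lemma damp_op s e z t : loc_bounded z ->
  damp e (char_op s z) t = damp e z t +
    s * B * expR (- (e * tau)) * convol (damp e k) (fun t => damp e z (t - tau)) t.
Proof.
move=> zb; have [mz _ _] := zb.
have -> : convol (damp e k) (fun t => damp e z (t - tau)) t =
    expR (e * tau) * damp e (convol k (delay tau z)) t.
  rewrite -convol_damp; [|exact: L1_measurable k1|exact: measurable_shift].
  rewrite -convolZr; last first.
  - by apply: measurable_damp; exact: measurable_shift.
  - by apply: measurable_damp; exact: L1_measurable k1.
  congr (convol _ _ t); apply/funext => x; rewrite /damp /delay mulrA -expRD.
  by congr (expR _ * _); ring.
rewrite mulrA (_ : s * B * expR (- (e * tau)) * expR (e * tau) = s * B); last first.
  by rewrite -mulrA -expRD addNr expR0 mulr1.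
by rewrite /damp /char_op; ring.
Qed.

(** After division by [|z^alpha + p|^2], [char_bound] bounds below by [m] the squared modulus of the
    symbol of [char_op s] on the line [Re z = e]: this is the frequency hypothesis of
    [plancherel_le]. Integrability of the damped signal has to be known beforehand. *)
Lemma transform_energy s e m z M : 0 < e -> loc_bounded z -> L1 (damp e z) ->
  (forall t, `|damp e z t| <= M) -> char_bound alpha p B tau m s e ->
  [/\ L1 (damp e (char_op s z)),
    (exists M', forall t, `|damp e (char_op s z) t| <= M') &
    m * \int[mu]_t damp e z t ^+ 2 <= \int[mu]_t damp e (char_op s z) t ^+ 2].
Proof.
move=> e0 zb z1 zM cb.
have dk1 := L1_damp (ltW e0) (resolvent_causal rk) k1.
have zs1 := L1_shift tau z1.
have conv1 := L1_conv dk1 zs1.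
have opE : damp e (char_op s z) = fun t => damp e z t +
    s * B * expR (- (e * tau)) * convol (damp e k) (fun t => damp e z (t - tau)) t.
  by apply/funext => t; exact: damp_op.
have v1 : L1 (damp e (char_op s z)) by rewrite opE; apply: L1D => //; exact: L1Z.
have convM t : `|convol (damp e k) (fun t => damp e z (t - tau)) t| <= M * \int[mu]_t k t.
  rewrite -(int_reflect t k1) -intZ; last exact: L1_reflect.
  apply: int_norm_le.
  - apply: measurable_funM; last exact: L1_measurable zs1.
    exact: measurable_reflect (L1_measurable dk1).
  - by apply: L1Z; exact: L1_reflect.
  move=> x; rewrite normrM mulrC ler_pM//.
  rewrite /damp normrM (ger0_norm (expR_ge0 _)) (ger0_norm (k_ge0 _)).
  have [tx|tx] := ltP 0 (t - x); last by rewrite (resolvent_causal rk) ?mulr0.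
  by rewrite ler_piMl// -expR0 ler_expR oppr_le0 mulr_ge0 ?ltW.
have vM : exists M', forall t, `|damp e (char_op s z) t| <= M'.
  exists (M + `|s * B * expR (- (e * tau))| * (M * \int[mu]_t k t)) => t.
  rewrite opE; apply: le_trans (ler_normD _ _) _; rewrite lerD//.
  by rewrite normrM ler_wpM2l.
split=> //; have [M' vM'] := vM.
apply: (plancherel_le z1 v1 zM vM') => w; rewrite opE.
rewrite cosTD//; last exact: L1Z.
rewrite sinTD//; last exact: L1Z.
rewrite cosTZ// sinTZ// cosT_conv// sinT_conv// cosT_shift// sinT_shift//.
have [h1 h2] := transform_resolvent w alpha_gt0 alpha_le1 p_gt0 rk e0.
have := cb w; set a := zpow_re _ _ _ + p in h1 h2 *; set b := zpow_im _ _ _ in h1 h2 *.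
set Kc := cosT (damp e k) w in h1 h2 *; set Ks := sinT (damp e k) w in h1 h2 *.
set C := cosT (damp e z) w; set S := sinT (damp e z) w.
set cw := cos (w * tau); set sw := sin (w * tau); set q := s * B * expR _ => ab.
have D0 : 0 < a ^+ 2 + b ^+ 2.
  rewrite lt_neqAle addr_ge0 ?sqr_ge0// andbT eq_sym; apply/eqP => ab0.
  have a0 : a = 0 by apply/eqP; rewrite -sqrf_eq0; apply/eqP; have := sqr_ge0 a; have := sqr_ge0 b; lra.
  have b0 : b = 0 by apply/eqP; rewrite -sqrf_eq0; apply/eqP; have := sqr_ge0 a; have := sqr_ge0 b; lra.
  by move: h1; rewrite a0 b0 !mul0r addr0 => /eqP; rewrite eq_sym oner_eq0.
have KcE : Kc = a / (a ^+ 2 + b ^+ 2).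
  apply: (@mulIf _ (a ^+ 2 + b ^+ 2)); rewrite ?gt_eqF// divfK ?gt_eqF//.
  have := congr1 (fun x => a * x) h1; have := congr1 (fun x => b * x) h2.
  by move=> {h1 h2}; lra.
have KsE : Ks = b / (a ^+ 2 + b ^+ 2).
  apply: (@mulIf _ (a ^+ 2 + b ^+ 2)); rewrite ?gt_eqF// divfK ?gt_eqF//.
  have := congr1 (fun x => b * x) h1; have := congr1 (fun x => a * x) h2.
  by move=> {h1 h2 KcE}; lra.
have cs : cw ^+ 2 + sw ^+ 2 = 1 by exact: cos2Dsin2.
have -> : (C + q * (Kc * (cw * C - sw * S) - Ks * (sw * C + cw * S))) ^+ 2 +
    (S + q * (Ks * (cw * C - sw * S) + Kc * (sw * C + cw * S))) ^+ 2 =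
    (C ^+ 2 + S ^+ 2) * (((a + q * cw) ^+ 2 + (b - q * sw) ^+ 2) / (a ^+ 2 + b ^+ 2)).
  rewrite KcE KsE.
  rewrite (_ : (a + q * cw) ^+ 2 + (b - q * sw) ^+ 2 =
    a ^+ 2 + b ^+ 2 + 2 * q * (a * cw - b * sw) + q ^+ 2 * (cw ^+ 2 + sw ^+ 2)); last by ring.
  rewrite cs; have -> : q ^+ 2 * 1 = q ^+ 2 * (cw ^+ 2 + sw ^+ 2) by rewrite cs.
  by field; rewrite gt_eqF.
by rewrite mulrC ler_wpM2l ?addr_ge0 ?sqr_ge0// ler_pdivlMr.
Qed.

Lemma char_op_causal z g T : (forall t, t < T -> z t = g t) ->
  forall t, t < T + tau -> convol k (delay tau z) t = convol k (delay tau g) t.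
Proof.
move=> zg t tT; apply: eq_Rintegral => x _; rewrite /delay.
have [tx|tx] := ltP 0 (t - x); last by rewrite (resolvent_causal rk)// !mul0r.
by rewrite zg//; lra.
Qed.

Lemma char_op_solve s g : loc_bounded g ->
  exists2 z, loc_bounded z & forall t, char_op s z t = g t.
Proof.
move=> gb.
have [z zb zE] : exists2 z, loc_bounded z & forall t, z t = g t - s * B * convol k (delay tau z) t.
  apply: (delay_fixpoint (F := fun z t => g t - s * B * convol k (delay tau z) t) tau_gt0).
    by move=> z zb; apply: loc_boundedB => //; apply: loc_boundedZ; exact: kd_bounded.
  by move=> f f' T _ _ ff' t tT; rewrite (char_op_causal ff').
by exists z => // t; rewrite /char_op {1}zE subrK.
Qed.

Lemma char_op_inj s z y T : loc_bounded z -> loc_bounded y ->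
  (forall t, t < T -> char_op s z t = char_op s y t) -> forall t, t < T -> z t = y t.
Proof.
move=> zb yb zy.
pose g := char_op s y; have gb : loc_bounded g by exact: char_op_bounded.
apply: (@delay_unique _ tau (fun z t => g t - s * B * convol k (delay tau z) t)) => //.
- by move=> f f' T' _ _ ff' t tT; rewrite (char_op_causal ff').
- by move=> t tT; rewrite /g -zy// /char_op addrK.
- by move=> t tT; rewrite /g /char_op addrK.
Qed.

Section causal_bound.
Variables (m e0 : R).
Hypotheses (m_gt0 : 0 < m) (m_le1 : m <= 1) (e0_gt0 : 0 < e0).
Hypothesis freq : forall s e, 0 <= s -> s <= 1 -> 0 < e -> e < e0 ->
  char_bound alpha p B tau m s e.

Let L1_damp_bounded e z Z : 0 < e -> loc_bounded z -> (forall t, `|z t| <= Z) ->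
  L1 (damp e z) /\ forall t, `|damp e z t| <= Z.
Proof.
move=> e_gt0 [mz z0 _] zZ; have Z0 : 0 <= Z by exact: le_trans (zZ 0).
have dE t : `|damp e z t| = expR (- (e * t)) * `|z t|.
  by rewrite /damp normrM ger0_norm ?expR_ge0.
split; last first.
  move=> t; rewrite dE; have [t0|t0] := ltP t 0; first by rewrite z0// normr0 mulr0.
  rewrite -[leRHS]mul1r ler_pM ?expR_ge0// -expR0 ler_expR oppr_le0 mulr_ge0//.
  exact: ltW.
apply: (@L1_le _ _ (fun t => Z * exp_step e t + Z * \1_`[0, 0] t)).
- exact: measurable_damp.
- move=> t; rewrite dE; have [t0|t0|t0] := ltgtP t 0.
  + rewrite z0// normr0 mulr0 addr_ge0// mulr_ge0//.
    by rewrite mulr_ge0 ?expR_ge0 ?heaviside_ge0.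
  + rewrite /exp_step heavisideE// mulr1 mulrC -[leLHS]addr0 lerD ?mulr_ge0//.
    by rewrite ler_wpM2r ?expR_ge0.
  + rewrite t0 mulr0 oppr0 expR0 mul1r /exp_step heaviside_le0// !mulr0 add0r.
    by rewrite indicE mem_setE in_itv/= lexx mulr1.
by apply: L1D; apply: L1Z; [exact: L1_exp_step|exact: L1_indic_itv].
Qed.

(** The damping is removed by making [e] small. A fixed horizon [T'] allows this, since the squared
    weight is at least [1 - 2 e T'] there. *)
Let energy_line s z T Z T' : 0 <= s -> s <= 1 -> loc_bounded z -> (forall t, `|z t| <= Z) ->
  (forall t, T <= t -> char_op s z t = 0) -> 0 < T' ->
  m * energy T' z <= energy T (char_op s z).
Proof.
move=> s0 s1 zb zZ gT T'0; set g := char_op s z; have gb : loc_bounded g by exact: char_op_bounded.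
have key e : 0 < e -> e < e0 -> m * ((1 - 2 * e * T') * energy T' z) <= energy T g.
  move=> e_gt0 ee0; have [u1 uZ] := L1_damp_bounded e_gt0 zb zZ.
  have [v1 [M' vM] le] := transform_energy e_gt0 zb u1 uZ (freq s0 s1 e_gt0 ee0).
  have sq f N : L1 f -> (forall t, `|f t| <= N) -> L1 (fun t => f t ^+ 2).
    by move=> f1 fN; have := L1_bounded_mul (L1_measurable f1) fN f1.
  apply: le_trans (le_trans _ le) _.
    rewrite ler_pM2l// -intZ; last exact: L1_energy.
    apply: int_le; [by apply: L1Z; exact: L1_energy|exact: (sq _ _ u1 uZ)|] => t.
    have [t0|t0] := ltP t 0; first by have [_ -> // _] := zb; rewrite expr0n mul0r mulr0 sqr_ge0.
    have [tT|tT] := ltP t T'; last by rewrite heaviside_le0 ?subr_le0// !mulr0 sqr_ge0.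
    rewrite heavisideE ?subr_gt0// mulr1 /damp exprMn ler_wpM2r ?sqr_ge0//.
    rewrite expr2 -expRD; apply: le_trans (expR_ge1Dx _).
    have : e * t <= e * T' by rewrite ler_pM2l// ltW.
    lra.
  apply: int_le; [exact: (sq _ _ v1 vM)|exact: L1_energy|] => t.
  have [t0|t0] := ltP t 0.
    by have [_ g0 _] := gb; rewrite /damp -/g g0// mulr0 expr0n mul0r.
  have [tT|tT] := ltP t T; last by rewrite /damp gT// mulr0 expr0n mulr_ge0 ?sqr_ge0 ?heaviside_ge0.
  rewrite heavisideE ?subr_gt0// mulr1 /damp exprMn ler_piMl ?sqr_ge0//.
  have et0 : 0 <= e * t by rewrite mulr_ge0// ltW.
  by rewrite expr2 -expRD -expR0 ler_expR; lra.
rewrite leNgt; apply/negP => lt.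
set X := energy T' z in lt key; set Y := energy T _ in lt key.
have Y0 : 0 <= Y by exact: energy_ge0.
have X0 : 0 < m * X by exact: le_lt_trans lt.
(* Then [2 e T' m X <= (m X - Y) / 2], so the weighted energy would still exceed [Y]. *)
pose e := Num.min (e0 / 2) ((m * X - Y) / (4 * T' * (m * X))).
have D0 : 0 < 4 * T' * (m * X) by apply: mulr_gt0 => //; exact: mulr_gt0.
have e_gt0 : 0 < e by rewrite lt_min divr_gt0//= divr_gt0 ?subr_gt0.
have ee0 : e < e0.
  by apply: (@le_lt_trans _ _ (e0 / 2)); [rewrite ge_min lexx|have := e0_gt0; lra].
have eX : e * (4 * T' * (m * X)) <= m * X - Y.
  by rewrite -ler_pdivlMr// ge_min lexx orbT.
have := key e e_gt0 ee0; lra.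
Qed.

(** The bound at [s] yields one at [s + ds] with the worse constant [m / 4], which serves only to
    show that the solution with truncated forcing is bounded. Then [energy_line] applies to it at
    [s + ds] itself and gives back [m], so nothing is lost from step to step. *)
Let step s ds : 0 <= s -> 0 <= ds -> s + ds <= 1 -> 4 * ds ^+ 2 * (B / p) ^+ 2 <= m ->
  (forall T z, loc_bounded z -> m * energy T z <= energy T (char_op s z)) ->
  forall T z, loc_bounded z -> m * energy T z <= energy T (char_op (s + ds) z).
Proof.
move=> s0 ds0 s1 dsm IH T z zb.
have [T0|T0] := ltP 0 T; last first.
  have e0' f : loc_bounded f -> energy T f = 0.
    move=> [_ f0 _]; rewrite /energy (_ : (fun t => _) = cst 0) ?/Rintegral ?integral0//.
    apply/funext => t /=; have [t0|t0] := ltP t 0; first by rewrite f0// expr0n mul0r.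
    by rewrite heaviside_le0 ?mulr0// subr_le0 (le_trans T0).
  by rewrite !e0' ?mulr0//; exact: char_op_bounded.
(* By causality, cutting the image at [T] leaves the solution unchanged before [T], and it produces
   a forcing of bounded support and finite total energy. *)
pose h t := char_op (s + ds) z t * H (T - t).
have opb := char_op_bounded (s + ds) zb.
have hb : loc_bounded h.
  have [mo o0 oM] := opb; split.
  - by apply: measurable_funM => //; exact: measurable_reflect measurable_heaviside.
  - by move=> t t0; rewrite /h o0// mul0r.
  move=> T1; have [M oM1] := oM T1; exists M => t tT; apply: le_trans (oM1 t tT).
  by rewrite normrM ler_piMr// ger0_norm ?heaviside_le1 ?heaviside_ge0.
have [zh zhb zhE] := char_op_solve (s + ds) hb.
have zzh t : t < T -> z t = zh t.
  apply: (char_op_inj (s := s + ds) zb zhb) => u uT; rewrite zhE /h heavisideE ?mulr1// subr_gt0//.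
have hT t : T <= t -> h t = 0 by move=> tT; rewrite /h heaviside_le0 ?mulr0// subr_le0.
have Eh T' : energy T' h <= energy T h.
  apply: int_le; [exact: L1_energy|exact: L1_energy|] => t.
  have [tT|tT] := ltP t T; last by rewrite hT// expr0n !mul0r.
  by rewrite (heavisideE (x := T - t)) ?subr_gt0// mulr1 ler_piMr ?sqr_ge0 ?heaviside_le1.
have kzb := kd_bounded zhb.
have Ek T' : energy T' (convol k (delay tau zh)) <= p^-1 ^+ 2 * energy T' zh.
  rewrite -(resolvent_int rk); apply: le_trans (energy_convol _ k_ge0 k1 T' _) _.
  - exact: resolvent_causal rk.
  - by apply: loc_bounded_delay => //; exact: ltW.
  rewrite ler_wpM2l ?sqr_ge0//; apply: energy_delay => //; exact: ltW.
(* This comes from [m X <= 2 energy(h) + (m / 2) X], where the second term is the perturbation by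
   [ds]. *)
pose N := 4 / m * energy T h.
have N0 : 0 <= N by rewrite mulr_ge0 ?energy_ge0// divr_ge0// ltW.
have EN T' : energy T' zh <= N.
  have dE t : char_op s zh t = h t - ds * B * convol k (delay tau zh) t.
    by rewrite -zhE /char_op; ring.
  have dkb : loc_bounded (fun t => ds * B * convol k (delay tau zh) t) by exact: loc_boundedZ.
  have := IH T' zh zhb; rewrite (funext dE : char_op s zh = _) => le1.
  have le2 := energyB_le T' hb dkb; rewrite (energyZ (ds * B) T' kzb) in le2.
  have le3 : (ds * B) ^+ 2 * energy T' (convol k (delay tau zh)) <= m / 4 * energy T' zh.
    apply: (@le_trans _ _ ((ds * B) ^+ 2 * (p^-1 ^+ 2 * energy T' zh))).
      by rewrite ler_wpM2l ?sqr_ge0.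
    rewrite mulrA ler_wpM2r ?energy_ge0// ler_pdivlMr//.
    by apply: le_trans dsm; rewrite le_eqVlt; apply/orP; left; apply/eqP; ring.
  have := Eh T'; rewrite /N mulrAC ler_pdivlMr//.
  set X := energy T' zh in le1 le2 le3 *; lra.
have [Z zhZ] : exists Z, forall t, `|zh t| <= Z.
  have [G hG] : exists G, forall t, `|h t| <= G.
    have [_ _ /(_ T)[G hG]] := hb; exists G => t; have [tT|Tt] := leP t T; first exact: hG.
    by rewrite hT; [rewrite normr0; exact: le_trans (normr_ge0 _) (hG T (lexx T))|exact: ltW].
  have G0 : 0 <= G by exact: le_trans (hG 0).
  (* Makes the part of the feedback due to the kernel near 0 at most [Z / 2], which closes the
     induction over delay intervals. *)
  have eta0 : 0 < (2 * (B + 1))^-1 by rewrite invr_gt0 mulr_gt0// ltr_wpDl.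
  have [C C0 split] := convol_split (resolvent_causal rk) k_ge0 k1 (resolvent_bound rk) eta0.
  pose Z := 2 * (G + B * (C + N)); exists Z => t.
  have Z0 : 0 <= Z.
    by apply: mulr_ge0 => //; apply: addr_ge0 => //; apply: mulr_ge0 => //; exact: addr_ge0.
  suff key n : forall t, t < n%:R * tau -> `|zh t| <= Z.
    by apply: (key (Num.truncn (t / tau)).+1); rewrite -ltr_pdivrMr//; exact: truncnS_gt.
  elim: n => [|n IHn] u.
    by rewrite mul0r => u0; have [_ -> // _] := zhb; rewrite normr0.
  rewrite -natr1 mulrDl mul1r => un.
  have -> : zh u = h u - (s + ds) * B * convol k (delay tau zh) u.
    by rewrite -zhE /char_op addrK.
  apply: le_trans (ler_normB _ _) _.
  have dzb : loc_bounded (delay tau zh) by apply: loc_bounded_delay => //; exact: ltW.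
  have xb x : x < u -> `|delay tau zh x| <= Z by move=> xu; apply: IHn; lra.
  have := split _ u Z 1 dzb xb ltr01; rewrite invr1 !mul1r => le.
  have eN : energy u (delay tau zh) <= N.
    by apply: le_trans (EN u); apply: energy_delay => //; exact: ltW.
  have le2 : `|(s + ds) * B * convol k (delay tau zh) u| <=
      B * ((2 * (B + 1))^-1 * Z + (C + N)).
    rewrite normrM normrM (ger0_norm B_ge0) (ger0_norm (addr_ge0 s0 ds0)).
    rewrite -mulrA; apply: (@le_trans _ _ (B * `|convol k (delay tau zh) u|)).
      by rewrite ler_piMl// mulr_ge0.
    by rewrite ler_wpM2l//; apply: le_trans le _; rewrite lerD2l lerD2l.
  have le3 : B * ((2 * (B + 1))^-1 * Z) <= Z / 2.
    rewrite mulrA mulrC ler_wpM2l// ler_pdivrMr ?mulr_gt0 ?ltr_wpDl//; lra.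
  have := hG u; move: le2; rewrite mulrDr.
  have ZE : Z = 2 * (G + B * (C + N)) by [].
  lra.
have s1' : 0 <= s + ds by exact: addr_ge0.
have lineT : forall t, T <= t -> char_op (s + ds) zh t = 0 by move=> t tT; rewrite zhE hT.
have := energy_line s1' s1 zhb zhZ lineT T0.
rewrite (eq_energy zzh) => le; apply: le_trans le _.
rewrite le_eqVlt; apply/orP; left; apply/eqP; apply: eq_energy => t tT.
by rewrite zhE /h heavisideE ?mulr1// subr_gt0.
Qed.

Theorem char_energy T z : loc_bounded z -> m * energy T z <= energy T (char_op 1 z).
Proof.
(* From [2 (B / p) / N <= m <= 1] the square is at most [m] as well, which is what [step] asks of
   [ds = 1 / N]. *)
pose N := (Num.truncn (2 * (B / p) / m)).+1.
have N0 : 0 < N%:R :> R by [].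
have Bp : 0 <= B / p by rewrite divr_ge0// ltW.
have dsm : 4 * N%:R^-1 ^+ 2 * (B / p) ^+ 2 <= m.
  have lt : 2 * (B / p) / m < N%:R by exact: truncnS_gt.
  have {}lt : 2 * (B / p) <= m * N%:R by move/ltW: lt; rewrite ler_pdivrMr// (mulrC m).
  have -> : 4 * N%:R^-1 ^+ 2 * (B / p) ^+ 2 = (2 * (B / p) / N%:R) ^+ 2.
    by field; rewrite !gt_eqF.
  have q0 : 0 <= 2 * (B / p) / N%:R by rewrite divr_ge0// mulr_ge0.
  have qm : 2 * (B / p) / N%:R <= m by rewrite ler_pdivrMr.
  rewrite -[m]mulr1 expr2; apply: ler_pM => //; exact: le_trans qm m_le1.
suff key n : (n <= N)%N -> forall T z, loc_bounded z ->
    m * energy T z <= energy T (char_op (n%:R / N%:R) z).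
  move=> zb; have := key N (leqnn N) T z zb; rewrite divff// gt_eqF//.
elim: n => [_ T1 z1 zb|n IH nN].
  rewrite (_ : char_op _ z1 = z1); first by rewrite ler_piMl// energy_ge0.
  by apply/funext => t; rewrite /char_op !mul0r addr0.
have E : n.+1%:R / N%:R = n%:R / N%:R + N%:R^-1 :> R by rewrite -natr1 mulrDl mul1r.
rewrite E; apply: step (IH (ltnW nN)) => //.
by rewrite -E ler_pdivrMr// mul1r ler_nat.
Qed.

End causal_bound.

End characteristic.

(** * Crossing of the imaginary axis *)

Section imaginary_axis.
Context {R : realType}.
Local Notation mu := (@lebesgue_measure R).
Local Notation H := (@heaviside R).
Variables (alpha p B : R).
Hypotheses (alpha_gt0 : 0 < alpha) (alpha_le1 : alpha <= 1) (p_gt0 : 0 < p) (pB : p < B).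
Implicit Types (w x s e tau : R).

Lemma continuous_norm_powR : continuous (fun x => `|x| `^ alpha).
Proof.
move=> x; have [->|x0] := eqVneq x 0; last first.
  apply: (@cvg_comp _ _ _ (fun y : R => `|y|) (fun y => y `^ alpha) _ (nbhs `|x|)).
    exact: norm_continuous.
  by apply: continuous_powR; rewrite normr_gt0.
apply/cvgrPdist_lt => e e0; rewrite normr0 powR0 ?gt_eqF//.
have d0 : 0 < e `^ alpha^-1 by exact: powR_gt0.
have := @nbhsx_ballx _ R^o (0 : R) _ d0; apply: filterS => y.
rewrite /ball/= sub0r normrN sub0r normrN => yd.
rewrite ger0_norm ?powR_ge0//.
have -> : e = (e `^ alpha^-1) `^ alpha by rewrite -powRrM mulVf ?gt_eqF// powRr1// ltW.
by apply: gt0_ltr_powR; rewrite ?nnegrE ?powR_ge0.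
Qed.

Let c := cos (alpha * pi / 2).
Let sg := sin (alpha * pi / 2).

Lemma axis_angle : 0 <= c /\ 0 < sg.
Proof.
have pi0 := @pi_gt0 R.
have a1 : alpha * pi / 2 <= pi / 2 by rewrite ler_pM2r ?invr_gt0// ler_piMl// ltW.
have a0 : 0 < alpha * pi / 2 by rewrite divr_gt0// mulr_gt0.
split; first by apply: cos_ge0_pihalf; rewrite a1 andbT; lra.
by apply: sin_gt0_pi; rewrite a0/=; lra.
Qed.

Let cs1 : c ^+ 2 + sg ^+ 2 = 1. Proof. exact: cos2Dsin2. Qed.

(* [crossing] is [w^alpha] for the [w > 0] with [|(i w)^alpha + p| = B]. *)
Definition crossing := - p * c + Num.sqrt (B ^+ 2 - p ^+ 2 * sg ^+ 2).
Local Notation wst := crossing.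

Let p2B2 : p ^+ 2 < B ^+ 2.
Proof. by rewrite ltr_pXn2r// nnegrE ltW// (lt_trans p_gt0). Qed.

Let disc_ge0 : 0 <= B ^+ 2 - p ^+ 2 * sg ^+ 2.
Proof.
have h : p ^+ 2 * sg ^+ 2 <= p ^+ 2.
  by rewrite ler_piMr ?sqr_ge0//; have := sqr_ge0 c; have := cs1; lra.
by have := p2B2; lra.
Qed.

Lemma crossing_gt0 : 0 < wst.
Proof.
have [c0 _] := axis_angle.
rewrite /crossing mulNr addrC subr_gt0 -(ltr_pXn2r (n := 2))// ?nnegrE ?sqrtr_ge0//.
  rewrite sqr_sqrtr// exprMn; have := p2B2.
  have : p ^+ 2 * (c ^+ 2 + sg ^+ 2) = p ^+ 2 by rewrite cs1 mulr1.
  lra.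
by rewrite mulr_ge0// ltW.
Qed.

Lemma crossingE : wst ^+ 2 + 2 * p * c * wst + p ^+ 2 = B ^+ 2.
Proof.
have sq : (wst + p * c) ^+ 2 = B ^+ 2 - p ^+ 2 * sg ^+ 2.
  by rewrite /crossing mulNr addrC addNKr sqr_sqrtr.
have : p ^+ 2 * (c ^+ 2 + sg ^+ 2) = p ^+ 2 by rewrite cs1 mulr1.
lra.
Qed.

(** Argument of [(i w)^alpha + p] at the crossing frequency [w]. The critical delay solves
    [th + w tau = pi]. *)
Definition crossing_angle := acos ((wst * c + p) / B).
Local Notation th := crossing_angle.

Let B_gt0 : 0 < B. Proof. exact: lt_trans pB. Qed.

Lemma crossing_angleE : [/\ cos th = (wst * c + p) / B, sin th = wst * sg / B,
  0 < th & th < pi].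
Proof.
have [c0 s0] := axis_angle; have w0 := crossing_gt0.
have a0 : 0 < wst * c + p by rewrite ltr_wpDl// mulr_ge0// ltW.
have ws0 : 0 < wst * sg by exact: mulr_gt0.
have E : (wst * c + p) ^+ 2 + (wst * sg) ^+ 2 = B ^+ 2.
  have -> : (wst * c + p) ^+ 2 + (wst * sg) ^+ 2 =
    wst ^+ 2 * (c ^+ 2 + sg ^+ 2) + 2 * p * c * wst + p ^+ 2 by ring.
  by rewrite cs1 mulr1 crossingE.
have q0 : 0 < (wst * c + p) / B by rewrite divr_gt0.
have q1 : (wst * c + p) / B < 1.
  rewrite ltr_pdivrMr// mul1r -(ltr_pXn2r (n := 2))// ?nnegrE ?(ltW a0) ?(ltW B_gt0)//.
  by rewrite -E ltrDl exprn_gt0.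
have qI : -1 <= (wst * c + p) / B <= 1 by apply/andP; split; lra.
have cE : cos th = (wst * c + p) / B by apply: acosK; rewrite in_itv.
have sE : sin th = wst * sg / B.
  rewrite sin_acos//.
  have -> : 1 - ((wst * c + p) / B) ^+ 2 = (wst * sg / B) ^+ 2.
    rewrite !expr_div_n; apply/eqP; rewrite subr_eq -mulrDl addrC E divff//.
    by rewrite gt_eqF// exprn_gt0.
  by rewrite sqrtr_sqr gtr0_norm// divr_gt0.
split=> //.
  rewrite lt_neqAle acos_ge0// andbT; apply/eqP => th0.
  by move: cE; rewrite -th0 cos0; lra.
by apply: acos_ltpi; apply/andP; split; lra.
Qed.

(** The definition of [tau_star] divides by [beta = - B], and [acos (- x) = pi - acos x]. *)
Lemma tau_starE : wst `^ alpha^-1 != 0 ->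
  acos ((wst * c + p) / - B) / wst `^ alpha^-1 = (pi - th) / wst `^ alpha^-1.
Proof.
move=> _; have [cE _ _ _] := crossing_angleE; congr (_ / _).
by rewrite invrN mulrN acosN// -cE cos_geN1 cos_le1.
Qed.

(* [sin th] times the left-hand side is
   [w sg sin(th + x) + p sin x sin th (1 - w / wst)]. *)
Lemma axis_im_gt0 w x : 0 < w -> w <= wst -> 0 < x -> x < pi - th ->
  0 < w * sg * cos x + (w * c + p) * sin x.
Proof.
move=> w0 ww x0 xth; have [cE sE th0 thpi] := crossing_angleE.
have [c0 s0] := axis_angle; have wst0 := crossing_gt0.
have sth : 0 < sin th by apply: sin_gt0_pi; rewrite th0.
have sx : 0 < sin x by apply: sin_gt0_pi; rewrite x0/=; lra.
have sthx : 0 < sin (th + x) by apply: sin_gt0_pi; apply/andP; split; lra.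
rewrite -(pmulr_rgt0 _ sth).
have -> : sin th * (w * sg * cos x + (w * c + p) * sin x) =
    w * sg * sin (th + x) + p * sin x * sin th * (1 - w / wst).
  rewrite sinD cE sE; field.
  by rewrite gt_eqF// gt_eqF.
rewrite ltr_pwDl ?mulr_gt0// mulr_ge0//; first by rewrite !mulr_ge0// ltW.
by rewrite subr_ge0 ler_pdivrMr// mul1r.
Qed.

Let are w := `|w| `^ alpha * c + p.
Let aim w := `|w| `^ alpha * sg.

Let are_cont : continuous are.
Proof.
move=> w; apply: cvgD; last exact: cvg_cst.
by apply: cvgM; [exact: continuous_norm_powR|exact: cvg_cst].
Qed.

Let aim_cont : continuous aim.
Proof. by move=> w; apply: cvgM; [exact: continuous_norm_powR|exact: cvg_cst]. Qed.

Let modE w : are w ^+ 2 + aim w ^+ 2 =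
  (`|w| `^ alpha) ^+ 2 + 2 * p * c * `|w| `^ alpha + p ^+ 2.
Proof.
have -> : are w ^+ 2 + aim w ^+ 2 =
  (`|w| `^ alpha) ^+ 2 * (c ^+ 2 + sg ^+ 2) + 2 * p * c * `|w| `^ alpha + p ^+ 2.
  by rewrite /are /aim; ring.
by rewrite cs1 mulr1.
Qed.

Let om := wst `^ alpha^-1.

Lemma crossing_freq : 0 < om /\ om `^ alpha = wst.
Proof.
have w0 := crossing_gt0; split; first exact: powR_gt0.
by rewrite /om -powRrM mulVf ?gt_eqF// powRr1// ltW.
Qed.

(** The rotated symbol [((i w)^alpha + p) exp(i w tau) + s B], with [0 <= s B <= B], can vanish only
    if its first term is a nonpositive real of modulus at most [B]. But that term has positive
    imaginary part for [0 < w <= om], has modulus above [B] beyond [om], and equals [p] at [w = 0];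
    compactness makes this quantitative. *)
Lemma axis_bound tau : 0 < tau -> om * tau < pi - th ->
  exists2 m, 0 < m & forall w s, 0 <= w -> 0 <= s -> s <= 1 ->
    m * (are w ^+ 2 + aim w ^+ 2) <=
    (are w + s * B * cos (w * tau)) ^+ 2 + (aim w - s * B * sin (w * tau)) ^+ 2.
Proof.
move=> tau0 omtau; have [c0 s0] := axis_angle; have wst0 := crossing_gt0.
have [om0 omE] := crossing_freq.
pose vre w := are w * cos (w * tau) - aim w * sin (w * tau).
pose vim w := are w * sin (w * tau) + aim w * cos (w * tau).
have csw w : cos (w * tau) ^+ 2 + sin (w * tau) ^+ 2 = 1 by exact: cos2Dsin2.
have vE w : vre w ^+ 2 + vim w ^+ 2 = are w ^+ 2 + aim w ^+ 2.
  have -> : vre w ^+ 2 + vim w ^+ 2 = (are w ^+ 2 + aim w ^+ 2) *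
      (cos (w * tau) ^+ 2 + sin (w * tau) ^+ 2) by rewrite /vre /vim; ring.
  by rewrite csw mulr1.
have sumE w s : (are w + s * B * cos (w * tau)) ^+ 2 + (aim w - s * B * sin (w * tau)) ^+ 2 =
    (vre w + s * B) ^+ 2 + vim w ^+ 2.
  transitivity (are w ^+ 2 + aim w ^+ 2 + 2 * s * B * vre w +
    (s * B) ^+ 2 * (cos (w * tau) ^+ 2 + sin (w * tau) ^+ 2)).
    by rewrite /vre; ring.
  by rewrite csw -vE; ring.
(* Positivity of this maximum encodes the three cases. Its minimum on [[0, om + 1]], together with
   the growth of the modulus beyond, gives the uniform margin [g0]. *)
pose G w := Num.max (vim w) (Num.max (vre w) (are w ^+ 2 + aim w ^+ 2 - B ^+ 2)).
have lin_cont : continuous (fun w => w * tau) by exact: mulrr_continuous.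
have cos_cont : continuous (fun w => cos (w * tau)).
  by move=> w; apply: (cvg_comp _ _ (lin_cont w)); exact: continuous_cos.
have sin_cont : continuous (fun w => sin (w * tau)).
  by move=> w; apply: (cvg_comp _ _ (lin_cont w)); exact: continuous_sin.
have vre_cont : continuous vre.
  by move=> w; apply: cvgB; apply: cvgM; [exact: are_cont|exact: cos_cont|exact: aim_cont|exact: sin_cont].
have vim_cont : continuous vim.
  by move=> w; apply: cvgD; apply: cvgM; [exact: are_cont|exact: sin_cont|exact: aim_cont|exact: cos_cont].
have mod_cont : continuous (fun w => are w ^+ 2 + aim w ^+ 2 - B ^+ 2).
  move=> w; apply: cvgB; last exact: cvg_cst.
  by apply: cvgD; apply: cvgM; [exact: are_cont|exact: are_cont|exact: aim_cont|exact: aim_cont].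
have G_cont : continuous G.
  move=> w; apply: continuous_max; first exact: vim_cont.
  by apply: continuous_max; [exact: vre_cont|exact: mod_cont].
have G_gt0 w : 0 <= w -> 0 < G w.
  move=> w0; rewrite /G !lt_max; have [->|wn0] := eqVneq w 0.
    by rewrite /vre mul0r cos0 sin0 /are normr0 powR0 ?gt_eqF// mul0r add0r mulr1 mulr0 subr0 p_gt0 orbT.
  have {}w0 : 0 < w by rewrite lt_neqAle eq_sym wn0.
  have wa0 : 0 < w `^ alpha by exact: powR_gt0.
  have [wom|omw] := leP w om.
    have wx : w * tau < pi - th by apply: le_lt_trans omtau; rewrite ler_pM2r.
    have ww : w `^ alpha <= wst.
      by rewrite -omE; apply: ge0_ler_powR; rewrite ?nnegrE//; exact: ltW.
    have := axis_im_gt0 wa0 ww (mulr_gt0 w0 tau0) wx.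
    by rewrite /vim /are /aim gtr0_norm// addrC => ->.
  have ww : wst < w `^ alpha.
    by rewrite -omE; apply: gt0_ltr_powR; rewrite ?nnegrE//; exact: ltW.
  suff -> : 0 < are w ^+ 2 + aim w ^+ 2 - B ^+ 2 by rewrite !orbT.
  rewrite modE gtr0_norm// subr_gt0 -crossingE ltrD2r ltr_leD//.
    by rewrite ltr_pXn2r// nnegrE ltW.
  by rewrite ler_wpM2l ?mulr_ge0// ltW.
pose W := om + 1.
have W0 : 0 <= W by rewrite addr_ge0// ltW.
have [w0 /[!in_itv]/= /andP[w00 _] Gmin] := EVT_min W0 (continuous_subspaceT G_cont).
pose g1 := are W ^+ 2 + aim W ^+ 2 - B ^+ 2.
have g1_gt0 : 0 < g1.
  have := crossingE; rewrite /g1 modE.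
  have ww : wst < `|W| `^ alpha.
    rewrite ger0_norm// -omE; apply: gt0_ltr_powR; rewrite ?nnegrE//; first exact: ltW.
    by rewrite ltrDl.
  have := mulr_ge0 (ltW p_gt0) c0; nra.
pose g0 := Num.min (G w0) g1.
have g0_gt0 : 0 < g0 by rewrite lt_min G_gt0.
have tri w : 0 <= w -> [\/ g0 <= vim w, g0 <= vre w | B ^+ 2 + g0 <= are w ^+ 2 + aim w ^+ 2].
  move=> w_ge0; have [wW|Ww] := leP w W.
    have : g0 <= G w by rewrite ge_min Gmin// in_itv/= w_ge0.
    by rewrite /G !le_max => /or3P[?|?|?]; [constructor 1|constructor 2|constructor 3; rewrite -lerBrDl].
  constructor 3; apply: (@le_trans _ _ (B ^+ 2 + g1)); first by rewrite lerD2l ge_min lexx orbT.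
  rewrite /g1 addrC subrK !modE.
  have ww : `|W| `^ alpha <= `|w| `^ alpha.
    by apply: ge0_ler_powR; rewrite ?nnegrE//; [exact: ltW|rewrite !ger0_norm// ltW].
  rewrite lerD2r lerD//; first by rewrite lerXn2r ?nnegrE ?powR_ge0.
  by rewrite ler_wpM2l// !mulr_ge0// ltW.
(* Threshold for the modulus [r] of the first term: above [B1] one has [r - s B >= (1 - B / B1) r],
   and below it the sum has modulus at least [g0] while [r <= B1]. *)
pose B1 := Num.sqrt (B ^+ 2 + g0).
have B1E : B1 ^+ 2 = B ^+ 2 + g0 by rewrite sqr_sqrtr// addr_ge0 ?sqr_ge0// ltW.
have B1_gt0 : 0 < B1 by rewrite sqrtr_gt0 addr_gt0// exprn_gt0.
have BB1 : B < B1.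
  by rewrite -(ltr_pXn2r (n := 2))// ?nnegrE ?(ltW B_gt0) ?(ltW B1_gt0)// B1E ltrDl.
exists (Num.min (g0 ^+ 2 / B1 ^+ 2) ((1 - B / B1) ^+ 2)).
  rewrite lt_min divr_gt0 ?exprn_gt0//= subr_gt0 ltr_pdivrMr// mul1r//.
move=> w s w_ge0 s_ge0 s_le1; rewrite sumE.
set M2 := are w ^+ 2 + aim w ^+ 2.
have M2_ge0 : 0 <= M2 by rewrite addr_ge0 ?sqr_ge0.
have sB0 : 0 <= s * B by rewrite mulr_ge0// ltW.
have [M2B|BM2] := leP (B ^+ 2 + g0) M2.
  apply: (@le_trans _ _ ((1 - B / B1) ^+ 2 * M2)).
    by rewrite ler_wpM2r// ge_min lexx orbT.
  pose r := Num.sqrt M2; have r0 : 0 <= r by exact: sqrtr_ge0.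
  have rE : r ^+ 2 = M2 by rewrite sqr_sqrtr.
  have B1r : B1 <= r by exact: ler_wsqrtr.
  have vr : - r <= vre w.
    have : `|vre w| <= r.
      rewrite -(ler_pXn2r (n := 2))// ?nnegrE// rE real_normK ?num_real//.
      by rewrite /M2 -vE lerDl sqr_ge0.
    by rewrite ler_norml => /andP[].
  have -> : (vre w + s * B) ^+ 2 + vim w ^+ 2 = M2 + 2 * (s * B) * vre w + (s * B) ^+ 2.
    by rewrite /M2 -vE; ring.
  have sBB : s * B <= B by rewrite ler_piMl// ltW.
  have q0 : 0 <= B / B1 by rewrite divr_ge0// ltW.
  have Bq : B <= B / B1 * r by rewrite mulrAC ler_pdivlMr// ler_wpM2l// ltW.
  have q1 : B / B1 <= 1 by rewrite ler_pdivrMr// mul1r ltW.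
  apply: (@le_trans _ _ ((r - s * B) ^+ 2)); last first.
    by rewrite -rE; nra.
  rewrite -rE -exprMn lerXn2r// ?nnegrE.
  - by rewrite mulr_ge0// subr_ge0.
  - by lra.
  by rewrite mulrBl mul1r lerD2l lerN2; apply: le_trans sBB _.
apply: (@le_trans _ _ (g0 ^+ 2)).
  apply: (@le_trans _ _ (g0 ^+ 2 / B1 ^+ 2 * M2)).
    by rewrite ler_wpM2r// ge_min lexx.
  rewrite mulrAC ler_pdivrMr ?exprn_gt0// ler_wpM2l ?sqr_ge0// B1E; exact: ltW.
have [vi|vr|] := tri w w_ge0.
- by rewrite -[leLHS]add0r lerD ?sqr_ge0// lerXn2r// nnegrE ltW// (lt_le_trans g0_gt0).
- rewrite -[leLHS]addr0 lerD ?sqr_ge0// lerXn2r// ?nnegrE; [exact: ltW| |].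
    by rewrite addr_ge0// (le_trans (ltW g0_gt0)).
  by rewrite -[leLHS]addr0 lerD.
- by rewrite -/M2; move: BM2; rewrite ltNge => /negP.
Qed.

(** With [K = Kc - i Ks] the inverse of [a + i b] and [u = cw - i sw], this is [|a + i b + q u|^2 =
    |a + i b|^2 |1 + q u K|^2]. The last factor involves only transforms of integrable kernels,
    which are close at all frequencies when the kernels are close in [L1]. *)
Lemma modulus_ratio (a b Kc Ks q cw sw : R) : a * Kc + b * Ks = 1 -> b * Kc = a * Ks ->
  cw ^+ 2 + sw ^+ 2 = 1 ->
  0 < a ^+ 2 + b ^+ 2 /\
  (a + q * cw) ^+ 2 + (b - q * sw) ^+ 2 = (a ^+ 2 + b ^+ 2) *
    ((1 + q * (cw * Kc - sw * Ks)) ^+ 2 + (q * (sw * Kc + cw * Ks)) ^+ 2).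
Proof.
move=> h1 h2 cs; set N := a ^+ 2 + b ^+ 2.
have aE : a = N * Kc.
  have := congr1 (fun x => a * x) h1; have := congr1 (fun x => b * x) h2.
  by rewrite /N => {h1 h2}; lra.
have bE : b = N * Ks.
  have := congr1 (fun x => b * x) h1; have := congr1 (fun x => a * x) h2.
  by rewrite /N => {h1 h2 aE}; lra.
have NK : N * (Kc ^+ 2 + Ks ^+ 2) = 1.
  by rewrite -h1 [in RHS]aE [in RHS]bE; ring.
split.
  rewrite lt_neqAle addr_ge0 ?sqr_ge0// andbT eq_sym; apply/eqP => N0.
  by move: NK; rewrite N0 mul0r => /eqP; rewrite eq_sym oner_eq0.
transitivity (N + 2 * q * (a * cw - b * sw) + q ^+ 2 * (cw ^+ 2 + sw ^+ 2)).
  by rewrite /N; ring.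
transitivity (N + 2 * q * ((N * Kc) * cw - (N * Ks) * sw) +
    q ^+ 2 * (N * (Kc ^+ 2 + Ks ^+ 2)) * (cw ^+ 2 + sw ^+ 2)); last by ring.
by rewrite -aE -bE NK mulr1.
Qed.

Let quarter_le (m x1 x2 x3 x4 x5 x6 x7 : R) : m <= x1 + x2 ->
  x1 <= 2 * x3 + 2 * x5 -> x2 <= 2 * x4 + 2 * x6 -> x5 <= x7 -> x6 <= x7 ->
  2 * x7 <= m / 4 -> m / 4 <= x3 + x4.
Proof. by move=> *; lra. Qed.

Section perturbation.
Variables (tau : R) (k : R -> R).
Hypotheses (tau_gt0 : 0 < tau) (rk : resolvent alpha p k).
Let k1 := resolvent_L1 rk.
Let k_ge0 := resolvent_ge0 rk.

Let damp_cvg (f : R -> R) t : damp n.+1%:R^-1 f t @[n --> \oo] --> f t.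
Proof.
suff : damp n.+1%:R^-1 f t @[n --> \oo] --> expR (- (0 * t)) * f t.
  by rewrite mul0r oppr0 expR0 mul1r.
apply: cvgM; last exact: cvg_cst.
apply: (@cvg_comp _ _ _ (fun n : nat => - (n.+1%:R^-1 * t)) expR); last exact: continuous_expR.
by apply: cvgN; apply: cvgM; [exact: (@cvg_harmonic R)|exact: cvg_cst].
Qed.

Let damp_le e t : 0 <= e -> `|damp e k t| <= k t.
Proof.
move=> e0; rewrite ger0_norm; last by rewrite mulr_ge0// expR_ge0.
have [t0|t0] := ltP 0 t; last by rewrite /damp (resolvent_causal rk) ?mulr0.
by rewrite ler_piMl// -expR0 ler_expR oppr_le0 mulr_ge0// ltW.
Qed.

(** For [w > 0] it is the limit of [transform_resolvent] along [e = 1 / (n + 1)], where the argument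
    of [z^alpha] tends to [alpha pi / 2]; at [w = 0] it is the value of the integral of [k]. *)
Lemma transform_resolvent_axis w : 0 <= w ->
  are w * cosT k w + aim w * sinT k w = 1 /\ aim w * cosT k w = are w * sinT k w.
Proof.
rewrite le_eqVlt => /predU1P[<-|w0].
  have -> : sinT k 0 = 0.
    rewrite /sinT (_ : (fun t => _) = cst 0) ?/Rintegral ?integral0//.
    by apply/funext => t /=; rewrite mul0r sin0 mulr0.
  have -> : cosT k 0 = p^-1.
    rewrite -(resolvent_int rk); apply: eq_Rintegral => t _.
    by rewrite mul0r cos0 mulr1.
  rewrite /are /aim normr0 powR0 ?gt_eqF// !mul0r add0r addr0 mulr0.
  by rewrite mulfV// gt_eqF.
have ccv : cosT (damp n.+1%:R^-1 k) w @[n --> \oo] --> cosT k w.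
  apply: (@int_dominated_cvg _ _ _ k _ _ k1 _).2 => [n|t|n t].
  - by apply: L1_measurable (L1_cos w (L1_damp _ (resolvent_causal rk) k1)).
  - by apply: cvgM; [exact: damp_cvg|exact: cvg_cst].
  - rewrite normrM -[leRHS]mulr1 ler_pM// ?cos_norm_le1//; exact: damp_le.
have scv : sinT (damp n.+1%:R^-1 k) w @[n --> \oo] --> sinT k w.
  apply: (@int_dominated_cvg _ _ _ k _ _ k1 _).2 => [n|t|n t].
  - by apply: L1_measurable (L1_sin w (L1_damp _ (resolvent_causal rk) k1)).
  - by apply: cvgM; [exact: damp_cvg|exact: cvg_cst].
  - rewrite normrM -[leRHS]mulr1 ler_pM// ?sin_norm_le1//; exact: damp_le.
have modcv : expR (alpha * (ln (n.+1%:R^-1 ^+ 2 + w ^+ 2) / 2)) @[n --> \oo] --> w `^ alpha.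
  have -> : w `^ alpha = expR (alpha * (ln (0 ^+ 2 + w ^+ 2) / 2)).
    rewrite expr0n add0r lnXn// /powR gt_eqF//; congr (expR (_ * _)).
    by rewrite mulr2n; field.
  apply: (@cvg_comp _ _ _ (fun n : nat => alpha * (ln (n.+1%:R^-1 ^+ 2 + w ^+ 2) / 2)) expR); last exact: continuous_expR.
  apply: cvgM; first exact: cvg_cst.
  apply: cvgM; last exact: cvg_cst.
  apply: (@cvg_comp _ _ _ (fun n : nat => (n.+1%:R^-1 : R) ^+ 2 + w ^+ 2) (@ln R) _ (nbhs ((0 : R) ^+ 2 + w ^+ 2))).
    apply: cvgD; last exact: cvg_cst.
    by apply: cvgM; exact: (@cvg_harmonic R).
  by apply: continuous_ln; rewrite expr0n add0r exprn_gt0.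
have thcv : alpha * atan (w / n.+1%:R^-1) @[n --> \oo] --> alpha * pi / 2.
  rewrite -mulrA; apply: cvgM; first exact: cvg_cst.
  apply: (@cvg_comp _ _ _ (fun n : nat => w / n.+1%:R^-1) atan _ (pinfty_nbhs R)).
    apply/cvgryPge => A; near=> n; rewrite invrK mulrC -ler_pdivrMr//.
    rewrite (@le_trans _ _ n%:R)// ?ler_nat//; near: n; exact: nbhs_infty_ger.
  exact: cvgy_atan.
have wE : `|w| = w by rewrite gtr0_norm.
have rcv : zpow_re alpha n.+1%:R^-1 w + p @[n --> \oo] --> are w.
  rewrite /are wE; apply: cvgD; last exact: cvg_cst.
  apply: cvgM; first exact: modcv.
  by apply: (cvg_comp _ _ thcv); exact: continuous_cos.
have icv : zpow_im alpha n.+1%:R^-1 w @[n --> \oo] --> aim w.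
  rewrite /aim wE; apply: cvgM; first exact: modcv.
  by apply: (cvg_comp _ _ thcv); exact: continuous_sin.
have n0 n : 0 < n.+1%:R^-1 :> R by rewrite invr_gt0.
have tr n := transform_resolvent w alpha_gt0 alpha_le1 p_gt0 rk (n0 n).
have L1_ : (zpow_re alpha n.+1%:R^-1 w + p) * cosT (damp n.+1%:R^-1 k) w +
    zpow_im alpha n.+1%:R^-1 w * sinT (damp n.+1%:R^-1 k) w @[n --> \oo] -->
    are w * cosT k w + aim w * sinT k w.
  by apply: cvgD; apply: cvgM.
have L2_ : zpow_im alpha n.+1%:R^-1 w * cosT (damp n.+1%:R^-1 k) w -
    (zpow_re alpha n.+1%:R^-1 w + p) * sinT (damp n.+1%:R^-1 k) w @[n --> \oo] -->
    aim w * cosT k w - are w * sinT k w.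
  by apply: cvgB; apply: cvgM.
split.
  apply: (cvg_unique _ L1_) => //.
  by apply: cvg_near_cst; apply: nearW => n; exact: (tr n).1.
apply/eqP; rewrite -subr_eq0; apply/eqP; apply: (cvg_unique _ L2_) => //.
apply: cvg_near_cst; apply: nearW => n; apply/eqP; rewrite subr_eq0; apply/eqP.
exact: (tr n).2.
Unshelve. all: end_near. Qed.

Let kt e := damp e (delay tau k).
Let kt1 e : 0 <= e -> L1 (kt e).
Proof.
move=> e0; apply: L1_damp => //; last exact: L1_shift.
by move=> t t0; rewrite /delay (resolvent_causal rk)//; have := tau_gt0; lra.
Qed.

Let kt_ge0 e t : 0 <= kt e t.
Proof. by rewrite mulr_ge0 ?expR_ge0// k_ge0. Qed.

Let kt_dec e e' t : e <= e' -> kt e' t <= kt e t.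
Proof.
move=> ee; rewrite /kt /damp; have [t0|t0] := ltP 0 t; last first.
  by rewrite /delay (resolvent_causal rk) ?mulr0//; have := tau_gt0; lra.
by rewrite ler_wpM2r ?k_ge0// ler_expR lerN2 ler_wpM2r// ltW.
Qed.

Let kt0 : kt 0 = delay tau k.
Proof. by apply/funext => t; rewrite /kt /damp mul0r oppr0 expR0 mul1r. Qed.

Let kt_close d : 0 < d -> exists2 e0, 0 < e0 & forall e, 0 < e -> e < e0 ->
  \int[mu]_t (kt 0 t - kt e t) <= d.
Proof.
move=> d0.
have cv : \int[mu]_t kt n.+1%:R^-1 t @[n --> \oo] --> \int[mu]_t kt 0 t.
  apply: (@int_dominated_cvg _ _ _ (kt 0) _ _ (kt1 (lexx 0)) _).2 => [n|t|n t].
  - by apply: L1_measurable (kt1 _).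
  - by rewrite kt0; exact: damp_cvg.
  - by rewrite ger0_norm ?kt_ge0//; apply: kt_dec.
have /cvgrPdist_le/(_ _ d0)[n _ /(_ n (leqnn n)) nd] := cv.
exists n.+1%:R^-1 => [|e e0 en]; first by rewrite invr_gt0.
rewrite intB; [|exact: kt1|exact/kt1/ltW].
apply: le_trans (le_trans (ler_norm _) nd); rewrite lerD2l lerN2.
by apply: int_le => [||t]; [exact: kt1|exact/kt1/ltW|exact/kt_dec/ltW].
Qed.

Let ktE e : kt e = fun t => expR (- (e * tau)) * damp e k (t - tau).
Proof.
apply/funext => t; rewrite /kt /damp /delay mulrA -expRD; congr (expR _ * _).
by ring.
Qed.

(** Transforms of the damped delayed kernel differ from those on the axis by at most the [L1]
    distance of the kernels, so the bound on the axis persists for small [e] at all frequencies at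
    once. *)
Lemma char_bound_axis : om * tau < pi - th ->
  exists m e0, [/\ 0 < m, m <= 1, 0 < e0 & forall s e, 0 <= s -> s <= 1 -> 0 < e -> e < e0 ->
    char_bound alpha p B tau m s e].
Proof.
move=> omtau; have [m0 m0_gt0 axis] := axis_bound tau_gt0 omtau.
(* Makes [2 (B d)^2 <= m0 / 4], so that the comparison of squares in [quarter_le] loses only a
   factor 4. *)
pose d := Num.min 1 (m0 / 8) / B.
have md0 : 0 < Num.min 1 (m0 / 8) by rewrite lt_min ltr01 divr_gt0.
have d0 : 0 < d by rewrite divr_gt0.
have Bd : 2 * (B * d) ^+ 2 <= m0 / 4.
  have -> : B * d = Num.min 1 (m0 / 8) by rewrite /d mulrC divfK// gt_eqF.
  have h1 : Num.min 1 (m0 / 8) <= 1 by rewrite ge_min lexx.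
  have h8 : Num.min 1 (m0 / 8) <= m0 / 8 by rewrite ge_min lexx orbT.
  have : Num.min 1 (m0 / 8) ^+ 2 <= m0 / 8.
    by rewrite expr2; apply: le_trans h8; rewrite ler_piMl// ltW.
  lra.
have [e0 e0_gt0 close] := kt_close d0.
exists (Num.min 1 (m0 / 4)), e0; split=> //.
- by rewrite lt_min ltr01 divr_gt0.
- by rewrite ge_min lexx.
move=> s e s0 s1 e_gt0 ee0.
suff key w : 0 <= w -> Num.min 1 (m0 / 4) * ((zpow_re alpha e w + p) ^+ 2 + zpow_im alpha e w ^+ 2) <=
    (zpow_re alpha e w + p + s * B * expR (- (e * tau)) * cos (w * tau)) ^+ 2 +
    (zpow_im alpha e w - s * B * expR (- (e * tau)) * sin (w * tau)) ^+ 2.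
  move=> w; have [w0|w0] := leP 0 w; first exact: key.
  have := key (- w); rewrite oppr_ge0 => /(_ (ltW w0)).
  rewrite /zpow_re /zpow_im sqrrN mulNr atanN mulrN cosN sinN !mulNr cosN sinN !mulrN.
  by rewrite [(- (expR _ * sin _)) ^+ 2]sqrrN -opprD sqrrN.
move=> w0.
have [a1 a2] := transform_resolvent_axis w0.
have [b1 b2] := transform_resolvent w alpha_gt0 alpha_le1 p_gt0 rk e_gt0.
have cs : cos (w * tau) ^+ 2 + sin (w * tau) ^+ 2 = 1 by exact: cos2Dsin2.
have [N0 E0] := modulus_ratio (s * B) a1 a2 cs.
have [N1 E1] := modulus_ratio (s * B * expR (- (e * tau))) b1 b2 cs.
have kt01 := kt1 (lexx 0); have kte1 := kt1 (ltW e_gt0).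
have dk1 := L1_damp (ltW e_gt0) (resolvent_causal rk) k1.
have P0E : cos (w * tau) * cosT k w - sin (w * tau) * sinT k w = cosT (kt 0) w.
  by rewrite kt0 cosT_shift.
have Q0E : sin (w * tau) * cosT k w + cos (w * tau) * sinT k w = sinT (kt 0) w.
  by rewrite kt0 sinT_shift.
have PE : expR (- (e * tau)) * (cos (w * tau) * cosT (damp e k) w - sin (w * tau) * sinT (damp e k) w) = cosT (kt e) w.
  by rewrite ktE cosTZ ?cosT_shift//; exact: L1_shift.
have QE : expR (- (e * tau)) * (sin (w * tau) * cosT (damp e k) w + cos (w * tau) * sinT (damp e k) w) = sinT (kt e) w.
  by rewrite ktE sinTZ ?sinT_shift//; exact: L1_shift.
have sPE : s * B * expR (- (e * tau)) * (cos (w * tau) * cosT (damp e k) w -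
    sin (w * tau) * sinT (damp e k) w) = s * B * cosT (kt e) w by rewrite -PE mulrA.
have sQE : s * B * expR (- (e * tau)) * (sin (w * tau) * cosT (damp e k) w +
    cos (w * tau) * sinT (damp e k) w) = s * B * sinT (kt e) w by rewrite -QE mulrA.
rewrite sPE sQE in E1.
rewrite P0E Q0E in E0.
rewrite E1 mulrC ler_wpM2l ?(ltW N1)//.
have := axis w s w0 s0 s1; rewrite E0 [leLHS]mulrC (ler_pM2l N0) => ax.
have L1d : L1 (fun t => kt 0 t - kt e t) by exact: L1B.
have id_ : \int[mu]_t `|kt 0 t - kt e t| <= d.
  apply: le_trans (close e e_gt0 ee0); rewrite le_eqVlt; apply/orP; left; apply/eqP.
  by apply: eq_Rintegral => t _; rewrite ger0_norm// subr_ge0; exact/kt_dec/ltW.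
have NE f g : (fun t => f t - g t) = (fun t => f t + -1 * g t) :> (R -> R).
  by apply/funext => t; rewrite mulN1r.
have dc : `|cosT (kt 0) w - cosT (kt e) w| <= d.
  apply: le_trans id_; apply: le_trans (cosT_norm_le w L1d).
  by rewrite (NE (kt 0)) cosTD ?cosTZ ?mulN1r//; exact: L1Z.
have ds : `|sinT (kt 0) w - sinT (kt e) w| <= d.
  apply: le_trans id_; apply: le_trans (sinT_norm_le w L1d).
  by rewrite (NE (kt 0)) sinTD ?sinTZ ?mulN1r//; exact: L1Z.
have sB : `|s * B| <= B by rewrite normrM (ger0_norm s0) (gtr0_norm B_gt0) ler_piMl// ltW.
have sq x : `|x| <= d -> (s * B * x) ^+ 2 <= (B * d) ^+ 2.
  move=> xd; rewrite -[leLHS]real_normK ?num_real// lerXn2r ?nnegrE//.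
    by rewrite mulr_ge0 ?ltW.
  by rewrite normrM ler_pM.
have h1 := sq _ dc; have h2 := sq _ ds.
set P0 := cosT (kt 0) w in ax h1; set Pe := cosT (kt e) w in h1 *.
set Q0 := sinT (kt 0) w in ax h2; set Qe := sinT (kt e) w in h2 *.
apply: (@le_trans _ _ (m0 / 4)); first by rewrite ge_min lexx orbT.
have e1 : (1 + s * B * P0) ^+ 2 <= 2 * (1 + s * B * Pe) ^+ 2 + 2 * (s * B * (P0 - Pe)) ^+ 2.
  rewrite -subr_ge0 (_ : _ - _ = (1 + s * B * Pe - s * B * (P0 - Pe)) ^+ 2) ?sqr_ge0//; ring.
have e2 : (s * B * Q0) ^+ 2 <= 2 * (s * B * Qe) ^+ 2 + 2 * (s * B * (Q0 - Qe)) ^+ 2.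
  rewrite -subr_ge0 (_ : _ - _ = (s * B * Qe - s * B * (Q0 - Qe)) ^+ 2) ?sqr_ge0//; ring.
exact: quarter_le ax e1 e2 h1 h2 Bd.
Qed.

End perturbation.

End imaginary_axis.

(** * Stability of the linearized closed loop *)

(** Indicator of []0, a]]. The history acts as a forcing during one delay, hence [pulse tau], and
    during two delays in differences over a delay, hence [pulse (2 * tau)]. *)
Definition pulse {R : realType} (a t : R) : R := heaviside t - heaviside (t - a).

Section energy_estimates.
Context {R : realType}.
Local Notation mu := (@lebesgue_measure R).
Local Notation H := (@heaviside R).
Implicit Types (z u w f g k : R -> R) (a b t T : R).

Lemma energy_le2 z u w a b T : loc_bounded z -> loc_bounded u -> loc_bounded w ->
  0 <= a -> 0 <= b -> (forall t, t < T -> `|z t| <= a * `|u t| + b * `|w t|) ->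
  energy T z <= 2 * a ^+ 2 * energy T u + 2 * b ^+ 2 * energy T w.
Proof.
move=> zb ub wb a0 b0 zuw; have u1 := L1_energy T ub; have w1 := L1_energy T wb.
rewrite /energy -!intZ// -intD; [|exact: L1Z|exact: L1Z].
apply: int_le; [exact: L1_energy|by apply: L1D; exact: L1Z|] => t.
have [tT|tT] := ltP t T; last by rewrite heaviside_le0 ?subr_le0// !mulr0 addr0.
rewrite heavisideE ?subr_gt0// !mulr1.
have le := zuw t tT; have q0 := addr_ge0 (mulr_ge0 a0 (normr_ge0 (u t))) (mulr_ge0 b0 (normr_ge0 (w t))).
apply: (@le_trans _ _ ((a * `|u t| + b * `|w t|) ^+ 2)).
  by rewrite -[leLHS]real_normK ?num_real// lerXn2r ?nnegrE.
rewrite -(real_normK (num_real (u t))) -(real_normK (num_real (w t))) -subr_ge0.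
by rewrite (_ : _ - _ = (a * `|u t| - b * `|w t|) ^+ 2) ?sqr_ge0//; ring.
Qed.

Lemma pulseE a t : 0 < a -> pulse a t = ((0 < t) && (t <= a))%R%:R.
Proof.
move=> a0; rewrite /pulse /heaviside subr_gt0.
have [t0|t0] := ltP 0 t; have [ta|ta] := ltP a t; rewrite /= ?subrr ?subr0//.
by exfalso; lra.
Qed.

Lemma pulse_bounds a t : 0 < a -> 0 <= pulse a t <= 1.
Proof. by move=> a0; rewrite pulseE// ler0n lern1 leq_b1. Qed.

Lemma loc_bounded_pulse a : 0 < a -> loc_bounded (pulse a).
Proof.
move=> a0; apply: loc_boundedB; first exact: loc_bounded_heaviside.
by apply: (loc_bounded_delay (tau := a)); [exact: ltW|exact: loc_bounded_heaviside].
Qed.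

Lemma energy_pulse a T : 0 < a -> energy T (pulse a) <= a.
Proof.
move=> a0; apply: (@le_trans _ _ (\int[mu]_t \1_`[0, a] t)).
  apply: int_le; [exact/L1_energy/loc_bounded_pulse|exact: L1_indic_itv|] => t.
  rewrite pulseE// indicE mem_setE in_itv/=.
  have [t0|t0] := ltP 0 t; last by rewrite expr0n mul0r.
  rewrite (ltW t0)/=; case: (t <= a); last by rewrite expr0n mul0r.
  by rewrite expr1n mul1r heaviside_le1.
by rewrite int_indic_itv ?subr0// ltW.
Qed.

Section kernel.
Variable k : R -> R.
Hypotheses (k0 : causal k) (k_ge0 : forall t, 0 <= k t) (k1 : L1 k).
Let kl : loc_L1 k. Proof. exact: loc_L1_intro. Qed.

Lemma L1_convol_bounded f t : loc_bounded f -> L1 (fun s => k (t - s) * f s).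
Proof.
move=> [mf f0 fM]; have [M fMt] := fM t.
by apply: (@L1_convol _ k f t M kl mf f0 _).1 => s /ltW; exact: fMt.
Qed.

Lemma convol_delayE tau f t : loc_bounded f ->
  convol k (delay tau f) t = delay tau (convol k f) t.
Proof. by move=> fb; apply: convol_delay; exact: L1_convol_bounded. Qed.

Lemma convol_le f t M : loc_bounded f -> 0 <= M -> (forall s, s < t -> `|f s| <= M) ->
  `|convol k f t| <= M * \int[mu]_s k s.
Proof.
move=> fb M0 fM; have kr := L1_reflect t k1.
rewrite -(int_reflect t k1) -intZ//.
apply: int_norm_le; [exact: L1_measurable (L1_convol_bounded t fb)|exact: L1Z|] => s.
rewrite normrM ger0_norm// mulrC.
have [st|ts] := ltP s t; first by rewrite ler_wpM2r// fM.
by rewrite k0 ?mulr0// subr_le0.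
Qed.

Lemma convol_cvg0 f a M : loc_bounded f -> (forall t, `|f t| <= M) ->
  (forall t, a < t -> f t = 0) -> convol k f t @[t --> +oo] --> 0.
Proof.
move=> fb fM fa; have [mf f0 _] := fb.
have M0 : 0 <= M by exact: le_trans (fM 0).
have -> : (0 : R) = \int[mu]_s ((fun=> 0 : R) s) by rewrite /Rintegral integral0.
have -> : convol k f = fun t => \int[mu]_s (f (t - s) * k s).
  by apply/funext => t; rewrite convolC//; exact: L1_convol_bounded.
apply: (@dominated_cvg_pinfty _ (fun t s => f (t - s) * k s) _ (fun s => M * k s)).
- by move=> t; apply: measurable_funM; [exact: measurable_reflect|exact: L1_measurable k1].
- move=> s; apply: cvg_near_cst; near=> t; rewrite fa ?mul0r// ltrBrDr.
  by near: t; apply: nbhs_pinfty_gt; exact: num_real.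
- exact: L1Z.
- by move=> t s; rewrite normrM (ger0_norm (k_ge0 s)) ler_wpM2r.
Unshelve. all: end_near. Qed.

End kernel.

End energy_estimates.

(** * From the energy estimate to uniform bounds and decay *)

Section closed_loop.
Context {R : realType}.
Local Notation mu := (@lebesgue_measure R).
Local Notation H := (@heaviside R).
Variables (alpha p B tau m e0 : R) (k kP : R -> R).
Hypotheses (alpha_gt0 : 0 < alpha) (alpha_le1 : alpha <= 1) (p_gt0 : 0 < p)
  (B_gt0 : 0 < B) (tau_gt0 : 0 < tau) (m_gt0 : 0 < m) (m_le1 : m <= 1) (e0_gt0 : 0 < e0).
Hypotheses (rk : resolvent alpha p k) (rkP : resolvent alpha (p + B) kP).
Hypothesis freq : forall s e, 0 <= s -> s <= 1 -> 0 < e -> e < e0 ->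
  char_bound alpha p B tau m s e.
Implicit Types (Y f : R -> R) (t T : R).

Let P_gt0 : 0 < p + B. Proof. exact: addr_gt0. Qed.

(* The linearized feedback is [- B Y (t - tau)], [f] is the remaining forcing. *)
Record forced (L kappa delta T y0 : R) (Y f : R -> R) : Prop := Forced {
  forced_Y : loc_bounded Y;
  forced_f : loc_bounded f;
  forced_y0 : `|y0| <= delta;
  forced_char : forall t, char_op B tau k 1 Y t = y0 * step_response p k t + convol k f t;
  forced_rep : forall t, Y t = y0 * step_response (p + B) kP t +
    convol kP (fun s => f s + B * (Y s - delay tau Y s)) t;
  forced_small : forall t, t < T -> `|f t| <= kappa * `|delay tau Y t| + L * delta * pulse tau t;
  forced_lipschitz : forall t, t < T -> `|f t - delay tau f t| <=
    kappa * `|delay tau Y t - delay tau (delay tau Y) t| + L * delta * pulse (2 * tau) t }.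

Let ktau := ltW tau_gt0.

(** For [z = Y - delay tau Y] the initial term becomes [E - delay tau E = pulse tau - p (k * pulse
    tau)], of energy at most [4 tau], and the forcing is bounded through the delayed [z] up to a
    pulse. The condition on [kappa] absorbs the former into half of [m energy(z)]. *)
Lemma energy_forced L kappa delta T y0 Y f : 0 <= L -> 0 <= kappa -> 0 < delta ->
  8 * kappa ^+ 2 * p^-1 ^+ 2 <= m -> forced L kappa delta T y0 Y f ->
  energy T (fun t => Y t - delay tau Y t) <=
    2 / m * (8 * tau + 8 * p^-1 ^+ 2 * L ^+ 2 * tau) * delta ^+ 2.
Proof.
move=> L0 kap0 del0 kapm [Yb fb y0d chE _ _ fL].
set z := fun t => _; have Ydb := loc_bounded_delay ktau Yb.
have fdb := loc_bounded_delay ktau fb.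
have zb : loc_bounded z by exact: loc_boundedB.
have kl := resolvent_loc_L1 rk.
have [k0 k_ge0 k1 kint _ _ _] := rk.
pose E := step_response p k.
have Hb := @loc_bounded_heaviside R.
have Eb : loc_bounded E.
  apply: loc_boundedB => //; apply: loc_boundedZ; exact: loc_bounded_convol.
have Edb := loc_bounded_delay ktau Eb.
have EE : (fun t => E t - delay tau E t) = (fun t => pulse tau t - p * convol k (pulse tau) t).
  apply/funext => t; rewrite /E /delay /step_response.
  have Hdb := loc_bounded_delay ktau Hb.
  have -> : convol k (pulse tau) t = convol k H t - convol k H (t - tau).
    rewrite -[X in _ - X]/(delay tau (convol k H) t) -convol_delayE//.
    by rewrite -convolBr.
  by rewrite /pulse; ring.
have pb := loc_bounded_pulse tau_gt0.
have kpb : loc_bounded (convol k (pulse tau)) by exact: loc_bounded_convol.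
have energyE : energy T (fun t => E t - delay tau E t) <= 4 * tau.
  rewrite EE; apply: le_trans (energyB_le T pb (loc_boundedZ p kpb)) _.
  rewrite energyZ//.
  have e1 := energy_pulse T tau_gt0.
  have e2 : p ^+ 2 * energy T (convol k (pulse tau)) <= tau.
    apply: le_trans (_ : p ^+ 2 * (p^-1 ^+ 2 * energy T (pulse tau)) <= _).
      by rewrite ler_wpM2l ?sqr_ge0// -kint; exact: energy_convol.
    by rewrite mulrA -exprMn mulfV ?gt_eqF// expr1n mul1r.
  lra.
have chz t : char_op B tau k 1 z t = y0 * (E t - delay tau E t) +
    convol k (fun t => f t - delay tau f t) t.
  have -> : char_op B tau k 1 z t = char_op B tau k 1 Y t - delay tau (char_op B tau k 1 Y) t.
    rewrite /char_op {2}/delay /z.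
    have -> : delay tau (fun t => Y t - delay tau Y t) = (fun t => delay tau Y t - delay tau (delay tau Y) t) by [].
    have Yddb := loc_bounded_delay ktau Ydb.
    rewrite convolBr//.
    rewrite (convol_delayE k0 k1 tau t Ydb) /delay; ring.
  rewrite convolBr// (convol_delayE k0 k1 tau t fb).
  by rewrite {1}/delay !chE -/E /delay; ring.
have fdfb : loc_bounded (fun t => f t - delay tau f t) by exact: loc_boundedB.
have kfb : loc_bounded (convol k (fun t => f t - delay tau f t)) by exact: loc_bounded_convol.
have EEb : loc_bounded (fun t => E t - delay tau E t) by exact: loc_boundedB.
have en1 := char_energy alpha_gt0 alpha_le1 p_gt0 (ltW B_gt0) tau_gt0 rk m_gt0 m_le1 e0_gt0 freq T zb.
have en2 : energy T (char_op B tau k 1 z) <= 2 * `|y0| ^+ 2 * energy T (fun t => E t - delay tau E t)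
    + 2 * 1 ^+ 2 * energy T (convol k (fun t => f t - delay tau f t)).
  apply: energy_le2 => //; first exact: (char_op_bounded B tau_gt0 rk).
  by move=> t _; rewrite chz mul1r -normrM ler_normD.
have en3 : energy T (convol k (fun t => f t - delay tau f t)) <= p^-1 ^+ 2 * energy T (fun t => f t - delay tau f t).
  by rewrite -kint; exact: energy_convol.
have tau2 : 0 < 2 * tau by rewrite mulr_gt0.
have en4 : energy T (fun t => f t - delay tau f t) <= 2 * kappa ^+ 2 * energy T (delay tau z) +
    2 * (L * delta) ^+ 2 * energy T (pulse (2 * tau)).
  apply: energy_le2 => //; [exact: loc_bounded_delay|exact: loc_bounded_pulse|by rewrite mulr_ge0// ltW|].
  move=> t tT; apply: le_trans (fL t tT) _; rewrite lerD2l ler_wpM2l ?ler_norm//.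
  by rewrite mulr_ge0// ltW.
have en5 := energy_delay T ktau zb.
have en6 := energy_pulse T tau2.
have y2 : `|y0| ^+ 2 <= delta ^+ 2 by rewrite lerXn2r// ?nnegrE// ltW.
set X := energy T z in en1 en5 *.
have X0 : 0 <= X by exact: energy_ge0.
have f1 : 2 * `|y0| ^+ 2 * energy T (fun t => E t - delay tau E t) <= 8 * tau * delta ^+ 2.
  rewrite (_ : 8 * tau * delta ^+ 2 = 2 * delta ^+ 2 * (4 * tau)); last by ring.
  by rewrite ler_pM ?energy_ge0 ?mulr_ge0 ?sqr_ge0// ler_wpM2l.
have f2 : 2 * 1 ^+ 2 * energy T (convol k (fun t => f t - delay tau f t)) <=
    m / 2 * X + 8 * p^-1 ^+ 2 * L ^+ 2 * tau * delta ^+ 2.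
  rewrite expr1n mulr1.
  have g1 : 2 * energy T (convol k (fun t => f t - delay tau f t)) <=
      2 * (p^-1 ^+ 2 * (2 * kappa ^+ 2 * X + 2 * (L * delta) ^+ 2 * (2 * tau))).
    rewrite ler_pM2l//; apply: le_trans en3 _; rewrite ler_wpM2l ?sqr_ge0//.
    apply: le_trans en4 _; rewrite lerD//; first by rewrite ler_wpM2l// mulr_ge0 ?sqr_ge0.
    by rewrite ler_wpM2l// mulr_ge0 ?sqr_ge0.
  apply: le_trans g1 _.
  rewrite (_ : 2 * (p^-1 ^+ 2 * (2 * kappa ^+ 2 * X + 2 * (L * delta) ^+ 2 * (2 * tau))) =
    (4 * kappa ^+ 2 * p^-1 ^+ 2) * X + 8 * p^-1 ^+ 2 * L ^+ 2 * tau * delta ^+ 2); last by ring.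
  by rewrite lerD2r ler_wpM2r//; lra.
have main : m / 2 * X <= (8 * tau + 8 * p^-1 ^+ 2 * L ^+ 2 * tau) * delta ^+ 2 by lra.
rewrite -mulrA [leRHS]mulrC -ler_pdivrMr; last by rewrite divr_gt0.
by rewrite invf_div mulrC.
Qed.

(** The first bound absorbs the nonlinearity in the energy estimate, the second in the supremum
    estimate. *)
Definition small_gain (kappa : R) : Prop :=
  8 * kappa ^+ 2 * p^-1 ^+ 2 <= m /\ kappa / (p + B) <= 4^-1.

Lemma small_gain_exists : exists2 kap0, 0 < kap0 &
  forall kappa, 0 <= kappa -> kappa <= kap0 -> small_gain kappa.
Proof.
pose kap1 := Num.min (p * Num.sqrt m / 3) ((p + B) / 4).
have kap1_gt0 : 0 < kap1.
  by rewrite lt_min !divr_gt0// mulr_gt0// sqrtr_gt0.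
exists kap1 => // kappa kap0 kapl; split.
  have h : kappa <= p * Num.sqrt m / 3 by apply: le_trans kapl _; rewrite ge_min lexx.
  have h2 : kappa ^+ 2 <= (p * Num.sqrt m / 3) ^+ 2.
    by rewrite lerXn2r ?nnegrE// (le_trans kap0).
  have h3 : (p * Num.sqrt m / 3) ^+ 2 = p ^+ 2 * m / 9.
    by rewrite !exprMn sqr_sqrtr ?ltW//; field.
  rewrite exprVn ler_pdivrMr ?exprn_gt0//; rewrite h3 in h2.
  have : 0 <= m * p ^+ 2 by rewrite mulr_ge0 ?sqr_ge0// ltW.
  lra.
rewrite ler_pdivrMr//; apply: le_trans kapl _.
by rewrite [leRHS]mulrC ge_min lexx orbT.
Qed.

(** A crude bound [Z] up to [T] improves to [Z / 2 + C2 delta]: a quarter of [Z] comes from the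
    forcing, an eighth from the part of [kP] near 0, and the energy of [z] controls the rest.
    Iteration eliminates the crude bound, so [C] does not depend on the horizon [T]. *)
Lemma sup_forced L : 0 <= L -> exists2 C, 0 < C &
  forall kappa delta T y0 Y f, 0 <= kappa -> small_gain kappa -> 0 < delta ->
    forced L kappa delta T y0 Y f -> forall t, t <= T -> `|Y t| <= C * delta.
Proof.
move=> L0.
have [k0 k_ge0 k1 kint kb _ _] := rkP.
have kl := resolvent_loc_L1 rkP.
have eta0 : 0 < (16 * B)^-1 by rewrite invr_gt0 mulr_gt0.
have [C C0 split] := convol_split k0 k_ge0 k1 kb eta0.
pose C1 := 2 / m * (8 * tau + 8 * p^-1 ^+ 2 * L ^+ 2 * tau).
have C1_ge0 : 0 <= C1.
  apply: mulr_ge0; first by rewrite divr_ge0// ltW.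
  have a1 : 0 <= 8 * tau by rewrite mulr_ge0.
  have a2 : 0 <= 8 * p^-1 ^+ 2 * L ^+ 2 * tau.
    by rewrite mulr_ge0// mulr_ge0 ?sqr_ge0// mulr_ge0 ?sqr_ge0.
  exact: addr_ge0.
pose C2 := 1 + L / (p + B) + B * (C + C1).
have C2_gt0 : 0 < C2.
  rewrite /C2 -addrA ltr_pwDl// addr_ge0//; first by rewrite divr_ge0// ltW.
  by rewrite mulr_ge0 ?addr_ge0// ltW.
exists (2 * C2); first by rewrite mulr_gt0.
move=> kappa delta T y0 Y f kap0 [kapm kapP] del0 F t tT.
have en := energy_forced L0 kap0 del0 kapm F.
have [Yb fb y0d _ rep fs _] := F.
have [mY Y0 YM] := Yb.
have [Z0 YZ0] := YM T.
have Z0_ge0 : 0 <= Z0 by exact: le_trans (YZ0 T (lexx T)).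
have step_ Z : 0 <= Z -> (forall t, t <= T -> `|Y t| <= Z) -> forall t, t <= T -> `|Y t| <= Z / 2 + C2 * delta.
  move=> Z_ge0 YZ u uT.
  have Ydb := loc_bounded_delay ktau Yb.
  pose z s := Y s - delay tau Y s.
  have zb : loc_bounded z by exact: loc_boundedB.
  have fzE : (fun s => f s + B * (Y s - delay tau Y s)) = (fun s => f s + B * z s) by [].
  rewrite rep fzE convolDr//; last exact: loc_boundedZ.
  rewrite convolZr; [|by have [] := kl|by have [] := zb].
  have t1 : `|y0 * step_response (p + B) kP u| <= delta.
    rewrite normrM (ger0_norm (step_response_ge0 P_gt0 rkP _)) -[leRHS]mulr1.
    by rewrite ler_pM// ?(step_response_ge0 P_gt0 rkP)// (step_response_le1 P_gt0 rkP).
  have t2 : `|convol kP f u| <= Z / 4 + L / (p + B) * delta.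
    have M0 : 0 <= kappa * Z + L * delta by rewrite addr_ge0// mulr_ge0// ltW.
    apply: le_trans (convol_le k0 k_ge0 k1 fb M0 _) _.
      move=> s su; apply: le_trans (fs s (lt_le_trans su uT)) _.
      have /andP[_ p1] := pulse_bounds s tau_gt0.
      rewrite lerD//; last by rewrite ler_piMr// mulr_ge0// ltW.
      by rewrite ler_wpM2l// /delay; apply: YZ; have := tau_gt0; lra.
    rewrite kint mulrDl lerD//; last by rewrite mulrAC.
    by rewrite mulrAC mulrC ler_wpM2l.
  have t3 : `|convol kP z u| <= Z / (8 * B) + (C + C1) * delta.
    have zZ s : s < u -> `|z s| <= 2 * Z.
      move=> su; apply: le_trans (ler_normB _ _) _; rewrite mulr2n mulrDl mul1r.
      by rewrite lerD// ?YZ ?/delay; have := tau_gt0; lra.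
    (* With [lam := delta] both [lam C] and [energy / lam] are linear in [delta], the energy being
       quadratic. *)
    apply: le_trans (split z u (2 * Z) delta zb zZ del0) _.
    rewrite (_ : (16 * B)^-1 * (2 * Z) = Z / (8 * B)); last by field; rewrite gt_eqF.
    rewrite lerD2l mulrDl (mulrC C) lerD2l ler_pdivrMl//.
    apply: (@le_trans _ _ (energy T z)).
      apply: int_le; [exact: L1_energy|exact: L1_energy|] => s.
      rewrite ler_wpM2l ?sqr_ge0// /heaviside ler_nat !subr_gt0.
      by case: (ltP s u) => // su; rewrite (lt_le_trans su uT).
    by apply: le_trans en _; rewrite -/C1 le_eqVlt; apply/orP; left; apply/eqP; ring.
  apply: le_trans (ler_normD _ _) _.
  have t23 : `|convol kP f u + B * convol kP z u| <=
      Z / 4 + L / (p + B) * delta + B * (Z / (8 * B) + (C + C1) * delta).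
    apply: le_trans (ler_normD _ _) _; rewrite lerD// normrM gtr0_norm//.
    by rewrite ler_wpM2l// ltW.
  apply: le_trans (lerD t1 t23) _.
  rewrite mulrDr (_ : B * (Z / (8 * B)) = Z / 8); last by field; rewrite gt_eqF.
  rewrite /C2; lra.
have cd : 0 < C2 * delta by exact: mulr_gt0.
have iter_ n : forall t, t <= T -> `|Y t| <= Z0 / 2 ^+ n + 2 * (C2 * delta).
  elim: n => [|n IH] u uT.
    by rewrite expr0 divr1; apply: le_trans (YZ0 u uT) _; rewrite lerDl mulr_ge0// ltW.
  have q0 : 0 <= Z0 / 2 ^+ n + 2 * (C2 * delta).
    by rewrite addr_ge0 ?divr_ge0 ?exprn_ge0// mulr_ge0// ltW.
  apply: le_trans (step_ _ q0 IH u uT) _.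
  rewrite exprS invfM; lra.
apply/ler_addgt0Pr => e e_gt0.
have [n nz] : exists n : nat, Z0 / 2 ^+ n <= e.
  exists (Num.truncn (Z0 / e)).+1; rewrite ler_pdivrMr ?exprn_gt0//.
  rewrite mulrC -ler_pdivrMr//; apply: le_trans (ltW (truncnS_gt _)) _.
  by rewrite -natrX ler_nat ltnW// ltn_expl.
have := iter_ n t tT; lra.
Qed.

Let eventually_small (g : R -> R) (nu : R) : g t @[t --> +oo] --> 0 -> 0 < nu ->
  exists A, forall t, A < t -> `|g t| <= nu.
Proof.
move=> /cvgrPdist_le g0 nu0; have [A [_ gA]] := g0 _ nu0; exists A => t /gA.
by rewrite /= sub0r normrN.
Qed.

Let loc_bounded_step (f : R -> R) a : loc_bounded f -> loc_bounded (fun s => f s * H (s - a)).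
Proof.
move=> [mf f0 fM]; split.
- by apply: measurable_funM => //; exact: measurable_shift measurable_heaviside.
- by move=> t t0; rewrite f0// mul0r.
move=> T; have [M fMT] := fM T; exists M => t tT; apply: le_trans (fMT t tT).
by rewrite normrM ler_piMr// ger0_norm ?heaviside_le1 ?heaviside_ge0.
Qed.

Let head_cvg0 (f : R -> R) a : loc_bounded f ->
  convol kP (fun s => f s - f s * H (s - a)) t @[t --> +oo] --> 0.
Proof.
have [k0 k_ge0 k1 kint kb _ _] := rkP.
move=> fb; have hb : loc_bounded (fun s => f s - f s * H (s - a)).
  by apply: loc_boundedB => //; exact: loc_bounded_step.
have hz t : a < t -> f t - f t * H (t - a) = 0.
  by move=> ta; rewrite heavisideE ?subr_gt0// mulr1 subrr.
have [_ _ /(_ a)[M hM]] := hb.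
apply: (convol_cvg0 k0 k_ge0 k1 (M := M) hb _ hz) => t.
have [ta|ta] := leP t a; first exact: hM.
by rewrite hz// normr0; exact: le_trans (normr_ge0 _) (hM a (lexx a)).
Qed.

Let tail_energy (z : R -> R) (N nu : R) : loc_bounded z -> (forall T, energy T z <= N) ->
  0 < nu -> exists2 b, 0 <= b & forall c t, b <= c -> energy t (fun s => z s * H (s - c)) <= nu.
Proof.
move=> zb zN nu0; pose A := [set energy T z | T in [set: R]].
have As : has_sup A.
  split; first by exists (energy 0 z), 0.
  by exists N => _ [T _ <-].
have [_ [b0 _ <-] b0s] := sup_adherent nu0 As.
pose b := Num.max 0 b0; exists b; first by rewrite le_max lexx.
move=> c t bc.
have b0c : b0 <= c by apply: le_trans bc; rewrite le_max lexx orbT.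
have [ct|tc] := leP c t; last first.
  rewrite /energy (_ : (fun s => _) = cst 0) ?/Rintegral ?integral0 ?ltW//.
  apply/funext => s /=; have [st|st] := ltP s t.
    by rewrite (heaviside_le0 (x := s - c)) ?mulr0 ?expr0n ?mul0r//; lra.
  by rewrite (heaviside_le0 (x := t - s)) ?mulr0// subr_le0.
have le1 : energy t (fun s => z s * H (s - c)) <= energy t z - energy b0 z.
  rewrite /energy -intB; [|exact: L1_energy|exact: L1_energy].
  apply: int_le; [exact/L1_energy/loc_bounded_step|by apply: L1B; exact: L1_energy|] => s.
  rewrite exprMn -mulrA -mulrBr ler_wpM2l ?sqr_ge0// /heaviside !subr_gt0.
  case: (ltP c s) => cs; case: (ltP s t) => st; case: (ltP s b0) => sb /=;
    rewrite ?expr1n ?expr0n ?mul0r ?mul1r ?subr0 ?subrr ?ler01 ?lexx//; exfalso; lra.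
have tA : A (energy t z) by exists t.
have := sup_upper_bound As tA; lra.
Qed.

(** An eventual bound [M] improves to [3 M / 4] by cutting [f] and [z] at a late time [a]. The heads
    have bounded support, so their responses decay; the tail of [f] is at most [kappa M]; the tail
    of [z] has small energy, because the total energy is finite. *)
Lemma cvg_forced L kappa delta y0 Y f : 0 <= L -> 0 <= kappa -> small_gain kappa ->
  0 < delta -> (forall T, forced L kappa delta T y0 Y f) -> Y t @[t --> +oo] --> 0.
Proof.
move=> L0 kap0 sg del0 F.
have [C C0 sup_] := sup_forced L0.
have YS t : `|Y t| <= C * delta by exact: sup_ kap0 sg del0 (F t) t (lexx t).
have S0 : 0 < C * delta by exact: mulr_gt0.
have [kapm kapP] := sg.
have [k0 k_ge0 k1 kint kb _ _] := rkP.
have kl := resolvent_loc_L1 rkP.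
have eta0 : 0 < (16 * B)^-1 by rewrite invr_gt0 mulr_gt0.
have [C' C'0 split_] := convol_split k0 k_ge0 k1 kb eta0.
pose z s := Y s - delay tau Y s.
have [Yb fb y0d _ rep _ _] := F 0.
have Ydb := loc_bounded_delay ktau Yb.
have zb : loc_bounded z by exact: loc_boundedB.
pose N := 2 / m * (8 * tau + 8 * p^-1 ^+ 2 * L ^+ 2 * tau) * delta ^+ 2.
have zN T : energy T z <= N by exact: energy_forced L0 kap0 del0 kapm (F T).
have improve M nu : 0 <= M -> 0 < nu -> (exists A, forall t, A < t -> `|Y t| <= M) ->
    exists A, forall t, A < t -> `|Y t| <= M / 2 + (3 + 3 * B) * nu.
  move=> M0 nu0 [A0 YM].
  (* Then [lam C' <= nu], and a tail energy of at most [lam nu] contributes another [nu]. *)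
  pose lam := nu / (C' + 1).
  have lam0 : 0 < lam by rewrite divr_gt0// ltr_wpDl.
  have [b b_ge0 bE] := tail_energy zb zN (mulr_gt0 lam0 nu0).
  pose a := Num.max b (`|A0| + tau).
  have ba : b <= a by rewrite le_max lexx.
  have A0a : `|A0| + tau <= a by rewrite le_max lexx orbT.
  have A0n := ler_norm A0.
  have atau : tau <= a by have := normr_ge0 A0; lra.
  have EP0 : y0 * step_response (p + B) kP t @[t --> +oo] --> 0.
    rewrite -(mulr0 y0); apply: cvgM; first exact: cvg_cst.
    exact: step_response_cvg0 P_gt0 rkP.
  have [A1 h1] := eventually_small EP0 nu0.
  have [A2 h2] := eventually_small (@head_cvg0 f a fb) nu0.
  have [A3 h3] := eventually_small (@head_cvg0 z a zb) nu0.
  exists (Num.max A1 (Num.max A2 A3)) => t; rewrite !gt_max => /and3P[tA1 tA2 tA3].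
  pose f1 s := f s * H (s - a); pose f2 s := f s - f s * H (s - a).
  pose z1 s := z s * H (s - a); pose z2 s := z s - z s * H (s - a).
  have f1b : loc_bounded f1 by exact: loc_bounded_step.
  have z1b : loc_bounded z1 by exact: loc_bounded_step.
  have f2b : loc_bounded f2 by exact: loc_boundedB.
  have z2b : loc_bounded z2 by exact: loc_boundedB.
  have fzE : (fun s => f s + B * (Y s - delay tau Y s)) =
      (fun s => (f1 s + f2 s) + B * (z1 s + z2 s)).
    by apply/funext => s; rewrite /f1 /f2 /z1 /z2 /z; ring.
  have fz : convol kP (fun s => f s + B * (Y s - delay tau Y s)) t =
      convol kP f1 t + convol kP f2 t + B * (convol kP z1 t + convol kP z2 t).
    rewrite fzE convolDr//; last 2 first.
    - exact: loc_boundedD.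
    - by apply: loc_boundedZ; exact: loc_boundedD.
    rewrite (convolDr t kl f1b f2b) convolZr; first by rewrite (convolDr t kl z1b z2b).
    - by have [] := kl.
    - by have [] := loc_boundedD z1b z2b.
  have YMa s : a < s -> `|delay tau Y s| <= M.
    by move=> as_; apply: YM; lra.
  have g1 : `|convol kP f1 t| <= M / 4.
    have f1M s : s < t -> `|f1 s| <= kappa * M.
      move=> _; rewrite /f1; have [as_|sa] := ltP a s; last first.
        by rewrite heaviside_le0 ?subr_le0// mulr0 normr0 mulr_ge0.
      rewrite heavisideE ?subr_gt0// mulr1.
      have [_ _ _ _ _ fs _] := F (s + 1).
      apply: le_trans (fs s _) _; first by rewrite ltrDl.
      rewrite pulseE// (_ : (s <= tau)%R = false) ?andbF ?mulr0 ?addr0; last first.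
        by apply/negbTE; rewrite -ltNge; lra.
      by rewrite ler_wpM2l// YMa.
    apply: le_trans (convol_le k0 k_ge0 k1 f1b (mulr_ge0 kap0 M0) f1M) _.
    by rewrite kint mulrAC mulrC ler_wpM2l.
  have g2 : `|convol kP z1 t| <= M / (8 * B) + 2 * nu.
    have z1M s : s < t -> `|z1 s| <= 2 * M.
      move=> _; rewrite /z1; have [as_|sa] := ltP a s; last first.
        by rewrite heaviside_le0 ?subr_le0// mulr0 normr0 mulr_ge0.
      rewrite heavisideE ?subr_gt0// mulr1 /z; apply: le_trans (ler_normB _ _) _.
      by rewrite mulr2n mulrDl mul1r lerD ?YMa//; apply: YM; have := tau_gt0; lra.
    apply: le_trans (split_ z1 t (2 * M) lam z1b z1M lam0) _.
    rewrite (_ : (16 * B)^-1 * (2 * M) = M / (8 * B)); last by field; rewrite gt_eqF.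
    rewrite lerD2l (_ : 2 * nu = nu + nu); last by ring.
    rewrite lerD//; first by rewrite mulrAC ler_pdivrMr ?ltr_wpDl// ler_wpM2l ?ltW// ltrDl.
    by rewrite ler_pdivrMl//; exact: bE.
  rewrite rep fz.
  apply: le_trans (ler_normD _ _) _; apply: le_trans (lerD (h1 t tA1) (lexx _)) _.
  apply: le_trans (_ : nu + ((M / 4 + nu) + B * ((M / (8 * B) + 2 * nu) + nu)) <= _); last first.
    rewrite mulrDr mulrDr (_ : B * (M / (8 * B)) = M / 8); last by field; rewrite gt_eqF.
    by have := mulr_ge0 (ltW B_gt0) (ltW nu0); lra.
  rewrite lerD2l; apply: le_trans (ler_normD _ _) _; apply: lerD.
    by apply: le_trans (ler_normD _ _) _; rewrite lerD// h2.
  rewrite normrM gtr0_norm//; apply: ler_wpM2l; first exact: ltW.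
  by apply: le_trans (ler_normD _ _) _; rewrite lerD// h3.
have B3 : 0 < 3 + 3 * B by rewrite addr_gt0// mulr_gt0.
have iter_ n : exists A, forall t, A < t -> `|Y t| <= C * delta * (3 / 4) ^+ n.
  elim: n => [|n IH]; first by exists 0 => t _; rewrite expr0 mulr1.
  have Mn : 0 < C * delta * (3 / 4) ^+ n by rewrite mulr_gt0 ?exprn_gt0// divr_gt0.
  (* This value of [nu] turns [M / 2 + (3 + 3 B) nu] into [3 M / 4]. *)
  have nun : 0 < C * delta * (3 / 4) ^+ n / 4 / (3 + 3 * B) by rewrite !divr_gt0.
  have [A YA] := improve _ _ (ltW Mn) nun IH; exists A => t /YA.
  rewrite mulrCA divff ?gt_eqF// mulr1 exprS => /le_trans; apply; lra.
apply/cvgrPdist_le => e e_gt0.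
have : C * delta * (3 / 4) ^+ n @[n --> \oo] --> 0.
  rewrite -(mulr0 (C * delta)); apply: cvgM; first exact: cvg_cst.
  by apply: cvg_expr; rewrite ger0_norm; lra.
move=> /cvgrPdist_le/(_ _ e_gt0)[n _ /(_ n (leqnn n))]; rewrite sub0r normrN => ne.
have [A YA] := iter_ n; exists A; split; first exact: num_real.
move=> t /YA h; rewrite sub0r normrN; apply: le_trans h _.
exact: le_trans (ler_norm _) ne.
Qed.

End closed_loop.

(** * Stability of the positive equilibrium *)

Definition mg_feedback {R : realType} (q r u : R) : R := q * (u / (1 + rpow r u)).

Lemma hill_is_derive {R : realType} (q r u : R) : 0 < u ->
  is_derive u 1 (fun v : R => q * (v / (1 + v `^ r)))
    (q * ((1 + u `^ r - r * u `^ r) / (1 + u `^ r) ^+ 2)).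
Proof.
move=> u0; have ur0 : 0 < u `^ r by exact: powR_gt0.
have D0 : 1 + u `^ r != 0 by rewrite gt_eqF// addr_gt0.
have dp := is_derive1_powR r u0.
have d1 : is_derive u 1 (fun v : R => 1 + v `^ r) (r * u `^ (r - 1)).
  by apply: is_derive_eq (dD (dCst 1 u) dp) _; rewrite add0r.
have d2 : is_derive u 1 (fun v : R => (1 + v `^ r)^-1) (- (1 + u `^ r) ^- 2 * (r * u `^ (r - 1))).
  exact: (@is_deriveV R (fun v => 1 + v `^ r) u _ 1 D0 d1).
apply: is_derive_eq (dZ q (dM (dId u) d2)) _.
  have uE : u `^ r = u * u `^ (r - 1).
    by rewrite -[X in X * _]powRr1 ?ltW// -powRD_gt0//; congr (_ `^ _); ring.
  have field_eq (P : R) : 1 + u * P != 0 ->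
      u * (- (1 + u * P) ^- 2 * (r * P)) + (1 + u * P)^-1 * 1 =
      (1 + u * P - r * (u * P)) / (1 + u * P) ^+ 2 by move=> nz; field.
  rewrite uE in D0 *; by rewrite -field_eq// addrC mulr1 mul1r.
Qed.

Section feedback.
Context {R : realType}.
Variables (p q r xs : R).
Hypotheses (p_gt0 : 0 < p) (q_gt0 : 0 < q) (r_gt0 : 0 < r)
  (xs_gt0 : 0 < xs) (xs_eq : rpow r xs = (q - p) / p).
Implicit Types (u v y : R).
Local Notation F := (mg_feedback q r).
Local Notation B := (- mg_beta p q r).

Lemma rpow_powR u : 0 <= u -> rpow r u = u `^ r.
Proof.
move=> u0; rewrite /rpow; case: ifP => // rn.
by rewrite -[in RHS](truncnK rn) powR_mulrn.
Qed.

Let oneD : 1 + (q - p) / p = q / p.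
Proof. by field; rewrite gt_eqF. Qed.

Lemma mg_feedback_eq : F xs = p * xs.
Proof. by rewrite /mg_feedback xs_eq oneD; field; rewrite !gt_eqF. Qed.

Let dF u : R := q * ((1 + u `^ r - r * u `^ r) / (1 + u `^ r) ^+ 2).

Let dF_is_derive u : 0 < u -> is_derive u 1 F (dF u).
Proof.
move=> u0; have d3 := hill_is_derive q r u0.
have : \forall v \near u, (fun v : R => q * (v / (1 + v `^ r))) v = F v.
  near=> v; rewrite /mg_feedback rpow_powR//; near: v.
  by apply: filterS (lt_nbhsr u0) => v /ltW.
by move=> nE; apply: near_eq_is_derive nE d3.
Unshelve. all: end_near. Qed.

Let dF_cont u : 0 < u -> {for u, continuous dF}.
Proof.
move=> u0; have ur0 : 0 < u `^ r by exact: powR_gt0.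
have pc : {for u, continuous (fun v => v `^ r)} by exact: continuous_powR.
have Dc : 1 + v `^ r @[v --> u] --> 1 + u `^ r by apply: cvgD; [exact: cvg_cst|exact: pc].
apply: cvgM; first exact: cvg_cst.
apply: cvgM.
  by apply: cvgB => //; apply: cvgM; [exact: cvg_cst|exact: pc].
apply: cvgV; first by rewrite gt_eqF// exprn_gt0// addr_gt0.
by apply: cvgM.
Qed.

Let dF_eq : dF xs = - B.
Proof.
rewrite opprK /dF -rpow_powR ?ltW// xs_eq /mg_beta oneD.
by field; rewrite !gt_eqF.
Qed.

(** The derivative of [F] at [xs] is [- B], so adding [B y] leaves a function of small derivative
    near 0, and the mean value theorem applies. The bound [rho < xs] keeps the argument positive,
    where [rpow] is the real power for every [r]. *)
Lemma mg_feedback_lipschitz kappa : 0 < kappa -> exists rho, [/\ 0 < rho, rho < xs &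
  forall y1 y2, `|y1| <= rho -> `|y2| <= rho ->
  `|(F (xs + y1) + B * y1) - (F (xs + y2) + B * y2)| <= kappa * `|y1 - y2|].
Proof.
move=> kap0.
have /cvgrPdist_le/(_ _ kap0)/nbhs_ballP[e /= e0 ed] := dF_cont xs_gt0.
pose rho := Num.min (e / 2) (xs / 2).
have rho0 : 0 < rho by rewrite lt_min !divr_gt0.
have rho_e : rho < e by apply: (@le_lt_trans _ _ (e / 2)); [rewrite ge_min lexx|lra].
have rho_x : rho < xs by apply: (@le_lt_trans _ _ (xs / 2)); [rewrite ge_min lexx orbT|have := xs_gt0; lra].
exists rho; split=> //.
have key y1 y2 : y1 <= y2 -> `|y1| <= rho -> `|y2| <= rho ->
    `|(F (xs + y2) + B * y2) - (F (xs + y1) + B * y1)| <= kappa * `|y2 - y1|.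
  move=> y12 /ler_normlP[y1l y1r] /ler_normlP[y2l y2r].
  pose G v := F (xs + v) + B * v.
  have dG v : y1 <= v -> v <= y2 -> is_derive v 1 G (dF (xs + v) + B).
    move=> v1 v2; have xv0 : 0 < xs + v by lra.
    have ds : is_derive v 1 (fun v : R => xs + v) 1.
      by apply: is_derive_eq (dD (dCst xs v) (dId v)) _; rewrite add0r.
    apply: is_derive_eq (dD (@dComp R F (fun v => xs + v) v _ _ (dF_is_derive xv0) ds) (dZ B (dId v))) _.
    by rewrite !mulr1.
  have cG : {within `[y1, y2], continuous G}.
    by apply: derivable_within_continuous => v; rewrite in_itv/= => /andP[v1 v2]; have [] := dG v v1 v2.
  have dG' v : v \in `]y1, y2[ -> is_derive v 1 G (dF (xs + v) + B).
    by rewrite in_itv/= => /andP[/ltW v1 /ltW v2]; exact: dG.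
  have [v /[!in_itv]/= /andP[v1 v2] GE] := MVT_segment y12 dG' cG.
  rewrite -/(G y2) -/(G y1) GE normrM ler_wpM2r//.
  have := ed (xs + v); rewrite /ball/= opprD addrA subrr sub0r normrN => /(_ _).
  rewrite dF_eq -opprD normrN addrC; apply.
  by apply: le_lt_trans rho_e; apply/ler_normlP; split; lra.
move=> y1 y2 h1 h2; have [y12|y21] := leP y1 y2; last exact: key (ltW y21) _ _.
by rewrite distrC (distrC y1); exact: key.
Qed.

Hypothesis pqr : p / q < 1 - 2 / r.

(** Clearing denominators turns the hypothesis on [p / q] into [2 q < r (q - p)], and multiplication
    by [p / q] gives [2 p < p + B]. This inequality is what makes the modulus condition reach the
    imaginary axis at a positive frequency. *)
Lemma mg_beta_gt : p < B.
Proof.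
rewrite /mg_beta; have h : p / q * (q * r) < (1 - 2 / r) * (q * r).
  by rewrite ltr_pM2r// mulr_gt0.
have {}h : p * r < q * r - 2 * q.
  by move: h; rewrite (_ : p / q * (q * r) = p * r); [rewrite (_ : (1 - 2 / r) * (q * r) = q * r - 2 * q)//|]; field; rewrite gt_eqF.
have : 2 * p < (q - p) * (r * p / q).
  rewrite (_ : 2 * p = 2 * q * (p / q)); last by field; rewrite gt_eqF.
  rewrite (_ : (q - p) * (r * p / q) = (q - p) * r * (p / q)); last by ring.
  by rewrite ltr_pM2r ?divr_gt0//; lra.
lra.
Qed.

End feedback.

Lemma first_crossing {R : realType} (g : R -> R) (rho b : R) : continuous g -> 0 <= b ->
  g 0 < rho -> rho <= g b ->
  exists T, [/\ 0 < T, rho <= g T & forall s, 0 <= s -> s < T -> g s < rho].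
Proof.
move=> gc b0 g0 gb; pose A := [set t : R | 0 <= t /\ rho <= g t].
have hA : has_inf A by split; [exists b|exists 0 => t []].
have A_lb t : A t -> inf A <= t by move=> At; apply: inf_lbound => //; exact: hA.2.
have infA0 : 0 <= inf A by apply: lb_le_inf => [|t []//]; exact: hA.1.
have gA : rho <= g (inf A).
  rewrite leNgt; apply/negP => gi.
  have /nbhs_ballP[e /= e0 ge] : \forall t \near inf A, g t < rho.
    exact: (cvgr_lt (g (inf A)) (gc (inf A))).
  have [t [t0 rt] te] := inf_adherent e0 hA.
  have := ge t; rewrite /ball/= distrC ger0_norm ?subr_ge0 ?A_lb// ltrBlDl => /(_ te).
  by rewrite ltNge rt.
exists (inf A); split=> // [|s s0 sA].
  by rewrite lt_neqAle infA0 andbT; apply/eqP => i0; move: gA; rewrite -i0 leNgt g0.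
by rewrite ltNge; apply/negP => rs; have := A_lb s (conj s0 rs); rewrite leNgt sA.
Qed.

Section solutions.
Context {R : realType}.
Local Notation mu := (@lebesgue_measure R).
Local Notation H := (@heaviside R).
Variables (alpha p q r tau xs : R).
Hypotheses (alpha_gt0 : 0 < alpha) (alpha_le1 : alpha <= 1)
  (p_gt0 : 0 < p) (q_gt0 : 0 < q) (r_gt0 : 0 < r)
  (xs_gt0 : 0 < xs) (xs_eq : rpow r xs = (q - p) / p) (tau_gt0 : 0 < tau).
Local Notation F := (mg_feedback q r).
Local Notation B := (- mg_beta p q r).
Implicit Types (phi x : R -> R) (s t T : R).

(** Agrees with [rpow] where that is defined, and is continuous on the whole line. *)
Let rp (u : R) : R := if r \is a Num.nat then u ^+ Num.truncn r else `|u| `^ r.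

Let rp_cont : continuous rp.
Proof.
rewrite /rp; case: (r \is a Num.nat); last exact: continuous_norm_powR.
by move=> u; exact: exprn_continuous.
Qed.

Let rp_rpow u : rpow_defined r u -> rpow r u = rp u.
Proof. by rewrite /rpow_defined /rpow /rp; case: ifP => //= _ u0; rewrite ger0_norm. Qed.

(** The equation at time [s + tau] guarantees that the power of [x s] is defined and that the
    denominator does not vanish. *)
Lemma mg_feedback_half_line phi x : mg_solution alpha p q r tau phi x ->
  exists2 g, continuous g & forall s, 0 <= s -> g s = F (x s).
Proof.
move=> [_ xc sol]; have zc := continuous_half_line xc.
have val s : 0 <= s -> rpow_defined r (x s) /\ 1 + rp (x s) != 0.
  move=> s0; have st0 : 0 < s + tau by exact: ltr_wpDl.
  have [_ d n _] := sol (s + tau) st0.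
  by move: d n; rewrite addrK => d; rewrite rp_rpow.
pose z s := x ((s + `|s|) / 2).
have z_ge0 s : 0 <= (s + `|s|) / 2 :> R.
  by rewrite divr_ge0//; have := ler_norm (- s); rewrite normrN; lra.
exists (fun s => q * (z s / (1 + rp (z s)))) => [s|s s0].
  apply: cvgM; first exact: cvg_cst.
  apply: cvgM; first exact: zc.
  apply: cvgV; first exact: (val _ (z_ge0 s)).2.
  apply: cvgD; first exact: cvg_cst.
  by apply: (cvg_comp _ _ (zc s)); exact: rp_cont.
have zs : z s = x s by rewrite /z ger0_norm//; congr x; field.
by rewrite /mg_feedback zs (rp_rpow (val s s0).1).
Qed.

Lemma hist_norm_le phi (d : R) : (hist_norm tau (fun t => (phi t - xs)%R) < d%:E)%E ->
  forall s, - tau <= s -> s <= 0 -> `|phi s - xs| <= d.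
Proof.
move=> h s s1 s2; rewrite -lee_fin; apply: le_trans (ltW h).
apply: ereal_sup_ubound; exists s => //.
by rewrite /= in_itv/= s1.
Qed.

Section one_solution.
Variables (phi x : R -> R) (M0 : R).
Hypothesis sol : mg_solution alpha p q r tau phi x.
Hypothesis history_bound : forall s, - tau <= s -> s <= 0 -> `|F (x s)| <= M0.

Let G t := F (x (t - tau)) * H t.

Let xH_bounded : loc_bounded (fun t => x t * H t).
Proof. by have [_ xc _] := sol; exact: loc_bounded_half_line. Qed.

Let G_le T : exists M, forall t, t <= T -> `|G t| <= M.
Proof.
have [g gc gE] := mg_feedback_half_line sol.
have [M gM] : exists M, forall s, 0 <= s -> s <= `|T| -> `|g s| <= M.
  have nc : {within `[0, `|T|], continuous (fun s => `|g s|)}.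
    by apply: continuous_subspaceT => s; apply: cvg_norm; exact: gc.
  have [m _ gm] := EVT_max (normr_ge0 T) nc.
  by exists `|g m| => s s0 sT; apply: gm; rewrite in_itv/= s0.
exists (Num.max 0 (Num.max M0 M)) => t tT; rewrite /G !le_max.
have [t0|t0] := ltP 0 t; last by rewrite heaviside_le0// mulr0 normr0 lexx.
rewrite heavisideE// mulr1; have [ttau|taut] := leP t tau.
  by rewrite history_bound ?orbT//; lra.
have := ler_norm T; have := tau_gt0 => ? ?.
rewrite -gE; last lra.
by rewrite gM ?orbT//; lra.
Qed.

Let caputoG t : 0 < t -> caputo alpha x t + p * x t = F (x (t - tau)).
Proof. by move=> t0; have [_ _ /(_ t t0)[_ _ _ ->]] := sol; rewrite /mg_feedback; ring. Qed.

(** The history is only controlled by a bound and may fail to be measurable: measurability of [G] on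
    the first delay interval is read off the equation, whose Caputo side is measurable. For
    [alpha = 1] the equation also supplies the bound on the derivative. *)
Lemma solution_representation c K : 0 < c -> resolvent alpha c K ->
  loc_bounded G /\ forall t, 0 < t -> x t = x 0 * step_response c K t +
    convol K (fun s => (F (x (s - tau)) + (c - p) * x s) * H s) t.
Proof.
move=> c0 rK; have [_ xc sol'] := sol.
have cdef t : 0 < t -> caputo_defined alpha x t by move=> /sol'[].
have cb : alpha = 1 -> forall T, exists M, forall t, 0 < t -> t <= T -> `|derive1 x t| <= M.
  move=> a1 T; have [M GM] := G_le T; have [_ _ /(_ T)[M' xM]] := xH_bounded.
  exists (M + p * M') => t t0 tT.
  have -> : derive1 x t = G t - p * (x t * H t).
    by rewrite /G -caputoG// heavisideE// /caputo a1 eqxx; ring.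
  apply: le_trans (ler_normB _ _) _; rewrite lerD ?GM// normrM gtr0_norm//.
  by rewrite ler_wpM2l ?xM// ltW.
have [mD repx] := caputo_representation alpha_gt0 alpha_le1 c0 rK xc cdef cb.
split.
  split; last exact: G_le.
    have -> : G = fun t => caputo alpha x t * H t + p * (x t * H t).
      apply/funext => t; rewrite /G; have [t0|t0] := ltP 0 t.
        by rewrite -caputoG// heavisideE//; ring.
      by rewrite heaviside_le0// !mulr0 addr0.
    apply: measurable_funD => //; apply: measurable_funM => //.
    by have [] := xH_bounded.
  by move=> t t0; rewrite /G heaviside_le0 ?mulr0// ltW.
move=> t t0; rewrite repx//; congr (_ + _); apply: eq_Rintegral => s _; congr (_ * _).
have [s0|s0] := ltP 0 s; last by rewrite heaviside_le0// !mulr0.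
by rewrite -caputoG//; congr (_ * _); ring.
Qed.

Let Y t := (x t - xs) * H t.
Let f t := (F (x (t - tau)) - p * xs + B * delay tau Y t) * H t.

Lemma deviation_bounded : loc_bounded Y.
Proof.
have -> : Y = fun t => x t * H t - xs * H t by apply/funext => t; rewrite /Y mulrBl.
exact: (loc_boundedB xH_bounded (loc_boundedZ xs (@loc_bounded_heaviside R))).
Qed.

(** The rate [c] is free: [c = p] gives the form to which [char_op] applies, and [c = p + B] the one
    where the undelayed part of the feedback joins the decay. As [Y] is cut at 0, the history enters
    during the first delay through [f]. *)
Lemma deviation_representation c K : 0 < c -> resolvent alpha c K ->
  loc_bounded f /\ forall t, Y t = (x 0 - xs) * step_response c K t +
    convol K (fun s => f s - B * delay tau Y s + (c - p) * Y s) t.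
Proof.
move=> c0 rK; have [Gb repx] := solution_representation c0 rK.
have kl := resolvent_loc_L1 rK.
have Hb := @loc_bounded_heaviside R; have Yb := deviation_bounded.
have Ydb := loc_bounded_delay (ltW tau_gt0) Yb.
have dH t : delay tau Y t * H t = delay tau Y t.
  have [t0|t0] := ltP 0 t; first by rewrite heavisideE ?mulr1.
  by rewrite /delay /Y (heaviside_le0 (x := t - tau)) ?mulr0 ?mul0r//; have := tau_gt0; lra.
have fE : f = fun t => (G t - p * xs * H t) + B * delay tau Y t.
  by apply/funext => t; rewrite /f !mulrDl -(mulrA B) dH /G mulNr.
have GHb : loc_bounded (fun t => G t - p * xs * H t).
  by apply: loc_boundedB => //; exact: loc_boundedZ.
have fb : loc_bounded f by rewrite fE; apply: loc_boundedD => //; exact: loc_boundedZ.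
split=> // t.
have [t0|t0] := ltP 0 t; last first.
  rewrite {1}/Y heaviside_le0// mulr0 (step_response_causal rK)// mulr0 add0r.
  rewrite convol_left0//; first exact: resolvent_causal rK.
  have gb : loc_bounded (fun s => f s - B * delay tau Y s + (c - p) * Y s).
    by apply: loc_boundedD; [apply: loc_boundedB => //|]; exact: loc_boundedZ.
  by have [_] := gb.
have gE : (fun s => f s - B * delay tau Y s + (c - p) * Y s) =
    (fun s => (F (x (s - tau)) + (c - p) * x s) * H s - (c * xs) * H s).
  by apply/funext => s; rewrite fE /G /Y; ring.
have FHb : loc_bounded (fun s => (F (x (s - tau)) + (c - p) * x s) * H s).
  have -> : (fun s => (F (x (s - tau)) + (c - p) * x s) * H s) =
      (fun s => G s + (c - p) * (x s * H s)) by apply/funext => s; rewrite /G; ring.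
  exact: (loc_boundedD Gb (loc_boundedZ (c - p) xH_bounded)).
rewrite gE convolBr//; last exact: loc_boundedZ.
rewrite convolZr; [|by have [] := kl|exact: measurable_heaviside].
rewrite /Y heavisideE// mulr1 (repx t t0) /step_response heavisideE//.
by ring.
Qed.

Variables (kappa rho d T : R) (k kP : R -> R).
Hypotheses (kappa_ge0 : 0 <= kappa) (d_gt0 : 0 < d) (d_le : d <= rho) (B_gt0 : 0 < B).
Hypotheses (rk : resolvent alpha p k) (rkP : resolvent alpha (p + B) kP).
Hypothesis lip : forall y1 y2, `|y1| <= rho -> `|y2| <= rho ->
  `|(F (xs + y1) + B * y1) - (F (xs + y2) + B * y2)| <= kappa * `|y1 - y2|.
Hypothesis hist : forall s, - tau <= s -> s <= 0 -> `|x s - xs| <= d.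
Hypothesis close : forall s, 0 <= s -> s < T -> `|x s - xs| <= rho.

Let rho_gt0 : 0 < rho. Proof. exact: lt_le_trans d_le. Qed.
Let FE := mg_feedback_eq p_gt0 q_gt0 xs_eq.

(** On [t <= tau] the delayed deviation is a history value of size at most [d], and [f], which there
    still contains the linear feedback, is at most [(B + kappa) d]. Later [f] is the Lipschitz
    remainder, valid while the solution stays within [rho]; its differences over a delay are free of
    the history only after two delays. *)
Lemma solution_forced : forced p B tau k kP (B + kappa) kappa d T (x 0 - xs) Y f.
Proof.
have P_gt0 : 0 < p + B by rewrite addr_gt0.
have [fb rep] := deviation_representation p_gt0 rk.
have [_ repP] := deviation_representation P_gt0 rkP.
have Yb := deviation_bounded; have Ydb := loc_bounded_delay (ltW tau_gt0) Yb.
have kl := resolvent_loc_L1 rk; have tau0 := tau_gt0.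
have Y0 t : t <= 0 -> Y t = 0 by move=> t0; rewrite /Y heaviside_le0// mulr0.
have f0 t : t <= 0 -> f t = 0 by move=> t0; rewrite /f heaviside_le0// mulr0.
have lip0 y : `|y| <= rho -> `|F (xs + y) - p * xs + B * y| <= kappa * `|y|.
  move=> yr; have := lip yr (_ : `|0| <= rho); rewrite normr0 => /(_ (ltW rho_gt0)).
  by rewrite addr0 mulr0 addr0 subr0 FE addrAC.
have fhist t : 0 < t -> t <= tau -> `|f t| <= (B + kappa) * d.
  move=> t0 tt; rewrite /f heavisideE// mulr1 /delay Y0 ?mulr0 ?addr0; last lra.
  pose y := x (t - tau) - xs.
  have yd : `|y| <= d by apply: hist; lra.
  have -> : x (t - tau) = xs + y by rewrite /y; ring.
  have -> : F (xs + y) - p * xs = (F (xs + y) - p * xs + B * y) - B * y by ring.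
  apply: le_trans (ler_normB _ _) _; rewrite mulrDl addrC lerD//.
    by rewrite normrM gtr0_norm// ler_wpM2l// ltW.
  by apply: le_trans (lip0 y (le_trans yd d_le)) _; rewrite ler_wpM2l.
have flater t : tau < t -> f t = F (xs + Y (t - tau)) - p * xs + B * Y (t - tau).
  move=> taut; rewrite /f heavisideE ?mulr1; last lra.
  by rewrite /delay /Y heavisideE ?mulr1 ?subr_gt0// (_ : xs + (x (t - tau) - xs) = x (t - tau))//; ring.
have Yrho t : tau < t -> t < T -> `|Y (t - tau)| <= rho.
  by move=> taut tT; rewrite /Y heavisideE ?mulr1 ?subr_gt0//; apply: close; lra.
have Lk0 : 0 <= (B + kappa) * d by rewrite mulr_ge0 ?addr_ge0// ltW.
split=> //.
- by apply: hist; lra.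
- move=> t; rewrite /char_op rep mul1r -addrA -convolZr; [|by have [] := kl|by have [] := Ydb].
  rewrite -convolDr//; last 2 first.
  + apply: loc_boundedD; last exact: loc_boundedZ.
    by apply: loc_boundedB => //; exact: loc_boundedZ.
  + exact: loc_boundedZ.
  by congr (_ + convol k _ t); apply/funext => s; ring.
- move=> t; rewrite repP; congr (_ + convol kP _ t); apply/funext => s; ring.
- move=> t tT; have [t0|t0] := ltP 0 t; last first.
    have /andP[pb _] := pulse_bounds t tau_gt0.
    by rewrite f0// normr0; apply: addr_ge0; apply: mulr_ge0.
  have [tt|taut] := leP t tau.
    by rewrite pulseE// t0 tt mulr1 ler_wpDl ?mulr_ge0// fhist.
  rewrite flater// pulseE// (_ : (t <= tau)%R = false) ?andbF ?mulr0 ?addr0; last first.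
    by apply/negbTE; rewrite -ltNge.
  by rewrite lip0// Yrho.
- move=> t tT; have tau2 : 0 < 2 * tau by rewrite mulr_gt0.
  have [t0|t0] := ltP 0 t; last first.
    rewrite /delay !f0 ?subr0 ?normr0//; last lra.
    have /andP[pb _] := pulse_bounds t tau2.
    by apply: addr_ge0; apply: mulr_ge0.
  have [tt|taut] := leP t tau.
    rewrite {1}/delay (f0 (t - tau)) ?subr0; last lra.
    rewrite pulseE// t0 (_ : (t <= 2 * tau)%R) ?mulr1; last lra.
    by rewrite ler_wpDl ?mulr_ge0// fhist.
  have [tt2|tau2t] := leP t (2 * tau).
    rewrite pulseE// t0 tt2 mulr1; apply: le_trans (ler_normB _ _) _; apply: lerD.
      rewrite flater// {2}/delay /delay (Y0 (t - tau - tau)) ?subr0; last lra.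
      by rewrite lip0// Yrho.
    by apply: fhist; lra.
  rewrite pulseE// (_ : (t <= 2 * tau)%R = false) ?andbF ?mulr0 ?addr0; last first.
    by apply/negbTE; rewrite -ltNge.
  rewrite {1}/delay !flater; [|lra|lra].
  have := lip (Yrho t taut tT) (_ : `|Y (t - tau - tau)| <= rho).
  have tt : tau < t - tau by lra.
  have tT' : t - tau < T by lra.
  move=> /(_ (Yrho _ tt tT')); rewrite -[delay tau Y t]/(Y (t - tau)).
  rewrite -[delay tau (delay tau Y) t]/(Y (t - tau - tau)); apply: le_trans.
  rewrite le_eqVlt; apply/orP; left; apply/eqP; congr `|_|; ring.
Qed.

End one_solution.

Variables (m e0 : R) (k kP : R -> R).
Hypotheses (B_gt0 : 0 < B) (m_gt0 : 0 < m) (m_le1 : m <= 1) (e0_gt0 : 0 < e0).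
Hypotheses (rk : resolvent alpha p k) (rkP : resolvent alpha (p + B) kP).
Hypothesis freq : forall s e, 0 <= s -> s <= 1 -> 0 < e -> e < e0 ->
  char_bound alpha p B tau m s e.

Lemma mg_close eps : 0 < eps -> exists2 d, 0 < d &
  forall phi x, mg_solution alpha p q r tau phi x ->
  (hist_norm tau (fun t => (phi t - xs)%R) < d%:E)%E ->
  (forall t, 0 <= t -> `|x t - xs| < eps) /\ x t @[t --> +oo] --> xs.
Proof.
move=> eps0.
have [kap0 kap0_gt0 sg] := small_gain_exists p_gt0 B_gt0 m_gt0.
have {}sg := sg _ (ltW kap0_gt0) (lexx kap0).
have [rho [rho0 rhox lip]] := mg_feedback_lipschitz p_gt0 q_gt0 xs_gt0 xs_eq kap0_gt0.
have L0 : 0 <= B + kap0 by rewrite addr_ge0// ltW.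
have [C C0 sup] := sup_forced alpha_gt0 alpha_le1 p_gt0 B_gt0 tau_gt0 m_gt0 m_le1 e0_gt0
  rk rkP freq L0.
have C1 : 0 < C + 1 by rewrite addr_gt0.
pose n := Num.min rho eps; have n0 : 0 < n by rewrite lt_min rho0.
pose d := n / 2 / (C + 1); have d0 : 0 < d by rewrite !divr_gt0.
have dE : C * d + d = n / 2 by rewrite /d; field; rewrite gt_eqF.
have Cd0 : 0 < C * d by rewrite mulr_gt0.
have nrho : n <= rho by rewrite ge_min lexx.
have neps : n <= eps by rewrite ge_min lexx orbT.
have d_rho : d < rho by lra.
have d_eps : d < eps by lra.
have Cd_rho : C * d < rho by lra.
have Cd_eps : C * d < eps by lra.
exists d => // phi x sol hd.
have hist s : - tau <= s -> s <= 0 -> `|x s - xs| <= d.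
  by move=> s1 s2; have [xE _ _] := sol; rewrite xE ?s1 ?s2//; exact: hist_norm_le hd _ s1 s2.
have hb s : - tau <= s -> s <= 0 -> `|F (x s)| <= p * xs + (B + kap0) * rho.
  move=> s1 s2; have xd := hist s s1 s2.
  have xr : `|x s - xs| <= rho by apply: le_trans xd (ltW d_rho).
  have := lip _ 0 xr; rewrite normr0 => /(_ (ltW rho0)).
  rewrite addr0 mulr0 addr0 subr0 (mg_feedback_eq p_gt0 q_gt0 xs_eq).
  rewrite (_ : xs + (x s - xs) = x s); last by ring.
  move=> h; have -> : F (x s) = p * xs + ((F (x s) + B * (x s - xs) - p * xs) - B * (x s - xs)) by ring.
  apply: le_trans (ler_normD _ _) _; apply: lerD; first by rewrite ger0_norm// mulr_ge0// ltW.
  apply: le_trans (ler_normB _ _) _; rewrite mulrDl addrC; apply: lerD.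
    by rewrite normrM gtr0_norm// ler_wpM2l// ltW.
  by apply: le_trans h _; rewrite ler_wpM2l// ltW.
have fT T : (forall s, 0 <= s -> s < T -> `|x s - xs| <= rho) -> _ :=
  solution_forced sol hb (ltW kap0_gt0) d0 (ltW d_rho) B_gt0 rk rkP lip hist (T := T).
have bound T : (forall s, 0 <= s -> s < T -> `|x s - xs| <= rho) ->
    forall t, 0 < t -> t <= T -> `|x t - xs| <= C * d.
  move=> /fT/(sup _ _ _ _ _ _ (ltW kap0_gt0) sg d0) h t t0 /h.
  by rewrite heavisideE// mulr1.
(* Continuity argument: the estimate applies up to the first time [T] at which the deviation reaches
   [rho], and at [T] itself it gives at most [C d < rho]. *)
have small t : 0 <= t -> `|x t - xs| < rho.
  move=> t0; rewrite ltNge; apply/negP => tr.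
  pose g s := `|x ((s + `|s|) / 2) - xs|.
  have gE s : 0 <= s -> g s = `|x s - xs|.
    by move=> s0; rewrite /g (ger0_norm s0) (_ : (s + s) / 2 = s)//; field.
  have gc : continuous g.
    move=> s; apply: cvg_norm; apply: cvgB; last exact: cvg_cst.
    by have [_ xc _] := sol; exact: (continuous_half_line xc).
  have g0 : g 0 < rho by rewrite gE//; apply: le_lt_trans d_rho; apply: hist; rewrite ?lexx// oppr_le0 ltW.
  have gt : rho <= g t by rewrite gE.
  have [T [T0 gT gs]] := first_crossing gc t0 g0 gt.
  have cl s : 0 <= s -> s < T -> `|x s - xs| <= rho.
    by move=> s0 sT; rewrite -gE//; apply/ltW; exact: gs.
  have := le_lt_trans (bound T cl T T0 (lexx T)) Cd_rho.
  by rewrite -gE ?(ltW T0)// ltNge gT.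
have smallT T s : 0 <= s -> s < T -> `|x s - xs| <= rho by move=> s0 _; apply/ltW/small.
split=> [t t0|].
  move: t0; rewrite le_eqVlt => /predU1P[<-|t0].
    by apply: le_lt_trans d_eps; apply: hist; rewrite ?lexx// oppr_le0 ltW.
  by apply: le_lt_trans Cd_eps; exact: (bound t (smallT t)).
have := cvg_forced alpha_gt0 alpha_le1 p_gt0 B_gt0 tau_gt0 m_gt0 m_le1 e0_gt0
  rk rkP freq L0 (ltW kap0_gt0) sg d0 (fun T => fT T (smallT T)).
move=> Yc; have : (x t - xs) * H t + xs @[t --> +oo] --> 0 + xs.
  by apply: cvgD => //; exact: cvg_cst.
rewrite add0r; apply: cvg_trans; apply: near_eq_cvg; near=> t.
by rewrite heavisideE ?mulr1 ?subrK//; near: t; apply: nbhs_pinfty_gt; exact: num_real.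
Unshelve. all: end_near. Qed.

End solutions.

Lemma mg_stable_positive {R : realType} (alpha p q r tau xs : R) :
  0 < alpha -> alpha <= 1 -> 0 < p -> 0 < q -> 0 < r -> 0 < xs ->
  rpow r xs = (q - p) / p -> p / q < 1 - 2 / r ->
  0 < tau -> tau < tau_star alpha p q r -> mg_asymptotically_stable alpha p q r tau xs.
Proof.
move=> a0 a1 p0 q0 r0 xs0 xsE pqr tau0.
have pB := mg_beta_gt p0 q0 r0 pqr; set B := - mg_beta p q r in pB.
have B0 : 0 < B by exact: lt_trans pB.
have om0 : 0 < crossing alpha p B `^ alpha^-1 by rewrite powR_gt0// crossing_gt0.
have betaE : mg_beta p q r = - B by rewrite opprK.
rewrite /tau_star betaE sqrrN.
rewrite (tau_starE a0 a1 p0 pB (negbT (gt_eqF om0))) ltr_pdivlMr// mulrC => tau_lt.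
have [k rk] := resolvent_exists a0 a1 p0.
have [kP rkP] := resolvent_exists a0 a1 (addr_gt0 p0 B0).
have [m [e0 [m0 m1 e00 freq]]] := char_bound_axis a0 a1 p0 pB tau0 rk tau_lt.
have close := mg_close a0 a1 p0 q0 r0 xs0 xsE tau0 B0 m0 m1 e00 rk rkP freq.
split=> [eps eps0|].
  by have [d d0 h] := close eps eps0; exists d => // phi x sol /(h phi x sol)[].
by have [d d0 h] := close 1 ltr01; exists d => // phi x sol /(h phi x sol)[].
Qed.

(** * A root in the right half plane *)

Section clamp.
Context {R : realType}.

Lemma continuous_clamp (f : R -> R) a b : a <= b -> {within `[a, b], continuous f} ->
  continuous (fun t => f (Num.max a (Num.min t b))).
Proof.
move=> ab fc t; have pos u : `[a, b]%classic (Num.max a (Num.min u b)).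
  by rewrite /= in_itv/= le_max lexx ge_max ab ge_min lexx orbT.
have /subspace_continuousP/(_ _ (pos t)) := fc; apply: cvg_comp => P /= wP.
have mc : continuous (fun u => Num.max a (Num.min u b)).
  move=> u; apply: (@continuous_max R _ (fun=> a) (fun u => Num.min u b)) => //; first exact: cvg_cst.
  by apply: (@continuous_min R _ (fun u => u) (fun=> b)) => //; exact: cvg_cst.
have mc' : nbhs t ((fun u => Num.max a (Num.min u b)) @^-1` [set x | `[a, b]%classic x -> P x]).
  exact: (mc t _ wP).
by apply: filterS mc' => u /= h; apply: h; exact: pos.
Qed.

Lemma clamp_id (a b t : R) : a <= t -> t <= b -> Num.max a (Num.min t b) = t.
Proof. by move=> at_ tb; rewrite (min_idPl tb); apply/max_idPr. Qed.

Lemma first_hit (g : R -> R) (rho b : R) : continuous g -> 0 <= b ->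
  g 0 < rho -> rho <= g b ->
  exists T, [/\ 0 < T, T <= b, g T = rho & forall s, 0 <= s -> s < T -> g s < rho].
Proof.
move=> gc b0 g0 gb; have [T [T0 gT gs]] := first_crossing gc b0 g0 gb.
exists T; split=> //.
  by rewrite leNgt; apply/negP => bT; have := gs b b0 bT; rewrite ltNge gb.
apply/eqP; rewrite eq_le gT andbT leNgt; apply/negP => Tg.
have /nbhs_ballP[e /= e0 ge] : \forall t \near T, rho < g t by exact: (cvgr_gt (g T) (gc T)).
pose s := Num.max 0 (T - e / 2).
have s0 : 0 <= s by rewrite le_max lexx.
have sT : s < T by rewrite gt_max T0/= ltrBlDr ltrDl divr_gt0.
have := ge s; rewrite /ball/= gtr0_norm ?subr_gt0//.
have sTe : T - e / 2 <= s by rewrite le_max lexx orbT.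
have se : T - s < e by lra.
by move=> /(_ se); rewrite ltNge ltW// gs.
Qed.

End clamp.

(** * The modulus curve and its phase *)

Section root_curve.
Context {R : realType}.
Variables (alpha p B tau : R).
Hypotheses (alpha_gt0 : 0 < alpha) (alpha_le1 : alpha <= 1) (p_gt0 : 0 < p) (pB : p < B)
  (tau_gt0 : 0 < tau).
Implicit Types (rho th a : R).

Let B_gt0 : 0 < B. Proof. exact: lt_trans pB. Qed.
Let pi_pos := @pi_gt0 R.

(* [|z^alpha + p|^2] at [z = rho e^(i th)]. *)
Let Q rho th : R := (`|rho| `^ alpha) ^+ 2 + 2 * p * `|rho| `^ alpha * cos (alpha * th) + p ^+ 2.
(** Its zeros form the curve of the modulus condition. It increases with the radius and decreases
    with the angle, which makes the curve a graph over the angle. *)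
Let N rho th : R := Q rho th - B ^+ 2 * expR (- (2 * tau * (rho * cos th))).

Let alpha_th th : 0 <= th -> th <= pi / 2 -> 0 <= alpha * th <= pi / 2.
Proof.
move=> t0 t1; rewrite mulr_ge0 ?(ltW alpha_gt0)//=; apply: le_trans t1.
by rewrite ler_piMl.
Qed.

Let cos_ge0 th : 0 <= th -> th <= pi / 2 -> 0 <= cos th.
Proof. by move=> t0 t1; apply: cos_ge0_pihalf; rewrite t1 andbT; have := pi_pos; lra. Qed.

Let cosa_ge0 th : 0 <= th -> th <= pi / 2 -> 0 <= cos (alpha * th).
Proof. by move=> t0 t1; have /andP[] := alpha_th t0 t1; exact: cos_ge0. Qed.

Let cos_lt (t1 t2 : R) : 0 <= t1 -> t1 < t2 -> t2 <= pi / 2 -> cos t2 < cos t1.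
Proof.
by move=> h1 h2 h3; rewrite ltr_cos// in_itv/=; apply/andP; split; have := pi_pos; lra.
Qed.

Let pw_lt r1 r2 : 0 <= r1 -> r1 < r2 -> `|r1| `^ alpha < `|r2| `^ alpha.
Proof.
move=> r10 r12; rewrite !ger0_norm ?(le_trans r10 (ltW r12))//.
by apply: gt0_ltr_powR; rewrite ?nnegrE// (le_trans r10)// ltW.
Qed.

Let Q_inc th r1 r2 : 0 <= th -> th <= pi / 2 -> 0 <= r1 -> r1 < r2 -> Q r1 th < Q r2 th.
Proof.
move=> t0 t1 r10 r12; rewrite /Q ltrD2r; have h := pw_lt r10 r12.
apply: ltr_leD; first by rewrite ltr_pXn2r// nnegrE powR_ge0.
by rewrite ler_wpM2r ?cosa_ge0// ler_wpM2l ?(ltW h)// mulr_ge0// ltW.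
Qed.

Let N_inc th r1 r2 : 0 <= th -> th <= pi / 2 -> 0 <= r1 -> r1 < r2 -> N r1 th < N r2 th.
Proof.
move=> t0 t1 r10 r12; rewrite /N; apply: ltr_leB; first exact: Q_inc.
rewrite ler_wpM2l ?sqr_ge0// ler_expR lerN2 ler_wpM2l ?mulr_ge0 ?(ltW tau_gt0)//.
by rewrite ler_wpM2r ?cos_ge0// ltW.
Qed.

Let N_dec rho (t1 t2 : R) : 0 < rho -> 0 <= t1 -> t1 < t2 -> t2 <= pi / 2 -> N rho t2 < N rho t1.
Proof.
move=> r0 h1 h2 h3; have cl := cos_lt h1 h2 h3; rewrite /N; apply: ler_ltB.
  rewrite /Q lerD2r lerD2l ler_wpM2l ?mulr_ge0 ?powR_ge0 ?(ltW p_gt0)//.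
  apply/ltW/cos_lt; [by rewrite mulr_ge0// ltW|by rewrite ltr_pM2l|].
  by have /andP[] := alpha_th (le_trans h1 (ltW h2)) h3.
rewrite ltr_pM2l ?exprn_gt0// ltr_expR ltrN2 ltr_pM2l ?mulr_gt0//.
by rewrite ltr_pM2l.
Qed.

Local Notation om := (crossing alpha p B `^ alpha^-1).

Let om_gt0 : 0 < om. Proof. by rewrite powR_gt0// crossing_gt0. Qed.

Let omE : `|om| `^ alpha = crossing alpha p B.
Proof.
rewrite gtr0_norm// -powRrM mulVf ?gt_eqF// powRr1//.
exact/ltW/crossing_gt0.
Qed.

Let N_om : N om (pi / 2) = 0.
Proof.
rewrite /N /Q omE cos_pihalf mulr0 mulr0 oppr0 expR0 mulr1.
rewrite -(crossingE alpha p_gt0 pB) (mulrA alpha); ring.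
Qed.

Let N_0 th : N 0 th < 0.
Proof.
rewrite /N /Q normr0 powR0 ?gt_eqF// expr0n/= mulr0 !mul0r mulr0 oppr0 expR0 mulr1 !add0r.
by rewrite subr_lt0 ltr_pXn2r// nnegrE ltW.
Qed.

Let N_cont_rho th : continuous (N ^~ th).
Proof.
have cp := continuous_norm_powR alpha_gt0.
move=> r; apply: cvgB.
  apply: cvgD; last exact: cvg_cst.
  apply: cvgD; first by apply: cvgM; exact: cp.
  apply: cvgM; last exact: cvg_cst.
  by apply: cvgM; [exact: cvg_cst|exact: cp].
apply: cvgM; first exact: cvg_cst.
apply: (cvg_comp _ expR); last exact: continuous_expR.
apply: cvgN; apply: cvgM; first exact: cvg_cst.
by apply: cvgM; [exact: cvg_id|exact: cvg_cst].
Qed.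

Let N_cont_th rho : continuous (N rho).
Proof.
move=> t; apply: cvgB.
  apply: cvgD; last exact: cvg_cst.
  apply: cvgD; first exact: cvg_cst.
  apply: cvgM; first exact: cvg_cst.
  apply: (cvg_comp _ cos); last exact: continuous_cos.
  by apply: cvgM; [exact: cvg_cst|exact: cvg_id].
apply: cvgM; first exact: cvg_cst.
apply: (cvg_comp _ expR); last exact: continuous_expR.
apply: cvgN; apply: cvgM; first exact: cvg_cst.
by apply: cvgM; [exact: cvg_cst|exact: continuous_cos].
Qed.

Let N_inj th r1 r2 : 0 <= th -> th <= pi / 2 -> 0 <= r1 -> 0 <= r2 ->
  N r1 th = 0 -> N r2 th = 0 -> r1 = r2.
Proof.
move=> t0 t1 r10 r20 h1 h2; apply/eqP; case: ltgtP => // h.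
  by have := N_inc t0 t1 r10 h; rewrite h1 h2 ltxx.
by have := N_inc t0 t1 r20 h; rewrite h1 h2 ltxx.
Qed.

(** Strict monotonicity of [N] in both variables gives one radius per angle, increasing with the
    angle. An increasing function onto an interval is continuous, and surjectivity is the
    intermediate value theorem in the angle. *)
Let curve : exists rho : R -> R, forall th, 0 <= th -> th <= pi / 2 ->
  [/\ 0 < rho th, N (rho th) th = 0 & {within `[0, pi / 2], continuous rho}].
Proof.
have ph0 : 0 <= pi / 2 :> R by rewrite divr_ge0// ltW.
have ex th : exists r, 0 <= th -> th <= pi / 2 -> 0 < r /\ N r th = 0.
  case: (boolP ((0 <= th) && (th <= pi / 2))) => [/andP[t0 t1]|h]; last first.
    by exists 0 => t0 t1; rewrite t0 t1 in h.
  have Nom : 0 <= N om th.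
    move: t1; rewrite le_eqVlt => /predU1P[->|t1]; first by rewrite N_om.
    by apply/ltW; rewrite -N_om; exact: N_dec.
  have [r] : exists2 r, r \in `[0, om] & N r th = 0.
    apply: IVT; [exact: ltW|exact: continuous_subspaceT|].
    by rewrite ge_min le_max (ltW (N_0 th)) Nom orbT.
  rewrite in_itv/= => /andP[r0 _] Nr; exists r => _ _; split=> //.
  rewrite lt_neqAle r0 andbT; apply/eqP => rE.
  by have := N_0 th; rewrite [in N 0 th]rE Nr ltxx.
have {ex}[rho rhoP] := choice ex; exists rho.
suff cont : {within `[0, pi / 2], continuous rho}.
  by move=> th t0 t1; have [] := rhoP th t0 t1.
have lt12 t1 t2 : 0 <= t1 -> t1 < t2 -> t2 <= pi / 2 -> rho t1 < rho t2.
  move=> h1 h2 h3; rewrite ltNge; apply/negP => h.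
  have [r1 N1] := rhoP t1 h1 (le_trans (ltW h2) h3).
  have [r2 N2] := rhoP t2 (le_trans h1 (ltW h2)) h3.
  have := N_dec r2 h1 h2 h3; rewrite N2 ltNge => /negP; apply; rewrite -N1.
  move: h; rewrite le_eqVlt => /predU1P[->//|h].
  by apply/ltW/N_inc => //; [exact: le_trans (ltW h2) h3|exact: ltW].
apply: segment_inc_surj_continuous.
  apply: le_mono_in => t1 t2; rewrite !in_itv/= => /andP[h1 _] /andP[_ h2] h.
  exact: lt12.
move=> r /=; rewrite in_itv/= => /andP[r1 r2].
have [ra Na] := rhoP 0 (lexx _) ph0; have [rb Nb] := rhoP _ ph0 (lexx _).
have r0 : 0 < r by exact: lt_le_trans r1.
have N0r : 0 <= N r 0.
  rewrite -[leLHS]Na; move: r1; rewrite le_eqVlt => /predU1P[->//|r1].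
  by apply/ltW/N_inc => //; exact: ltW.
have Npr : N r (pi / 2) <= 0.
  rewrite -[leRHS]Nb; move: r2; rewrite le_eqVlt => /predU1P[->//|r2].
  by apply/ltW/N_inc => //; exact: ltW.
have [t] : exists2 t, t \in `[0, pi / 2] & N r t = 0.
  apply: IVT => //; first exact: continuous_subspaceT.
  by rewrite ge_min le_max N0r Npr orbT.
rewrite in_itv/= => /andP[t0 t1] Nt; exists t; first by rewrite /= in_itv/= t0.
have [rt Nrt] := rhoP t t0 t1.
by apply: (@N_inj t) => //; exact: ltW.
Qed.

(* [Re z^alpha] is nondecreasing, and [|z|] increasing, in [Im z >= 0]. *)
Let Q_vertical a (t1 t2 : R) : 0 < a -> 0 <= t1 -> t1 < t2 -> t2 < pi / 2 ->
  Q (a / cos t1) t1 < Q (a / cos t2) t2.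
Proof.
move=> a0 h1 h2 h3; have pp := pi_pos.
have cpos t : t1 <= t -> t <= t2 -> 0 < cos t.
  by move=> u1 u2; apply: cos_gt0_pihalf; apply/andP; split; lra.
have c1 := cpos t1 (lexx _) (ltW h2); have c2 := cpos t2 (ltW h2) (lexx _).
pose g t := cos (alpha * t) * (cos t) `^ (- alpha).
have dg t : t1 <= t -> t <= t2 ->
    is_derive t 1 g (alpha * (cos t) `^ (- alpha - 1) * sin (t - alpha * t)).
  move=> u1 u2; have ct := cpos t u1 u2.
  have d1 := @dComp R cos (fun t => alpha * t) t _ _ (is_derive_cos _) (dZ alpha (dId t)).
  have d2 := @dComp R (fun u => u `^ (- alpha)) cos t _ _ (is_derive1_powR (- alpha) ct) (is_derive_cos t).
  apply: is_derive_eq (dM d1 d2) _; rewrite sinB.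
  have -> : cos t `^ (- alpha) = cos t * cos t `^ (- alpha - 1).
    by rewrite -[X in X * _]powRr1 ?ltW// -powRD_gt0//; congr (_ `^ _); ring.
  by ring.
have g12 : g t1 <= g t2.
  have gc : {within `[t1, t2], continuous g}.
    by apply: derivable_within_continuous => t; rewrite in_itv/= => /andP[u1 u2]; have [] := dg t u1 u2.
  have dg' t : t \in `]t1, t2[ -> is_derive t 1 g (alpha * (cos t) `^ (- alpha - 1) * sin (t - alpha * t)).
    by rewrite in_itv/= => /andP[/ltW u1 /ltW u2]; exact: dg.
  have [t /[!in_itv]/= /andP[u1 u2] E] := MVT_segment (ltW h2) dg' gc.
  rewrite -subr_ge0 E mulr_ge0 ?subr_ge0 ?(ltW h2)// mulr_ge0 ?mulr_ge0 ?powR_ge0 ?(ltW alpha_gt0)//.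
  have t0 : 0 <= t by lra.
  have at0 : alpha * t <= t by rewrite ler_piMl.
  by apply: sin_ge0_pi; rewrite subr_ge0 at0/= (le_trans (_ : _ <= t))// ?gerBl ?mulr_ge0 ?(ltW alpha_gt0)//; lra.
have pwE t : t1 <= t -> t <= t2 -> `|a / cos t| `^ alpha * cos (alpha * t) = a `^ alpha * g t.
  move=> u1 u2; have ct := cpos t u1 u2.
  rewrite gtr0_norm ?divr_gt0// powRM ?invr_ge0 ?(ltW ct) ?(ltW a0)// /g powRN.
  by rewrite -powR_inv1 ?(ltW ct)// -powRrM mulN1r powRN; ring.
rewrite /Q ltrD2r; apply: ltr_leD.
  rewrite ltr_pXn2r ?nnegrE ?powR_ge0//; apply: pw_lt; first by rewrite divr_ge0 ?ltW.
  by rewrite ltr_pM2l// ltf_pV2// cos_lt// ltW.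
rewrite -!mulrA !ler_pM2l// !pwE ?lexx ?(ltW h2)//.
by rewrite ler_wpM2l ?powR_ge0.
Qed.

(** If the second point had at least the real part of the first, the modulus condition would make
    [|z^alpha + p|] no larger there, whereas moving upwards and then outwards from the first point
    increases it. In particular a vertical line meets the curve at most once in [Im z >= 0]. *)
Let rho_cos_lt rho1 rho2 t1 t2 : 0 < rho1 -> 0 < rho2 -> 0 <= t1 -> t1 < t2 -> t2 < pi / 2 ->
  N rho1 t1 = 0 -> N rho2 t2 = 0 -> rho2 * cos t2 < rho1 * cos t1.
Proof.
move=> r1 r2 h1 h2 h3 /eqP; rewrite subr_eq0 => /eqP N1 /eqP; rewrite subr_eq0 => /eqP N2.
have pp := pi_pos.
have c1 : 0 < cos t1 by apply: cos_gt0_pihalf; apply/andP; split; lra.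
have c2 : 0 < cos t2 by apply: cos_gt0_pihalf; apply/andP; split; lra.
rewrite ltNge; apply/negP => h.
have Q12 : Q rho2 t2 <= Q rho1 t1.
  rewrite N1 N2 ler_wpM2l ?sqr_ge0// ler_expR lerN2 ler_wpM2l// mulr_ge0// ltW//.
have := Q_vertical (mulr_gt0 r1 c1) h1 h2 h3; rewrite mulfK ?gt_eqF//.
rewrite ltNge => /negP; apply; apply: le_trans Q12.
have : rho1 * cos t1 / cos t2 <= rho2 by rewrite ler_pdivrMr.
rewrite le_eqVlt => /predU1P[->//|h']; apply/ltW/Q_inc => //; [lra|lra|].
by rewrite divr_ge0 ?mulr_ge0// ltW.
Qed.

Let expR_ln_sqr (a M : R) : 0 < M -> expR (a * (ln (M ^+ 2) / 2)) = M `^ a.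
Proof. by move=> M0; rewrite /powR gt_eqF// lnXn// mulr2n; congr expR; field. Qed.

Lemma zpow_of_polar rho th : 0 < rho -> 0 <= th -> th < pi / 2 ->
  zpow_re alpha (rho * cos th) (rho * sin th) = `|rho| `^ alpha * cos (alpha * th) /\
  zpow_im alpha (rho * cos th) (rho * sin th) = `|rho| `^ alpha * sin (alpha * th).
Proof.
move=> r0 t0 t1; have pp := pi_pos.
have c0 : 0 < cos th by apply: cos_gt0_pihalf; apply/andP; split; lra.
have sq : (rho * cos th) ^+ 2 + (rho * sin th) ^+ 2 = rho ^+ 2.
  by rewrite !exprMn -mulrDr cos2Dsin2 mulr1.
have at_ : atan (rho * sin th / (rho * cos th)) = th.
  rewrite -mulf_div divff ?gt_eqF// mul1r -/(tan th) tanK// in_itv/=.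
  by apply/andP; split; lra.
by rewrite /zpow_re /zpow_im sq at_ expR_ln_sqr// gtr0_norm.
Qed.

Let X rho th := `|rho| `^ alpha * cos (alpha * th) + p.
Let Y rho th := `|rho| `^ alpha * sin (alpha * th).

Let X_gt0 rho th : 0 <= th -> th <= pi / 2 -> 0 < X rho th.
Proof. by move=> t0 t1; rewrite ltr_wpDl// mulr_ge0 ?powR_ge0 ?cosa_ge0. Qed.

Let XYE rho th : X rho th ^+ 2 + Y rho th ^+ 2 = Q rho th.
Proof.
rewrite /Q /X /Y; have cs := cos2Dsin2 (alpha * th); move: cs.
move: (cos _) (sin _) => c s cs; rewrite exprMn.
have -> : s ^+ 2 = 1 - c ^+ 2 by rewrite -cs addrAC subrr add0r.
by ring.
Qed.

Let modulus_polar rho th : 0 < rho -> 0 <= th -> th <= pi / 2 -> N rho th = 0 ->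
  let d := atan (Y rho th / X rho th) in
  let M := B * expR (- (rho * cos th * tau)) in
  X rho th = M * cos d /\ Y rho th = M * sin d.
Proof.
move=> r0 t0 t1 /eqP; rewrite subr_eq0 => /eqP NE d M.
have M0 : 0 < M by rewrite mulr_gt0 ?expR_gt0.
have ME : X rho th ^+ 2 + Y rho th ^+ 2 = M ^+ 2.
  rewrite XYE NE exprMn; congr (_ * _); rewrite -expRM_natl; congr expR; ring.
have := zpow_polar (Y rho th) (X_gt0 rho t0 t1).
rewrite ME -[ln _ / 2]mul1r expR_ln_sqr// powRr1 ?(ltW M0)// => -[-> ->].
by [].
Qed.

(** Argument of [(z^alpha + p) exp(z tau)]. On the curve this product has modulus [B], so [z] is a
    root exactly when the phase is an odd multiple of [pi]. *)
Let phase rho th := atan (Y rho th / X rho th) + tau * (rho * sin th).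

Let atan_phase rho th : 0 < rho -> 0 < th -> th < pi / 2 ->
  0 < atan (Y rho th / X rho th) < pi / 2.
Proof.
move=> r0 t0 t1; rewrite atan_ltpi2 andbT.
have /andP[_ at1] := alpha_th (ltW t0) (ltW t1); have pp := pi_pos.
have q0 : 0 < Y rho th / X rho th.
  rewrite divr_gt0 ?X_gt0 ?(ltW t0) ?(ltW t1)// mulr_gt0//.
    by rewrite powR_gt0// normr_gt0 gt_eqF.
  by apply: sin_gt0_pi; rewrite mulr_gt0//=; lra.
have := q0; rewrite -{1}[Y rho th / X rho th]atanK.
case: (ltrP 0 (atan (Y rho th / X rho th))) => // h; rewrite ltNge => /negP[].
rewrite /tan pmulr_lle0.
  by rewrite -oppr_ge0 -sinN; apply: sin_ge0_pi; rewrite oppr_ge0 h/=; have := atan_gtNpi2 (Y rho th / X rho th); lra.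
by rewrite invr_gt0 cos_gt0_pihalf// atan_gtNpi2 atan_ltpi2.
Qed.

Let root_of_phase rho th : 0 < rho -> 0 < th -> th < pi / 2 -> N rho th = 0 ->
  phase rho th = pi ->
  [/\ 0 < rho * sin th * tau, rho * sin th * tau < pi,
    zpow_re alpha (rho * cos th) (rho * sin th) + p +
      B * expR (- (rho * cos th * tau)) * cos (rho * sin th * tau) = 0 &
    zpow_im alpha (rho * cos th) (rho * sin th) -
      B * expR (- (rho * cos th * tau)) * sin (rho * sin th * tau) = 0].
Proof.
move=> r0 t0 t1 NE; have pp := pi_pos.
have [-> ->] := zpow_of_polar r0 (ltW t0) t1.
rewrite -/(X rho th) -/(Y rho th).
have /= := modulus_polar r0 (ltW t0) (ltW t1) NE.
have /andP[] := atan_phase r0 t0 t1.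
rewrite /phase (mulrC tau); move: (atan _) => d d0 d1 [-> ->]; set b := rho * sin th * tau.
move=> db; have -> : d = pi - b by lra.
rewrite [cos (pi - b)]cosB [sin (pi - b)]sinB cospi sinpi; split; [|lra|ring|ring].
by rewrite /b !mulr_gt0// sin_gt0_pi// t0/=; lra.
Qed.

(** A root on this vertical line satisfies the modulus condition, so up to conjugation it is the
    given point of the curve, whose phase lies strictly between two consecutive odd multiples of
    [pi]. Compactness and growth turn the absence of roots into a lower bound. *)
Let free_of_phase rho th : 0 < rho -> 0 < th -> th < pi / 2 -> N rho th = 0 ->
  pi < phase rho th -> phase rho th < 3 * pi ->
  exists2 m, 0 < m & char_bound alpha p B tau m 1 (rho * cos th).
Proof.
move=> r0 t0 t1 NE ph1 ph2; have pp := pi_pos.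
have c0 : 0 < cos th by apply: cos_gt0_pihalf; apply/andP; split; lra.
set a := rho * cos th; have a0 : 0 < a by rewrite mulr_gt0.
pose M := B * expR (- (a * tau)); have M0 : 0 < M by rewrite mulr_gt0 ?expR_gt0.
pose U w := zpow_re alpha a w + p; pose V w := zpow_im alpha a w.
pose G w := (U w + M * cos (w * tau)) ^+ 2 + (V w - M * sin (w * tau)) ^+ 2.
pose L w := U w ^+ 2 + V w ^+ 2.
have polar w : 0 <= w -> exists r t, [/\ 0 < r, 0 <= t, t < pi / 2, r * cos t = a & r * sin t = w].
  move=> w0; have [h1 h2] := zpow_polar w a0.
  exists (expR (ln (a ^+ 2 + w ^+ 2) / 2)), (atan (w / a)); split; rewrite ?expR_gt0 ?atan_ltpi2//.
  rewrite leNgt; apply/negP => ht; move: w0; rewrite -h2 pmulr_rge0 ?expR_gt0// leNgt => /negP; apply.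
  by rewrite -oppr_gt0 -sinN sin_gt0_pi// oppr_gt0 ht/=; have := atan_gtNpi2 (w / a); lra.
have UVN w : U (- w) = U w /\ V (- w) = - V w.
  by rewrite /U /V /zpow_re /zpow_im sqrrN mulNr atanN mulrN cosN sinN mulrN.
have Gpos0 w : 0 <= w -> 0 < G w.
  move=> w0; rewrite lt_neqAle addr_ge0 ?sqr_ge0// andbT; apply/eqP => /esym/eqP.
  rewrite paddr_eq0 ?sqr_ge0// !sqrf_eq0 addr_eq0 subr_eq0 => /andP[/eqP UE /eqP VE].
  have [r [t [rp tp tp2 ra rw]]] := polar w w0.
  have [zr zi] := zpow_of_polar rp tp tp2.
  have LM : L w = M ^+ 2.
    rewrite /L UE VE sqrrN !exprMn -mulrDr cos2Dsin2 mulr1//.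
  have Nr : N r t = 0.
    apply/eqP; rewrite subr_eq0; apply/eqP; rewrite -XYE /X /Y -zr -zi ra rw -/(U w) -/(V w) -/(L w) LM.
    by rewrite exprMn; congr (_ * _); rewrite -expRM_natl; congr expR; ring.
  have tt : t = th.
    apply/eqP; case: ltgtP => // h.
      by have := rho_cos_lt rp r0 tp h t1 Nr NE; rewrite ra -/a ltxx.
    by have := rho_cos_lt r0 rp (ltW t0) h tp2 NE Nr; rewrite ra -/a ltxx.
  have rr : r = rho by apply: (mulIf (negbT (gt_eqF c0))); rewrite -{1}tt ra.
  rewrite rr tt in zr zi rw ra; move: UE VE; rewrite /U /V -ra -rw zr zi -/(X rho th) -/(Y rho th).
  have /= := modulus_polar r0 (ltW t0) (ltW t1) NE; move: ph1 ph2.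
  rewrite /phase (mulrC tau); set b := rho * sin th * tau; rewrite -/a -/M.
  move: (atan _) => d ph1 ph2 [-> ->].
  rewrite -mulrN => /(mulfI (negbT (gt_eqF M0))) cE /(mulfI (negbT (gt_eqF M0))) sE.
  have : cos (d + b) = -1 by rewrite cosD cE sE -[RHS]/(- 1) -(cos2Dsin2 b); ring.
  have -> : d + b = (d + b - pi) / 2 + (d + b - pi) / 2 + pi by field.
  rewrite cosDpi => /oppr_inj; rewrite cosD.
  have s0 : 0 < sin ((d + b - pi) / 2) by apply: sin_gt0_pi; apply/andP; split; lra.
  have := cos2Dsin2 ((d + b - pi) / 2); have := mulr_gt0 s0 s0; rewrite !expr2; lra.
have Gpos w : 0 < G w.
  have [w0|w0] := leP 0 w; first exact: Gpos0.
  rewrite (_ : G w = G (- w)); first by apply: Gpos0; rewrite oppr_ge0 ltW.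
  by have [h1 h2] := UVN w; rewrite /G h1 h2 mulNr cosN sinN; ring.
have lnc (w : R) : {for w, continuous (fun w : R => ln (a ^+ 2 + w ^+ 2) / 2)}.
  have D0 : 0 < a ^+ 2 + w ^+ 2 by rewrite ltr_wpDr ?sqr_ge0// exprn_gt0.
  apply: cvgM; last exact: cvg_cst.
  apply: (@cvg_comp _ _ _ (fun w : R => a ^+ 2 + w ^+ 2) (@ln R) _ (nbhs (a ^+ 2 + w ^+ 2))); last exact: continuous_ln.
  by apply: cvgD; [exact: cvg_cst|exact: exprn_continuous].
have atc : continuous (fun w : R => alpha * atan (w / a)).
  move=> w; apply: cvgM; first exact: cvg_cst.
  apply: (cvg_comp _ (@atan R)); last exact: continuous_atan.
  by apply: cvgM; [exact: cvg_id|exact: cvg_cst].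
have exc : continuous (fun w : R => expR (alpha * (ln (a ^+ 2 + w ^+ 2) / 2))).
  move=> w; apply: (cvg_comp _ (@expR R)); last exact: continuous_expR.
  by apply: cvgM; [exact: cvg_cst|exact: lnc].
have Uc : continuous U.
  move=> w; apply: cvgD; last exact: cvg_cst.
  apply: cvgM; first exact: exc.
  by apply: (cvg_comp _ (@cos R)); [exact: atc|exact: continuous_cos].
have Vc : continuous V.
  move=> w; apply: cvgM; first exact: exc.
  by apply: (cvg_comp _ (@sin R)); [exact: atc|exact: continuous_sin].
have tauc (w : R) : (fun u : R => u * tau) u @[u --> w] --> w * tau by apply: cvgM; [exact: cvg_id|exact: cvg_cst].
have sqc (f : R -> R) : continuous f -> continuous (fun w : R => f w ^+ 2).
  by move=> fc w; apply: (cvg_comp _ (fun y : R => y ^+ 2)); [exact: fc|exact: exprn_continuous].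
have Gc : continuous G.
  move=> w; apply: cvgD; [apply: (sqc (fun w => U w + M * cos (w * tau)))|apply: (sqc (fun w => V w - M * sin (w * tau)))] => {}w.
    apply: cvgD; first exact: Uc.
    apply: cvgM; first exact: cvg_cst.
    by apply: (cvg_comp _ (@cos R)); [exact: tauc|exact: continuous_cos].
  apply: cvgB; first exact: Vc.
  apply: cvgM; first exact: cvg_cst.
  by apply: (cvg_comp _ (@sin R)); [exact: tauc|exact: continuous_sin].
have Lc : continuous L by move=> w; apply: cvgD; exact: sqc.
have UL w : (`|w| `^ alpha) ^+ 2 <= L w.
  have w2 : `|w| `^ alpha <= expR (alpha * (ln (a ^+ 2 + w ^+ 2) / 2)).
    rewrite /powR normr_eq0; have [->|w0] := eqVneq w 0.
      by rewrite gt_eqF//=; exact: expR_ge0.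
    rewrite ler_expR ler_pM2l// ler_pdivlMr// mulr_natr -lnXn ?normr_gt0//.
    rewrite real_normK ?num_real// ler_ln ?posrE ?exprn_even_gt0//; last first.
      by rewrite ltr_wpDr ?sqr_ge0// exprn_gt0.
    by rewrite lerDr sqr_ge0.
  have c1 : 0 <= cos (alpha * atan (w / a)).
    rewrite -cos_norm normrM gtr0_norm//; apply: cosa_ge0 => //.
    by rewrite ler_norml ltW ?atan_gtNpi2// ltW// atan_ltpi2.
  rewrite /L /U /V /zpow_re /zpow_im.
  have cs := cos2Dsin2 (alpha * atan (w / a)); move: c1 cs w2 (expR_ge0 (alpha * (ln (a ^+ 2 + w ^+ 2) / 2))).
  move: (cos _) (sin _) (expR _) (`|w| `^ alpha) (powR_ge0 `|w| alpha) => c s E A A0 c1 cs AE E0.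
  have -> : (E * c + p) ^+ 2 + (E * s) ^+ 2 = E ^+ 2 + 2 * p * (E * c) + p ^+ 2.
    by rewrite [(E * s) ^+ 2]exprMn (_ : s ^+ 2 = 1 - c ^+ 2); [ring|rewrite -cs; ring].
  apply: (@le_trans _ _ (E ^+ 2)); first by rewrite ler_pXn2r.
  by rewrite -addrA lerDl addr_ge0 ?sqr_ge0// !mulr_ge0// ltW.
(* Beyond [W] one has [|z^alpha + p| >= 2 M], so that adding a term of modulus [M] leaves at least
   half of it, whence the [1/4]. *)
pose W := (2 * M) `^ alpha^-1.
have WW : - W <= W by rewrite ge0_cp// powR_ge0.
have [w1 _ G1] := EVT_min WW (continuous_subspaceT Gc).
have [w2 _ L2] := EVT_max WW (continuous_subspaceT Lc).
have L_ge0 w : 0 <= L w by rewrite addr_ge0 ?sqr_ge0.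
have K0 : 0 < L w2 + 1 by rewrite ltr_wpDl.
exists (Num.min 4^-1 (G w1 / (L w2 + 1))); first by rewrite lt_min invr_gt0 ltr0n/= divr_gt0.
move=> w; rewrite mul1r -/M -/(U w) -/(V w) -/(L w) -/(G w).
have [wW|wW] := boolP (w \in `[- W, W]).
  apply: le_trans (G1 w wW); apply: (@le_trans _ _ (G w1 / (L w2 + 1) * L w)).
    by rewrite ler_wpM2r// ge_min lexx orbT.
  rewrite mulrAC ler_pdivrMr// ler_wpM2l ?(ltW (Gpos _))//.
  by apply: le_trans (L2 w wW) _; rewrite lerDl.
apply: (@le_trans _ _ (4^-1 * L w)); first by rewrite ler_wpM2r// ge_min lexx.
have Ww : W < `|w| by rewrite ltNge ler_norml; move: wW; rewrite in_itv.
have ML : 4 * M ^+ 2 <= L w.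
  apply: le_trans (UL w); rewrite (_ : 4 * M ^+ 2 = (2 * M) ^+ 2); last by ring.
  have M20 : 0 <= 2 * M by rewrite mulr_ge0// ltW.
  rewrite ler_pXn2r ?nnegrE ?powR_ge0//.
  have -> : 2 * M = W `^ alpha by rewrite /W -powRrM mulVf ?gt_eqF// powRr1.
  by rewrite ge0_ler_powR ?nnegrE ?powR_ge0// ltW.
have cs := cos2Dsin2 (w * tau); move: ML; rewrite /G /L.
move: (U w) (V w) (cos _) (sin _) cs => u v c s cs ML.
have h1 := sqr_ge0 (u + 2 * M * c); have h2 := sqr_ge0 (v - 2 * M * s).
rewrite -subr_ge0.
have -> : (u + M * c) ^+ 2 + (v - M * s) ^+ 2 - 4^-1 * (u ^+ 2 + v ^+ 2) =
  ((u + 2 * M * c) ^+ 2 + (v - 2 * M * s) ^+ 2) / 2 +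
  (u ^+ 2 + v ^+ 2 - 4 * M ^+ 2 * (c ^+ 2 + s ^+ 2)) / 4 by field.
by rewrite cs mulr1; lra.
Qed.

(** The phase is 0 on the real axis and [crossing_angle + om tau > pi] on the imaginary axis. The
    root is taken at the largest angle of phase [pi]; a slightly larger angle has phase in []pi, 3
    pi[] and a smaller real part, and gives the root-free line. *)
Lemma unstable_root : pi - crossing_angle alpha p B < om * tau ->
  exists a0 b0 kap m, [/\ 0 < kap < a0, 0 < b0 * tau < pi,
    zpow_re alpha a0 b0 + p + B * expR (- (a0 * tau)) * cos (b0 * tau) = 0,
    zpow_im alpha a0 b0 - B * expR (- (a0 * tau)) * sin (b0 * tau) = 0 &
    0 < m /\ char_bound alpha p B tau m 1 kap].
Proof.
move=> om_tau; have pp := pi_pos.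
have ph0 : 0 < pi / 2 :> R by rewrite divr_gt0.
have [rho rhoP] := curve.
have rhoc : {within `[0, pi / 2], continuous rho} by have [] := rhoP 0 (lexx _) (ltW ph0).
pose cl t : R := Num.max 0 (Num.min t (pi / 2)).
have clc : continuous cl.
  apply: (@continuous_clamp R id 0 (pi / 2) (ltW ph0)); apply: continuous_subspaceT => t.
  exact: cvg_id.
have rc : continuous (fun t => rho (cl t)) by exact: continuous_clamp (ltW ph0) rhoc.
have cl01 t : 0 <= cl t /\ cl t <= pi / 2.
  by rewrite /cl le_max lexx ge_max (ltW ph0) ge_min lexx orbT.
have clid t : 0 <= t -> t <= pi / 2 -> cl t = t by exact: clamp_id.
pose Phi t := phase (rho (cl t)) (cl t).
have comp (f g : R -> R) : continuous f -> continuous g -> continuous (fun t => f (g t)).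
  by move=> fc gc t; apply: (cvg_comp _ f); [exact: gc|exact: fc].
have ac : continuous (fun t => alpha * cl t) by move=> t; apply: cvgM; [exact: cvg_cst|exact: clc].
have pwc := comp _ _ (continuous_norm_powR alpha_gt0) rc.
have Phic : continuous Phi.
  move=> t; apply: cvgD; last first.
    apply: cvgM; first exact: cvg_cst.
    by apply: cvgM; [exact: rc|exact: comp (@continuous_sin R) clc t].
  apply: (cvg_comp _ (@atan R)); last exact: continuous_atan.
  apply: cvgM.
    by apply: cvgM; [exact: pwc|exact: comp (@continuous_sin R) ac t].
  apply: cvgV; first by have [h1 h2] := cl01 t; rewrite gt_eqF// X_gt0.
  apply: cvgD; last exact: cvg_cst.
  by apply: cvgM; [exact: pwc|exact: comp (@continuous_cos R) ac t].
have rho_end : rho (pi / 2) = om.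
  have [r0 N0 _] := rhoP _ (ltW ph0) (lexx _).
  by apply: (@N_inj (pi / 2)) => //; exact: ltW.
have Phi_end : pi < Phi (pi / 2).
  rewrite /Phi clid ?(ltW ph0)// rho_end /phase sin_pihalf mulr1.
  have [cE sE th0 thpi] := crossing_angleE alpha_gt0 alpha_le1 p_gt0 pB.
  have wE : `|om| `^ alpha = crossing alpha p B := omE.
  have -> : Y om (pi / 2) / X om (pi / 2) = tan (crossing_angle alpha p B).
    rewrite /tan cE sE /X /Y wE mulrA; field.
    rewrite gt_eqF//=; have := X_gt0 om (ltW ph0) (lexx _); rewrite /X wE mulrA => /gt_eqF ->//.
  rewrite tanK; first by rewrite mulrC; lra.
  rewrite in_itv/=; apply/andP; split; first lra.
  rewrite ltNge; apply/negP => h.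
  have : cos (crossing_angle alpha p B) <= 0.
    rewrite -[crossing_angle _ _ _](subrK pi) cosDpi oppr_le0; apply: cos_ge0_pihalf; apply/andP; split; lra.
  rewrite cE leNgt => /negP; apply; rewrite divr_gt0//.
  by have := X_gt0 om (ltW ph0) (lexx _); rewrite /X wE mulrA.
have Phi0 : Phi 0 = 0.
  by rewrite /Phi clid ?(ltW ph0)// /phase /Y mulr0 sin0 !mulr0 mul0r atan0 addr0.
(* Angles are read downwards from [pi / 2], so that the first hit is the largest angle. *)
pose g t := - Phi (pi / 2 - t).
have gc : continuous g.
  move=> t; apply: cvgN; apply: (cvg_comp _ Phi); last exact: Phic.
  by apply: cvgB; [exact: cvg_cst|exact: cvg_id].
have g0 : g 0 < - pi by rewrite /g subr0 ltrN2.
have gb : - pi <= g (pi / 2) by rewrite /g subrr Phi0 oppr0 oppr_le0 ltW.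
have [T [T0 Tb gT gs]] := first_hit gc (ltW ph0) g0 gb.
pose th0 := pi / 2 - T.
have PhiT : Phi th0 = pi by apply: oppr_inj; rewrite -gT.
have th00 : 0 < th0.
  rewrite lt_neqAle subr_ge0 Tb andbT; apply/eqP => h.
  by move: PhiT; rewrite -h Phi0; lra.
have /nbhs_ballP[e /= e0 ge] : \forall t \near th0, Phi t < 3 * pi.
  by apply: (cvgr_lt (Phi th0) (Phic th0)); rewrite PhiT; lra.
pose th1 := th0 + Num.min (e / 2) (T / 2).
have d0 : 0 < Num.min (e / 2) (T / 2) by rewrite lt_min !divr_gt0.
have de : Num.min (e / 2) (T / 2) <= e / 2 by rewrite ge_min lexx.
have dT : Num.min (e / 2) (T / 2) <= T / 2 by rewrite ge_min lexx orbT.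
have th01 : th0 < th1 by rewrite ltrDl.
have th1pi : th1 < pi / 2 by rewrite /th1 /th0; lra.
have Phi1 : pi < Phi th1.
  have := gs (pi / 2 - th1); rewrite /g subKr ltrN2; apply; first lra.
  by rewrite /th1 /th0 in th01 *; lra.
have Phi3 : Phi th1 < 3 * pi.
  apply: ge; rewrite /ball/= distrC gtr0_norm ?subr_gt0// /th1; lra.
have th1_ge0 : 0 <= th1 by lra.
have [r0 N0 _] := rhoP th0 (ltW th00) (ltW (lt_trans th01 th1pi)).
have [r1 N1 _] := rhoP th1 th1_ge0 (ltW th1pi).
have th0pi : th0 < pi / 2 by lra.
have th1_gt0 : 0 < th1 by lra.
have cl0 : cl th0 = th0 by apply: clid; lra.
have cl1 : cl th1 = th1 by apply: clid; lra.
rewrite /Phi cl0 in PhiT; rewrite /Phi cl1 in Phi1 Phi3.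
have [b1 b2 e1 e2] := root_of_phase r0 th00 th0pi N0 PhiT.
have [m m0 cb] := free_of_phase r1 th1_gt0 th1pi N1 Phi1 Phi3.
exists (rho th0 * cos th0), (rho th0 * sin th0), (rho th1 * cos th1), m; split=> //.
- rewrite (rho_cos_lt r0 r1 (ltW th00) th01 th1pi N0 N1) andbT mulr_gt0//.
  by apply: cos_gt0_pihalf; apply/andP; split; lra.
- by rewrite b1.
Qed.

End root_curve.

(** * A perturbed solution *)

Section odd_saturation.
Context {R : realType}.
Variables (q r : R).
Hypotheses (q_gt0 : 0 < q) (r_gt0 : 0 < r).
Implicit Types (u v t : R).

(* Odd extension of [mg_feedback] from the half line, which is C^1. *)
Definition odd_feedback v : R := q * (v / (1 + `|v| `^ r)).
Definition odd_feedback' v : R := q * ((1 + `|v| `^ r - r * `|v| `^ r) / (1 + `|v| `^ r) ^+ 2).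

Let D_gt0 v : 0 < 1 + `|v| `^ r.
Proof. by rewrite ltr_wpDr ?powR_ge0. Qed.

Let D_cont : continuous (fun v : R => 1 + `|v| `^ r).
Proof. by move=> v; apply: cvgD; [exact: cvg_cst|exact: continuous_norm_powR]. Qed.

Lemma odd_feedbackE v : 0 <= v -> odd_feedback v = mg_feedback q r v.
Proof. by move=> v0; rewrite /mg_feedback rpow_powR// /odd_feedback ger0_norm. Qed.

Lemma odd_feedback_ge0 v : 0 <= v -> 0 <= odd_feedback v.
Proof. by move=> v0; rewrite mulr_ge0 ?(ltW q_gt0)// divr_ge0// ltW. Qed.

(** The difference quotient at 0 is [g] itself; this handles the absolute values at the origin. *)
Lemma is_derive_id_mul (g : R -> R) : {for 0, continuous g} ->
  is_derive (0 : R) (1 : R) (fun v : R => v * g v) (g 0).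
Proof.
move=> gc; have c : h^-1 *: ((h%:A + 0) * g (h%:A + 0) - 0 * g 0) @[h --> 0^'] --> g 0.
  have gc' : g h @[h --> 0^'] --> g 0 by apply: cvg_trans gc; apply: cvg_app; exact: nbhs_dnbhs.
  apply: cvg_trans gc'; apply: near_eq_cvg; near=> h.
  have h0 : h != 0 by near: h; exact: nbhs_dnbhs_neq.
  by rewrite mul0r subr0 addr0 /GRing.scale/= mulr1 mulKf.
apply: DeriveDef; first by apply/cvg_ex; exists (g 0).
exact: cvg_lim c.
Unshelve. all: end_near. Qed.

Lemma odd_feedback_is_derive v : is_derive v 1 odd_feedback (odd_feedback' v).
Proof.
have pos u : 0 < u -> is_derive u 1 odd_feedback (odd_feedback' u).
  move=> u0; rewrite /odd_feedback' gtr0_norm//.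
  have nE : \forall v \near u, (fun v : R => q * (v / (1 + v `^ r))) v = odd_feedback v.
    near=> x; rewrite /odd_feedback ger0_norm//; near: x.
    by apply: filterS (lt_nbhsr u0) => x /ltW.
  exact: near_eq_is_derive nE (hill_is_derive q r u0).
have [v0|v0|->] := ltgtP v 0; last 2 first.
- exact: pos.
- have c0 : {for (0 : R), continuous (fun v : R => q * (1 + `|v| `^ r)^-1)}.
    by apply: cvgM; [exact: cvg_cst|apply: cvgV; [rewrite gt_eqF|exact: D_cont]].
  have d := is_derive_id_mul c0.
  have -> : odd_feedback = fun v => v * (q * (1 + `|v| `^ r)^-1) by apply/funext => x; rewrite /odd_feedback; ring.
  apply: is_derive_eq d _; rewrite /odd_feedback' normr0 powR0 ?gt_eqF//.
  by field.
- have nv0 : 0 < - v by rewrite oppr_gt0.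
  have -> : odd_feedback = fun v => - odd_feedback (- v).
    by apply/funext => x; rewrite /odd_feedback normrN; ring.
  apply: is_derive_eq (dN (@dComp R odd_feedback (fun x => - x) v _ _ (pos _ nv0) (dN (dId v)))) _.
  by rewrite mulrN1 opprK /odd_feedback' normrN.
Unshelve. all: end_near. Qed.

Lemma odd_feedback'_cont : continuous odd_feedback'.
Proof.
move=> v; have pc : continuous (fun x : R => `|x| `^ r) by exact: continuous_norm_powR.
apply: cvgM; first exact: cvg_cst.
apply: cvgM.
  by apply: cvgB; [exact: D_cont|apply: cvgM; [exact: cvg_cst|exact: pc]].
apply: cvgV; first by rewrite gt_eqF// exprn_gt0.
by apply: cvgM; exact: D_cont.
Qed.

Lemma odd_feedback'_bound v : `|odd_feedback' v| <= q * (1 + r).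
Proof.
rewrite /odd_feedback' normrM gtr0_norm// ler_pM2l//.
have := D_gt0 v; have := powR_ge0 `|v| r; move: (_ `^ r) => A A0 D0.
rewrite normrM normfV (ger0_norm (sqr_ge0 _)) ler_pdivrMr ?exprn_gt0//.
have rA : 0 <= r * A by rewrite mulr_ge0// ltW.
apply: (@le_trans _ _ ((1 + r) * (1 + A))).
  by rewrite ler_norml; apply/andP; split; have := r_gt0; lra.
rewrite ler_pM2l; last by rewrite addr_gt0.
by rewrite expr2 ler_peMl ?(ltW D0)// lerDl.
Qed.

End odd_saturation.

Section hump.
Context {R : realType}.
Variables (tau : R).
Hypothesis tau_gt0 : 0 < tau.
Implicit Types t : R.

Let v t : R := t * (t - tau).

(* [v^2] where [v < 0], that is on [0, tau], and 0 elsewhere. *)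
Definition hump t : R := (v t ^+ 2 - v t * `|v t|) / 2.
Definition hump' t : R := (v t - `|v t|) * (2 * t - tau).

Let v_ge0 t : t <= 0 \/ tau <= t -> 0 <= v t.
Proof.
move=> [t0|t0]; first by rewrite mulr_le0// subr_le0 (le_trans t0)// ltW.
by rewrite mulr_ge0 ?subr_ge0// (le_trans _ t0)// ltW.
Qed.

Lemma hump0 t : t <= 0 \/ tau <= t -> hump t = 0 /\ hump' t = 0.
Proof. by move=> /v_ge0 v0; rewrite /hump /hump' ger0_norm// -expr2 !subrr !mul0r. Qed.

Lemma hump_gt0 t : 0 < t -> t < tau -> 0 < hump t.
Proof.
move=> t0 tt; have v0 : v t < 0 by rewrite nmulr_llt0// subr_lt0.
rewrite /hump ltr0_norm// (_ : _ / 2 = v t ^+ 2); last by field.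
by rewrite exprn_even_gt0//= lt_eqF.
Qed.

Lemma hump_ge0 t : 0 <= hump t.
Proof.
have [t0|t0] := leP t 0; first by rewrite (hump0 (or_introl t0)).1.
have [tt|tt] := leP tau t; first by rewrite (hump0 (or_intror tt)).1.
exact/ltW/hump_gt0.
Qed.

Lemma hump_le t : hump t <= tau ^+ 4.
Proof.
have t4 : 0 <= tau ^+ 4 by rewrite exprn_ge0// ltW.
have [t0|t0] := leP t 0; first by rewrite (hump0 (or_introl t0)).1.
have [tt|tt] := leP tau t; first by rewrite (hump0 (or_intror tt)).1.
have v0 : v t < 0 by rewrite nmulr_llt0// subr_lt0.
rewrite /hump ltr0_norm// (_ : _ / 2 = t ^+ 2 * (tau - t) ^+ 2); last by rewrite /v; field.
have h1 : t ^+ 2 <= tau ^+ 2 by rewrite ler_pXn2r ?nnegrE ?ltW.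
have h2 : (tau - t) ^+ 2 <= tau ^+ 2.
  by have tg := tau_gt0; apply: lerXn2r; rewrite ?nnegrE; lra.
rewrite (_ : tau ^+ 4 = tau ^+ 2 * tau ^+ 2); last by rewrite -exprD.
by apply: ler_pM; rewrite ?sqr_ge0.
Qed.

Lemma hump_is_derive t : is_derive t 1 hump (hump' t).
Proof.
have absd (x : R) : is_derive x 1 (fun y : R => y * `|y|) (2 * `|x|).
  have pos (y : R) : 0 < y -> is_derive y 1 (fun y : R => y * `|y|) (2 * `|y|).
    move=> y0; have nE : \forall z \near y, (fun z : R => z * z) z = z * `|z|.
      near=> z; rewrite ger0_norm//; near: z.
      by apply: filterS (lt_nbhsr y0) => z /ltW.
    apply: near_eq_is_derive nE _; apply: is_derive_eq (dM (dId y) (dId y)) _.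
    by rewrite gtr0_norm//; ring.
  have [x0|x0|->] := ltgtP x 0; last 2 first.
  - exact: pos.
  - apply: is_derive_eq (is_derive_id_mul (@norm_continuous _ R^o 0)) _.
    by rewrite normr0 mulr0.
  - have nx0 : 0 < - x by rewrite oppr_gt0.
    have -> : (fun y : R => y * `|y|) = fun y => - ((fun y => y * `|y|) (- y)).
      by apply/funext => y /=; rewrite normrN; ring.
    apply: is_derive_eq (dN (@dComp R (fun y => y * `|y|) (fun x => - x) x _ _ (pos _ nx0) (dN (dId x)))) _.
    by rewrite normrN; ring.
have dv : is_derive t 1 v (2 * t - tau).
  apply: is_derive_eq (dM (dId t) (dB (dId t) (dCst tau t))) _; rewrite subr0; ring.
have d1 := @dComp R (fun y => y * `|y|) v t _ _ (absd _) dv.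
have d2 := dM (dB (dM dv dv) d1) (dCst 2^-1 t).
have -> : hump = fun t => (v t * v t - v t * `|v t|) * 2^-1 by apply/funext => x; rewrite /hump expr2.
apply: is_derive_eq d2 _; by rewrite mulr0 addr0 /hump'; field.
Unshelve. all: end_near. Qed.

Lemma hump'_cont : continuous hump'.
Proof.
have vc : continuous v.
  move=> t; apply: cvgM; first exact: cvg_id.
  by apply: cvgB; [exact: cvg_id|exact: cvg_cst].
move=> t; apply: cvgM.
  by apply: cvgB; [exact: vc|apply: cvg_norm; exact: vc].
by apply: cvgB; [apply: cvgM; [exact: cvg_cst|exact: cvg_id]|exact: cvg_cst].
Qed.

Lemma hump_cont : continuous hump.
Proof. exact: is_derive_continuous hump_is_derive. Qed.

Lemma loc_bounded_hump : loc_bounded hump.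
Proof.
split; first exact: continuous_measurableT hump_cont.
  by move=> t /ltW t0; rewrite (hump0 (or_introl t0)).1.
by move=> T; exists (tau ^+ 4) => t _; rewrite ger0_norm ?hump_ge0 ?hump_le.
Qed.

Lemma continuous_loc_bounded (f : R -> R) : continuous f -> (forall t, t <= 0 -> f t = 0) -> loc_bounded f.
Proof.
move=> fc f0; have fcH : {within `[0, +oo[, continuous f} by exact: continuous_subspaceT.
have := loc_bounded_half_line fcH; congr loc_bounded; apply/funext => t.
by have [t0|t0] := ltP 0 t; [rewrite heavisideE ?mulr1|rewrite f0// mul0r].
Qed.

End hump.

Section convolutions.
Context {R : realType}.
Local Notation mu := (@lebesgue_measure R).
Local Notation H := (@heaviside R).
Implicit Types (f g h k w : R -> R) (t C T : R).

Lemma convol_assoc_bounded f g h C t : causal f -> causal g ->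
  measurable_fun [set: R] f -> measurable_fun [set: R] g ->
  (forall s, 0 <= f s) -> (forall s, 0 <= g s) ->
  (forall x, L1 (fun s => f (x - s) * g s)) ->
  measurable_fun [set: R] (convol f g) -> (forall x, convol f g x <= C) -> loc_bounded h ->
  L1 (fun s => f (t - s) * convol g h s) /\ convol f (convol g h) t = convol (convol f g) h t.
Proof.
move=> f0 g0 mf mg f_ge0 g_ge0 fg1 mfg fgC hb; have [mh h0 hM] := hb.
apply: conv_assoc => //.
have -> : convol (fun x => `|f x|) (fun x => `|g x|) = convol f g.
  by apply/funext => x; apply: eq_Rintegral => s _; rewrite !ger0_norm.
have fg_ge0 x : 0 <= convol f g x by apply: Rintegral_ge0 => s _; rewrite mulr_ge0.
apply: (L1_le _ _ (L1Z C (L1_norm (loc_bounded_L1 t hb)))).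
  by apply: measurable_funM; [exact: measurable_reflect|exact: measurableT_comp].
move=> s; rewrite !normrM normr_id (ger0_norm (fg_ge0 _)) indicE mem_setE in_itv/=.
have [s0|s0] := ltP s 0; first by rewrite h0// normr0 !(mulr0, mul0r).
have [st|ts] := leP s t; first by rewrite normr1 mulr1 ler_wpM2r.
by rewrite convol_causal// ?mul0r ?normr0 ?mulr0// subr_le0 ltW.
Qed.

Lemma convol_cont k g t : L1 k -> causal k -> loc_bounded g ->
  (forall s, s <= t -> {for s, continuous g}) -> {for t, continuous (convol k g)}.
Proof.
move=> k1 k0 [mg g0 gM] gc; have [M gMt] := gM (t + 1).
(* Freezing [g] after [t + 1] makes it bounded on the whole line without changing the convolution
   near [t]. *)
pose G u := g (Num.min u (t + 1)).
have mG : measurable_fun [set: R] G.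
  by apply: (measurableT_comp mg); apply: measurable_minr.
have Gb u : `|G u| <= M by apply: gMt; rewrite ge_min lexx orbT.
have kG u : u <= t + 1 -> convol k g u = \int[mu]_s (G (u - s) * k s).
  move=> ut; rewrite convolC; last first.
    have [M' gMu] := gM u.
    by apply: (@L1_convol _ k g u M' (loc_L1_intro k1 k0) mg g0 _).1 => s /ltW; exact: gMu.
  apply: eq_Rintegral => s _; have [s0|s0] := ltP 0 s; last by rewrite k0// !mulr0.
  by rewrite /G (min_idPl _)//; lra.
have c : {for t, continuous (fun u => \int[mu]_s (G (u - s) * k s))}.
  apply: (@dominated_cvg_pt _ _ _ (fun s => M * `|k s|)).
  - by move=> u; apply: measurable_funM; [exact: measurable_reflect|exact: L1_measurable k1].
  - move=> s; have [s0|s0] := ltP 0 s; last first.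
      have kz : k s = 0 by exact: k0.
      rewrite kz mulr0 (_ : (fun u => _) = fun=> 0); first exact: cvg_cst.
      by apply/funext => u; rewrite mulr0.
    apply: cvgM; last exact: cvg_cst.
    have tsE : Num.min (t - s) (t + 1) = t - s by apply/min_idPl; lra.
    rewrite /G tsE; apply: (@cvg_comp _ _ _ (fun u => Num.min (u - s) (t + 1)) g _ (nbhs (t - s))); last by apply: gc; lra.
    have : {for t, continuous (fun u : R => Num.min (u - s) (t + 1))}.
      apply: (@continuous_min R _ (fun u : R => u - s) (fun=> t + 1)); last exact: cvg_cst.
      by apply: cvgB; [exact: cvg_id|exact: cvg_cst].
    by rewrite /prop_for /continuous_at tsE.
  - exact: L1Z (L1_norm k1).
  - by move=> u s; rewrite normrM ler_wpM2r.
rewrite /prop_for /continuous_at kG; last by rewrite lerDl.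
apply: cvg_trans c; apply: near_eq_cvg; near=> u; rewrite kG//.
near: u; apply: filterS (lt_nbhsl (_ : t < t + 1)) => [u /ltW//|]; by rewrite ltrDl.
Unshelve. all: end_near. Qed.

Lemma primitive_is_derive w : continuous w -> (forall t, t <= 0 -> w t = 0) ->
  forall t, is_derive t 1 (convol H w) (w t).
Proof.
move=> wc w0 t; have wb := continuous_loc_bounded wc w0.
have wl T : L1 (fun s => w s * \1_`]-oo, T] s).
  apply: L1_le (L1_norm (loc_bounded_L1 T wb)).
    apply: measurable_funM; first exact: continuous_measurableT.
    exact: measurable_indic.
  move=> s; rewrite !normrM !indicE !mem_setE !in_itv/=.
  by have [s0|s0] := ltP s 0; [rewrite w0 ?normr0 ?mul0r// ltW|].
have wi : mu.-integrable `]-oo, (t + 1)] (EFin \o w) by apply/(L1_in _ _); [exact: measurable_itv|exact: wl].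
have t1 : t < t + 1 by rewrite ltrDl.
have [] := continuous_FTC1 t1 wi (ltNyr _) (wc t).
set F := fun x => _; have -> : F = convol H w.
  apply/funext => x; rewrite /F.
  have wo : mu.-integrable `]-oo, x[ (EFin \o w).
    apply: (@integrableS _ _ _ mu `]-oo, x]); [exact: measurable_itv|exact: measurable_itv|by move=> s /=; rewrite !in_itv/=; exact: ltW|].
    by apply/(L1_in _ _); [exact: measurable_itv|exact: wl].
  rewrite -(Rintegral_itv_bndo_bndc wo) int_in; apply: eq_Rintegral => s _.
  by rewrite indicE mem_setE in_itv/= mulrC /heaviside subr_gt0.
move=> d dE; apply: DeriveDef; first exact: d.
by rewrite -derive1E; exact: dE.
Qed.

Lemma L1_convol_loc j g t : loc_L1 j -> loc_bounded g -> L1 (fun s => j (t - s) * g s).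
Proof.
move=> jl [mg g0 gM]; have [M gMt] := gM t.
by apply: (@L1_convol _ j g t M jl mg g0 _).1 => s /ltW; exact: gMt.
Qed.

Lemma loc_L1_bounded g : loc_bounded g -> causal g -> loc_L1 g.
Proof.
move=> gb g0; have := loc_bounded_loc_L1 gb; congr loc_L1; apply/funext => t.
by have [t0|t0] := ltP 0 t; [rewrite heavisideE ?mulr1|rewrite g0// mul0r].
Qed.

Lemma loc_L1_heaviside : loc_L1 H.
Proof. by apply: loc_L1_bounded (@loc_bounded_heaviside R) _ => t; exact: heaviside_le0. Qed.

Lemma loc_bounded_mul (g f : R -> R) C : measurable_fun [set: R] g -> (forall t, `|g t| <= C) ->
  loc_bounded f -> loc_bounded (fun t => g t * f t).
Proof.
move=> mg gC [mf f0 fM]; split; first exact: measurable_funM.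
  by move=> t t0; rewrite f0// mulr0.
move=> T; have [M fMT] := fM T; exists (C * M) => t tT.
by rewrite normrM ler_pM// fMT.
Qed.

Lemma convol_heaviside_cont w : loc_bounded w -> continuous (convol H w).
Proof.
move=> wb t; have [mw w0 wM] := wb; have [M wMt] := wM (t + 1).
have M0 : 0 <= M by apply: le_trans (wMt t _); rewrite ?lerDl.
have lip a c : a <= c -> c <= t + 1 -> `|convol H w c - convol H w a| <= M * (c - a).
  move=> ac ct; rewrite /convol -intB; [|exact: L1_convol_loc loc_L1_heaviside wb|exact: L1_convol_loc loc_L1_heaviside wb].
  rewrite -(int_indic_itv ac) -intZ; last exact: L1_indic_itv.
  apply: int_norm_le; [|by apply: L1Z; exact: L1_indic_itv|].
    apply: measurable_funB; apply: measurable_funM => //; exact: measurable_reflect measurable_heaviside.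
  move=> s; rewrite -mulrBl /heaviside !subr_gt0 indicE mem_setE in_itv/= normrM.
  have [sa|sa] := ltP s a.
    by rewrite (lt_le_trans sa ac) subrr normr0 mul0r mulr_ge0.
  have [sc|sc] := ltP s c; last by rewrite subrr normr0 mul0r mulr_ge0.
  by rewrite subr0 normr1 mul1r (ltW sc) mulr1 wMt// (le_trans (ltW sc)).
apply/cvgrPdist_lt => e e0; have M1 : 0 < M + 1 by rewrite ltr_wpDl.
have e1 : 0 < e / (M + 1) by exact: divr_gt0.
near=> s.
have se : `|t - s| < e / (M + 1) by near: s; exact: (@nbhsx_ballx _ R^o t _ e1).
have s1 : s <= t + 1 by near: s; apply: filterS (lt_nbhsl (_ : t < t + 1)) => [u /ltW//|]; rewrite ltrDl.
apply: (@le_lt_trans _ _ (M * `|t - s|)).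
  have [ts|st] := leP t s.
    by rewrite distrC (distrC t) (ger0_norm (_ : 0 <= s - t)) ?subr_ge0// lip.
  by rewrite (ger0_norm (_ : 0 <= t - s)) ?subr_ge0 ?(ltW st)// lip ?(ltW st)// lerDl.
apply: (@le_lt_trans _ _ ((M + 1) * `|t - s|)); first by rewrite ler_wpM2r// lerDl.
by rewrite mulrC -ltr_pdivlMr.
Unshelve. all: end_near. Qed.

Lemma loc_L1_riesz z : 0 < z -> loc_L1 (riesz z : R -> R).
Proof.
move=> z0; split; [exact: measurable_riesz|by move=> t; exact: riesz_le0|move=> T].
have [T0|T0] := ltP 0 T; first exact: (int_riesz z0 T0).1.
rewrite (_ : (fun t => _) = cst 0); first exact: L1_0.
apply/funext => t /=; have [t0|t0] := leP t 0; first by rewrite riesz_le0// mul0r.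
by rewrite heaviside_le0 ?mulr0// subr_le0 (le_trans T0)// ltW.
Qed.

End convolutions.

Section perturbed_solution.
Context {R : realType}.
Local Notation mu := (@lebesgue_measure R).
Local Notation H := (@heaviside R).
Variables (alpha p q r tau xs eta : R) (k : R -> R).
Hypotheses (alpha_gt0 : 0 < alpha) (alpha_le1 : alpha <= 1) (p_gt0 : 0 < p)
  (q_gt0 : 0 < q) (r_gt0 : 0 < r) (tau_gt0 : 0 < tau) (xs_gt0 : 0 < xs)
  (xs_eq : rpow r xs = (q - p) / p) (eta_ge0 : 0 <= eta).
Hypothesis rk : resolvent alpha p k.
Implicit Types (z w : R -> R) (t s T : R).
Local Notation S := (odd_feedback q r).
Local Notation S' := (odd_feedback' q r).
Local Notation E := (step_response p k).

Let kl := resolvent_loc_L1 rk.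
Let k1 := resolvent_L1 rk.
Let k0 := resolvent_causal rk.
Let k_ge0 := resolvent_ge0 rk.
Let Hb := @loc_bounded_heaviside R.

(* In terms of [w], the derivative of the deviation on [t > 0]: the deviation
   at [t - tau], the feedback it produces, and the derivative of the latter. *)
Let u w t := eta * hump tau t + delay tau (convol H w) t.
Let G w t := S (xs + u w t) - S xs.
Let G' w t := S' (xs + u w t) * (eta * hump' tau t + delay tau w t).

Let u_measurable w : loc_bounded w -> measurable_fun [set: R] (u w).
Proof.
move=> wb; apply: measurable_funD.
  by apply: measurable_funM => //; apply: continuous_measurableT; exact: hump_cont.
apply: measurable_shift; apply: continuous_measurableT; exact: convol_heaviside_cont.
Qed.

Let hump'_bounded : loc_bounded (hump' tau).
Proof.
apply: continuous_loc_bounded; first exact: hump'_cont.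
by move=> t t0; rewrite (hump0 tau_gt0 (or_introl t0)).2.
Qed.

Let G'_bounded w : loc_bounded w -> loc_bounded (G' w).
Proof.
move=> wb; apply: (@loc_bounded_mul _ _ _ (q * (1 + r))).
- have mS : measurable_fun [set: R] S' by apply: continuous_measurableT; exact: odd_feedback'_cont.
  apply: (measurableT_comp mS).
  by apply: measurable_funD => //; exact: u_measurable.
- by move=> t; exact: odd_feedback'_bound.
- by apply: loc_boundedD; [exact: loc_boundedZ|apply: loc_bounded_delay => //; exact: ltW].
Qed.

Let G'_causal z w T : (forall t, t < T -> z t = w t) -> forall t, t < T + tau -> G' z t = G' w t.
Proof.
move=> zw t tT; have tT' : t - tau < T by rewrite ltrBlDr.
have cE : convol H z (t - tau) = convol H w (t - tau).
  apply: eq_Rintegral => s _; have [st|ts] := ltP s (t - tau).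
    by rewrite zw// (lt_trans st).
  by rewrite heaviside_le0 ?mul0r// subr_le0.
by rewrite /G' /u /delay (zw _ tT') cE.
Qed.

(** The unknown is the derivative of the deviation, and the differentiated equation is solved by
    steps. A continuous [w] makes the solution [C^1], which settles absolute continuity and the
    Caputo integral; the history bump vanishes to first order at time 0, so the pieces match. *)
Let W_exists : exists w, [/\ continuous w, loc_bounded w, forall t, t <= 0 -> w t = 0 &
  forall t, w t = convol k (G' w) t].
Proof.
have [|z w T zb wb zw t tT|w wb wE] := @delay_fixpoint _ tau (fun w => convol k (G' w)) tau_gt0.
- by move=> z zb; apply: loc_bounded_convol => //; exact: G'_bounded.
- apply: eq_Rintegral => s _; have [st|ts] := ltP s t; last by rewrite k0 ?mul0r// subr_le0.
  by rewrite (G'_causal zw)// (lt_trans st).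
have [_ G'0 _] := G'_bounded wb; have [_ w0 _] := wb.
exists w; split=> //; last by move=> t t0; rewrite wE convol_left0.
have step n : forall t, t < n%:R * tau -> {for t, continuous w}.
  elim: n => [|n IH] t.
    rewrite mul0r => t0; have c : (fun=> 0 : R) u @[u --> t] --> w t by rewrite w0//; exact: cvg_cst.
    apply: cvg_trans c; apply: near_eq_cvg; near=> s; rewrite w0//.
    by near: s; exact: lt_nbhsl.
  rewrite -natr1 mulrDl mul1r => tn.
  have -> : w = convol k (G' w) by apply/funext.
  apply: convol_cont => // [|s st]; first exact: G'_bounded.
  have uc : {for s, continuous (fun s => xs + u w s)}.
    apply: cvgD; first exact: cvg_cst.
    apply: cvgD; first by apply: cvgM; [exact: cvg_cst|exact: hump_cont].
    apply: (@cvg_comp _ _ _ (fun s => s - tau) (convol H w) _ (nbhs (s - tau))).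
      by apply: cvgB; [exact: cvg_id|exact: cvg_cst].
    exact: convol_heaviside_cont.
  apply: cvgM.
    by apply: (@cvg_comp _ _ _ (fun s => xs + u w s) S' _ (nbhs (xs + u w s))) => //; exact: odd_feedback'_cont.
  apply: cvgD; first by apply: cvgM; [exact: cvg_cst|exact: hump'_cont].
  apply: (@cvg_comp _ _ _ (fun s => s - tau) w _ (nbhs (s - tau))).
    by apply: cvgB; [exact: cvg_id|exact: cvg_cst].
  by apply: IH; lra.
move=> t; apply: (step (Num.truncn (t / tau)).+1).
by rewrite -ltr_pdivrMr//; exact: truncnS_gt.
Unshelve. all: end_near. Qed.

Let convol_kH_le x : convol k H x <= p^-1.
Proof.
rewrite -(resolvent_int rk) -(int_reflect x k1); apply: int_le.
- exact: L1_resolvent_heaviside rk x.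
- exact: L1_reflect.
by move=> s; rewrite ler_piMr ?heaviside_le1.
Qed.

Let mk := L1_measurable k1.
Let mH := @measurable_heaviside R.
Let convol_kH_bounded : loc_bounded (convol k H).
Proof. exact: loc_bounded_convol. Qed.

Let convolHk : convol H k = convol k H.
Proof.
by apply/esym/funext => x; apply: convolC; exact: (L1_resolvent_heaviside rk).
Qed.

Let convol_swap g t : loc_bounded g -> convol H (convol k g) t = convol k (convol H g) t.
Proof.
move=> gb; have [mkH _ _] := convol_kH_bounded.
have H0 : causal H by move=> s; exact: heaviside_le0.
have HkL x : L1 (fun s => H (x - s) * k s).
  have := L1_reflect x (L1_resolvent_heaviside rk x); congr L1; apply/funext => s.
  by rewrite subKr mulrC.
rewrite (@convol_assoc_bounded _ H k g p^-1 t H0 k0 mH mk (@heaviside_ge0 R) k_ge0 HkL _ _ gb).2 ?convolHk//.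
rewrite (@convol_assoc_bounded _ k H g p^-1 t k0 H0 mk mH k_ge0 (@heaviside_ge0 R) _ mkH convol_kH_le gb).2//.
by move=> x; exact: (L1_resolvent_heaviside rk).
Qed.

Let convolE g t : loc_bounded g -> convol E g t = convol H g t - p * convol k (convol H g) t.
Proof.
move=> gb; have [mkH _ _] := convol_kH_bounded.
have H0 : causal H by move=> s; exact: heaviside_le0.
rewrite -(convol_swap t gb).
have HkL x : L1 (fun s => H (x - s) * k s).
  have := L1_reflect x (L1_resolvent_heaviside rk x); congr L1; apply/funext => s.
  by rewrite subKr mulrC.
rewrite (@convol_assoc_bounded _ H k g p^-1 t H0 k0 mH mk (@heaviside_ge0 R) k_ge0 HkL _ _ gb).2 ?convolHk//.
have l2 : loc_L1 (convol k H) by apply: loc_L1_bounded => //; exact: convol_causal.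
rewrite /convol -intZ; last exact: L1_convol_loc l2 gb.
rewrite -intB; [|exact: L1_convol_loc loc_L1_heaviside gb|by apply: L1Z; exact: L1_convol_loc l2 gb].
by apply: eq_Rintegral => s _; rewrite /step_response -/(convol k H _); ring.
Qed.

Lemma perturbed_solution : exists Y, [/\ loc_bounded Y, continuous Y,
  forall t, t <= 0 -> Y t = 0,
  forall t, Y t = convol k (fun s => mg_feedback q r (xs + (eta * hump tau s + delay tau Y s)) - p * xs) t &
  let x t := xs + (eta * hump tau (t + tau) + Y t) in mg_solution alpha p q r tau x x].
Proof.
have [w [wc wb w0 wE]] := W_exists; have G'b := G'_bounded wb.
pose Y := convol H w; pose x t := xs + (eta * hump tau (t + tau) + Y t).
have H0 : causal H by move=> s; exact: heaviside_le0.
have Yd t : is_derive t 1 Y (w t) by exact: primitive_is_derive.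
have Y0 t : t <= 0 -> Y t = 0 by apply: convol_causal.
have Yc : continuous Y by exact: is_derive_continuous Yd.
have Yb : loc_bounded Y by exact: continuous_loc_bounded.
have dshift (a t : R) : is_derive t 1 (fun t : R => t + a) 1.
  by apply: is_derive_eq (dD (dId t) (dCst a t)) _; rewrite addr0.
have Sd v := odd_feedback_is_derive q r_gt0 v.
have Gd t : is_derive t 1 (G w) (G' w t).
  have d1 := @dComp R Y (fun t => t - tau) t _ _ (Yd _) (dshift (- tau) t).
  have d2 := dD (dCst xs t) (dD (dZ eta (hump_is_derive tau t)) d1).
  have d3 := dB (@dComp R S (fun t => xs + u w t) t _ _ (Sd _) d2) (dCst (S xs) t).
  by apply: is_derive_eq d3 _; rewrite mulr1 add0r subr0.
have G0 t : t <= 0 -> G w t = 0.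
  move=> t0; have t1 : t - tau <= 0 by have := tau_gt0; lra.
  rewrite /G /u (hump0 tau_gt0 (or_introl t0)).1 mulr0 add0r /delay -/Y.
  by rewrite (Y0 _ t1) addr0 subrr.
have Gc : continuous (G w) by exact: is_derive_continuous Gd.
have Gb : loc_bounded (G w) by exact: continuous_loc_bounded.
have uc : continuous (u w).
  move=> t; apply: cvgD; first by apply: cvgM; [exact: cvg_cst|exact: hump_cont].
  apply: (cvg_comp _ Y); last exact: Yc.
  by apply: cvgB; [exact: cvg_id|exact: cvg_cst].
have G'c : continuous (G' w).
  move=> t; apply: cvgM.
    apply: (cvg_comp _ S'); last exact: odd_feedback'_cont.
    by apply: cvgD; [exact: cvg_cst|exact: uc].
  apply: cvgD; first by apply: cvgM; [exact: cvg_cst|exact: hump'_cont].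
  apply: (cvg_comp _ w); last exact: wc.
  by apply: cvgB; [exact: cvg_id|exact: cvg_cst].
have G'0 t : t <= 0 -> G' w t = 0.
  move=> t0; rewrite /G' (hump0 tau_gt0 (or_introl t0)).2 mulr0 add0r /delay w0 ?mulr0//.
  by have := tau_gt0; lra.
(* Both sides have derivative [G' w] and vanish for [t <= 0]. The differentiated equation thus
   integrates to [Y = k * G]. *)
have GE : convol H (G' w) = G w.
  have dd t : is_derive t 1 (fun t => convol H (G' w) t - G w t) 0.
    by apply: is_derive_eq (dB (primitive_is_derive G'c G'0 t) (Gd t)) _; rewrite subrr.
  apply/funext => t; apply/eqP; rewrite -subr_eq0; apply/eqP.
  rewrite (is_derive_0_is_cst t 0 dd) G0// subr0; apply: convol_causal => //.
have wE' : convol k (G' w) = w by apply/esym/funext.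
have YE t : Y t = convol k (G w) t by rewrite -GE -(convol_swap t G'b) wE'.
have Sxs : S xs = p * xs by rewrite odd_feedbackE ?ltW// (mg_feedback_eq p_gt0 q_gt0 xs_eq).
have xu t : x (t - tau) = xs + u w t by rewrite /x subrK.
(* By steps: a nonnegative past has nonnegative feedback, so [G >= - p xs], and [p (k * H) <= 1]
   gives [Y >= - xs]. Hence the odd extension coincides with the true feedback along [x]. *)
have x_ge0 t : 0 <= x t.
  have neg s : s <= 0 -> 0 <= x s.
    by move=> s0; rewrite /x Y0// addr0 addr_ge0 ?(ltW xs_gt0)// mulr_ge0 ?hump_ge0.
  have step n : forall t, t < n%:R * tau -> 0 <= x t.
    elim: n => [|n IH] s; first by rewrite mul0r => /ltW; exact: neg.
    rewrite -natr1 mulrDl mul1r => sn; have [s0|s0] := leP s 0; first exact: neg.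
    suff : - xs <= Y s.
      move=> h; have := mulr_ge0 eta_ge0 (hump_ge0 tau_gt0 (s + tau)); rewrite /x; lra.
    rewrite YE; apply: (@le_trans _ _ (- (p * xs) * convol k H s)).
      rewrite mulNr lerN2 mulrAC mulrC -[leRHS]mulr1 ler_wpM2l ?(ltW xs_gt0)//.
      by rewrite mulrC -ler_pdivlMr// mul1r convol_kH_le.
    rewrite /convol -intZ; last exact: L1_convol_loc kl Hb.
    apply: int_le; [by apply: L1Z; exact: L1_convol_loc kl Hb|exact: L1_convol_loc kl Gb|].
    move=> v; rewrite mulrCA.
    have [vs|sv] := ltP v s; last by rewrite k0 ?mul0r// subr_le0.
    rewrite ler_wpM2l//; have [v0|v0] := ltP 0 v; last by rewrite heaviside_le0// mulr0 G0.
    rewrite heavisideE// mulr1 /G Sxs lerBrDl subrr odd_feedback_ge0// -xu.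
    by apply: IH; lra.
  apply: (step (Num.truncn (t / tau)).+1).
  by rewrite -ltr_pdivrMr//; exact: truncnS_gt.
have FG t : mg_feedback q r (x (t - tau)) - p * xs = G w t.
  by rewrite -odd_feedbackE// xu /G Sxs.
exists Y; split=> //.
  move=> t; rewrite YE; congr (convol k _ t); apply/funext => s.
  by rewrite -FG xu.
have xd t : is_derive t 1 x (eta * hump' tau (t + tau) + w t).
  have d1 := @dComp R (hump tau) (fun t => t + tau) t _ _ (hump_is_derive tau _) (dshift tau t).
  have d2 := dD (dCst xs t) (dD (dZ eta d1) (Yd t)).
  by apply: is_derive_eq d2 _; rewrite mulr1 add0r.
have xc : continuous x by exact: is_derive_continuous xd.
have dx t : 0 <= t -> derive1 x t = w t.
  move=> t0; rewrite derive1E (@derive_val _ _ _ _ _ _ _ (xd t)).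
  by rewrite (hump0 tau_gt0 (or_intror _)).2 ?mulr0 ?add0r// lerDr.
have kernelE t : alpha < 1 -> 0 < t -> (fun s => caputo_kernel alpha x t s * \1_`[0, t] s) =
    fun s => riesz (1 - alpha) (t - s) * w s.
  move=> a1 t0; apply/funext => s; rewrite indicE mem_setE in_itv/= /caputo_kernel /riesz.
  have [s0|s0] := ltP s 0; first by rewrite (w0 s (ltW s0)) !mulr0.
  rewrite dx//; have [st|ts] := ltP s t.
    rewrite (ltW st) heavisideE ?subr_gt0//= !mulr1; congr (_ `^ _ * _); ring.
  rewrite [H _]heaviside_le0 ?subr_le0// mulr0 mul0r.
  have [->|] := eqVneq s t; last by rewrite neq_lt ltNge ts/= => ts'; rewrite leNgt ts' mulr0.
  by rewrite subrr powR0 ?mul0r// oppr_eq0 gt_eqF.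
have kernelL t : alpha < 1 -> L1 (fun s => riesz (1 - alpha) (t - s) * w s).
  by move=> a1; apply: L1_convol_loc => //; apply: loc_L1_riesz; rewrite subr_gt0.
split=> // [|t t0]; first exact: continuous_subspaceT.
have d1c : {within `[0, t], continuous (derive1 x)}.
  have -> : derive1 x = fun t => eta * hump' tau (t + tau) + w t.
    by apply/funext => s; rewrite derive1E (@derive_val _ _ _ _ _ _ _ (xd s)).
  apply: continuous_subspaceT => s; apply: cvgD; last exact: wc.
  apply: cvgM; first exact: cvg_cst.
  apply: (cvg_comp _ (hump' tau)); last exact: hump'_cont.
  by apply: cvgD; [exact: cvg_id|exact: cvg_cst].
(* For [alpha < 1], with [b] the Caputo weight, the left is [b * w = (b * k) * G' = E * G'], and
   [E = H - p (k * H)] turns this into [G - p Y]. *)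
have capE : caputo alpha x t = G w t - p * Y t.
  have -> : G w t - p * Y t = convol E (G' w) t by rewrite convolE// GE -YE.
  have [a1|a1] := eqVneq alpha 1.
    have kE : k = E by rewrite (resolvent_exp rk a1) exp_step_response.
    by rewrite /caputo a1 eqxx dx ?ltW// wE {1}kE.
  have {}a1 : alpha < 1 by rewrite lt_neqAle a1.
  rewrite /caputo (lt_eqF a1) int_in (kernelE _ a1 t0) -intZ; last exact: kernelL.
  have a0 : 0 < 1 - alpha by rewrite subr_gt0.
  have a0' : 1 - alpha <= 1 by rewrite lerBlDr lerDl ltW.
  set b := caputo_weight alpha.
  have b0 : causal b by move=> s s0; rewrite /b /caputo_weight riesz_le0 ?mulr0.
  have b_ge0 s : 0 <= b s.
    by rewrite mulr_ge0 ?riesz_ge0// invr_ge0 ltW// Gamma_gt0.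
  have mb : measurable_fun [set: R] b by apply: measurable_funM => //; exact: measurable_riesz.
  have bkE : convol b k = E by apply/funext => s; rewrite (resolvent_caputo rk a1 s).2 /step_response convolHk.
  transitivity (convol b w t); first by apply: eq_Rintegral => s _; rewrite /b /caputo_weight mulrA.
  rewrite -[w in LHS]wE' -bkE.
  apply: (@convol_assoc_bounded _ b k (G' w) 1 t b0 k0 mb mk b_ge0 k_ge0 _ _ _ G'b).2.
  - by move=> s; exact: (resolvent_caputo rk a1 s).1.
  - by rewrite bkE; exact: measurable_step_response rk.
  - by move=> s; rewrite bkE; exact: step_response_le1 p_gt0 rk s.
split.
- rewrite /caputo_defined; case: eqP => [_|/eqP a1]; first by have [] := xd t.
  have {}a1 : alpha < 1 by rewrite lt_neqAle a1.
  split; last by apply/(L1_in _ _); [exact: measurable_itv|rewrite kernelE//; exact: kernelL].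
  split.
  + by apply: aeW => s _; have [] := xd s.
  + by apply: continuous_compact_integrable => //; exact: segment_compact.
  + move=> s /andP[s0 st].
    have xE : \int[mu]_(v in `[0, s]) derive1 x v = x s - x 0.
      apply: FTC_itv s0 _ _ _.
      * apply: continuous_subspaceW d1c => v /=; rewrite !in_itv/= => /andP[-> vs].
        exact: le_trans vs st.
      * exact: continuous_subspaceT.
      * by move=> v _; apply: is_derive_eq (xd v) _; rewrite derive1E (@derive_val _ _ _ _ _ _ _ (xd v)).
    have h : x s = x 0 + \int[mu]_(v in `[0, s]) derive1 x v.
      by rewrite xE; move: (x s) (x 0) => a b; ring.
    exact: h.
- by apply/orP; right; exact: x_ge0 (t - tau).
- have := rpow_powR r (x_ge0 (t - tau)); rewrite /x => ->.
  by rewrite gt_eqF// ltr_wpDr ?powR_ge0.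
- have h : caputo alpha x t = - p * x t + mg_feedback q r (x (t - tau)); last exact: h.
  rewrite capE -FG /x (hump0 tau_gt0 (or_intror (_ : tau <= t + tau))).1 ?lerDr ?(ltW t0)//.
  by rewrite mulr0 add0r; ring.
Qed.

End perturbed_solution.

(** * Instability of the positive equilibrium *)

Section weighted_bounds.
Context {R : realType}.
Local Notation mu := (@lebesgue_measure R).
Local Notation H := (@heaviside R).
Implicit Types (f v z Y : R -> R) (e t T M : R).

Lemma damp_bounded e z M : 0 < e -> measurable_fun [set: R] z -> causal z -> (forall t, `|z t| <= M) ->
  [/\ L1 (damp e z), forall t, `|damp e z t| <= M & L1 (fun t => damp e z t ^+ 2)].
Proof.
move=> e0 mz z0 zM; have md := measurable_damp e mz.
have dM t : `|damp e z t| <= M.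
  have [t0|t0] := ltP 0 t; last by rewrite /damp z0// mulr0 normr0 (le_trans _ (zM t)).
  rewrite /damp normrM (ger0_norm (expR_ge0 _)); apply: le_trans (zM t).
  by rewrite ler_piMl// -expR0 ler_expR oppr_le0 mulr_ge0// ltW.
have d1 : L1 (damp e z).
  apply: L1_le (L1Z M (L1_exp_step e0)) => // t.
  have [t0|t0] := ltP 0 t; last first.
    by rewrite /damp z0// mulr0 normr0 /exp_step heaviside_le0// !mulr0.
  rewrite /damp /exp_step heavisideE// mulr1 normrM (ger0_norm (expR_ge0 _)) mulrC.
  by rewrite ler_wpM2r ?expR_ge0.
split=> //; have := L1_bounded_mul md dM d1; congr L1.
Qed.

Lemma sqr_int_le v C : loc_bounded v -> L1 (fun t => v t ^+ 2) -> (forall T, energy T v <= C) ->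
  \int[mu]_t v t ^+ 2 <= C.
Proof.
move=> vb v2 vC; have [mv _ _] := vb.
have c : energy T v @[T --> +oo] --> \int[mu]_t v t ^+ 2.
  apply: (dominated_cvg_pinfty _ _ (L1_norm v2)).
  - move=> T; apply: measurable_funM; first exact: measurable_funX.
    exact: measurable_reflect measurable_heaviside.
  - move=> t; apply: cvg_near_cst; near=> T; rewrite heavisideE ?mulr1// subr_gt0.
    by near: T; apply: nbhs_pinfty_gt; exact: num_real.
  - move=> T t; rewrite normrM ler_piMr// ger0_norm ?heaviside_ge0//.
    exact: heaviside_le1.
rewrite -(cvg_lim (@Rhausdorff R) c); apply: limr_le; last by apply: nearW => T; exact: vC.
by apply/cvg_ex; eexists; exact: c.
Unshelve. all: end_near. Qed.

End weighted_bounds.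

Section unstable_linear.
Context {R : realType}.
Local Notation mu := (@lebesgue_measure R).
Local Notation H := (@heaviside R).
Variables (alpha p B tau : R) (k Y f : R -> R) (MY Mf : R).
Hypotheses (alpha_gt0 : 0 < alpha) (alpha_le1 : alpha <= 1) (p_gt0 : 0 < p)
  (tau_gt0 : 0 < tau).
Hypothesis rk : resolvent alpha p k.
Hypotheses (Yb : loc_bounded Y) (Y0 : causal Y) (YM : forall t, `|Y t| <= MY).
Hypotheses (fb : loc_bounded f) (f0 : causal f) (fM : forall t, `|f t| <= Mf).
Hypothesis char : forall t, char_op B tau k 1 Y t = convol k f t.
Implicit Types (e m t : R).

Let kl := resolvent_loc_L1 rk.
Let k1 := resolvent_L1 rk.
Let k0 := resolvent_causal rk.
Let k_ge0 := resolvent_ge0 rk.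
Let mk := L1_measurable k1.
Let mf : measurable_fun [set: R] f. Proof. by have [] := fb. Qed.
Let mY : measurable_fun [set: R] Y. Proof. by have [] := Yb. Qed.

Let damp_kf e : damp e (convol k f) = convol (damp e k) (damp e f).
Proof. by apply/funext => t; rewrite convol_damp. Qed.

Let damp_loc_bounded e z : loc_bounded z -> loc_bounded (damp e z).
Proof.
move=> [mz z0 zM]; split; first exact: measurable_damp.
  by move=> t t0; rewrite /damp z0// mulr0.
move=> T; have [M zMT] := zM T; exists (expR (`|e| * (`|T|)) * M) => t tT.
have M0 : 0 <= M by exact: le_trans (zMT t tT).
have [t0|t0] := ltP t 0.
  by rewrite /damp z0// mulr0 normr0 mulr_ge0// expR_ge0.
rewrite /damp normrM (ger0_norm (expR_ge0 _)) ler_pM ?expR_ge0//; last exact: zMT.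
rewrite ler_expR -mulNr; apply: (@le_trans _ _ (`|e| * t)).
  by rewrite ler_wpM2r// -normrN ler_norm.
by rewrite ler_wpM2l// (le_trans tT)// ler_norm.
Qed.

(** Plancherel's inequality on the line [Re z = e], then Young's inequality, the damped kernel
    having mass at most [1 / p]. The term in [Y] on the right is at most half of the left and is
    absorbed, which is legitimate because a bounded [Y] has finite weighted energy. *)
Lemma weighted_energy e m L kappa eta : 0 < e -> 0 < m -> char_bound alpha p B tau m 1 e ->
  0 <= L -> 0 <= kappa -> 0 <= eta -> 4 * kappa ^+ 2 <= m * p ^+ 2 ->
  (forall t, `|f t| <= L * eta * hump tau t + kappa * `|delay tau Y t|) ->
  \int[mu]_t damp e Y t ^+ 2 <=
    4 * L ^+ 2 / (m * p ^+ 2) * \int[mu]_t damp e (hump tau) t ^+ 2 * eta ^+ 2.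
Proof.
move=> e0 m0 cb L0 kap0 eta0 small fle.
have [dY1 dYM dY2] := damp_bounded e0 mY Y0 YM.
have [df1 dfM df2] := damp_bounded e0 mf f0 fM.
have hump_c : causal (hump tau) by move=> t t0; rewrite (hump0 tau_gt0 (or_introl t0)).1.
have humpM t : `|hump tau t| <= tau ^+ 4 by rewrite ger0_norm ?hump_ge0 ?hump_le.
have mb : measurable_fun [set: R] (hump tau) by apply: continuous_measurableT; exact: hump_cont.
have [db1 dbM db2] := damp_bounded e0 mb hump_c humpM.
have [v1 [Mv vM] key] := transform_energy alpha_gt0 alpha_le1 p_gt0 rk e0 Yb dY1 dYM cb.
have vE : damp e (char_op B tau k 1 Y) = convol (damp e k) (damp e f).
  by rewrite -damp_kf; congr damp; apply/funext.
rewrite vE in v1 vM key.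
have dk1 := L1_damp (ltW e0) k0 k1.
have dk0 : causal (damp e k) by move=> t t0; rewrite /damp k0// mulr0.
have dk_ge0 t : 0 <= damp e k t by rewrite mulr_ge0 ?expR_ge0.
have dfb := damp_loc_bounded e fb.
have v2 : L1 (fun t => convol (damp e k) (damp e f) t ^+ 2).
  by have := L1_bounded_mul (L1_measurable v1) vM v1; congr L1.
set IY := \int[mu]_t damp e Y t ^+ 2 in key *; set Ib := \int[mu]_t damp e (hump tau) t ^+ 2.
have dYs2 := L1_shift tau dY2.
have dfle t : damp e f t ^+ 2 <= 2 * (L * eta) ^+ 2 * damp e (hump tau) t ^+ 2 +
    2 * kappa ^+ 2 * damp e Y (t - tau) ^+ 2.
  have dle : `|damp e f t| <= L * eta * damp e (hump tau) t + kappa * `|damp e Y (t - tau)|.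
    rewrite /damp !normrM !(ger0_norm (expR_ge0 _)).
    apply: (@le_trans _ _ (expR (- (e * t)) * (L * eta * hump tau t + kappa * `|delay tau Y t|))).
      by rewrite ler_wpM2l ?expR_ge0.
    rewrite mulrDr mulrCA lerD2l mulrCA ler_wpM2l// /delay ler_wpM2r// ler_expR lerN2.
    by rewrite ler_wpM2l ?(ltW e0)// gerBl ltW.
  rewrite -(real_normK (num_real (damp e f t))) -(real_normK (num_real (damp e Y (t - tau)))).
  move: dle; move: (damp e (hump tau) t) `|damp e Y (t - tau)| (normr_ge0 (damp e f t)).
  move=> b y; move: `|damp e f t| => g g0 gle.
  apply: (@le_trans _ _ ((L * eta * b + kappa * y) ^+ 2)).
    by rewrite lerXn2r// nnegrE// (le_trans g0).
  rewrite -subr_ge0 (_ : _ - _ = (L * eta * b - kappa * y) ^+ 2) ?sqr_ge0//; ring.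
have En T : energy T (convol (damp e k) (damp e f)) <=
    p^-1 ^+ 2 * (2 * (L * eta) ^+ 2 * Ib + 2 * kappa ^+ 2 * IY).
  apply: le_trans (energy_convol dk0 dk_ge0 dk1 T dfb) _.
  have K0 : 0 <= \int[mu]_t damp e k t by apply: Rintegral_ge0.
  apply: ler_pM; [exact: sqr_ge0|exact: energy_ge0| |].
    rewrite lerXn2r ?nnegrE// ?invr_ge0 ?(ltW p_gt0)// -(resolvent_int rk).
    apply: int_le => // t; have [t0|t0] := ltP 0 t; last by rewrite dk0// k0.
    by rewrite /damp ler_piMl// -expR0 ler_expR oppr_le0 mulr_ge0// ltW.
  have <- : \int[mu]_t (2 * (L * eta) ^+ 2 * damp e (hump tau) t ^+ 2 +
    2 * kappa ^+ 2 * damp e Y (t - tau) ^+ 2) = 2 * (L * eta) ^+ 2 * Ib + 2 * kappa ^+ 2 * IY.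
    rewrite intD; [|exact: L1Z|exact: L1Z].
    by rewrite !intZ// (int_shift tau dY2).
  apply: int_le; [exact: L1_energy|by apply: L1D; exact: L1Z|] => t.
  apply: le_trans (dfle t); rewrite ler_piMr ?sqr_ge0//; exact: heaviside_le1.
have vb : loc_bounded (convol (damp e k) (damp e f)).
  by apply: loc_bounded_convol => //; exact: loc_L1_intro.
have := le_trans key (sqr_int_le vb v2 En).
have p2 : 0 < p ^+ 2 by exact: exprn_gt0.
have mp0 : 0 < m * p ^+ 2 by exact: mulr_gt0.
have IY0 : 0 <= IY by apply: Rintegral_ge0 => t _; exact: sqr_ge0.
rewrite exprVn ler_pdivlMl// => h.
have {}h : m * p ^+ 2 * IY <= 2 * (L * eta) ^+ 2 * Ib + 2 * kappa ^+ 2 * IY.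
  by rewrite (_ : m * p ^+ 2 * IY = p ^+ 2 * (m * IY))//; ring.
have h2 : 4 * kappa ^+ 2 * IY <= m * p ^+ 2 * IY by rewrite ler_wpM2r.
rewrite (_ : 4 * L ^+ 2 / (m * p ^+ 2) * Ib * eta ^+ 2 = 4 * L ^+ 2 * Ib * eta ^+ 2 / (m * p ^+ 2)); last by ring.
rewrite ler_pdivlMr// exprMn in h *; lra.
Qed.

(** At [z = a0 + i b0] the transformed equation equates the transform of [f] to that of [Y] times
    [z^alpha + p + B exp(- z tau)], which is zero. Up to sign the integral is the imaginary part of
    the transform of [f]. *)
Lemma root_balance a0 b0 : 0 < a0 ->
  zpow_re alpha a0 b0 + p + B * expR (- (a0 * tau)) * cos (b0 * tau) = 0 ->
  zpow_im alpha a0 b0 - B * expR (- (a0 * tau)) * sin (b0 * tau) = 0 ->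
  \int[mu]_t (damp a0 f t * sin (b0 * t)) = 0.
Proof.
move=> a00 re0 im0.
have [dY1 dYM dY2] := damp_bounded a00 mY Y0 YM.
have [df1 dfM df2] := damp_bounded a00 mf f0 fM.
have dk1 := L1_damp (ltW a00) k0 k1.
have dYs1 := L1_shift tau dY1.
have conv1 := L1_conv dk1 dYs1.
set q := B * expR (- (a0 * tau)) in re0 im0.
have eqn : (fun t => damp a0 Y t + q * convol (damp a0 k) (fun t => damp a0 Y (t - tau)) t) =
    convol (damp a0 k) (damp a0 f).
  rewrite -damp_kf; apply/funext => t; rewrite /damp -char -/(damp a0 (char_op B tau k 1 Y) t).
  by rewrite (damp_op B tau rk)// mul1r.
have := congr1 (fun g => cosT g b0) eqn; have := congr1 (fun g => sinT g b0) eqn.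
rewrite /= cosTD//; last exact: L1Z.
rewrite sinTD//; last exact: L1Z.
rewrite cosTZ// sinTZ// !cosT_conv// !sinT_conv// cosT_shift// sinT_shift//.
have [h1 h2] := transform_resolvent b0 alpha_gt0 alpha_le1 p_gt0 rk a00.
rewrite -/(sinT (damp a0 f) b0).
set a := zpow_re _ _ _ + p in h1 h2 re0; set b := zpow_im _ _ _ in h1 h2 im0.
move: h1 h2 re0 im0.
move: (cosT (damp a0 k) b0) (sinT (damp a0 k) b0) (cosT (damp a0 Y) b0) (sinT (damp a0 Y) b0)
  (cosT (damp a0 f) b0) (sinT (damp a0 f) b0) => Kc Ks C S Fc Fs h1 h2 re0 im0 eS eC.
have -> : Fs = (a * Kc + b * Ks) * Fs + (a * Ks - b * Kc) * Fc by rewrite h1 h2; ring.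
have -> : (a * Kc + b * Ks) * Fs + (a * Ks - b * Kc) * Fc =
  a * (Ks * Fc + Kc * Fs) - b * (Kc * Fc - Ks * Fs) by ring.
rewrite -eS -eC.
move: (cos (b0 * tau)) (sin (b0 * tau)) re0 im0 => cw sw re0 im0.
transitivity ((a + q * cw) * S - (b - q * sw) * C +
  q * ((a * Ks - b * Kc) * (cw * C - sw * S) + (a * Kc + b * Ks - 1) * (sw * C + cw * S))).
  ring.
by rewrite re0 im0 h1 h2; ring.
Qed.

End unstable_linear.

(** The condition [b tau < pi] makes the sine positive on []0, tau[], where the hump lives. *)
Lemma hump_sine_gt0 {R : realType} (tau a b : R) : 0 < tau -> 0 < a -> 0 < b * tau -> b * tau < pi ->
  0 < \int[lebesgue_measure]_t (damp a (hump tau) t * sin (b * t)).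
Proof.
move=> tau0 a0 b0 bpi; pose g t := damp a (hump tau) t * sin (b * t).
have bp : 0 < b by rewrite -(pmulr_lgt0 b tau0).
have gpos t : 0 < t -> t < tau -> 0 < g t.
  move=> t0 tt; rewrite /g /damp; apply: mulr_gt0; first by rewrite mulr_gt0 ?expR_gt0 ?hump_gt0.
  by apply: sin_gt0_pi; rewrite mulr_gt0//= (lt_trans _ bpi)// ltr_pM2l.
have ge0 t : 0 <= g t.
  have [t0|t0] := leP t 0; first by rewrite /g /damp (hump0 tau0 (or_introl t0)).1 mulr0 mul0r.
  have [tt|tt] := leP tau t; first by rewrite /g /damp (hump0 tau0 (or_intror tt)).1 mulr0 mul0r.
  exact/ltW/gpos.
have gc : continuous g.
  have ec : continuous (fun t => expR (- (a * t))).
    move=> t; apply: (cvg_comp _ expR); last exact: continuous_expR.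
    by apply: cvgN; apply: cvgM; [exact: cvg_cst|exact: cvg_id].
  move=> t; apply: cvgM; first by apply: cvgM; [exact: ec|exact: hump_cont].
  apply: (cvg_comp _ sin); last exact: continuous_sin.
  by apply: cvgM; [exact: cvg_cst|exact: cvg_id].
have cab : tau / 4 <= tau / 2 by lra.
have [c cI gle] := EVT_min cab (continuous_subspaceT gc).
have gc0 : 0 < g c by move: cI; rewrite in_itv/= => /andP[c1 c2]; apply: gpos; lra.
have hump_c : causal (hump tau) by move=> t t0; rewrite (hump0 tau0 (or_introl t0)).1.
have humpM t : `|hump tau t| <= tau ^+ 4 by rewrite ger0_norm ?hump_ge0 ?hump_le.
have mb : measurable_fun [set: R] (hump tau) by apply: continuous_measurableT; exact: hump_cont.
have [d1 _ _] := damp_bounded a0 mb hump_c humpM.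
apply: (@lt_le_trans _ _ (\int[lebesgue_measure]_t (g c * \1_`[tau / 4, tau / 2] t))).
  by rewrite intZ ?int_indic_itv//; [apply: mulr_gt0 => //; lra|exact: L1_indic_itv].
apply: int_le; [by apply: L1Z; exact: L1_indic_itv|exact: L1_sin|] => t.
rewrite indicE mem_setE; case: (boolP (t \in _)) => [tI|_]; last by rewrite mulr0; exact: ge0.
by rewrite mulr1; exact: gle.
Qed.

Section instability.
Context {R : realType}.
Local Notation mu := (@lebesgue_measure R).
Variables (alpha p q r tau xs : R).
Hypotheses (alpha_gt0 : 0 < alpha) (alpha_le1 : alpha <= 1) (p_gt0 : 0 < p) (q_gt0 : 0 < q)
  (r_gt0 : 0 < r) (xs_gt0 : 0 < xs) (xs_eq : rpow r xs = (q - p) / p) (tau_gt0 : 0 < tau).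
Local Notation F := (mg_feedback q r).
Local Notation B := (- mg_beta p q r).
Hypothesis pB : p < B.
Variables (k : R -> R) (a0 b0 e m : R).
Hypothesis rk : resolvent alpha p k.
Hypotheses (e_gt0 : 0 < e) (e_a0 : e < a0) (b0tau_gt0 : 0 < b0 * tau) (b0tau_pi : b0 * tau < pi)
  (re0 : zpow_re alpha a0 b0 + p + B * expR (- (a0 * tau)) * cos (b0 * tau) = 0)
  (im0 : zpow_im alpha a0 b0 - B * expR (- (a0 * tau)) * sin (b0 * tau) = 0)
  (m_gt0 : 0 < m) (cb : char_bound alpha p B tau m 1 e).

(** At the root the forcing has zero transform. It is [- B eta hump] plus a remainder bounded by
    [kappa |U|]: the first part forces the remainder to contribute [B eta S0], whereas its
    contribution is at most [kappa eta K]. As [K] depends on neither [kappa] nor [eta], a small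
    [kappa] is contradictory. *)
Lemma not_stable : ~ mg_stable alpha p q r tau xs.
Proof.
move=> stable.
have B_gt0 : 0 < B by exact: lt_trans pB.
have a0_gt0 : 0 < a0 by exact: lt_trans e_a0.
have tau0 := tau_gt0.
have hump_c : causal (hump tau) by move=> t t0; rewrite (hump0 tau0 (or_introl t0)).1.
have humpM t : `|hump tau t| <= tau ^+ 4 by rewrite ger0_norm ?hump_ge0 ?hump_le.
have mb : measurable_fun [set: R] (hump tau) by apply: continuous_measurableT; exact: hump_cont.
have [hump1 _ _] := damp_bounded a0_gt0 mb hump_c humpM.
pose S0 := \int[mu]_t (damp a0 (hump tau) t * sin (b0 * t)).
have S0_gt0 : 0 < S0 by exact: hump_sine_gt0.
(* Covers [B + kappa] for every [kappa <= 1], so that [C] does not depend on [kappa]. *)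
pose L := B + 1; have L0 : 0 <= L by rewrite addr_ge0// ltW.
pose C := 4 * L ^+ 2 / (m * p ^+ 2) * \int[mu]_t damp e (hump tau) t ^+ 2.
have C0 : 0 <= C.
  apply: mulr_ge0; last by apply: Rintegral_ge0 => t _; exact: sqr_ge0.
  by apply: divr_ge0; apply: mulr_ge0; rewrite ?sqr_ge0// ltW.
have d_gt0 : 0 < 2 * (a0 - e) by rewrite mulr_gt0// subr_gt0.
have J1 := L1_exp_step d_gt0; pose J := \int[mu]_t exp_step (2 * (a0 - e)) t.
have J0 : 0 <= J.
  by apply: Rintegral_ge0 => t _; rewrite mulr_ge0 ?expR_ge0 ?heaviside_ge0.
pose Psi := \int[mu]_t damp a0 (hump tau) t.
have Psi0 : 0 <= Psi.
  by apply: Rintegral_ge0 => t _; rewrite mulr_ge0 ?expR_ge0 ?hump_ge0.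
pose K := Psi + J / 2 + C / 2 + 1.
have K0 : 0 < K by rewrite /K; lra.
(* The three bounds serve [B + kappa <= L], the absorption in [weighted_energy], and
   [kappa K <= B S0 / 2]. *)
pose kappa := Num.min 1 (Num.min (p * Num.sqrt m / 2) (B * S0 / (2 * K))).
have kap0 : 0 < kappa.
  rewrite !lt_min ltr01 !divr_gt0 ?mulr_gt0// sqrtr_gt0//.
have kap1 : kappa <= 1 by rewrite ge_min lexx.
have kap2 : 4 * kappa ^+ 2 <= m * p ^+ 2.
  have h : kappa <= p * Num.sqrt m / 2 by rewrite /kappa !ge_min lexx orbT.
  have : kappa ^+ 2 <= (p * Num.sqrt m / 2) ^+ 2.
    by rewrite lerXn2r// nnegrE ?(ltW kap0)// (le_trans (ltW kap0)).
  rewrite expr_div_n exprMn sqr_sqrtr ?(ltW m_gt0)//; lra.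
have kap3 : kappa * K <= B * S0 / 2.
  have h : kappa <= B * S0 / (2 * K) by rewrite /kappa !ge_min lexx !orbT.
  apply: le_trans (_ : _ <= B * S0 / (2 * K) * K) _; first by rewrite ler_wpM2r// ltW.
  by rewrite le_eqVlt; apply/orP; left; apply/eqP; field; rewrite gt_eqF.
have [rho [rho0 rhox lip]] := mg_feedback_lipschitz p_gt0 q_gt0 xs_gt0 xs_eq kap0.
have [delta delta0 st] := stable rho rho0.
(* As [hump <= tau^4], the history stays within [min(delta, rho) / 2] of [xs]. *)
pose eta := Num.min delta rho / 2 / (tau ^+ 4 + 1).
have dr0 : 0 < Num.min delta rho by rewrite lt_min delta0.
have t4 : 0 < tau ^+ 4 by rewrite exprn_gt0.
have eta0 : 0 < eta by rewrite !divr_gt0// addr_gt0.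
have eta_t4 : eta * tau ^+ 4 <= Num.min delta rho / 2.
  rewrite /eta mulrAC ler_pdivrMr ?addr_gt0// ler_wpM2l ?divr_ge0 ?(ltW dr0)//.
  by rewrite lerDl.
have dmin : Num.min delta rho <= delta by rewrite ge_min lexx.
have rmin : Num.min delta rho <= rho by rewrite ge_min lexx orbT.
have [Y [Yb Yc Y0 YE sol]] := perturbed_solution alpha_gt0 alpha_le1 p_gt0 q_gt0 r_gt0 tau_gt0
  xs_gt0 xs_eq (ltW eta0) rk.
pose x t := xs + (eta * hump tau (t + tau) + Y t).
have hist : (hist_norm tau (fun t => (x t - xs)%R) < delta%:E)%E.
  apply: (@le_lt_trans _ _ (eta * tau ^+ 4)%:E); last by rewrite lte_fin; lra.
  apply: ge_ereal_sup => _ [t /= /[!in_itv]/= /andP[t1 t2] <-].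
  rewrite lee_fin /x Y0// addr0 addrAC subrr add0r normrM gtr0_norm//.
  by rewrite ler_wpM2l// ltW.
have near t : 0 <= t -> `|x t - xs| < rho by exact: st sol hist t.
pose U t := eta * hump tau t + delay tau Y t.
have UE t : U t = x (t - tau) - xs by rewrite /U /x subrK /delay; ring.
have Yd0 : causal (delay tau Y) by move=> t t0; apply: Y0; lra.
have U_rho t : `|U t| <= rho.
  have [tt|tt] := leP tau t; first by rewrite UE; apply/ltW/near; rewrite subr_ge0.
  rewrite /U /delay Y0 ?addr0; last lra.
  by rewrite normrM gtr0_norm// (le_trans (ler_wpM2l (ltW eta0) (humpM t)))//; lra.
have YM t : `|Y t| <= rho.
  have [t0|t0] := leP t 0; first by rewrite Y0// normr0 ltW.
  have := near t (ltW t0); rewrite /x (hump0 tau0 (or_intror (_ : tau <= t + tau))).1 ?lerDr ?(ltW t0)//.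
  by rewrite mulr0 add0r addrAC subrr add0r => /ltW.
have Fxs := mg_feedback_eq p_gt0 q_gt0 xs_eq.
pose Rm t := F (xs + U t) - p * xs + B * U t.
have Rm_le t : `|Rm t| <= kappa * `|U t|.
  have := lip (U t) 0 (U_rho t); rewrite normr0 => /(_ (ltW rho0)).
  by rewrite addr0 mulr0 addr0 subr0 Fxs /Rm addrAC.
pose f t := F (xs + U t) - p * xs + B * delay tau Y t.
have fE t : f t = Rm t - B * (eta * hump tau t) by rewrite /f /Rm /U; ring.
have U_le t : `|U t| <= eta * hump tau t + `|delay tau Y t|.
  apply: le_trans (ler_normD _ _) _; rewrite lerD2r ger0_norm// mulr_ge0 ?hump_ge0// ltW//.
have f_le t : `|f t| <= L * eta * hump tau t + kappa * `|delay tau Y t|.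
  rewrite fE; apply: le_trans (ler_normB _ _) _.
  have eh : 0 <= eta * hump tau t by rewrite mulr_ge0 ?hump_ge0// ltW.
  rewrite [X in _ + X]ger0_norm; last by rewrite mulr_ge0// ltW.
  have h1 := le_trans (Rm_le t) (ler_wpM2l (ltW kap0) (U_le t)).
  have h2 : kappa * (eta * hump tau t) <= eta * hump tau t by rewrite ler_piMl.
  by rewrite mulrDr in h1; rewrite /L -mulrA mulrDl mul1r; lra.
have f0 : causal f.
  move=> t t0; rewrite /f Yd0// mulr0 addr0 /U hump_c// Yd0// mulr0 add0r addr0 Fxs subrr//.
have mYd : measurable_fun [set: R] (delay tau Y).
  by apply: measurable_shift; exact: continuous_measurableT.
have mU : measurable_fun [set: R] U by apply: measurable_funD => //; exact: measurable_funM.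
have mRm : measurable_fun [set: R] Rm.
  have -> : Rm = fun t => odd_feedback q r (xs + U t) - p * xs + B * U t.
    apply/funext => t; rewrite /Rm odd_feedbackE//.
    by have := ler_norm (- U t); rewrite normrN; have := U_rho t; lra.
  have Sc : continuous (odd_feedback q r).
    by apply: is_derive_continuous => v; exact: (odd_feedback_is_derive q r_gt0 v).
  have mS := continuous_measurableT Sc.
  apply: measurable_funD; last exact: measurable_funM.
  apply: measurable_funB => //; apply: (measurableT_comp mS).
  exact: measurable_funD.
have hump_b := loc_bounded_hump tau_gt0.
have mf : measurable_fun [set: R] f.
  by rewrite (funext fE); apply: measurable_funB => //; do 2 apply: measurable_funM => //.
have fM t : `|f t| <= L * eta * tau ^+ 4 + kappa * rho.
  apply: le_trans (f_le t) _; apply: lerD.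
    by rewrite ler_wpM2l ?hump_le// mulr_ge0// ltW.
  by apply: ler_wpM2l; [exact: ltW|exact: YM].
have fb : loc_bounded f.
  by split=> // [t /ltW|T]; [exact: f0|exists (L * eta * tau ^+ 4 + kappa * rho)].
have Ydb := loc_bounded_delay (ltW tau_gt0) Yb.
have kl := resolvent_loc_L1 rk.
have char t : char_op B tau k 1 Y t = convol k f t.
  rewrite /char_op mul1r YE -convolZr; [|by have [] := kl|by []].
  have g1E : (fun s => F (xs + (eta * hump tau s + delay tau Y s)) - p * xs) =
      fun s => f s - B * delay tau Y s by apply/funext => s; rewrite /f /U; ring.
  rewrite g1E -convolDr//; [|exact: loc_boundedB fb (loc_boundedZ B Ydb)|exact: loc_boundedZ].
  by congr (convol k _ t); apply/funext => s; ring.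
have IY := weighted_energy alpha_gt0 alpha_le1 p_gt0 tau_gt0 rk Yb Y0 YM fb f0 fM char
  e_gt0 m_gt0 cb L0 (ltW kap0) (ltW eta0) kap2 f_le.
have bal := root_balance alpha_gt0 alpha_le1 p_gt0 rk Yb Y0 YM fb f0 fM char a0_gt0 re0 im0.
have mY : measurable_fun [set: R] Y by exact: continuous_measurableT.
have [_ _ dY2] := damp_bounded e_gt0 mY Y0 YM.
have Rm0 : causal Rm.
  by move=> t t0; have := fE t; rewrite f0// hump_c// !mulr0 subr0 => <-.
have RmM t : `|Rm t| <= kappa * rho by apply: le_trans (Rm_le t) _; rewrite ler_wpM2l// ltW.
have [dRm1 _ _] := damp_bounded a0_gt0 mRm Rm0 RmM.
(* Weighted arithmetic-geometric inequality after [exp(- a0 s) = exp(- (a0 - e) s) exp(- e s)]: the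
   weights [eta] and [1 / eta] make every term linear in [eta], since the weighted energy of [Y] is
   of order [eta^2]. The gap [a0 - e > 0] makes the first exponential square integrable. *)
pose g t := kappa * (eta * damp a0 (hump tau) t +
  (eta / 2 * exp_step (2 * (a0 - e)) (t - tau) + (2 * eta)^-1 * damp e Y (t - tau) ^+ 2)).
have balE : B * eta * S0 = \int[mu]_t (damp a0 Rm t * sin (b0 * t)).
  apply/eqP; rewrite eq_sym -subr_eq0; apply/eqP; rewrite -bal /S0 -intZ; last exact: L1_sin.
  rewrite -intB; [|exact: L1_sin|by apply: L1Z; exact: L1_sin].
  by apply: eq_Rintegral => t _; rewrite /damp fE; ring.
have gl1 := L1_shift tau J1; have gl2 := L1_shift tau dY2.
have g1 : L1 g by apply: L1Z; apply: L1D; [exact: L1Z|apply: L1D; exact: L1Z].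
have gE : \int[mu]_t g t = kappa * (eta * Psi + (eta / 2 * J + (2 * eta)^-1 * \int[mu]_t damp e Y t ^+ 2)).
  rewrite intZ; last by apply: L1D; [exact: L1Z|apply: L1D; exact: L1Z].
  rewrite intD; [|exact: L1Z|by apply: L1D; exact: L1Z].
  rewrite intD; [|exact: L1Z|exact: L1Z].
  by rewrite !intZ// (int_shift tau J1) (int_shift tau dY2).
have le_g t : damp a0 Rm t * sin (b0 * t) <= g t.
  apply: le_trans (ler_norm _) _; rewrite normrM.
  apply: (@le_trans _ _ `|damp a0 Rm t|); first by rewrite ler_piMr// sin_norm_le1.
  rewrite /damp normrM (ger0_norm (expR_ge0 _)).
  apply: le_trans (ler_wpM2l (expR_ge0 _) (le_trans (Rm_le t) (ler_wpM2l (ltW kap0) (U_le t)))) _.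
  rewrite mulrCA ler_wpM2l ?(ltW kap0)// mulrDr mulrCA lerD2l /delay.
  set s := t - tau; have [s0|s0] := leP s 0.
    have e2 : 0 <= eta / 2 by apply: divr_ge0 => //; exact: ltW.
    have e3 : 0 <= (2 * eta)^-1 by rewrite invr_ge0 mulr_ge0// ltW.
    rewrite Y0// normr0 mulr0; apply: addr_ge0; apply: mulr_ge0 => //; last exact: sqr_ge0.
    by apply: mulr_ge0; [exact: expR_ge0|exact: heaviside_ge0].
  rewrite /exp_step heavisideE// mulr1 exprMn -(real_normK (num_real (Y s))).
  apply: (@le_trans _ _ (expR (- ((a0 - e) * s)) * (expR (- (e * s)) * `|Y s|))).
    rewrite mulrA -expRD ler_wpM2r// ler_expR (_ : - ((a0 - e) * s) - e * s = - (a0 * s)); last by ring.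
    by rewrite lerN2 ler_wpM2l ?(ltW a0_gt0)// gerBl ltW.
  rewrite (_ : expR (- (2 * (a0 - e) * s)) = expR (- ((a0 - e) * s)) ^+ 2); last first.
    by rewrite -expRM_natl; congr expR; ring.
  move: (expR _) (expR (- (e * s))) `|Y s| => u1 u2 y.
  rewrite -subr_ge0 (_ : _ - _ = (2 * eta)^-1 * (eta * u1 - u2 * y) ^+ 2).
    by rewrite mulr_ge0 ?sqr_ge0// invr_ge0 mulr_ge0// ltW.
  by field; rewrite gt_eqF.
have h : B * eta * S0 <= \int[mu]_t g t.
  by rewrite balE; apply: int_le => //; exact: L1_sin.
have h2 : \int[mu]_t g t <= eta * (kappa * K).
  have IY' : (2 * eta)^-1 * \int[mu]_t damp e Y t ^+ 2 <= eta * (C / 2).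
    have e3 : 0 <= (2 * eta)^-1 by rewrite invr_ge0 mulr_ge0// ltW.
    apply: le_trans (ler_wpM2l e3 IY) _; rewrite -/C le_eqVlt; apply/orP; left; apply/eqP.
    by move: (C) => c; field; rewrite gt_eqF.
  rewrite gE [leRHS]mulrCA; apply: ler_wpM2l; first exact: ltW.
  have -> : eta * K = eta * Psi + (eta / 2 * J + eta * (C / 2)) + eta.
    by rewrite /K; move: (C) (J) (Psi) => c j ps; field.
  by rewrite -[leLHS]addr0; apply: lerD; [rewrite !lerD2l|exact: ltW].
have h3 : eta * (kappa * K) <= eta * (B * S0 / 2) by rewrite ler_wpM2l// ltW.
have h4 : 0 < B * S0 by exact: mulr_gt0.
have half (y : R) : 0 < y -> y <= y / 2 -> False by lra.
apply: half h4 _; rewrite -(ler_pM2l eta0).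
by apply: le_trans (le_trans h2 h3); apply: le_trans h; rewrite mulrA (mulrC eta).
Qed.

End instability.

Lemma mg_unstable_positive {R : realType} (alpha p q r tau xs : R) :
  0 < alpha -> alpha <= 1 -> 0 < p -> 0 < q -> 0 < r -> 0 < xs ->
  rpow r xs = (q - p) / p -> p / q < 1 - 2 / r ->
  tau_star alpha p q r < tau -> mg_unstable alpha p q r tau xs.
Proof.
move=> alpha0 alpha1 p0 q0 r0 xs0 xsE pqr.
have pB := mg_beta_gt p0 q0 r0 pqr; set B := - mg_beta p q r in pB.
have om0 : 0 < crossing alpha p B `^ alpha^-1 by rewrite powR_gt0// crossing_gt0.
have betaE : mg_beta p q r = - B by rewrite opprK.
rewrite /tau_star betaE sqrrN.
rewrite (tau_starE alpha0 alpha1 p0 pB (negbT (gt_eqF om0))) => tau_gt.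
have [_ _ _ thpi] := crossing_angleE alpha0 alpha1 p0 pB.
have tau0 : 0 < tau by apply: lt_trans tau_gt; rewrite divr_gt0// subr_gt0.
rewrite ltr_pdivrMr// mulrC in tau_gt.
have [k rk] := resolvent_exists alpha0 alpha1 p0.
have [a0 [b0 [e [m [/andP[e0 ea] /andP[b1 b2] re0 im0 [m0 cb]]]]]] :=
  unstable_root alpha0 alpha1 p0 pB tau0 tau_gt.
exact: (not_stable alpha0 alpha1 p0 q0 r0 xs0 xsE tau0 pB rk e0 ea b1 b2 re0 im0 m0 cb).
Qed.

(** * The negative equilibrium *)

Section opposite.
Context {R : realType}.
Local Notation mu := (@lebesgue_measure R).
Variables (alpha p q r tau : R).
Hypotheses (r_nat : r \is a Num.nat) (r_even : ~~ odd (Num.truncn r)).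
Implicit Types (phi x f : R -> R) (t xs : R).

Let rpowN u : rpow r (- u) = rpow r u.
Proof. by rewrite /rpow r_nat exprNn -signr_odd (negbTE r_even) expr0 mul1r. Qed.

Let derivableN f t : derivable f t 1 -> derivable (fun s => - f s) t 1.
Proof. by move=> df; have := derivableP df => /dN[]. Qed.

Let derive1N f t : derive1 (fun s => - f s) t = - derive1 f t.
Proof.
have [df|ndf] := pselect (derivable f t 1).
  by rewrite !derive1E; have /dN/@derive_val := derivableP df.
(* At a point of non-derivability [derive1] has the default value 0, which is invariant under
   negation. *)
have dv0 (g : R -> R) : ~ derivable g t 1 -> derive1 g t = 0.
  by move=> ndg; rewrite derive1E /derive; exact: dvgP.
rewrite (dv0 f ndf) oppr0; apply: dv0 => /derivableN dNN; apply: ndf.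
have -> // : f = fun s => - - f s.
by apply/funext => s; rewrite opprK.
Qed.

Let intN (D : set R) f : measurable D -> mu.-integrable D (EFin \o f) ->
  \int[mu]_(s in D) (- f s) = - \int[mu]_(s in D) f s.
Proof.
move=> mD /(L1_in _ mD) fi; transitivity (\int[mu]_s ((- 1) * (f s * \1_D s))).
  by rewrite int_in; apply: eq_Rintegral => s _; rewrite mulN1r mulNr.
by rewrite intZ// mulN1r [in RHS]int_in.
Qed.

Let integrableN (D : set R) f : measurable D -> mu.-integrable D (EFin \o f) ->
  mu.-integrable D (EFin \o (fun s => - f s)).
Proof.
move=> mD /(L1_in _ mD) fi; apply/(L1_in _ mD).
by have := L1N fi; congr L1; apply/funext => s; rewrite mulNr.
Qed.

Let kernelN f t s : caputo_kernel alpha (fun s => - f s) t s = - caputo_kernel alpha f t s.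
Proof. by rewrite /caputo_kernel derive1N mulrN. Qed.

Lemma caputoN f t : caputo_defined alpha f t ->
  caputo_defined alpha (fun s => - f s) t /\ caputo alpha (fun s => - f s) t = - caputo alpha f t.
Proof.
rewrite /caputo_defined /caputo; case: eqP => [_ df|_ [[ad fi fE] ki]].
  by split; [exact: derivableN|exact: derive1N].
have mI (a b : R) : measurable `[a, b]%classic by exact: measurable_itv.
split; last first.
  rewrite -mulrN -intN//; congr (_ * _); apply: eq_Rintegral => s _; exact: kernelN.
split; last first.
  by have := integrableN (mI _ _) ki; congr (mu.-integrable _ _); apply/funext => s /=; rewrite kernelN.
split.
- move: ad; apply: filterS; first exact: (ae_filter_ringOfSetsType mu).
  by move=> s h /h; exact: derivableN.
- by have := integrableN (mI _ _) fi; congr (mu.-integrable _ _); apply/funext => s /=; rewrite derive1N.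
- move=> s /andP[s0 st]; rewrite (fE s) ?s0// opprD -intN//.
    by congr (_ + _); apply: eq_Rintegral => u _; rewrite derive1N.
  apply: integrableS fi => // u /=; rewrite !in_itv/= => /andP[-> us].
  exact: le_trans us st.
Qed.

(** For an even integer [r] the right-hand side is an odd function of the pair of present and
    delayed values. *)
Lemma mg_solutionN phi x : mg_solution alpha p q r tau phi x ->
  mg_solution alpha p q r tau (fun t => - phi t) (fun t => - x t).
Proof.
move=> [xphi xc eqn]; split=> [t /xphi->//||t t0].
  by move=> t; apply: cvgN; exact: xc.
have [cd _ n0 cE] := eqn t t0; have [cdN cN] := caputoN cd.
split=> //; first by rewrite /rpow_defined r_nat.
  by rewrite rpowN.
by rewrite cN cE rpowN; ring.
Qed.

Lemma hist_normN phi xs :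
  hist_norm tau (fun t => (- phi t - xs)%R) = hist_norm tau (fun t => (phi t - - xs)%R).
Proof.
rewrite /hist_norm; congr ereal_sup; congr image; apply/funext => t.
by rewrite (_ : - phi t - xs = - (phi t - - xs)) ?normrN//; ring.
Qed.

Lemma mg_stableN xs : mg_stable alpha p q r tau xs -> mg_stable alpha p q r tau (- xs).
Proof.
move=> st eps /st[d d0 h]; exists d => // phi x sol hd t t0.
have := h _ _ (mg_solutionN sol); rewrite hist_normN => /(_ hd t t0).
by rewrite (_ : - x t - xs = - (x t - - xs)) ?normrN//; ring.
Qed.

Lemma mg_attractiveN xs : mg_attractive alpha p q r tau xs -> mg_attractive alpha p q r tau (- xs).
Proof.
move=> [d d0 h]; exists d => // phi x sol hd.
have := h _ _ (mg_solutionN sol); rewrite hist_normN => /(_ hd) c.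
by rewrite (_ : x = fun t => - - x t); [exact: cvgN|apply/funext => t; rewrite opprK].
Qed.

End opposite.

Theorem theorem3p3 (R : realType) (alpha p q r xs : R)
    (alpha_gt0 : 0 < alpha) (alpha_le1 : alpha <= 1)
    (p_gt0 : 0 < p) (q_gt0 : 0 < q) (r_gt0 : 0 < r) (pq : p < q)
    (xs_defined : rpow_defined r xs) (xs_eq : rpow r xs = (q - p) / p)
    (pqr : p / q < 1 - 2 / r) :
  (forall tau : R, 0 < tau < tau_star alpha p q r ->
     mg_asymptotically_stable alpha p q r tau xs) /\
  (forall tau : R, tau_star alpha p q r < tau ->
     mg_unstable alpha p q r tau xs).
Proof.
have pos (y : R) : 0 < y -> rpow r y = (q - p) / p ->
    (forall tau : R, 0 < tau < tau_star alpha p q r -> mg_asymptotically_stable alpha p q r tau y) /\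
    (forall tau : R, tau_star alpha p q r < tau -> mg_unstable alpha p q r tau y).
  move=> y0 yE; split=> tau; last exact: mg_unstable_positive.
  by move=> /andP[tau0 taus]; exact: mg_stable_positive.
have rp0 : 0 < rpow r xs by rewrite xs_eq divr_gt0// subr_gt0.
have [xs0|xs0|xs0] := ltgtP xs 0; last 2 first.
- exact: pos.
- by move: rp0; rewrite xs0 rpow_powR// powR0 ?ltxx// gt_eqF.
move: xs_defined; rewrite /rpow_defined [0 <= xs]leNgt xs0 orbF => r_nat.
(* An odd power of the negative [xs] would be negative, whereas [(q - p) / p > 0]. *)
have r_even : ~~ odd (Num.truncn r).
  apply/negP => ro; move: rp0; rewrite /rpow r_nat.
  by rewrite ltNge ltW// exprn_odd_lt0.
have xsN : rpow r (- xs) = (q - p) / p.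
  by rewrite -xs_eq /rpow r_nat exprNn -signr_odd (negbTE r_even) expr0 mul1r.
have nxs0 : 0 < - xs by rewrite oppr_gt0.
have [st un] := pos (- xs) nxs0 xsN.
split=> tau.
  move=> /st[h1 h2]; rewrite -[xs]opprK; split; first exact: mg_stableN.
  exact: mg_attractiveN.
by move=> /un h1 h2; apply: h1; exact: mg_stableN.
Qed.
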